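(* Let $\alpha>0$ and let $m\ge 1$ be an integer. Let $u^{0}\in \mathcal{X}^{0}(\mathbb{R}^{3})$ be a divergence-free vector field. Then there exists a time $T=T(u^{0})>0$ such that the problem $(NSE_M)$ with initial datum $u^0$ admits a unique solution $$u \in \mathcal{C}_{T}\bigl(\mathcal{X}^{0}(\mathbb{R}^{3})\bigr)\cap L^{1}_{T}\bigl(\mathcal{X}^{2}(\mathbb{R}^{3})\bigr).$$
   Context: The Fourier transform is $\widehat f(\xi)=\mathcal F(f)(\xi)=\int_{\mathbb{R}^3}e^{-ix\cdot\xi}f(x)\,dx$ (extended to tempered distributions). For $\rho\in\mathbb{R}$, $$\mathcal{X}^{\rho}(\mathbb{R}^3)=\Big\{f\in\mathcal{S}'(\mathbb{R}^{3}):\ \widehat f\in L^1_{\mathrm{loc}}(\mathbb{R}^3),\ \|f\|_{\mathcal{X}^\rho}:=\int_{\mathbb{R}^{3}}|\xi|^{\rho}|\widehat f(\xi)|\,d\xi<\infty\Big\}.$$ For vector fields the same definition is used with $|\cdot|$ the Euclidean norm on $\mathbb{C}^3$. For a Banach space $X$ and $T>0$, $\mathcal C_T(X)=C([0,T];X)$ and $L^1_T(X)=L^1([0,T];X)$. The problem $(NSE_M)$ is $$\partial_t u-\Delta u+u\cdot\nabla u+\alpha\sum_{k=1}^3u_k^{2m+1}e_k=-\nabla p,\qquad \operatorname{div}u=0,\qquad u(0,\cdot)=u^0,$$ on $\mathbb{R}^+\times\mathbb{R}^3$, where $u=(u_1,u_2,u_3)$ is the velocity, $p$ the pressure and $(e_1,e_2,e_3)$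 the canonical basis of $\mathbb{R}^3$. A solution on $[0,T]$ is understood in the integral (Duhamel) sense: for $t\in[0,T]$, $$u(t)=e^{t\Delta}u^0-\int_0^te^{(t-\tau)\Delta}\mathbb P(u\cdot\nabla u)(\tau)\,d\tau-\alpha\sum_{k=1}^3\int_0^te^{(t-\tau)\Delta}\mathbb P\bigl(u_k^{2m+1}e_k\bigr)(\tau)\,d\tau,$$ where $\mathcal F(e^{t\Delta}f)(\xi)=e^{-t|\xi|^2}\widehat f(\xi)$ and $\mathbb P$ is the Leray projector, $\mathcal F(\mathbb P f)(\xi)=\widehat f(\xi)-\frac{\xi\cdot\widehat f(\xi)}{|\xi|^2}\xi$. *)

(* Defs.v *)
From HB Require Import structures.
From mathcomp Require Import all_boot all_order all_algebra.
From mathcomp Require Import all_classical all_reals all_analysis.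
From mathcomp Require Import complex.

Set Implicit Arguments.
Unset Strict Implicit.
Unset Printing Implicit Defensive.

Import Order.TTheory GRing.Theory Num.Theory.
Import numFieldNormedType.Exports.

Local Open Scope classical_set_scope.
Local Open Scope ring_scope.
Local Open Scope complex_scope.

(* R^3 is the library product R * R * R, so that Lebesgue measure on it is an
   iterated product measure and directional derivatives are available. *)

Definition coord3 (R : realType) (k : 'I_3) (x : R * R * R) : R :=
  match val k with 0%N => x.1.1 | 1%N => x.1.2 | _ => x.2 end.

Definition basis3 (R : realType) (j : 'I_3) : R * R * R :=
  ((val j == 0)%N%:R, (val j == 1)%N%:R, (val j == 2)%N%:R).

Definition dot (R : realType) (x y : R * R * R) : R :=
  \sum_(k < 3) coord3 k x * coord3 k y.

(* The library norm on a product is the sup norm. *)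
Definition enorm (R : realType) (x : R * R * R) : R := Num.sqrt (dot x x).

Lemma product_sigma_finite (d1 d2 : measure_display)
    (T1 : measurableType d1) (T2 : measurableType d2) (R : realType)
    (m1 : {sigma_finite_measure set T1 -> \bar R})
    (m2 : {sigma_finite_measure set T2 -> \bar R}) :
  sigma_finite setT (m1 \x m2)%E.
Proof.
have /sigma_finiteP[F [TF ndF Foo]] := sigma_finiteT m1.
have /sigma_finiteP[G [TG ndG Goo]] := sigma_finiteT m2.
exists (fun n => F n `*` G n) => [|k].
  rewrite -setXTT TF TG predeqE => -[x y]; split.
    move=> [/= [n _ Fnx] [k _ Gky]]; exists (maxn n k) => //; split.
    - by move: x Fnx; exact/subsetPset/ndF/leq_maxl.
    - by move: y Gky; exact/subsetPset/ndG/leq_maxr.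
  by move=> [n _ []/= ? ?]; split; exists n.
have [? ?] := Foo k; have [? ?] := Goo k.
split; first exact: measurableX.
by rewrite product_measure1E// lte_mul_pinfty// ge0_fin_numE.
Qed.

(* The library's sigma-finite structure on products is hidden by the one for
   products of subprobabilities, hence the constants [leb2] and [leb3]. *)
Definition leb2 (R : realType) :
    set (measurableTypeR R * measurableTypeR R) -> \bar R :=
  (@lebesgue_measure R \x @lebesgue_measure R)%E.

HB.instance Definition _ (R : realType) := Measure.on (@leb2 R).
HB.instance Definition _ (R : realType) :=
  Measure_isSigmaFinite.Build _ _ _ (@leb2 R)
    (product_sigma_finite (@lebesgue_measure R) (@lebesgue_measure R)).

Definition leb3 (R : realType) :
    set (measurableTypeR R * measurableTypeR R * measurableTypeR R) ->
    \bar R :=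
  (@leb2 R \x @lebesgue_measure R)%E.

HB.instance Definition _ (R : realType) := Measure.on (@leb3 R).
HB.instance Definition _ (R : realType) :=
  Measure_isSigmaFinite.Build _ _ _ (@leb3 R)
    (product_sigma_finite (@leb2 R) (@lebesgue_measure R)).

Definition cabs (R : realType) (z : R[i]) : R :=
  Num.sqrt (complex.Re z ^+ 2 + complex.Im z ^+ 2).

Definition cvabs (R : realType) (z : 'I_3 -> R[i]) : R :=
  Num.sqrt (\sum_(k < 3) cabs (z k) ^+ 2).

Definition cexpi (R : realType) (a : R) : R[i] := cos a +i* sin a.

Definition cmeasurable (d : measure_display) (T : measurableType d)
    (R : realType) (D : set T) (f : T -> R[i]) : Prop :=
  measurable_fun D (fun x => complex.Re (f x)) /\
  measurable_fun D (fun x => complex.Im (f x)).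

Definition cintegrable (d : measure_display) (T : measurableType d)
    (R : realType) (mu : {measure set T -> \bar R}) (D : set T)
    (f : T -> R[i]) : Prop :=
  mu.-integrable D (fun x => (complex.Re (f x))%:E) /\
  mu.-integrable D (fun x => (complex.Im (f x))%:E).

Definition cintegral (d : measure_display) (T : measurableType d)
    (R : realType) (mu : {measure set T -> \bar R}) (D : set T)
    (f : T -> R[i]) : R[i] :=
  (\int[mu]_(x in D) complex.Re (f x)) +i*
  (\int[mu]_(x in D) complex.Im (f x)).

(* Lebesgue measure lives on the Borel sets, which are not complete: integrals
   in time allow for a modification on a negligible set. *)
Definition has_time_integral (R : realType) (D : set R) (f : R -> R[i])
    (I : R[i]) : Prop :=
  exists g : R -> R[i],
    [/\ {ae @lebesgue_measure R, forall t, D t -> f t = g t},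
        cintegrable (@lebesgue_measure R) D g &
        I = cintegral (@lebesgue_measure R) D g].

Definition cpartial (R : realType) (j : 'I_3) (f : R * R * R -> R[i]) :
    R * R * R -> R[i] :=
  fun x => ('D_(basis3 R j) (fun y => complex.Re (f y)) x) +i*
           ('D_(basis3 R j) (fun y => complex.Im (f y)) x).

Definition cpartials (R : realType) (s : seq 'I_3) (f : R * R * R -> R[i]) :
    R * R * R -> R[i] :=
  foldr (@cpartial R) f s.

Definition smooth (R : realType) (f : R * R * R -> R[i]) : Prop :=
  forall s : seq 'I_3,
    [/\ continuous (fun x => complex.Re (cpartials s f x)),
        continuous (fun x => complex.Im (cpartials s f x)) &
        forall (j : 'I_3) (x : R * R * R),
          derivable (fun y => complex.Re (cpartials s f y)) x (basis3 R j) /\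
          derivable (fun y => complex.Im (cpartials s f y)) x (basis3 R j)].

Definition schwartz (R : realType) (f : R * R * R -> R[i]) : Prop :=
  smooth f /\
  forall (N : nat) (s : seq 'I_3), exists B : R,
    forall x, (1 + enorm x) ^+ N * cabs (cpartials s f x) <= B.

(* A distribution is a functional on all functions, of which only the values on
   Schwartz functions are meaningful; equality of distributions is [deq]. This
   makes the operations defined by duality total. *)
Definition distr (R : realType) : Type := (R * R * R -> R[i]) -> R[i].

Definition vdistr (R : realType) : Type := 'I_3 -> distr R.

Definition deq (R : realType) (f g : distr R) : Prop :=
  forall phi, schwartz phi -> f phi = g phi.

(* The bound [B] dominates the Schwartz seminorm of order [N] of [phi]. *)
Definition tempered (R : realType) (f : distr R) : Prop :=
  (forall (a : R[i]) phi psi, schwartz phi -> schwartz psi ->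
     f (fun x => a * phi x + psi x) = a * f phi + f psi) /\
  exists (N : nat) (C : R), forall phi, schwartz phi -> forall B : R,
    (forall (s : seq 'I_3) (x : R * R * R), (size s <= N)%N ->
       (1 + enorm x) ^+ N * cabs (cpartials s phi x) <= B) ->
    cabs (f phi) <= C * B.

Definition of_fun (R : realType) (h : R * R * R -> R[i]) : distr R :=
  fun phi => cintegral (@leb3 R) setT (fun x => h x * phi x).

Definition loc_integrable (R : realType) (h : R * R * R -> R[i]) : Prop :=
  cmeasurable (setT : set (measurableTypeR R * measurableTypeR R *
                           measurableTypeR R)) h /\
  forall r : R, cintegrable (@leb3 R) [set x | enorm x <= r] h.

Definition represents (R : realType) (h : R * R * R -> R[i]) (f : distr R) :
    Prop :=
  [/\ loc_integrable h,
      forall phi, schwartz phi ->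
        cintegrable (@leb3 R) setT (fun x => h x * phi x) &
      deq f (of_fun h)].

Definition regular (R : realType) (f : distr R) : Prop :=
  exists h, represents h f.

(* The function, unique up to a.e. equality, which [f] is when it is regular;
   the zero function otherwise. *)
Definition fun_of (R : realType) (f : distr R) : R * R * R -> R[i] :=
  xget (fun=> 0) [set h | represents h f].

Definition fourier (R : realType) (f : R * R * R -> R[i]) :
    R * R * R -> R[i] :=
  fun xi => cintegral (@leb3 R) setT (fun x => cexpi (- dot x xi) * f x).

Definition inv_fourier (R : realType) (f : R * R * R -> R[i]) :
    R * R * R -> R[i] :=
  fun x => ((2 * pi) ^- 3)%:C *
    cintegral (@leb3 R) setT (fun xi => cexpi (dot x xi) * f xi).

Definition dfourier (R : realType) (f : distr R) : distr R :=
  fun phi => f (fourier phi).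

Definition dinv_fourier (R : realType) (f : distr R) : distr R :=
  fun phi => f (inv_fourier phi).

Definition dmul (R : realType) (a : R * R * R -> R[i]) (f : distr R) :
    distr R :=
  fun phi => f (fun x => a x * phi x).

Definition dpartial (R : realType) (j : 'I_3) (f : distr R) : distr R :=
  fun phi => - f (cpartial j phi).

Definition div_free (R : realType) (f : vdistr R) : Prop :=
  deq (\sum_(k < 3) dpartial k (f k)) (fun=> 0).

Definition hat (R : realType) (f : vdistr R) (k : 'I_3) :
    R * R * R -> R[i] :=
  fun_of (dfourier (f k)).

Definition Xnorm (R : realType) (rho : R) (f : vdistr R) : \bar R :=
  (\int[@leb3 R]_xi (enorm xi `^ rho * cvabs (fun k => hat f k xi))%:E)%E.

Definition Xspace (R : realType) (rho : R) (f : vdistr R) : Prop :=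
  [/\ forall k, tempered (f k),
      forall k, regular (dfourier (f k)) &
      (Xnorm rho f < +oo)%E].

Definition CT_X (R : realType) (T rho : R) (u : R -> vdistr R) : Prop :=
  (forall t, t \in `[0, T] -> Xspace rho (u t)) /\
  forall t, t \in `[0, T] ->
    Xnorm rho (u s - u t) @[s --> within `[0, T] (nbhs t)] --> (0 : \bar R).

Definition X_simple (R : realType) (rho : R) (s : R -> vdistr R) : Prop :=
  exists (n : nat) (A : 'I_n -> set R) (v : 'I_n -> vdistr R),
    [/\ forall i, measurable (A i),
        forall i, Xspace rho (v i) &
        forall t k phi, s t k phi = \sum_(i < n) (\1_(A i) t)%:C * v i k phi].

(* Bochner space L^1([0, T]; X^rho): strongly measurable functions whose norm
   is integrable. *)
Definition L1T_X (R : realType) (T rho : R) (u : R -> vdistr R) : Prop :=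
  [/\ {ae @lebesgue_measure R, forall t, t \in `[0, T] -> Xspace rho (u t)},
      exists s : nat -> R -> vdistr R,
        (forall n, X_simple rho (s n)) /\
        {ae @lebesgue_measure R, forall t, t \in `[0, T] ->
           Xnorm rho (u t - s n t) @[n --> \oo] --> (0 : \bar R)} &
      (\int[@lebesgue_measure R]_(t in `[0%R, T]) Xnorm rho (u t) < +oo)%E].

Definition heat (R : realType) (t : R) (f : distr R) : distr R :=
  dinv_fourier
    (dmul (fun xi => (expR (- t * enorm xi ^+ 2))%:C) (dfourier f)).

Definition leray (R : realType) (f : vdistr R) : vdistr R := fun k =>
  dinv_fourier (of_fun (fun xi =>
    hat f k xi -
    (\sum_(j < 3) (coord3 j xi)%:C * hat f j xi) / (enorm xi ^+ 2)%:C *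
    (coord3 k xi)%:C)).

(* The products below are pointwise products of regular distributions. *)
Definition advection (R : realType) (u : vdistr R) : vdistr R := fun k =>
  of_fun (fun x => \sum_(j < 3) fun_of (u j) x * fun_of (dpartial j (u k)) x).

Definition damping (R : realType) (m : nat) (k : 'I_3) (u : vdistr R) :
    vdistr R := fun i =>
  if i == k then of_fun (fun x => fun_of (u k) x ^+ (2 * m + 1)) else fun=> 0.

(* Duhamel's formula on [0, T], the integrals over [0, t] being taken in the
   space of tempered distributions, that is, against Schwartz functions. *)
Definition NSEM_solution (R : realType) (alpha : R) (m : nat) (u0 : vdistr R)
    (T : R) (u : R -> vdistr R) : Prop :=
  forall t, t \in `[0, T] ->
  forall (i : 'I_3) (phi : R * R * R -> R[i]), schwartz phi ->
  exists (I : R[i]) (J : 'I_3 -> R[i]),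
    [/\ has_time_integral `[0, t]
          (fun tau => heat (t - tau) (leray (advection (u tau)) i) phi) I,
        forall k, has_time_integral `[0, t]
          (fun tau => heat (t - tau) (leray (damping m k (u tau)) i) phi)
          (J k) &
        u t i phi = heat t (u0 i) phi - I - alpha%:C * \sum_(k < 3) J k].

(* Main.v *)
(* On the Fourier side the data are integrable functions, and X^0 is L^1.  Since
   the product of two functions is the inverse transform of a convolution, Young's
   inequality and |xi| <= r |xi|^2 + 1/r bound the integral over a time interval of
   length r^2 of the X^0 norm of the nonlinearity at g by r times a constant that
   depends on the C(X^0) and L^1(X^2) norms of g.  Duhamel's operator maps
   L^1(0,T; X^0) to C(X^0) and L^1(X^2) with norm at most 1, because the heat
   kernel is bounded by 1 and |xi|^2 exp(-t|xi|^2) has integral at most 1 in time.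
   The unknown of the fixed-point problem is therefore not the solution g but its
   nonlinearity F in L^1((0,T) x R^3): for small T Picard's iteration contracts.
   Conversely a solution in the sense of distributions, which is merely a path in
   X^0, has a jointly measurable representative (the limit of its samples on finer
   and finer grids), whose nonlinearity is such a fixed point; two fixed points agree
   on successive time intervals of the same length, hence everywhere.  The link with
   distributions is Fourier inversion on Schwartz functions, proved with the Poisson
   kernel (prod_j pi (1 + x_j^2))^-1, and the resulting injectivity of the Fourier
   transform on L^1. *)
Require Import Defs.
From mathcomp Require Import all_boot all_order all_algebra.
From mathcomp Require Import all_classical all_reals all_analysis.
From mathcomp Require Import measurable_realfun complex ring lra.

Set Implicit Arguments.
Unset Strict Implicit.
Unset Printing Implicit Defensive.

Import Order.TTheory GRing.Theory Num.Theory.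
Import numFieldNormedType.Exports.

(** * Complex-valued integrals *)

Section modulus.
Local Open Scope ring_scope.
Local Open Scope complex_scope.
Context (R : realType).
Implicit Types z w : R[i].

(** Taking the nonlinearity as unknown puts the fixed point in L^1 of a product measure:
    completeness is the Riesz-Fischer theorem, joint measurability in time and frequency belongs to
    the data, and one norm of [F] controls both norms of the solution. The obstacle lies on the side
    of distributions: [fun_of] and [hat] are choices, made separately at each time and determined
    only almost everywhere, so a path of distributions comes with no measurability in time, and
    every passage between distributions and functions is an almost everywhere identity. The length
    r^2 balances two terms: 1/r integrated over that length gives r, the factor already in front of
    the X^2 norm. The Poisson kernel is preferred to the Gaussian because it and its transform have
    elementary antiderivatives, and because its polynomial decay also makes it an integrable
    majorant of Schwartz functions. *)

Lemma cabsE z : cabs z = Normc.normc z.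
Proof. by case: z. Qed.

Lemma cabs_ge0 z : 0 <= cabs z.
Proof. exact: sqrtr_ge0. Qed.

Lemma cabs0 : cabs (0 : R[i]) = 0.
Proof. by rewrite cabsE Normc.normc0. Qed.

Lemma cabs_real (r : R) : cabs r%:C = `|r|.
Proof. by rewrite /cabs /= expr0n /= addr0 sqrtr_sqr. Qed.

Lemma cabsM z w : cabs (z * w) = cabs z * cabs w.
Proof. by rewrite !cabsE Normc.normcM. Qed.

Lemma cabsV z : cabs z^-1 = (cabs z)^-1.
Proof. by rewrite !cabsE Normc.normcV. Qed.

Lemma cabsN z : cabs (- z) = cabs z.
Proof. by rewrite !cabsE normcN. Qed.

Lemma cabsD z w : cabs (z + w) <= cabs z + cabs w.
Proof. by rewrite !cabsE le_normcD. Qed.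

Lemma cabsB z w : cabs (z - w) <= cabs z + cabs w.
Proof. by rewrite (le_trans (cabsD _ _))// cabsN. Qed.

Lemma cabs_distC z w : cabs (z - w) = cabs (w - z).
Proof. by rewrite -cabsN opprB. Qed.

Lemma cabs_eq0 z : cabs z = 0 -> z = 0.
Proof. by rewrite cabsE => /Normc.eq0_normc. Qed.

Lemma cabs_sum (I : Type) (r : seq I) (P : pred I) (F : I -> R[i]) :
  cabs (\sum_(i <- r | P i) F i) <= \sum_(i <- r | P i) cabs (F i).
Proof.
elim/big_ind2: _ => [|x x' y y' hx hy|i _//]; first by rewrite cabs0.
by rewrite (le_trans (cabsD _ _))// lerD.
Qed.

Lemma abs_Re_le z : `|complex.Re z| <= cabs z.
Proof. by rewrite -sqrtr_sqr ler_wsqrtr// lerDl sqr_ge0. Qed.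

Lemma abs_Im_le z : `|complex.Im z| <= cabs z.
Proof. by rewrite -sqrtr_sqr ler_wsqrtr// lerDr sqr_ge0. Qed.

Lemma cabs_le_ReIm z : cabs z <= `|complex.Re z| + `|complex.Im z|.
Proof.
rewrite -[leRHS]ger0_norm ?addr_ge0// -sqrtr_sqr ler_wsqrtr//.
rewrite sqrrD !real_normK ?num_real// [leRHS]addrAC lerDl.
by rewrite mulrn_wge0// mulr_ge0.
Qed.

Lemma cReD z w : complex.Re (z + w) = complex.Re z + complex.Re w.
Proof. by case: z w => ? ? [? ?]. Qed.
Lemma cImD z w : complex.Im (z + w) = complex.Im z + complex.Im w.
Proof. by case: z w => ? ? [? ?]. Qed.
Lemma cReN z : complex.Re (- z) = - complex.Re z. Proof. by case: z. Qed.
Lemma cImN z : complex.Im (- z) = - complex.Im z. Proof. by case: z. Qed.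
Lemma cReM z w : complex.Re (z * w) =
  complex.Re z * complex.Re w - complex.Im z * complex.Im w.
Proof. by case: z w => ? ? [? ?]. Qed.
Lemma cImM z w : complex.Im (z * w) =
  complex.Re z * complex.Im w + complex.Im z * complex.Re w.
Proof. by case: z w => ? ? [? ?]. Qed.
Lemma complex_ext z w : complex.Re z = complex.Re w ->
  complex.Im z = complex.Im w -> z = w.
Proof. by case: z w => ? ? [? ?] /= -> ->. Qed.

Lemma rcM (a b : R) : (a * b)%:C = a%:C * b%:C.
Proof. by rewrite rmorphM. Qed.
Lemma rcD (a b : R) : (a + b)%:C = a%:C + b%:C.
Proof. by rewrite rmorphD. Qed.
Lemma rcB (a b : R) : (a - b)%:C = a%:C - b%:C.
Proof. by rewrite rmorphB. Qed.
Lemma rcV (a : R) : (a^-1)%:C = a%:C^-1.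
Proof. by rewrite fmorphV. Qed.
Lemma rc_sum (I : Type) (r : seq I) (P : pred I) (F : I -> R) :
  (\sum_(i <- r | P i) F i)%:C = \sum_(i <- r | P i) (F i)%:C.
Proof. by rewrite rmorph_sum. Qed.

Lemma mulcJ_cabs z : conjc z * z = (cabs z ^+ 2)%:C.
Proof.
rewrite sqr_sqrtr ?addr_ge0 ?sqr_ge0//.
by case: z => a b; apply: complex_ext => /=; rewrite ?expr2; ring.
Qed.

Lemma cabs_cexpi (a : R) : cabs (cexpi a) = 1.
Proof. by rewrite /cabs /= cos2Dsin2 sqrtr1. Qed.

Lemma cexpiD (a b : R) : cexpi (a + b) = cexpi a * cexpi b.
Proof. by apply: complex_ext; rewrite ?cReM ?cImM /= ?cosD ?sinD// addrC. Qed.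

Lemma cabs_conj z : cabs (conjc z) = cabs z.
Proof. by case: z => a b; rewrite /cabs /= sqrrN. Qed.

End modulus.

(** * Limits of complex sequences *)

Section limits.
Local Open Scope classical_set_scope.
Local Open Scope ring_scope.
Context (R : realType).

Lemma cvg0_squeeze (a b : nat -> R) : a n @[n --> \oo] --> (0 : R) ->
  (forall n, 0 <= b n <= a n) -> b n @[n --> \oo] --> (0 : R).
Proof.
move=> a0 ba; apply: (@squeeze_cvgr _ _ _ _ (cst 0) a) => //; last exact: cvg_cst.
exact: nearW.
Qed.

Lemma cvg0_mulr (c : R) (a : nat -> R) : a n @[n --> \oo] --> (0 : R) ->
  a n * c @[n --> \oo] --> (0 : R).
Proof. by move=> a0; rewrite -(mul0r c); apply: cvgM => //; exact: cvg_cst. Qed.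

(** Convergence in [R[i]] is expressed throughout by a real modulus tending to 0; this is the
    corresponding uniqueness of limits. *)
Lemma cabs_lim_unique (a : nat -> R[i]) (l l' : R[i]) :
  cabs (a n - l) @[n --> \oo] --> (0 : R) ->
  cabs (a n - l') @[n --> \oo] --> (0 : R) -> l = l'.
Proof.
move=> al al'; apply/eqP; rewrite -subr_eq0; apply/eqP/cabs_eq0.
have h : cabs (a n - l) + cabs (a n - l') @[n --> \oo] --> (0 : R).
  by rewrite -[X in _ --> X]addr0; exact: cvgD.
have h2 : (fun _ : nat => cabs (l - l')) n @[n --> \oo] --> (0 : R).
  apply: (@cvg0_squeeze _ (fun=> cabs (l - l')) h) => n; rewrite cabs_ge0/=.
  rewrite (_ : l - l' = (a n - l') - (a n - l)).
    by rewrite (le_trans (cabsB _ _))// addrC.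
  by ring.
by move/(cvg_lim (@Rhausdorff R)) : h2; rewrite lim_cst.
Qed.

End limits.

(** * Measurability of complex functions *)

Section cmeasurable_theory.
Local Open Scope ring_scope.
Local Open Scope complex_scope.
Context d (T : measurableType d) (R : realType).
Implicit Types f g : T -> R[i].
Local Notation cmeas := (cmeasurable (setT : set T)).

Lemma cmeasD f g : cmeas f -> cmeas g -> cmeas (fun x => f x + g x).
Proof.
move=> [f1 f2] [g1 g2]; split.
  by under eq_fun do rewrite cReD; exact: measurable_funD.
by under eq_fun do rewrite cImD; exact: measurable_funD.
Qed.

Lemma cmeasN f : cmeas f -> cmeas (fun x => - f x).
Proof.
move=> [f1 f2]; split.
  by under eq_fun do rewrite cReN; exact: measurable_funN.
by under eq_fun do rewrite cImN; exact: measurable_funN.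
Qed.

Lemma cmeasB f g : cmeas f -> cmeas g -> cmeas (fun x => f x - g x).
Proof. by move=> mf mg; apply: cmeasD => //; exact: cmeasN. Qed.

Lemma cmeasM f g : cmeas f -> cmeas g -> cmeas (fun x => f x * g x).
Proof.
move=> [f1 f2] [g1 g2]; split.
  under eq_fun do rewrite cReM.
  by apply: measurable_funB; exact: measurable_funM.
under eq_fun do rewrite cImM.
by apply: measurable_funD; exact: measurable_funM.
Qed.

Lemma cmeas_cst (c : R[i]) : cmeas (fun=> c).
Proof. by split; exact: measurable_cst. Qed.

Lemma cmeas_real (h : T -> R) : measurable_fun setT h -> cmeas (fun x => (h x)%:C).
Proof. by move=> mh; split => //=; exact: measurable_cst. Qed.

Lemma cmeas_sum (I : Type) (r : seq I) (P : pred I) (F : I -> T -> R[i]) :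
  (forall i, cmeas (F i)) -> cmeas (fun x => \sum_(i <- r | P i) F i x).
Proof.
move=> mF; elim: r => [|i r ih].
  by under eq_fun do rewrite big_nil; exact: cmeas_cst.
under eq_fun do rewrite big_cons.
by case: (P i) => //; exact: cmeasD.
Qed.

Lemma cmeasX f n : cmeas f -> cmeas (fun x => f x ^+ n).
Proof.
move=> mf; elim: n => [|n ih]; first exact: cmeas_cst.
by under eq_fun do rewrite exprS; exact: cmeasM.
Qed.

Lemma cmeas_cexpi (h : T -> R) : measurable_fun setT h ->
  cmeas (fun x => cexpi (h x)).
Proof.
move=> mh; split => /=.
  have mc : measurable_fun setT (@cos R).
    by apply: continuous_measurable_fun; exact: continuous_cos.
  exact: (measurableT_comp mc mh).
have mc : measurable_fun setT (@sin R).
  by apply: continuous_measurable_fun; exact: continuous_sin.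
exact: (measurableT_comp mc mh).
Qed.

Lemma measurable_cabs f : cmeas f -> measurable_fun setT (fun x => cabs (f x)).
Proof.
move=> [f1 f2]; rewrite /cabs.
rewrite (_ : (fun _ => _) = (fun x => Num.sqrt x) \o
  (fun x => complex.Re (f x) ^+ 2 + complex.Im (f x) ^+ 2))//.
apply: measurableT_comp.
  by apply: continuous_measurable_fun => x; exact: sqrt_continuous.
by apply: measurable_funD; exact: measurable_funX.
Qed.

Lemma measurable_ecabs f : cmeas f -> measurable_fun setT (fun x => (cabs (f x))%:E).
Proof. by move=> mf; apply/measurable_EFinP; exact: measurable_cabs. Qed.

End cmeasurable_theory.

Lemma cmeas_comp d d' (T : measurableType d) (U : measurableType d')
    (R : realType) (f : U -> R[i]) (p : T -> U) :
  cmeasurable setT f -> measurable_fun setT p ->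
  cmeasurable setT (fun x => f (p x)).
Proof.
move=> [f1 f2] mp; split.
  exact: (measurableT_comp f1 mp).
exact: (measurableT_comp f2 mp). Qed.

(** * Integrability, the L^1 norm and dominated convergence *)

Section cintegral_theory.
Local Open Scope classical_set_scope.
Local Open Scope ring_scope.
Local Open Scope complex_scope.
Context d (T : measurableType d) (R : realType).
Variable mu : {measure set T -> \bar R}.
Implicit Types f g : T -> R[i].
Local Notation cmeas := (cmeasurable (setT : set T)).
Local Notation cint := (cintegral mu setT).
Local Notation cinte := (cintegrable mu setT).

(** The value is an extended real, so that inequalities between norms can be stated before
    integrability is known. *)
Definition L1 f : \bar R := (\int[mu]_x (cabs (f x))%:E)%E.

Lemma L1_ge0 f : (0 <= L1 f)%E.
Proof. by apply: integral_ge0 => x _; rewrite lee_fin cabs_ge0. Qed.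

(** Both directions are comparisons: the modulus dominates the real and imaginary parts and is
    dominated by the sum of their absolute values. *)
Lemma cintegrableP f : cinte f <-> cmeas f /\ (L1 f < +oo)%E.
Proof.
split=> [[i1 i2]|[mf fo]].
  have mf : cmeas f.
    by split; apply/measurable_EFinP; [exact: measurable_int i1|exact: measurable_int i2].
  split=> //.
  have := integrableD measurableT (integrable_norm i1) (integrable_norm i2).
  move/(le_integrable measurableT).
  move=> /(_ _ (measurable_ecabs mf)) h.
  have /integrableP[_] : mu.-integrable setT (fun x => (cabs (f x))%:E).
    apply: h => x _ /=; rewrite !lee_fin ger0_norm ?cabs_ge0//.
    by rewrite ger0_norm ?addr_ge0// cabs_le_ReIm.
  by under eq_integral do rewrite /= ger0_norm ?cabs_ge0//.
have i : mu.-integrable setT (fun x => (cabs (f x))%:E).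
  apply/integrableP; split; first exact: measurable_ecabs.
  by under eq_integral do rewrite /= ger0_norm ?cabs_ge0//.
have [f1 f2] := mf.
split; apply: (le_integrable measurableT _ _ i).
- exact/measurable_EFinP.
- by move=> x _ /=; rewrite !lee_fin (ger0_norm (cabs_ge0 _)) abs_Re_le.
- exact/measurable_EFinP.
- by move=> x _ /=; rewrite !lee_fin (ger0_norm (cabs_ge0 _)) abs_Im_le.
Qed.

Lemma cinte_meas f : cinte f -> cmeas f.
Proof. by move/cintegrableP => []. Qed.

Lemma cinte_L1 f : cinte f -> (L1 f < +oo)%E.
Proof. by move/cintegrableP => []. Qed.

Lemma cinte_abs f : cinte f -> mu.-integrable setT (fun x => (cabs (f x))%:E).
Proof.
move=> /cintegrableP[mf fo]; apply/integrableP; split.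
  exact: measurable_ecabs.
by under eq_integral do rewrite /= ger0_norm ?cabs_ge0//.
Qed.

Lemma le_L1 f g : cmeas f -> cmeas g -> (forall x, cabs (f x) <= cabs (g x)) ->
  (L1 f <= L1 g)%E.
Proof.
move=> mf mg fg; apply: ge0_le_integral => //.
- by move=> x _; rewrite lee_fin cabs_ge0.
- exact: measurable_ecabs.
- exact: measurable_ecabs.
- by move=> x _; rewrite lee_fin.
Qed.

Lemma cinte_le f g : cmeas f -> cinte g ->
  (forall x, cabs (f x) <= cabs (g x)) -> cinte f.
Proof.
move=> mf /cintegrableP[mg go] fg; apply/cintegrableP; split => //.
by apply: le_lt_trans go; exact: le_L1.
Qed.

Lemma ae_le_L1 f g : cmeas f -> cmeas g ->
  {ae mu, forall x, cabs (f x) <= cabs (g x)} -> (L1 f <= L1 g)%E.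
Proof.
move=> mf mg fg; apply: ae_ge0_le_integral => //.
- by move=> x _; rewrite lee_fin cabs_ge0.
- exact: measurable_ecabs.
- by move=> x _; rewrite lee_fin cabs_ge0.
- exact: measurable_ecabs.
- by apply: filterS fg => x fgx _; rewrite lee_fin.
Qed.

Lemma ae_eq_L1 f g : cmeas f -> cmeas g ->
  {ae mu, forall x, f x = g x} -> L1 f = L1 g.
Proof.
move=> mf mg fg; apply/eqP; rewrite eq_le; apply/andP; split.
  by apply: ae_le_L1 => //; apply: filterS fg => x ->.
by apply: ae_le_L1 => //; apply: filterS fg => x ->.
Qed.

Lemma L1D f g : cmeas f -> cmeas g ->
  (L1 (fun x => (f x + g x)%R) <= L1 f + L1 g)%E.
Proof.
move=> mf mg; rewrite /L1 -ge0_integralD//; last 4 first.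
- by move=> x _; rewrite lee_fin cabs_ge0.
- exact: measurable_ecabs.
- by move=> x _; rewrite lee_fin cabs_ge0.
- exact: measurable_ecabs.
apply: ge0_le_integral => //.
- by move=> x _; rewrite lee_fin cabs_ge0.
- by apply: measurable_ecabs; exact: cmeasD.
- by apply: emeasurable_funD; exact: measurable_ecabs.
- by move=> x _; rewrite -EFinD lee_fin cabsD.
Qed.

Lemma L1N f : L1 (fun x => - f x) = L1 f.
Proof. by apply: eq_integral => x _; rewrite cabsN. Qed.

Lemma L1B f g : cmeas f -> cmeas g ->
  (L1 (fun x => (f x - g x)%R) <= L1 f + L1 g)%E.
Proof.
by move=> mf mg; rewrite -(L1N g); apply: L1D => //; exact: cmeasN.
Qed.

Lemma L1Z (c : R[i]) f : cmeas f ->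
  L1 (fun x => (c * f x)%R) = ((cabs c)%:E * L1 f)%E.
Proof.
move=> mf; rewrite /L1 -ge0_integralZl//.
- by apply: eq_integral => x _; rewrite cabsM.
- exact: measurable_ecabs.
- by move=> x _; rewrite lee_fin cabs_ge0.
- by rewrite lee_fin cabs_ge0.
Qed.

Lemma L1_eq0 f : cmeas f -> L1 f = 0 -> {ae mu, forall x, f x = 0}.
Proof.
move=> mf f0.
have [h _] := @ae_eq_integral_abs _ _ _ mu _ measurableT _ (measurable_ecabs mf).
have {h}h : ae_eq mu setT (fun x => (cabs (f x))%:E) (cst 0%E).
  apply: h; rewrite -f0; apply: eq_integral => x _.
  by rewrite /= ger0_norm// cabs_ge0.
by apply: filterS h => x /(_ I) [] /cabs_eq0.
Qed.

Lemma L1_cst0 : L1 (fun=> 0) = 0.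
Proof. by rewrite /L1; apply: integral0_eq => x _; rewrite cabs0. Qed.

Lemma cinteD f g : cinte f -> cinte g -> cinte (fun x => f x + g x).
Proof.
move=> /cintegrableP[mf fo] /cintegrableP[mg go]; apply/cintegrableP.
split; first exact: cmeasD.
by apply: le_lt_trans (L1D mf mg) _; rewrite lte_add_pinfty.
Qed.

Lemma cinteN f : cinte f -> cinte (fun x => - f x).
Proof.
by move=> /cintegrableP[mf fo]; apply/cintegrableP; rewrite L1N; split=> //; exact: cmeasN.
Qed.

Lemma cinteB f g : cinte f -> cinte g -> cinte (fun x => f x - g x).
Proof. by move=> mf mg; apply: cinteD => //; exact: cinteN. Qed.

Lemma cinteZ (c : R[i]) f : cinte f -> cinte (fun x => c * f x).
Proof.
move=> /cintegrableP[mf fo]; apply/cintegrableP; split.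
  by apply: cmeasM => //; exact: cmeas_cst.
by rewrite L1Z// lte_mul_pinfty// ?lee_fin ?cabs_ge0.
Qed.

Lemma cinte0 : cinte (fun=> 0).
Proof. by apply/cintegrableP; rewrite L1_cst0; split => //; exact: cmeas_cst. Qed.

Lemma cinte_sum (I : Type) (r : seq I) (P : pred I) (F : I -> T -> R[i]) :
  (forall i, cinte (F i)) -> cinte (fun x => \sum_(i <- r | P i) F i x).
Proof.
move=> mF; elim: r => [|i r ih].
  by under eq_fun do rewrite big_nil; exact: cinte0.
under eq_fun do rewrite big_cons.
by case: (P i) => //; exact: cinteD.
Qed.

Lemma cinte_cabs f : cinte f -> cinte (fun x => (cabs (f x))%:C).
Proof.
move=> fi; apply: (cinte_le _ fi).
  by apply: cmeas_real; apply: measurable_cabs; exact: cinte_meas fi.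
by move=> x; rewrite cabs_real ger0_norm ?cabs_ge0.
Qed.

Lemma cinte_bndM (B : R) f g : cmeas f -> (forall x, cabs (f x) <= B) ->
  cinte g -> cinte (fun x => f x * g x).
Proof.
move=> mf fB ig; apply: (@cinte_le _ (fun x => B%:C * g x)).
- by apply: cmeasM => //; exact: cinte_meas.
- exact: cinteZ.
- move=> x; rewrite !cabsM cabs_real ler_wpM2r ?cabs_ge0//.
  by rewrite (le_trans (fB x))// ler_norm.
Qed.

Lemma cintD f g : cinte f -> cinte g ->
  cint (fun x => f x + g x) = cint f + cint g.
Proof.
move=> [f1 f2] [g1 g2]; apply: complex_ext => /=.
  under eq_Rintegral do rewrite cReD.
  by rewrite RintegralD.
under eq_Rintegral do rewrite cImD.
by rewrite RintegralD.
Qed.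

Lemma RintegralN (h : T -> R) :
  mu.-integrable setT (EFin \o h) ->
  (\int[mu]_x (- h x) = - \int[mu]_x h x)%R.
Proof.
move=> ih; rewrite -[RHS]mulN1r -RintegralZl//.
by apply: eq_Rintegral => x _; rewrite mulN1r.
Qed.

Lemma cintN f : cinte f -> cint (fun x => - f x) = - cint f.
Proof.
move=> [f1 f2]; apply: complex_ext => /=.
  by under eq_Rintegral do rewrite cReN; rewrite RintegralN.
by under eq_Rintegral do rewrite cImN; rewrite RintegralN.
Qed.

Lemma cintB f g : cinte f -> cinte g ->
  cint (fun x => f x - g x) = cint f - cint g.
Proof. by move=> fi gi; rewrite cintD ?cintN//; exact: cinteN. Qed.

Lemma cintZ (c : R[i]) f : cinte f ->
  cint (fun x => c * f x) = c * cint f.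
Proof.
move=> [f1 f2]; have Z r h : mu.-integrable setT (EFin \o h) ->
    mu.-integrable setT (EFin \o (fun x => r * h x)).
  by move=> hi; exact: (integrableZl measurableT r hi).
apply: complex_ext; rewrite ?cReM ?cImM /=.
  under eq_Rintegral do rewrite cReM.
  by rewrite RintegralB ?RintegralZl//; exact: Z.
under eq_Rintegral do rewrite cImM.
by rewrite RintegralD ?RintegralZl//; exact: Z.
Qed.

Lemma cintZr (c : R[i]) f : cinte f ->
  cint (fun x => f x * c) = cint f * c.
Proof.
by move=> fi; under eq_fun do rewrite mulrC; rewrite cintZ// mulrC.
Qed.

Lemma cint0 : cint (fun=> 0) = 0.
Proof. by apply: complex_ext => /=; rewrite Rintegral_cst// mul0r. Qed.

Lemma cint_sum (I : Type) (r : seq I) (P : pred I) (F : I -> T -> R[i]) :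
  (forall i, cinte (F i)) ->
  cint (fun x => \sum_(i <- r | P i) F i x) = \sum_(i <- r | P i) cint (F i).
Proof.
move=> mF; elim: r => [|i r ih].
  by under eq_fun do rewrite big_nil; rewrite big_nil cint0.
under eq_fun do rewrite big_cons.
rewrite big_cons; case: (P i) => //; rewrite cintD ?ih//.
exact: cinte_sum.
Qed.

Lemma cint_ae_eq f g : cmeas f -> cmeas g ->
  {ae mu, forall x, f x = g x} -> cint f = cint g.
Proof.
move=> [f1 f2] [g1 g2] fg; apply: complex_ext => /=.
  rewrite /Rintegral; congr fine; apply: ae_eq_integral => //.
  - exact/measurable_EFinP.
  - exact/measurable_EFinP.
  - by apply: filterS fg => x ->.
rewrite /Rintegral; congr fine; apply: ae_eq_integral => //.
- exact/measurable_EFinP.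
- exact/measurable_EFinP.
- by apply: filterS fg => x ->.
Qed.

Lemma cinte_ae_eq f g : cmeas g -> cinte f ->
  {ae mu, forall x, f x = g x} -> cinte g.
Proof.
move=> mg /cintegrableP[mf fo] fg; apply/cintegrableP; split => //.
by rewrite -(ae_eq_L1 mf mg fg).
Qed.

(* Multiplying by the conjugate phase of the integral reduces the complex
   triangle inequality to the real one. *)
Lemma cabs_cint_le f : cinte f -> ((cabs (cint f))%:E <= L1 f)%E.
Proof.
move=> fi; set I := cint f.
have [I0|I0] := eqVneq (cabs I) 0; first by rewrite I0 L1_ge0.
pose w : R[i] := conjc I / (cabs I)%:C.
have w1 : cabs w = 1.
  rewrite /w cabsM cabsV cabs_real cabs_conj ger0_norm ?cabs_ge0//.
  by rewrite divff.
have wI : w * I = (cabs I)%:C.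
  apply: (mulfI (x := (cabs I)%:C)); first by rewrite (inj_eq (@complexI _)).
  rewrite /w mulrA mulrCA divff ?mulr1; last by rewrite (inj_eq (@complexI _)).
  by rewrite mulcJ_cabs -rmorphM expr2.
have : cint (fun x => w * f x) = (cabs I)%:C by rewrite cintZ.
have wi : cinte (fun x => w * f x) by exact: cinteZ.
move=> /(congr1 (@complex.Re R)) /= <-.
have [wi1 _] := wi.
rewrite /Rintegral fineK; last exact: integrable_fin_num.
rewrite -[leRHS]mul1e -w1 -L1Z; last exact: cinte_meas.
apply: le_trans (lee_abs _) _.
apply: le_trans (le_abse_integral _ measurableT _) _.
  exact: measurable_int wi1.
apply: ge0_le_integral => //.
- by apply: measurableT_comp => //; exact: measurable_int wi1.
- by apply: measurable_ecabs; exact: cinte_meas.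
- by move=> x _ /=; rewrite lee_fin abs_Re_le.
Qed.

(* Holds even for non-integrable functions, whose integral is a junk value. *)
Lemma cabs_cint_le_gen f : cmeas f -> ((cabs (cint f))%:E <= L1 f)%E.
Proof.
move=> mf; have [fo|] := ltP (L1 f) +oo%E.
  by apply: cabs_cint_le; apply/cintegrableP.
by rewrite leye_eq => /eqP ->; rewrite leey.
Qed.

Lemma cabs_lim_le (a : nat -> R[i]) (l : R[i]) (c : R) :
  cabs (a n - l) @[n --> \oo] --> (0 : R) -> (forall n, cabs (a n) <= c) ->
  cabs l <= c.
Proof.
move=> al ac; have h : cabs l - cabs (a n - l) @[n --> \oo] --> cabs l - 0.
  by apply: cvgB => //; exact: cvg_cst.
rewrite -[leLHS]subr0 -(cvg_lim _ h)//; apply: limr_le.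
  by apply/cvg_ex; exists (cabs l - 0).
apply: nearW => n; rewrite lerBlDr (le_trans _ (lerD (ac n) (lexx _)))//.
by rewrite -[in leLHS](subKr (a n) l) (le_trans (cabsB _ _)).
Qed.

(** Dominated convergence for |F n - f|, with majorant 2g: the bound by [g] passes to the limit
    [f]. *)
Lemma cvg_L1 (F : nat -> T -> R[i]) f (g : T -> R) :
  (forall n, cmeas (F n)) -> cmeas f ->
  {ae mu, forall x, cabs (F n x - f x) @[n --> \oo] --> (0 : R)} ->
  mu.-integrable setT (EFin \o g) ->
  {ae mu, forall x, forall n, cabs (F n x) <= g x} ->
  L1 (fun x => (F n x - f x)%R) @[n --> \oo] --> (0 : \bar R)%E.
Proof.
move=> mF mf Ff gi Fg.
have mFf n : cmeas (fun x => F n x - f x) by exact: cmeasB.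
have fg : {ae mu, forall x, cabs (f x) <= g x}.
  apply: filterS2 Ff Fg => x Fx Fgx.
  exact: (cabs_lim_le Fx).
have gi2 : mu.-integrable setT (EFin \o (fun x => 2 * g x)).
  exact: (integrableZl measurableT 2 gi).
have := @dominated_convergence _ _ _ mu setT measurableT
  (fun n x => (cabs (F n x - f x))%:E) (cst 0%E) (EFin \o (fun x => 2 * g x)).
case=> //.
- by move=> n; exact: measurable_ecabs.
- apply: filterS Ff => x Fx _; apply: cvg_EFin; last exact: Fx.
  exact: nearW.
- apply: filterS2 fg Fg => x fx Fx n _ /=.
  rewrite lee_fin ger0_norm ?cabs_ge0// mulr_natl mulr2n.
  by rewrite (le_trans (cabsB _ _))// lerD.
- by move=> _ _; rewrite integral_cst// mul0e.
Qed.

Lemma cvg_cint (F : nat -> T -> R[i]) f (g : T -> R) :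
  (forall n, cmeas (F n)) -> cmeas f ->
  {ae mu, forall x, cabs (F n x - f x) @[n --> \oo] --> (0 : R)} ->
  mu.-integrable setT (EFin \o g) ->
  {ae mu, forall x, forall n, cabs (F n x) <= g x} ->
  cabs (cint (F n) - cint f) @[n --> \oo] --> (0 : R).
Proof.
move=> mF mf Ff gi Fg.
have h := cvg_L1 mF mf Ff gi Fg.
have gb (h' : T -> R[i]) : cmeas h' -> {ae mu, forall x, cabs (h' x) <= g x} ->
    cinte h'.
  move=> mh hg; apply/cintegrableP; split => //.
  apply: (@le_lt_trans _ _ (\int[mu]_x (`|g x|)%:E)%E).
    apply: ae_ge0_le_integral => //.
    - by move=> x _; rewrite lee_fin cabs_ge0.
    - exact: measurable_ecabs.
    - apply/measurable_EFinP; apply: measurableT_comp => //.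
      by apply/measurable_EFinP; exact: measurable_int gi.
    - apply: filterS hg => x hx _; rewrite lee_fin (le_trans hx)//.
      exact: ler_norm.
  by case/integrableP : gi.
have Fi n : cinte (F n).
  by apply: gb => //; apply: filterS Fg => x.
have fg : cinte f.
  apply: gb => //; apply: filterS2 Ff Fg => x Fx Fgx.
  exact: (cabs_lim_le Fx).
suff : (cabs (cint (F n) - cint f))%:E @[n --> \oo] --> (0 : \bar R)%E.
  by move/fine_cvgP => [].
apply: (@squeeze_cvge _ _ _ _ (cst 0%E) _ (fun n => L1 (fun x => (F n x - f x)%R))).
- apply: nearW => n; rewrite lee_fin cabs_ge0/= -cintB//.
  by apply: cabs_cint_le; exact: cinteB.
- exact: cvg_cst.
- exact: h.
Qed.

End cintegral_theory.

Lemma eq_cint d (T : measurableType d) (R : realType)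
    (mu : measure T R) (D : set T) (f g : T -> R[i]) :
  f =1 g -> cintegral mu D f = cintegral mu D g.
Proof. by move=> /funext ->. Qed.

(** * Integrals depending on a parameter *)

Section cparam.
Local Open Scope classical_set_scope.
Local Open Scope ring_scope.
Local Open Scope complex_scope.
Context d1 d2 (T1 : measurableType d1) (T2 : measurableType d2) (R : realType).
Variable m2 : {sigma_finite_measure set T2 -> \bar R}.
Implicit Type f : T1 * T2 -> R[i].

(** Tonelli's theorem gives measurability for the positive and the negative part; [fine] of their
    difference is measurable also where the integral is a default value. *)
Lemma measurable_Rintegral_param (h : T1 * T2 -> R) : measurable_fun setT h ->
  measurable_fun setT (fun x => \int[m2]_y h (x, y)).
Proof.
move=> mh; apply: measurableT_comp => //.
rewrite [X in measurable_fun _ X](_ : _ = fun x =>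
  (\int[m2]_y ((EFin \o h)^\+ (x, y))%E - \int[m2]_y ((EFin \o h)^\- (x, y))%E)%E).
  apply: emeasurable_funB.
    apply: (measurable_fun_fubini_tonelli_F ((EFin \o h)^\+)%E); last first.
      by move=> z; rewrite funepos_ge0.
    by apply: measurable_funepos; exact/measurable_EFinP.
  apply: (measurable_fun_fubini_tonelli_F ((EFin \o h)^\-)%E); last first.
    by move=> z; rewrite funeneg_ge0.
  by apply: measurable_funeneg; exact/measurable_EFinP.
apply/funext => x; rewrite [LHS]integralE.
congr (_ - _)%E; apply: eq_integral => y _.
  by rewrite !funeposE.
by rewrite !funenegE.
Qed.

Lemma cmeas_cint_param f : cmeasurable setT f ->
  cmeasurable setT (fun x => cintegral m2 setT (fun y => f (x, y))).
Proof.
move=> [f1 f2]; split => /=.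
  exact: (measurable_Rintegral_param f1).
exact: (measurable_Rintegral_param f2).
Qed.

Lemma measurable_L1_param f : cmeasurable setT f ->
  measurable_fun setT (fun x => L1 m2 (fun y => f (x, y))).
Proof.
move=> mf; apply: (measurable_fun_fubini_tonelli_F (fun z => (cabs (f z))%:E)).
  exact: measurable_ecabs.
by move=> z; rewrite lee_fin cabs_ge0.
Qed.

End cparam.

(** * Tonelli's and Fubini's theorems for complex functions *)

Section cfubini.
Local Open Scope classical_set_scope.
Local Open Scope ring_scope.
Local Open Scope complex_scope.
Context d1 d2 (T1 : measurableType d1) (T2 : measurableType d2) (R : realType).
Variable m1 : {sigma_finite_measure set T1 -> \bar R}.
Variable m2 : {sigma_finite_measure set T2 -> \bar R}.
Implicit Type f : T1 * T2 -> R[i].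

Lemma L1_tonelli1 f : cmeasurable setT f ->
  (\int[m1]_x L1 m2 (fun y => f (x, y)) = L1 (m1 \x m2)%E f)%E.
Proof.
move=> mf; rewrite /L1 (fubini_tonelli1 (fun z => (cabs (f z))%:E))//.
  exact: measurable_ecabs.
by move=> z; rewrite lee_fin cabs_ge0.
Qed.

Lemma L1_tonelli2 f : cmeasurable setT f ->
  (\int[m2]_y L1 m1 (fun x => f (x, y)) = L1 (m1 \x m2)%E f)%E.
Proof.
move=> mf; rewrite /L1 (fubini_tonelli2 (fun z => (cabs (f z))%:E))//.
  exact: measurable_ecabs.
by move=> z; rewrite lee_fin cabs_ge0.
Qed.

Lemma ae_cinte1 f : cintegrable (m1 \x m2)%E setT f ->
  {ae m1, forall x, cintegrable m2 setT (fun y => f (x, y))}.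
Proof.
move=> [f1 f2]; have := ae_integrable1 f1; have := ae_integrable1 f2.
by apply: filterS2 => x; split.
Qed.

Lemma ae_cinte2 f : cintegrable (m1 \x m2)%E setT f ->
  {ae m2, forall y, cintegrable m1 setT (fun x => f (x, y))}.
Proof.
move=> [f1 f2]; have := ae_integrable2 f1; have := ae_integrable2 f2.
by apply: filterS2 => x; split.
Qed.

Lemma Rintegral12 (h : T1 * T2 -> R) :
  (m1 \x m2)%E.-integrable setT (EFin \o h) ->
  \int[m1]_x (\int[m2]_y h (x, y)) = \int[(m1 \x m2)%E]_z h z.
Proof.
move=> hi; rewrite /Rintegral -[in RHS]integral12_prod_meas1//; congr fine.
apply: ae_eq_integral => //.
- apply/measurable_EFinP; apply: measurable_Rintegral_param.
  by apply/measurable_EFinP; exact: measurable_int hi.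
- exact: (measurable_fubini_F hi).
- have := ae_integrable1 hi; apply: filterS => x xi _ /=.
  by rewrite fineK//; exact: integrable_fin_num.
Qed.

(** The measurability hypothesis is supplied in [cint21], by swapping the two factors and using
    [cmeas_cint_param]. *)
Lemma Rintegral21 (h : T1 * T2 -> R) :
  (m1 \x m2)%E.-integrable setT (EFin \o h) ->
  measurable_fun setT (fun y => \int[m1]_x h (x, y)) ->
  \int[m2]_y (\int[m1]_x h (x, y)) = \int[(m1 \x m2)%E]_z h z.
Proof.
move=> hi mh; rewrite /Rintegral -[in RHS]integral21_prod_meas1//; congr fine.
apply: ae_eq_integral => //.
- exact/measurable_EFinP.
- exact: (measurable_fubini_G hi).
- have := ae_integrable2 hi; apply: filterS => x xi _ /=.
  by rewrite fineK//; exact: integrable_fin_num.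
Qed.

Lemma cint12 f : cintegrable (m1 \x m2)%E setT f ->
  cintegral m1 setT (fun x => cintegral m2 setT (fun y => f (x, y))) =
  cintegral (m1 \x m2)%E setT f.
Proof. by move=> [f1 f2]; apply: complex_ext => /=; rewrite -Rintegral12. Qed.

End cfubini.

Section cfubini_swap.
Local Open Scope classical_set_scope.
Local Open Scope ring_scope.
Local Open Scope complex_scope.
Context d1 d2 (T1 : measurableType d1) (T2 : measurableType d2) (R : realType).
Variable m1 : {sigma_finite_measure set T1 -> \bar R}.
Variable m2 : {sigma_finite_measure set T2 -> \bar R}.
Implicit Type f : T1 * T2 -> R[i].

Lemma cint21 f : cintegrable (m1 \x m2)%E setT f ->
  cintegral m2 setT (fun y => cintegral m1 setT (fun x => f (x, y))) =
  cintegral (m1 \x m2)%E setT f.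
Proof.
move=> fi; have [f1 f2] := fi; have mf := cinte_meas fi.
have [m1' m2'] : cmeasurable setT (fun y => cintegral m1 setT (fun x => f (x, y))).
  have h := @cmeas_cint_param _ _ _ _ _ m1 (fun z => f (z.2, z.1)).
  apply: h.
  apply: (cmeas_comp (p := fun z => (z.2, z.1)) mf).
  exact: measurable_swap.
by apply: complex_ext => /=; rewrite -Rintegral21.
Qed.

Lemma cfubini f : cmeasurable setT f ->
  (\int[m1]_x L1 m2 (fun y => f (x, y)) < +oo)%E ->
  cintegral m1 setT (fun x => cintegral m2 setT (fun y => f (x, y))) =
  cintegral m2 setT (fun y => cintegral m1 setT (fun x => f (x, y))).
Proof.
move=> mf fo; have fi : cintegrable (m1 \x m2)%E setT f.
  by apply/cintegrableP; rewrite -L1_tonelli1.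
by rewrite cint12// cint21.
Qed.

(** A way to meet the hypothesis of [cfubini] when the inner norm is bounded by an integrable
    function of the outer variable. *)
Lemma L1_param_bound f (g : T1 -> R[i]) (B : R) : cmeasurable setT f ->
  cintegrable m1 setT g -> 0 <= B ->
  (forall x, L1 m2 (fun y => f (x, y)) <= (B * cabs (g x))%:E)%E ->
  (\int[m1]_x L1 m2 (fun y => f (x, y)) < +oo)%E.
Proof.
move=> mf gi B0 fg.
apply: (@le_lt_trans _ _ (L1 m1 (fun x => B%:C * g x))); last exact/cinte_L1/cinteZ.
apply: ge0_le_integral => //.
- by move=> x _; exact: L1_ge0.
- exact: measurable_L1_param.
- by apply: measurable_ecabs; apply: cmeasM; [exact: cmeas_cst|exact: cinte_meas gi].
- by move=> x _; rewrite cabsM cabs_real ger0_norm.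
Qed.

Lemma cinte_cint_param f : cintegrable (m1 \x m2)%E setT f ->
  cintegrable m1 setT (fun x => cintegral m2 setT (fun y => f (x, y))).
Proof.
move=> fi; have [mf fo] := (cintegrableP _ _).1 fi.
apply/cintegrableP; split; first exact: cmeas_cint_param.
apply: le_lt_trans fo; rewrite -L1_tonelli1//.
apply: ge0_le_integral => //.
- by move=> x _; rewrite lee_fin cabs_ge0.
- by apply: measurable_ecabs; exact: cmeas_cint_param.
- exact: measurable_L1_param.
- move=> x _; apply: cabs_cint_le_gen.
  by apply: (cmeas_comp mf); exact: pair1_measurable.
Qed.

End cfubini_swap.

(** * Lebesgue measure on R^3 *)

Lemma ge0_intZ d (T : measurableType d) (R : realType) (mu : measure T R)
    (f : T -> \bar R) (k : R) : measurable_fun setT f ->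
  (forall x, 0 <= f x)%E -> (0 <= k)%R ->
  (\int[mu]_x (k%:E * f x) = k%:E * \int[mu]_x f x)%E.
Proof. by move=> mf f0 k0; rewrite ge0_integralZl. Qed.

Section affine.
Local Open Scope classical_set_scope.
Local Open Scope ring_scope.
Context (R : realType).
Local Notation leb := (@lebesgue_measure R).

Lemma measurable_affine (a r : R) :
  measurable_fun (setT : set (measurableTypeR R))
    (fun x : measurableTypeR R => a + r * x : measurableTypeR R).
Proof. by apply: measurable_funD => //; exact: measurable_funM. Qed.

(** By uniqueness of Lebesgue measure: the rescaled push-forward takes the right values on half-open
    intervals. *)
Lemma lebesgue_affine (a r : R) (A : set (measurableTypeR R)) : 0 < r ->
  measurable A ->
  leb A = (r%:E * leb ((fun x => a + r * x)%R @^-1` A))%E.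
Proof.
move=> r0 mA; pose rr := NngNum (ltW r0).
pose phi := (fun x : measurableTypeR R => a + r * x : measurableTypeR R).
have mphi : measurable_fun setT phi by exact: measurable_affine.
pose nu : {measure set (measurableTypeR R) -> \bar R} :=
  mscale rr (pushforward leb phi).
have -> : (r%:E * leb ((fun x => a + r * x)%R @^-1` A))%E = nu mphi A by [].
apply: lebesgue_measure_unique => //= _ [[u v]] _ <-/=.
rewrite /nu /mscale /= /pushforward.
have -> : phi @^-1` `]u, v] = `](u - a) / r, (v - a) / r]%classic.
  apply/seteqP; split => x /=; rewrite !in_itv /= /phi.
    move=> /andP[h1 h2]; apply/andP; split.
      by rewrite ltr_pdivrMr// mulrC ltrBlDl.
    by rewrite ler_pdivlMr// mulrC lerBrDl.
  move=> /andP[h1 h2]; apply/andP; split.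
    by move: h1; rewrite ltr_pdivrMr// mulrC ltrBlDl.
  by move: h2; rewrite ler_pdivlMr// mulrC lerBrDl.
rewrite !lebesgue_measure_itv /= !lte_fin.
rewrite ltr_pM2r ?invr_gt0// ltrD2r.
case: ifPn => uv; last by rewrite mule0.
rewrite -!EFinB -EFinM; congr EFin.
by field; rewrite gt_eqF.
Qed.

Lemma ge0_integral_affine (a r : R) (f : measurableTypeR R -> \bar R) : 0 < r ->
  measurable_fun setT f -> (forall x, 0 <= f x)%E ->
  (\int[leb]_x f (a + r * x)%R = (r^-1)%:E * \int[leb]_x f x)%E.
Proof.
move=> r0 mf f0; pose rr := NngNum (ltW r0).
pose phi := (fun x : measurableTypeR R => a + r * x : measurableTypeR R).
have mphi : measurable_fun setT phi by exact: measurable_affine.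
have H := ge0_integral_pushforward mphi leb measurableT mf (fun x _ => f0 x).
rewrite preimage_setT in H.
have -> : (\int[leb]_x f (a + r * x)%R)%E = (\int[leb]_x (f \o phi) x)%E by [].
rewrite -H.
suff <- : (r%:E * \int[pushforward leb phi]_y f y = \int[leb]_x f x)%E.
  by rewrite muleA -EFinM mulVf ?mul1e// gt_eqF.
rewrite -[r]/(rr%:num) -ge0_integral_mscale//.
by apply: eq_measure_integral => A mA _; exact/esym/lebesgue_affine.
Qed.

Lemma ge0_integral_opp (f : measurableTypeR R -> \bar R) :
  measurable_fun setT f -> (forall x, 0 <= f x)%E ->
  (\int[leb]_x f (- x)%R = \int[leb]_x f x)%E.
Proof.
move=> mf f0.
have mphi : measurable_fun setT (-%R : measurableTypeR R -> measurableTypeR R).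
  exact: oppr_measurable.
have H := ge0_integral_pushforward mphi leb measurableT mf (fun x _ => f0 x).
rewrite preimage_setT in H.
have -> : (\int[leb]_x f (- x)%R)%E = (\int[leb]_x (f \o -%R) x)%E by [].
rewrite -H.
by apply: eq_measure_integral => A mA _; exact: lebesgue_measureN.
Qed.

End affine.

Notation E3 R := (measurableTypeR R * measurableTypeR R * measurableTypeR R)%type.

Section leb3_theory.
Local Open Scope classical_set_scope.
Local Open Scope ring_scope.
Context (R : realType).
Local Notation leb := (@lebesgue_measure R).
Local Notation E := (E3 R).

Lemma tonelli2 (f : measurableTypeR R * measurableTypeR R -> \bar R) :
  measurable_fun setT f -> (forall x, 0 <= f x)%E ->
  (\int[@leb2 R]_x f x = \int[leb]_x \int[leb]_y f (x, y))%E.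
Proof. exact: fubini_tonelli1. Qed.

Lemma tonelli3 (f : E -> \bar R) :
  measurable_fun setT f -> (forall x, 0 <= f x)%E ->
  (\int[@leb3 R]_x f x = \int[leb]_x \int[leb]_y \int[leb]_z f (x, y, z))%E.
Proof.
move=> mf f0.
have -> : (\int[@leb3 R]_x f x = \int[@leb2 R]_x \int[leb]_z f (x, z))%E.
  exact: fubini_tonelli1.
rewrite tonelli2//.
  exact: measurable_fun_fubini_tonelli_F.
by move=> x; exact: integral_ge0.
Qed.

Lemma measurable_affine3 (a : E) (r : R) :
  measurable_fun setT (fun x : E => (a + r *: (x : R * R * R)) : E).
Proof.
apply/measurable_fun_pairP; split.
  apply/measurable_fun_pairP; split.
    apply: (measurable_comp measurableT) (measurable_affine a.1.1 r) _ => //.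
    by apply: measurableT_comp.
  apply: (measurable_comp measurableT) (measurable_affine a.1.2 r) _ => //.
  by apply: measurableT_comp.
by apply: (measurable_comp measurableT) (measurable_affine a.2 r) _.
Qed.

Lemma measurable_opp3 :
  measurable_fun setT (fun x : E => (- (x : R * R * R)) : E).
Proof.
apply/measurable_fun_pairP; split.
  apply/measurable_fun_pairP; split.
    by apply: (measurable_comp measurableT) (@oppr_measurable R setT) _ => //; apply: measurableT_comp.
  by apply: (measurable_comp measurableT) (@oppr_measurable R setT) _ => //; apply: measurableT_comp.
by apply: (measurable_comp measurableT) (@oppr_measurable R setT) _.
Qed.

Let m1 (f : E -> \bar R) x y : measurable_fun setT f ->
  measurable_fun setT (fun z => f (x, y, z)).
Proof. by move=> mf; apply: measurableT_comp => //; exact: pair1_measurable. Qed.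

Let m2 (f : E -> \bar R) x : measurable_fun setT f -> (forall x, 0 <= f x)%E ->
  measurable_fun setT (fun y => \int[leb]_z f (x, y, z))%E.
Proof.
move=> mf f0.
have h : measurable_fun setT (fun p => \int[leb]_z f (p, z))%E.
  exact: measurable_fun_fubini_tonelli_F.
by apply: (measurableT_comp h); exact: pair1_measurable.
Qed.

Let m3 (f : E -> \bar R) : measurable_fun setT f -> (forall x, 0 <= f x)%E ->
  measurable_fun setT (fun x => \int[leb]_y \int[leb]_z f (x, y, z))%E.
Proof.
move=> mf f0.
apply: (measurable_fun_fubini_tonelli_F (fun p => \int[leb]_z f (p, z))%E).
  by apply: measurable_fun_fubini_tonelli_F.
by move=> p; exact: integral_ge0.
Qed.

(** Tonelli's theorem reduces this to three changes of variable on the line, from the innermost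
    integral outwards, each contributing a factor 1/r. *)
Lemma ge0_integral_affine3 (a : E) (r : R) (f : E -> \bar R) : 0 < r ->
  measurable_fun setT f -> (forall x, 0 <= f x)%E ->
  (\int[@leb3 R]_x f (a + r *: (x : R * R * R))%R =
   (r ^- 3)%:E * \int[@leb3 R]_x f x)%E.
Proof.
move=> r0 mf f0; rewrite tonelli3//; last first.
  by apply: (measurable_comp measurableT) mf (measurable_affine3 a r).
rewrite (tonelli3 mf f0) exprS expr2 !invfM.
have n1 x y : (0 <= \int[leb]_z f (x, y, z))%E by exact: integral_ge0.
have n2 x : (0 <= \int[leb]_y \int[leb]_z f (x, y, z))%E by exact: integral_ge0.
have r1 : 0 <= r^-1 by rewrite invr_ge0 ltW.
transitivity (\int[leb]_x \int[leb]_y (r^-1%:E * \int[leb]_z f (a.1.1 + r * x, a.1.2 + r * y, z)%R))%E.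
  apply: eq_integral => x _; apply: eq_integral => y _.
  rewrite -(ge0_integral_affine a.2 r0 (m1 _ _ mf))//.
transitivity (\int[leb]_x (r^-1%:E * (r^-1%:E * \int[leb]_y \int[leb]_z f (a.1.1 + r * x, y, z)%R)))%E.
  apply: eq_integral => x _.
  have h : measurable_fun setT
      (fun y : measurableTypeR R => \int[leb]_z f (a.1.1 + r * x, a.1.2 + r * y, z)%R)%E.
    exact: (measurable_comp measurableT) (m2 (a.1.1 + r * x) mf f0)
      (measurable_affine a.1.2 r).
  etransitivity; first exact: (ge0_intZ _ h (fun y => n1 _ _) r1).
  by rewrite (ge0_integral_affine a.1.2 r0 (m2 _ mf f0)).
under eq_integral do rewrite muleA -EFinM.
have h : measurable_fun setT
    (fun x : measurableTypeR R => \int[leb]_y \int[leb]_z f (a.1.1 + r * x, y, z)%R)%E.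
  exact: (measurable_comp measurableT) (m3 mf f0) (measurable_affine a.1.1 r).
etransitivity; first exact: (ge0_intZ _ h (fun y => n2 _) (mulr_ge0 r1 r1)).
rewrite (ge0_integral_affine a.1.1 r0 (m3 mf f0))//.
by rewrite muleA -EFinM mulrA.
Qed.

Lemma ge0_integral_opp3 (f : E -> \bar R) :
  measurable_fun setT f -> (forall x, 0 <= f x)%E ->
  (\int[@leb3 R]_x f (- (x : R * R * R))%R = \int[@leb3 R]_x f x)%E.
Proof.
move=> mf f0; rewrite tonelli3//; last first.
  by apply: (measurable_comp measurableT) mf measurable_opp3.
rewrite (tonelli3 mf f0).
have n1 x y : (0 <= \int[leb]_z f (x, y, z))%E by exact: integral_ge0.
have n2 x : (0 <= \int[leb]_y \int[leb]_z f (x, y, z))%E by exact: integral_ge0.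
transitivity (\int[leb]_x \int[leb]_y \int[leb]_z f (- x, - y, z)%R)%E.
  apply: eq_integral => x _; apply: eq_integral => y _.
  by rewrite -(ge0_integral_opp (m1 _ _ mf)).
transitivity (\int[leb]_x \int[leb]_y \int[leb]_z f (- x, y, z)%R)%E.
  apply: eq_integral => x _.
  by rewrite (ge0_integral_opp (m2 _ mf f0)).
by rewrite (ge0_integral_opp (m3 mf f0)).
Qed.

End leb3_theory.

(** * From nonnegative to complex integrands in a change of variables *)

Section change_of_variables.
Local Open Scope classical_set_scope.
Local Open Scope ring_scope.
Local Open Scope complex_scope.
Context d (T : measurableType d) (R : realType) (mu : {measure set T -> \bar R}).
Variables (phi : T -> T) (c : R).
Hypothesis mphi : measurable_fun setT phi.
Hypothesis c0 : 0 <= c.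
Hypothesis phiE : forall f : T -> \bar R, measurable_fun setT f ->
  (forall x, 0 <= f x)%E -> (\int[mu]_x f (phi x) = c%:E * \int[mu]_x f x)%E.

Lemma L1_change (f : T -> R[i]) : cmeasurable setT f ->
  L1 mu (fun x => f (phi x)) = (c%:E * L1 mu f)%E.
Proof.
move=> mf; rewrite /L1 (phiE (f := fun x => (cabs (f x))%:E))//.
  exact: measurable_ecabs.
by move=> x; rewrite lee_fin cabs_ge0.
Qed.

Lemma integral_change (f : T -> \bar R) : mu.-integrable setT f ->
  (\int[mu]_x f (phi x) = c%:E * \int[mu]_x f x)%E.
Proof.
move=> fi; have mf := measurable_int _ fi.
rewrite integralE [X in _ = (_ * X)%E]integralE.
rewrite muleBr//; last first.
  apply: fin_num_adde_defr.
  by apply: integrable_pos_fin_num.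
rewrite -!phiE//; last 2 first.
- exact: measurable_funeneg.
- exact: measurable_funepos.
by congr (_ - _)%E; apply: eq_integral => x _; rewrite ?funeposE ?funenegE.
Qed.

Lemma cint_change (f : T -> R[i]) : cintegrable mu setT f ->
  cintegral mu setT (fun x => f (phi x)) = c%:C * cintegral mu setT f.
Proof.
move=> [f1 f2]; apply: complex_ext; rewrite ?cReM ?cImM /=.
  rewrite mul0r subr0 /Rintegral.
  rewrite (integral_change f1) fineM//.
  exact: integrable_fin_num.
rewrite mul0r addr0 /Rintegral (integral_change f2) fineM//.
exact: integrable_fin_num.
Qed.

Lemma cinte_change (f : T -> R[i]) : cintegrable mu setT f ->
  cintegrable mu setT (fun x => f (phi x)).
Proof.
move=> /cintegrableP[mf fo]; apply/cintegrableP; split.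
  exact: (cmeas_comp mf mphi).
by rewrite L1_change// lte_mul_pinfty// L1_ge0.
Qed.

End change_of_variables.

Section leb3_cint.
Local Open Scope classical_set_scope.
Local Open Scope ring_scope.
Local Open Scope complex_scope.
Context (R : realType).
Local Notation E := (E3 R).
Local Notation mu := (@leb3 R).
Local Notation cint := (cintegral mu setT).
Local Notation cinte := (cintegrable mu setT).

Let shiftE (a : E) (f : E -> \bar R) : measurable_fun setT f ->
  (forall x, 0 <= f x)%E ->
  (\int[mu]_x f (a + (x : R * R * R))%R = 1%:E * \int[mu]_x f x)%E.
Proof.
move=> mf f0; have := @ge0_integral_affine3 R a 1 f ltr01 mf f0.
by under eq_integral do rewrite scale1r; rewrite expr1n invr1.
Qed.

Let mshift (a : E) : measurable_fun setT (fun x : E => (a + (x : R * R * R)) : E).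
Proof.
have := measurable_affine3 a 1.
by under eq_fun do rewrite scale1r.
Qed.

Lemma measurable_shift (a : E) :
  measurable_fun setT (fun x : E => (a + (x : R * R * R)) : E).
Proof. exact: mshift. Qed.

Lemma cint_shift (a : E) (f : E -> R[i]) : cinte f ->
  cint (fun x => f (a + (x : R * R * R))) = cint f.
Proof.
move=> fi.
by have -> := cint_change (shiftE a) fi; rewrite mul1r.
Qed.

Lemma cinte_shift (a : E) (f : E -> R[i]) : cinte f ->
  cinte (fun x => f (a + (x : R * R * R))).
Proof.
move=> fi.
exact: (cinte_change (mshift a) ler01 (shiftE a) fi).
Qed.

Lemma L1_shift (a : E) (f : E -> R[i]) : cmeasurable setT f ->
  L1 mu (fun x => f (a + (x : R * R * R))) = L1 mu f.
Proof.
move=> fi.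
by have -> := L1_change (shiftE a) fi; rewrite mul1e.
Qed.

Lemma cint_affine3 (a : E) (r : R) (f : E -> R[i]) : 0 < r -> cinte f ->
  cint (fun x => f (a + r *: (x : R * R * R))) = (r ^- 3)%:C * cint f.
Proof.
move=> r0 fi.
exact: (cint_change
  (fun g mg g0 => ge0_integral_affine3 a r0 mg g0) fi).
Qed.

Lemma cint_opp3 (f : E -> R[i]) : cinte f ->
  cint (fun x => f (- (x : R * R * R))) = cint f.
Proof.
move=> fi.
have h (g : E -> \bar R) : measurable_fun setT g -> (forall x, 0 <= g x)%E ->
    (\int[mu]_x g (- (x : R * R * R))%R = 1%:E * \int[mu]_x g x)%E.
  by move=> mg g0; rewrite mul1e ge0_integral_opp3.
by have -> := cint_change h fi; rewrite mul1r.
Qed.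

End leb3_cint.

(** * Cauchy and Laplace kernels *)

Section derivatives.
Local Open Scope classical_set_scope.
Local Open Scope ring_scope.
Context (R : realType) (V : normedModType R).
Implicit Types (f g : V -> R) (x v : V).

(** Directional derivatives become derivatives of one real variable, to which the chain rule and the
    mean value theorem apply. *)
Lemma is_derive_line f x v (df : R) :
  is_derive x v f df <-> is_derive (0 : R) (1 : R) (fun h : R => f (h *: v + x)) df.
Proof.
have e : (fun h : R => h^-1 *: ((f \o shift x) (h *: v) - f x)) =
    (fun h : R => h^-1 *: (((fun h : R => f (h *: v + x)) \o shift 0) (h *: (1 : R))
      - f (0 *: v + x))).
  apply/funext => h /=; rewrite addr0 scale0r add0r.
  by rewrite [h *: (1 : R)]mulr1.
split => -[d1 d2]; apply: DeriveDef.
- by rewrite /derivable -e.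
- by rewrite -d2 /derive -e.
- by rewrite /derivable e.
- by rewrite -d2 /derive e.
Qed.

Lemma isdD f g x v (df dg : R) : is_derive x v f df -> is_derive x v g dg ->
  is_derive x v (fun y => f y + g y) (df + dg).
Proof. exact: is_deriveD. Qed.

Lemma isdB f g x v (df dg : R) : is_derive x v f df -> is_derive x v g dg ->
  is_derive x v (fun y => f y - g y) (df - dg).
Proof. exact: is_deriveB. Qed.

Lemma isdM f g x v (df dg : R) : is_derive x v f df -> is_derive x v g dg ->
  is_derive x v (fun y => f y * g y) (df * g x + f x * dg).
Proof.
move=> fd gd; apply: (@is_derive_eq _ _ _ (f * g)).
by rewrite addrC [df * _]mulrC.
Qed.

Lemma isdcst (c : R) x v : is_derive x v (fun=> c) 0.
Proof. exact: is_derive_cst. Qed.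

Lemma isdcomp (F : R -> R) g x v (a b : R) : is_derive (g x) (1 : R) F a ->
  is_derive x v g b -> is_derive x v (fun y => F (g y)) (a * b).
Proof.
move=> Fd /is_derive_line gd; apply/is_derive_line.
have Fd' : is_derive ((fun h : R => g (h *: v + x)) 0) (1 : R) F a.
  by rewrite scale0r add0r.
have := @is_derive1_comp _ F (fun h : R => g (h *: v + x)) 0 a b Fd' gd.
by [].
Qed.

Lemma derivable_is_derive f x v : derivable f x v -> is_derive x v f ('D_v f x).
Proof. by move=> fd; apply: DeriveDef. Qed.

Lemma is_derive_derivable f x v df : is_derive x v f df -> derivable f x v.
Proof. by case. Qed.

Lemma is_derive_val f x v df : is_derive x v f df -> 'D_v f x = df.
Proof. by case. Qed.

End derivatives.

Section line_integrals.
Local Open Scope classical_set_scope.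
Local Open Scope ring_scope.
Context (R : realType).
Local Notation leb := (@lebesgue_measure R).

Lemma integral_cauchy :
  (\int[leb]_x ((1 + x ^+ 2)^-1)%:E = (pi : R)%:E)%E.
Proof.
have c (x : R) : {for x, continuous (fun x : R => (1 + x ^+ 2)^-1)}.
  exact: (@continuous_oneDsqrV R x).
rewrite (@ge0_symfun_integralT R (fun x => (1 + x ^+ 2)^-1))//; last first.
- by move=> x /=; rewrite sqrrN.
- by move=> x; rewrite invr_ge0 addr_ge0// sqr_ge0.
rewrite -set_itvcy (@ge0_continuous_FTC2y _ _ (@atan R) _ (pi / 2)).
- rewrite atan0 sube0 -EFinM; congr EFin; by field.
- by move=> x _; rewrite invr_ge0 addr_ge0// sqr_ge0.
- by apply: continuous_subspaceT => x; exact: c.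
- exact: cvgy_atan.
- by move=> x _; apply: is_derive_derivable (is_derive1_atan x).
- by apply: cvg_at_right_filter; exact: continuous_atan.
- by move=> x _; rewrite derive1_atan.
Qed.

Lemma cvg_expR_cst (e M : R) : 0 < e -> M * expR (- (e * x)) @[x --> +oo] --> (0 : R).
Proof.
move=> e0; rewrite -[X in _ --> X](mulr0 M); apply: cvgM; first exact: cvg_cst.
apply: (cvg_comp (fun x => e * x) (fun y => expR (- y))); last exact: cvgr_expR.
by apply/gt0_cvgMry => //; exact: cvg_id.
Qed.

(** Adding 1 to the cosine makes the integrand nonnegative, as the fundamental theorem on a
    half-line requires. The case z = 0 gives the integral of the exponential alone, which is then
    subtracted. *)
Lemma integral_exp_cos (e z : R) : 0 < e ->
  (\int[leb]_x (expR (- (e * `|x|)) * (1 + cos (z * x)))%:E =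
   (2 * (e^-1 + e / (e ^+ 2 + z ^+ 2)))%:E)%E.
Proof.
move=> e0.
have ez0 : 0 < e ^+ 2 + z ^+ 2 by rewrite ltr_pwDl ?exprn_gt0// sqr_ge0.
(* The antiderivative obtained by integrating by parts twice; it vanishes at infinity. *)
pose F x := expR (- (e * x)) * ((z * sin (z * x) - e * cos (z * x)) / (e ^+ 2 + z ^+ 2) - e^-1).
pose f x := expR (- (e * x)) * (1 + cos (z * x)).
have dl (c x : R) : is_derive x (1:R) (fun y : R => c * y) c.
  apply: (is_derive_eq (isdM (isdcst c x (1:R)) (is_derive_id x (1:R)))).
  by rewrite mul0r add0r mulr1.
have dF x : is_derive x (1:R) F (f x).
  apply: is_derive_eq.
  rewrite /GRing.scale /= /f; field; by rewrite ?gt_eqF.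
have cf : continuous f.
  move=> x; apply/differentiable_continuous/derivable1_diffP.
  exact: is_derive_derivable.
have f0 x : 0 <= f x.
  by rewrite mulr_ge0 ?expR_ge0// -lerBlDl sub0r cos_geN1.
rewrite (@ge0_symfun_integralT R (fun x => expR (- (e * `|x|)) * (1 + cos (z * x))))//.
- have -> : (\int[leb]_(x in [set x | (0 <= x)%R])
      (expR (- (e * `|x|)) * (1 + cos (z * x)))%:E =
      \int[leb]_(x in `[0%R, +oo[) (f x)%:E)%E.
    rewrite -set_itvcy; apply: eq_integral => x; rewrite inE /= in_itv /= andbT => x0.
    by rewrite /f ger0_norm.
  rewrite (@ge0_continuous_FTC2y _ f F 0 0)//.
  + rewrite /F mulr0 oppr0 expR0 mulr0 sin0 cos0 mulr0 sub0r mulr1 mul1r.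
    by rewrite -EFinB -EFinM; congr EFin; field; rewrite ?gt_eqF.
  + by apply: continuous_subspaceT.
  + pose M := (`|z| + e) / (e ^+ 2 + z ^+ 2) + e^-1.
    apply: norm_cvg0.
    apply: (@squeeze_cvgr _ _ _ _ (cst 0) (fun x => M * expR (- (e * x)))).
    * apply: nearW => x; rewrite normr_ge0/= /F normrM mulrC.
      rewrite [X in _ * X]ger0_norm ?expR_ge0//.
      rewrite ler_wpM2r ?expR_ge0// (le_trans (ler_normB _ _))// lerD//; last first.
        by rewrite ger0_norm// invr_ge0 ltW.
      rewrite normrM [X in _ * X]ger0_norm ?invr_ge0 ?(ltW ez0)//.
      rewrite ler_wpM2r ?invr_ge0 ?(ltW ez0)// (le_trans (ler_normB _ _))//.
      rewrite !normrM (gtr0_norm e0) lerD//.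
        by rewrite ler_piMr// ler_norml sin_geN1 sin_le1.
      by rewrite ler_piMr ?(ltW e0)// ler_norml cos_geN1 cos_le1.
    * exact: cvg_cst.
    * exact: cvg_expR_cst.
  + apply: cvg_at_right_filter.
    by apply/differentiable_continuous/derivable1_diffP; exact: is_derive_derivable (dF 0).
  + by move=> x _; rewrite derive1E; exact: is_derive_val.
- move=> x; apply: cvgM.
    apply: (cvg_comp (fun x => - (e * `|x|)) expR); last exact: continuous_expR.
    apply: cvgN; apply: cvgM; first exact: cvg_cst.
    exact: norm_continuous.
  apply: cvgD; first exact: cvg_cst.
  apply: (cvg_comp (fun x => z * x) cos); last exact: continuous_cos.
  by apply: cvgM; [exact: cvg_cst|exact: cvg_id].
- by move=> x /=; rewrite normrN mulrN cosN.
Qed.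

End line_integrals.

(** * Integrals of products of functions of separate variables *)

Section tensor.
Local Open Scope classical_set_scope.
Local Open Scope ring_scope.
Local Open Scope complex_scope.
Context d1 d2 (T1 : measurableType d1) (T2 : measurableType d2) (R : realType).
Variable m1 : {sigma_finite_measure set T1 -> \bar R}.
Variable m2 : {sigma_finite_measure set T2 -> \bar R}.
Variables (f : T1 -> R[i]) (g : T2 -> R[i]).

Lemma cmeas_tensor : cmeasurable setT f -> cmeasurable setT g ->
  cmeasurable setT (fun z : T1 * T2 => f z.1 * g z.2).
Proof.
move=> mf mg; apply: cmeasM.
  exact: (cmeas_comp mf measurable_fst).
exact: (cmeas_comp mg measurable_snd).
Qed.

Lemma L1_tensor : cmeasurable setT f -> cmeasurable setT g ->
  L1 (m1 \x m2)%E (fun z => f z.1 * g z.2) = (L1 m1 f * L1 m2 g)%E.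
Proof.
move=> mf mg; rewrite -L1_tonelli1; last exact: cmeas_tensor.
rewrite /= muleC /L1 -ge0_integralZl//; last 3 first.
- exact: measurable_ecabs.
- by move=> x _; rewrite lee_fin cabs_ge0.
- by apply: integral_ge0 => x _; rewrite lee_fin cabs_ge0.
apply: eq_integral => x _; by rewrite muleC -/(L1 m2 g) -L1Z.
Qed.

Lemma cinte_tensor : cintegrable m1 setT f -> cintegrable m2 setT g ->
  cintegrable (m1 \x m2)%E setT (fun z => f z.1 * g z.2).
Proof.
move=> /cintegrableP[mf fo] /cintegrableP[mg go]; apply/cintegrableP; split.
  exact: cmeas_tensor.
rewrite L1_tensor// lte_mul_pinfty ?L1_ge0//.
by rewrite ge0_fin_numE ?L1_ge0.
Qed.

Lemma cint_tensor : cintegrable m1 setT f -> cintegrable m2 setT g ->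
  cintegral (m1 \x m2)%E setT (fun z => f z.1 * g z.2) =
  cintegral m1 setT f * cintegral m2 setT g.
Proof.
move=> fi gi; rewrite -cint12; last exact: cinte_tensor.
rewrite /=; under eq_cint do rewrite cintZ//.
by rewrite cintZr.
Qed.

End tensor.

Section tensor3.
Local Open Scope classical_set_scope.
Local Open Scope ring_scope.
Local Open Scope complex_scope.
Context (R : realType).
Local Notation leb := (@lebesgue_measure R).
Local Notation E := (E3 R).
Local Notation R1 := (measurableTypeR R).
Variables (f g h : R1 -> R[i]).

Lemma cinte_tensor3 : cintegrable leb setT f -> cintegrable leb setT g ->
  cintegrable leb setT h ->
  cintegrable (@leb3 R) setT (fun x : E => f x.1.1 * g x.1.2 * h x.2).
Proof.
move=> fi gi hi.
have fg : cintegrable (@leb2 R) setT (fun x => f x.1 * g x.2) by exact: cinte_tensor.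
exact: (cinte_tensor fg hi).
Qed.

Lemma cint_tensor3 : cintegrable leb setT f -> cintegrable leb setT g ->
  cintegrable leb setT h ->
  cintegral (@leb3 R) setT (fun x : E => f x.1.1 * g x.1.2 * h x.2) =
  cintegral leb setT f * cintegral leb setT g * cintegral leb setT h.
Proof.
move=> fi gi hi.
have fg : cintegrable (@leb2 R) setT (fun x => f x.1 * g x.2) by exact: cinte_tensor.
etransitivity; first exact: (cint_tensor fg hi).
by congr (_ * _); exact: cint_tensor.
Qed.

End tensor3.

Section coordinates.
Local Open Scope classical_set_scope.
Local Open Scope ring_scope.
Context (R : realType) d (T : measurableType d).
Local Notation E := (E3 R).
Implicit Types p q : T -> E.

Lemma dotE (x y : R * R * R) : dot x y = x.1.1 * y.1.1 + x.1.2 * y.1.2 + x.2 * y.2.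
Proof. by rewrite /dot !big_ord_recr big_ord0 /= add0r. Qed.

Lemma measurable_coord3 (k : 'I_3) p : measurable_fun setT p ->
  measurable_fun setT (fun t => coord3 k (p t)).
Proof.
move=> mp; case: k => -[|[|k]] hk; rewrite /coord3 /=.
- have h : measurable_fun setT (fun x : E => x.1.1) by exact: measurableT_comp.
  exact: (measurableT_comp h mp).
- have h : measurable_fun setT (fun x : E => x.1.2) by exact: measurableT_comp.
  exact: (measurableT_comp h mp).
- exact: (measurableT_comp measurable_snd mp).
Qed.

Lemma measurable_dot p q : measurable_fun setT p -> measurable_fun setT q ->
  measurable_fun setT (fun t => dot (p t) (q t)).
Proof.
move=> mp mq; rewrite (_ : (fun _ => _) =
  fun t => \sum_(k < 3) coord3 k (p t) * coord3 k (q t))//.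
by apply: measurable_sum => k; apply: measurable_funM; exact: measurable_coord3.
Qed.

Lemma measurable_addZ p q (r : R) : measurable_fun setT p -> measurable_fun setT q ->
  measurable_fun setT (fun t => ((p t : R * R * R) + r *: (q t : R * R * R)) : E).
Proof.
have h1 u : measurable_fun setT u -> measurable_fun setT (fun t : T => (u t : E).1.1).
  by move=> mu; exact: (measurable_coord3 (@Ordinal 3 0 isT) mu).
have h2 u : measurable_fun setT u -> measurable_fun setT (fun t : T => (u t : E).1.2).
  by move=> mu; exact: (measurable_coord3 (@Ordinal 3 1 isT) mu).
have h3 u : measurable_fun setT u -> measurable_fun setT (fun t : T => (u t : E).2).
  by move=> mu; exact: (measurable_coord3 (@Ordinal 3 2 isT) mu).
move=> mp mq; apply/measurable_fun_pairP; split.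
  apply/measurable_fun_pairP; split.
    apply: (@measurable_funD _ _ _ _ (fun t => (p t).1.1) (fun t => r * (q t).1.1)); first exact: h1.
    by apply: measurable_funM => //; exact: h1.
  apply: (@measurable_funD _ _ _ _ (fun t => (p t).1.2) (fun t => r * (q t).1.2)); first exact: h2.
  by apply: measurable_funM => //; exact: h2.
apply: (@measurable_funD _ _ _ _ (fun t => (p t).2) (fun t => r * (q t).2)); first exact: h3.
by apply: measurable_funM => //; exact: h3.
Qed.

Lemma measurable_enorm p : measurable_fun setT p ->
  measurable_fun setT (fun t => enorm (p t)).
Proof.
move=> mp; apply: (measurableT_comp (f := @Num.sqrt R)).
  by apply: continuous_measurable_fun => x; exact: sqrt_continuous.
exact: measurable_dot.
Qed.

End coordinates.

Section kernels.
Local Open Scope classical_set_scope.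
Local Open Scope ring_scope.
Local Open Scope complex_scope.
Context (R : realType).
Local Notation leb := (@lebesgue_measure R).
Local Notation E := (E3 R).
Local Notation R1 := (measurableTypeR R).

(** The Cauchy density without its factor 1/pi. *)
Definition cauchy1 (x : R) : R := (1 + x ^+ 2)^-1.

Lemma cauchy1_gt0 x : 0 < cauchy1 x.
Proof. by rewrite invr_gt0 ltr_pwDl// sqr_ge0. Qed.

Lemma measurable_cauchy1 : measurable_fun (setT : set R1) cauchy1.
Proof. by apply: continuous_measurable_fun => x; exact: (@continuous_oneDsqrV R x). Qed.

Lemma L1_cauchy1 : L1 leb (fun x : R1 => (cauchy1 x)%:C) = (pi : R)%:E.
Proof.
rewrite -integral_cauchy; apply: eq_integral => x _.
by rewrite cabs_real ger0_norm// ltW// cauchy1_gt0.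
Qed.

Lemma cinte_cauchy1 : cintegrable leb setT (fun x : R1 => (cauchy1 x)%:C).
Proof.
apply/cintegrableP; split; last by rewrite L1_cauchy1 ltry.
by apply: cmeas_real; exact: measurable_cauchy1.
Qed.

Lemma cint_cauchy1 : cintegral leb setT (fun x : R1 => (cauchy1 x)%:C) = pi%:C.
Proof.
apply: complex_ext => /=; last by rewrite Rintegral_cst// mul0r.
by rewrite /Rintegral integral_cauchy.
Qed.

(* Its Fourier transform is the Poisson kernel, by [cint_laplace]. *)
Definition laplace1 (e x : R) : R := expR (- (e * `|x|)).

Lemma measurable_laplace1 e : measurable_fun (setT : set R1) (laplace1 e).
Proof.
apply: (measurableT_comp (@measurable_expR R)); apply: measurable_funN.
by apply: measurable_funM => //; exact: normr_measurable.
Qed.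

Lemma laplace1_ge0 e x : 0 <= laplace1 e x.
Proof. exact: expR_ge0. Qed.

Lemma L1_laplace1 e : 0 < e -> L1 leb (fun x : R1 => (laplace1 e x)%:C) = (2 / e)%:E.
Proof.
move=> e0; have := integral_exp_cos 0 e0.
under eq_integral do rewrite mul0r cos0 mulrC EFinM.
rewrite ge0_intZ//; last first.
  by apply/measurable_EFinP; exact: measurable_laplace1.
move=> h; have {h} : (2^-1%:E * ((1 + 1)%:E * (\int[leb]_x (expR (- (e * `|x|)))%:E)) =
  2^-1%:E * (2 * (e^-1 + e / (e ^+ 2 + 0 ^+ 2)))%:E :> \bar R)%E by rewrite h.
rewrite muleA -!EFinM -[1 + 1]/(2%:R) mulVf// mul1e => h.
transitivity (\int[leb]_x (expR (- (e * `|x|)))%:E)%E.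
  by apply: eq_integral => x _; rewrite cabs_real ger0_norm// laplace1_ge0.
by rewrite h; congr EFin; field; rewrite ?gt_eqF.
Qed.

Lemma cinte_laplace1 e : 0 < e -> cintegrable leb setT (fun x : R1 => (laplace1 e x)%:C).
Proof.
move=> e0; apply/cintegrableP; split; last by rewrite L1_laplace1// ltry.
by apply: cmeas_real; exact: measurable_laplace1.
Qed.

Lemma cinte_cexpi_laplace1 e z : 0 < e ->
  cintegrable leb setT (fun x : R1 => cexpi (z * x) * (laplace1 e x)%:C).
Proof.
move=> e0; apply: (@cinte_bndM _ _ _ _ 1).
- by apply: cmeas_cexpi; exact: measurable_funM.
- by move=> x; rewrite cabs_cexpi.
- exact: cinte_laplace1.
Qed.

Lemma cint_laplace e z : 0 < e ->
  cintegral leb setT (fun x : R1 => cexpi (z * x) * (laplace1 e x)%:C) =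
  (2 * e / (e ^+ 2 + z ^+ 2))%:C.
Proof.
move=> e0; have [h1 h2] := cinte_cexpi_laplace1 z e0.
have [l1 _] := cinte_laplace1 e0.
have ez0 : 0 < e ^+ 2 + z ^+ 2 by rewrite ltr_pwDl ?exprn_gt0// sqr_ge0.
apply: complex_ext; rewrite /=.
  have cosE x : cos (z * x) * laplace1 e x - sin (z * x) * 0 =
      laplace1 e x * (1 + cos (z * x)) - laplace1 e x.
    by rewrite mulr0 subr0 mulrDr mulr1 addrAC subrr add0r mulrC.
  have le : \int[leb]_x laplace1 e x = 2 / e.
    rewrite /Rintegral; have := L1_laplace1 e0; rewrite /L1.
    by under eq_integral do rewrite cabs_real ger0_norm ?laplace1_ge0//; move=> ->.
  have lc : leb.-integrable setT (EFin \o (fun x : R1 => laplace1 e x * (1 + cos (z * x)))).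
    rewrite (_ : _ \o _ = (fun x => (complex.Re ((laplace1 e x)%:C))%:E +
      (complex.Re (cexpi (z * x) * (laplace1 e x)%:C))%:E)%E).
      exact: integrableD.
    by apply/funext => x /=; rewrite -EFinD mulr0 subr0 mulrDr mulr1 [cos _ * _]mulrC.
  under eq_Rintegral do rewrite cosE.
  rewrite RintegralB// le /Rintegral integral_exp_cos//=.
  by field; rewrite ?gt_eqF.
(* The imaginary part integrates an odd function, so it equals its own opposite. *)
set I := Rintegral _ _ _.
suff : I = - I by move=> /eqP; rewrite -addr_eq0 -mulr2n mulrn_eq0 => /eqP.
have inv (f : R1 -> \bar R) : measurable_fun setT f -> (forall x, 0 <= f x)%E ->
    (\int[leb]_x f (- x)%R = 1%:E * \int[leb]_x f x)%E.
  by move=> mf f0; rewrite mul1e ge0_integral_opp.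
have hh := integral_change (phi := fun x : R1 => - x : R1) inv h2.
rewrite mul1e in hh; have {hh} hh := congr1 fine hh.
etransitivity; first exact/esym/hh.
etransitivity; last exact: (RintegralN (mu := leb)
  (h := fun x : R1 => complex.Im (cexpi (z * x) * (laplace1 e x)%:C)) h2).
rewrite /Rintegral; congr fine; apply: eq_integral => x _ /=.
by congr EFin; rewrite /laplace1 normrN mulrN cosN sinN !mulr0 !add0r mulNr.
Qed.

(** A product of kernels on the line instead of a radial kernel on R^3: its integral and transform
    then factor into integrals on the line. *)
Definition cauchy3 (x : E) : R := cauchy1 x.1.1 * cauchy1 x.1.2 * cauchy1 x.2.

Definition laplace3 (e : R) (x : E) : R :=
  laplace1 e x.1.1 * laplace1 e x.1.2 * laplace1 e x.2.

Lemma cauchy3_gt0 x : 0 < cauchy3 x.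
Proof. by rewrite !mulr_gt0// cauchy1_gt0. Qed.

Lemma cauchy3_le1 x : cauchy3 x <= 1.
Proof.
have h (y : R) : cauchy1 y <= 1 by exact: (oneDsqrV_le1 y).
have p (y : R) : 0 <= cauchy1 y by exact/ltW/cauchy1_gt0.
by rewrite -[leRHS]mulr1 ler_pM ?mulr_ge0// -[leRHS]mulr1 ler_pM.
Qed.

Lemma cinte_cauchy3 : cintegrable (@leb3 R) setT (fun x => (cauchy3 x)%:C).
Proof.
have := cinte_tensor3 cinte_cauchy1 cinte_cauchy1 cinte_cauchy1.
by under eq_fun do rewrite -!rcM.
Qed.

Lemma measurable_cauchy3 : measurable_fun (setT : set E) cauchy3.
Proof. by have [[]] := (cintegrableP _ _).1 cinte_cauchy3. Qed.

Lemma integrable_cauchy3 (B : R) :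
  (@leb3 R).-integrable setT (fun x => (B * cauchy3 x)%:E).
Proof.
have [h _] := cinte_cauchy3.
exact: (integrableZl measurableT B h).
Qed.

Lemma cint_cauchy3 : cintegral (@leb3 R) setT (fun x => (cauchy3 x)%:C) = (pi ^+ 3)%:C.
Proof.
have := cint_tensor3 cinte_cauchy1 cinte_cauchy1 cinte_cauchy1.
rewrite cint_cauchy1; under eq_cint do rewrite -!rcM.
by move=> h; rewrite [LHS]h -!rcM exprS expr2 mulrA.
Qed.

Lemma cinte_laplace3 e : 0 < e ->
  cintegrable (@leb3 R) setT (fun x => (laplace3 e x)%:C).
Proof.
move=> e0; have l := cinte_laplace1 e0.
have := cinte_tensor3 l l l.
by under eq_fun do rewrite -!rcM.
Qed.

Lemma measurable_laplace3 e : 0 < e -> measurable_fun (setT : set E) (laplace3 e).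
Proof. by move=> /cinte_laplace3 /cintegrableP[[]]. Qed.

Lemma laplace3_ge0 e x : 0 <= laplace3 e x.
Proof. by rewrite !mulr_ge0// laplace1_ge0. Qed.

Lemma laplace3_le1 e x : 0 < e -> laplace3 e x <= 1.
Proof.
have h1 (y : R) : 0 < e -> laplace1 e y <= 1.
  move=> e0; rewrite /laplace1 -expR0 ler_expR oppr_le0 mulr_ge0//.
  exact: ltW.
move=> e0; rewrite /laplace3 -[leRHS]mulr1 ler_pM ?mulr_ge0 ?laplace1_ge0 ?h1//.
by rewrite -[leRHS]mulr1 ler_pM ?laplace1_ge0 ?h1.
Qed.

(* Partial fractions: the Poisson kernel is a rescaled Cauchy kernel. *)
Lemma cint_laplace3 e (z : E) : 0 < e ->
  cintegral (@leb3 R) setT (fun x : E => cexpi (dot z x) * (laplace3 e x)%:C) =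
  (8 / e ^+ 3 * cauchy3 (e^-1 *: (z : R * R * R)))%:C.
Proof.
move=> e0; have l z := cinte_cexpi_laplace1 z e0.
have := cint_tensor3 (l z.1.1) (l z.1.2) (l z.2).
rewrite !cint_laplace//.
under eq_cint.
  move=> x; rewrite (_ : _ * _ = cexpi (dot z x) * (laplace3 e x)%:C); first by over.
  by rewrite dotE !cexpiD /laplace3 !rcM; ring.
move=> ->; rewrite -!rcM; congr (_ %:C).
have ez0 (u : R) : e ^+ 2 + u ^+ 2 != 0.
  by rewrite gt_eqF// ltr_pwDl ?exprn_gt0// sqr_ge0.
have kE (u : R) : cauchy1 (e^-1 * u) = e ^+ 2 / (e ^+ 2 + u ^+ 2).
  have := ez0 u; rewrite /cauchy1 => h; field; rewrite h gt_eqF//=.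
rewrite /cauchy3 /= !kE; field.
by rewrite !ez0 gt_eqF.
Qed.

Lemma cinte_cexpi_laplace3 e (z : E) : 0 < e ->
  cintegrable (@leb3 R) setT (fun x : E => cexpi (dot z x) * (laplace3 e x)%:C).
Proof.
move=> e0; apply: (@cinte_bndM _ _ _ _ 1).
- by apply: cmeas_cexpi; exact: measurable_dot.
- by move=> x; rewrite cabs_cexpi.
- exact: cinte_laplace3.
Qed.

End kernels.

(** * Functions with vanishing integrals over boxes *)

Section caratheodory.
Local Open Scope classical_set_scope.
Local Open Scope ring_scope.
Context d (T : measurableType d) (R : realType).
Local Notation R1 := (measurableTypeR R).

Let grid (n : nat) (x : R) : R := (Num.floor (n.+1%:R * x))%:~R / n.+1%:R.

Let cvg_grid (x : R) : grid n x @[n --> \oo] --> x.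
Proof.
apply/cvgrPdist_le => e e0.
near=> n.
have n0 : 0 < n.+1%:R :> R by [].
have /andP[f1 f2] := mem_rg1_floor (n.+1%:R * x).
have h1 : grid n x <= x by rewrite /grid ler_pdivrMr// [x * _]mulrC.
have h2 : x <= grid n x + n.+1%:R^-1.
  rewrite /grid -[X in _ + X]mul1r -mulrDl ler_pdivlMr// [x * _]mulrC ltW//.
rewrite ger0_norm ?subr_ge0// lerBlDl (le_trans h2)// lerD2l.
by near: n; apply: filterS (near_infty_natSinv_lt (PosNum e0)) => n /ltW.
Unshelve. all: by end_near. Qed.

(* Discretizing the continuous variable on the grid of mesh 1/(n+1). *)
Lemma measurable_caratheodory (f : T * R1 -> R) :
  (forall x, measurable_fun setT (fun t => f (t, x))) ->
  (forall t, continuous (fun x : R => f (t, x))) ->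
  measurable_fun setT f.
Proof.
move=> mf cf.
apply: (@measurable_fun_cvg _ _ _ setT (fun n z => f (z.1, grid n z.2))) => //; last first.
  move=> [t x] _ /=.
  by apply: (cvg_comp (fun n => grid n x) (fun y : R => f (t, y))); [exact: cvg_grid|exact: cf].
move=> n _ B mB; rewrite setTI.
pose D (k : int) := [set t | B (f (t, k%:~R / n.+1%:R))] `*`
  [set x : R1 | Num.floor (n.+1%:R * x) = k].
have -> : (fun z : T * R1 => f (z.1, grid n z.2)) @^-1` B = \bigcup_k D k.
  apply/seteqP; split => [[t x] /= h|[t x] [k _ [/= h e]]].
    by exists (Num.floor (n.+1%:R * x)).
  by rewrite /grid e.
apply: countable_bigcupT_measurable; first exact: countableP.
move=> k; apply: measurableX.
  have := mf (k%:~R / n.+1%:R) measurableT B mB.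
  by rewrite setTI.
rewrite [X in measurable X](_ : _ = `[k%:~R / n.+1%:R, (k + 1)%:~R / n.+1%:R[%classic).
  exact: measurable_itv.
apply/seteqP; split => x /=; rewrite in_itv /=.
  move=> <-; have /andP[f1 f2] := mem_rg1_floor (n.+1%:R * x).
  by rewrite intrD ler_pdivrMr// ltr_pdivlMr// [x * _]mulrC f1 f2.
rewrite ler_pdivrMr// ltr_pdivlMr// [x * _]mulrC => /andP[f1 f2].
by apply: floor_def; rewrite f1 f2.
Qed.

End caratheodory.

Section continuous_measurable.
Local Open Scope classical_set_scope.
Local Open Scope ring_scope.
Context (R : realType).
Local Notation E := (E3 R).

Lemma cvg3 (U : Type) (F : set_system U) (FF : Filter F) (f g h : U -> R)
    (a b c : R) : f t @[t --> F] --> a -> g t @[t --> F] --> b ->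
  h t @[t --> F] --> c ->
  (((f t, g t), h t) : R * R * R) @[t --> F] --> (((a, b), c) : R * R * R).
Proof.
move=> fa gb hc; apply: (@cvg_pair _ _ _ _ (nbhs (a, b)) (nbhs c)) => //.
exact: (@cvg_pair _ _ _ _ (nbhs a) (nbhs b)).
Qed.

(** Measurability on R^3 refers to the product structure, so variables are added one at a time
    through [measurable_caratheodory], from separate continuity. *)
Lemma continuous_measurable3 (f : R * R * R -> R) : continuous f ->
  measurable_fun (setT : set E) f.
Proof.
move=> cf.
have c1 (y z x : R) : (((t, y), z) : R * R * R) @[t --> x] --> ((x, y), z).
  by apply: cvg3; [exact: cvg_id|exact: cvg_cst|exact: cvg_cst].
have c2 (x z y : R) : (((x, t), z) : R * R * R) @[t --> y] --> ((x, y), z).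
  by apply: cvg3; [exact: cvg_cst|exact: cvg_id|exact: cvg_cst].
have c3 (p : R * R) (z : R) : ((p, t) : R * R * R) @[t --> z] --> (p, z).
  case: p => p q.
  by apply: cvg3; [exact: cvg_cst|exact: cvg_cst|exact: cvg_id].
have m2 (z : R) : measurable_fun (setT : set (measurableTypeR R * measurableTypeR R))
    (fun p => f (p, z)).
  apply: measurable_caratheodory.
    move=> y; apply: continuous_measurable_fun => x.
    exact: (cvg_comp _ f (c1 y z x) (cf (x, y, z))).
  move=> x y.
  exact: (cvg_comp _ f (c2 x z y) (cf (x, y, z))).
apply: measurable_caratheodory => // p x.
exact: (cvg_comp _ f (c3 p x) (cf (p, x))).
Qed.

End continuous_measurable.

(** * Dynkin's argument for vanishing integrals *)

Section dynkin.
Local Open Scope classical_set_scope.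
Local Open Scope ring_scope.
Context d (T : measurableType d) (R : realType) (mu : {measure set T -> \bar R}).
Variable H : T -> R.
Hypothesis Hi : mu.-integrable setT (EFin \o H).

(** The sets over whose preimage the integral vanishes form a Dynkin system: complements use the
    vanishing total integral, disjoint unions use countable additivity. A projection for [p] frees
    one factor of a product at a time. *)
Lemma dynkin_integral0 d' (U : measurableType d') (p : T -> U) (G : set (set U)) :
  measurable_fun setT p -> @measurable _ U = <<s G >> -> setI_closed G ->
  (\int[mu]_x (H x)%:E = 0)%E ->
  (forall A, G A -> \int[mu]_(x in p @^-1` A) (H x)%:E = 0)%E ->
  forall A, measurable A -> (\int[mu]_(x in p @^-1` A) (H x)%:E = 0)%E.
Proof.
move=> mp mG GI HT HG A; rewrite mG.
have mpre B : measurable B -> measurable (p @^-1` B).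
  by move=> mB; rewrite -[X in measurable X]setTI; exact: mp.
apply: (dynkin_induction (P := fun A => \int[mu]_(x in p @^-1` A) (H x)%:E = 0)%E mG GI) => //.
- move=> S mS S0; move: HT; rewrite -(setUv (p @^-1` S)) integral_setU_EFin//.
  + by rewrite S0 add0e preimage_setC.
  + exact: mpre.
  + by apply: measurableC; exact: mpre.
  + by rewrite setUv; apply/measurable_EFinP; exact: measurable_int Hi.
  + exact/disj_setPCl.
- move=> F mF tF F0; rewrite preimage_bigcup integral_bigcup//.
  + by rewrite eseries0// => i _ _; exact: F0.
  + by apply/trivIsetP => i j _ _ ij; rewrite -preimage_setI (trivIsetP.1 tF)// preimage_set0.
  + by move=> k; exact: mpre.
  + apply: integrableS Hi => //.
    by apply: bigcup_measurable => k _; exact: mpre.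
Qed.

End dynkin.

Section box_integral.
Local Open Scope classical_set_scope.
Local Open Scope ring_scope.
Context (R : realType).
Local Notation E := (E3 R).
Local Notation mu := (@leb3 R).
Local Notation R1 := (measurableTypeR R).

(** The whole line is included so that boxes may be unbounded; with it the vanishing total integral
    in [dynkin_integral0] is a case of the hypothesis on boxes. *)
Definition ocitvT : set (set R) := [set A | A = setT \/ ocitv A].

Lemma ocitvTI : setI_closed ocitvT.
Proof.
move=> A B [->|hA] [->|hB]; rewrite ?setTI ?setIT; [by left|by right|by right|].
by right; exact: ocitvI.
Qed.

Lemma measurable_ocitvT : @measurable _ R1 = <<s ocitvT >>.
Proof.
apply/seteqP; split.
  apply: smallest_sub; first exact: smallest_sigma_algebra.
  move=> A hA; apply: sub_sigma_algebra; right.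
  by move: hA.
apply: smallest_sub; first exact: sigma_algebra_measurable.
move=> A [->|hA]; first exact: measurableT.
by apply: sub_sigma_algebra; move: hA.
Qed.

(** Dynkin's argument is used five times: for each side of the box, then for the two nested products
    that make up R^3. *)
Lemma integral_box0 (H : E -> R) : mu.-integrable setT (EFin \o H) ->
  (forall A B C, ocitvT A -> ocitvT B -> ocitvT C ->
     \int[mu]_(x in A `*` B `*` C) (H x)%:E = 0)%E ->
  forall A : set E, measurable A -> (\int[mu]_(x in A) (H x)%:E = 0)%E.
Proof.
move=> Hi H0.
have mo A : ocitvT A -> measurable (A : set R1).
  by move=> hA; rewrite measurable_ocitvT; exact: sub_sigma_algebra.
(* The coordinate [q] is released while the constraints on the others are kept in [S], absorbed into
   the integrand. *)
have step (S : set E) (q : E -> R1) (mS : measurable S) : measurable_fun setT q ->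
    (forall A, ocitvT A -> \int[mu]_(x in (q @^-1` A) `&` S) (H x)%:E = 0)%E ->
    (forall A, measurable A -> \int[mu]_(x in (q @^-1` A) `&` S) (H x)%:E = 0)%E.
  move=> mq h A mA; rewrite integral_mkcondr.
  have e B : (\int[mu]_(x in q @^-1` B) (((fun x => (H x)%:E) \_ S) x) =
      \int[mu]_(x in q @^-1` B) ((H \_ S) x)%:E)%E.
    by apply: eq_integral => x _; rewrite restrict_EFin.
  rewrite e; apply: (dynkin_integral0 _ mq measurable_ocitvT ocitvTI _ _ mA).
  - rewrite -restrict_EFin -/(EFin \o H); apply/(integrable_mkcond _ mS).
    exact: integrableS Hi.
  - have := h setT (or_introl erefl); rewrite preimage_setT.
    by rewrite integral_mkcondr => <-; rewrite -(e setT) preimage_setT.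
  - by move=> B /h; rewrite integral_mkcondr e.
have mX (A B C : set R1) : measurable A -> measurable B -> measurable C ->
    measurable (A `*` B `*` C : set E).
  by move=> mA mB mC; apply: measurableX => //; exact: measurableX.
have s1 A B C : measurable (A : set R1) -> ocitvT B -> ocitvT C ->
    (\int[mu]_(x in A `*` B `*` C) (H x)%:E = 0)%E.
  move=> mA oB oC.
  have := @step (setT `*` B `*` C) (fun x => x.1.1) _ _ _ A mA.
  rewrite (_ : _ `&` _ = A `*` B `*` C); first apply.
  - by apply: mX => //; exact: mo.
  - exact: measurableT_comp.
  - move=> A' oA'; rewrite (_ : _ `&` _ = A' `*` B `*` C); first exact: H0.
    by apply/seteqP; split => -[[x y] z] /=; tauto.
  - by apply/seteqP; split => -[[x y] z] /=; tauto.
have s2 A B C : measurable (A : set R1) -> measurable (B : set R1) -> ocitvT C ->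
    (\int[mu]_(x in A `*` B `*` C) (H x)%:E = 0)%E.
  move=> mA mB oC.
  have := @step (A `*` setT `*` C) (fun x => x.1.2) _ _ _ B mB.
  rewrite (_ : _ `&` _ = A `*` B `*` C); first apply.
  - by apply: mX => //; exact: mo.
  - exact: measurableT_comp.
  - move=> B' oB'; rewrite (_ : _ `&` _ = A `*` B' `*` C); first exact: s1.
    by apply/seteqP; split => -[[x y] z] /=; tauto.
  - by apply/seteqP; split => -[[x y] z] /=; tauto.
have s3 A B C : measurable (A : set R1) -> measurable (B : set R1) -> measurable (C : set R1) ->
    (\int[mu]_(x in A `*` B `*` C) (H x)%:E = 0)%E.
  move=> mA mB mC.
  have := @step (A `*` B `*` setT) (fun x => x.2) _ _ _ C mC.
  rewrite (_ : _ `&` _ = A `*` B `*` C); first apply.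
  - by apply: mX.
  - exact: measurable_snd.
  - move=> C' oC'; rewrite (_ : _ `&` _ = A `*` B `*` C'); first exact: s2.
    by apply/seteqP; split => -[[x y] z] /=; tauto.
  - by apply/seteqP; split => -[[x y] z] /=; tauto.
have HT : (\int[mu]_x (H x)%:E = 0)%E.
  rewrite (_ : setT = setT `*` setT `*` setT); first exact: s3.
  by apply/seteqP; split => -[[x y] z].
have rectI (d1 d2 : measure_display) (T1 : measurableType d1) (T2 : measurableType d2) :
    setI_closed [set A `*` B | A in @measurable _ T1 & B in @measurable _ T2].
  move=> _ _ [A mA [B mB <-]] [A' mA' [B' mB' <-]].
  rewrite -setXI; exists (A `&` A'); first exact: measurableI.
  by exists (B `&` B') => //; exact: measurableI.
have s4 (A : set (R1 * R1)) (C : set R1) : measurable A -> measurable C ->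
    (\int[mu]_(x in A `*` C) (H x)%:E = 0)%E.
  move=> mA mC.
  pose S : set E := setT `*` C.
  have mS : measurable S by exact: measurableX.
  have e B : (\int[mu]_(x in B `*` C) (H x)%:E = \int[mu]_(x in fst @^-1` B) ((H \_ S) x)%:E)%E.
    rewrite (_ : B `*` C = (fst @^-1` B) `&` S); last by apply/seteqP; split => -[x y]; rewrite /S /=; tauto.
    by rewrite integral_mkcondr; apply: eq_integral => x _; rewrite restrict_EFin.
  rewrite e; apply: (dynkin_integral0 _ measurable_fst (measurable_prod_measurableType _ _) (@rectI _ _ _ _) _ _ mA).
  - rewrite -restrict_EFin -/(EFin \o H); apply/(integrable_mkcond _ mS).
    exact: integrableS Hi.
  - transitivity (\int[mu]_(x in setT `*` C) (H x)%:E)%E; first by rewrite e preimage_setT.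
    have -> : (setT : set (R1 * R1)) = setT `*` setT by rewrite setXTT.
    exact: s3.
  - by move=> _ [A1 mA1 [A2 mA2 <-]]; rewrite -e; exact: s3.
move=> A mA.
apply: (dynkin_integral0 Hi (@measurable_id _ _ _) (measurable_prod_measurableType _ _) (@rectI _ _ _ _) HT _ mA).
by move=> _ [A1 mA1 [A2 mA2 <-]]; exact: s4.
Qed.

End box_integral.

(** * Schwartz functions *)

Section mean_value.
Local Open Scope classical_set_scope.
Local Open Scope ring_scope.
Context (R : realType).

Lemma is_derive_line_at (V : normedModType R) (f : V -> R) (x v : V) (h df : R) :
  is_derive (h *: v + x) v f df ->
  is_derive h (1 : R) (fun h : R => f (h *: v + x)) df.
Proof.
move=> /is_derive_line fd; apply/is_derive_line.
rewrite (_ : (fun h0 : R => _) = (fun h0 : R => f (h0 *: v + (h *: v + x))))//.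
apply/funext => k; congr f.
by rewrite [k *: (1 : R)]mulr1 scalerDl addrA.
Qed.

Lemma line_MVT (V : normedModType R) (f df : V -> R) (x v : V) (h : R) : 0 <= h ->
  (forall y, is_derive y v f (df y)) ->
  exists2 c, 0 <= c <= h & f (h *: v + x) - f x = df (c *: v + x) * h.
Proof.
move=> h0 fd.
have dl (k : R) : is_derive k (1 : R) (fun h : R => f (h *: v + x)) (df (k *: v + x)).
  exact: is_derive_line_at.
have [|c] := @MVT_segment R (fun h => f (h *: v + x)) (fun h => df (h *: v + x)) 0 h h0
   (fun k _ => dl k).
  apply: continuous_subspaceT => k.
  by apply/differentiable_continuous/derivable1_diffP; case: (dl k).
rewrite in_itv /= => ch; rewrite scale0r add0r subr0 => e.
by exists c.
Qed.

(** Each Taylor bound for sine and cosine follows from a bound of lower order on the derivative; the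
    constants are not optimal. *)
Lemma line_MVT_abs (f df : R -> R) (a B : R) :
  (forall y, is_derive y (1:R) f (df y)) ->
  (forall y, `|y| <= `|a| -> `|df y| <= B) -> `|f a - f 0| <= B * `|a|.
Proof.
move=> fd fB; have [a0|a0] := leP 0 a.
  have [c /andP[c0 ca]] := @line_MVT R^o f df 0 1 a a0 fd.
  rewrite !addr0 ![_ *: (1:R)]mulr1 => ->; rewrite normrM ler_wpM2r// fB//.
  by rewrite !ger0_norm.
have := @line_MVT R^o f df a 1 (- a) _ fd; case=> [|c /andP[c0 ca]].
  by rewrite oppr_ge0 ltW.
rewrite ![_ *: (1:R)]mulr1 addNr => e.
rewrite distrC e normrM normrN ler_wpM2r// fB//.
rewrite (ltr0_norm a0) ler_norml opprK; apply/andP; split; first by rewrite lerDr.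
by rewrite (le_trans _ (ltW _ : 0 <= - a))// ?oppr_gt0// -lerBrDr sub0r.
Qed.

Lemma abs_sin_le (a : R) : `|sin a| <= `|a|.
Proof.
have := @line_MVT_abs (@sin R) (@cos R) a 1; rewrite sin0 subr0 mul1r; apply.
by move=> y _; rewrite ler_norml cos_geN1 cos_le1.
Qed.

Lemma abs_cosB1_le (a : R) : `|cos a - 1| <= `|a|.
Proof.
have := @line_MVT_abs (@cos R) (fun x => - sin x) a 1; rewrite cos0 mul1r; apply.
by move=> y _; rewrite normrN ler_norml sin_geN1 sin_le1.
Qed.

Lemma abs_cosB1_le2 (a : R) : `|cos a - 1| <= a ^+ 2.
Proof.
have := @line_MVT_abs (@cos R) (fun x => - sin x) a `|a|.
rewrite cos0 -expr2 real_normK ?num_real//; apply.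
by move=> y ya; rewrite normrN (le_trans (abs_sin_le _)).
Qed.

Lemma abs_sinBid_le2 (a : R) : `|sin a - a| <= a ^+ 2.
Proof.
have := @line_MVT_abs (fun x => sin x - x) (fun x => cos x - 1) a `|a|.
rewrite sin0 !subr0 -expr2 real_normK ?num_real//; apply.
by move=> y ya; rewrite (le_trans (abs_cosB1_le _)).
Qed.

Lemma cabs_cexpiB1 (a : R) : cabs (cexpi a - 1) <= 2 * `|a|.
Proof.
rewrite (le_trans (cabs_le_ReIm _))// cReD cImD cReN cImN /= oppr0 addr0.
by rewrite mulr_natl mulr2n lerD// ?abs_cosB1_le ?abs_sin_le.
Qed.

(** The quadratic error that [has_partial_quad] asks for when a Fourier transform is
    differentiated. *)
Lemma cabs_cexpiB1id (a : R) : cabs (cexpi a - 1 - (0 +i* a)%C) <= 2 * a ^+ 2.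
Proof.
rewrite (le_trans (cabs_le_ReIm _))// !cReD !cImD !cReN !cImN /= !oppr0 !addr0.
by rewrite mulr_natl mulr2n lerD// ?abs_cosB1_le2 ?abs_sinBid_le2.
Qed.

End mean_value.

(** * Partial derivatives of complex functions on R^3 *)

Section complex_derivatives.
Local Open Scope classical_set_scope.
Local Open Scope ring_scope.
Local Open Scope complex_scope.
Context (R : realType).
Local Notation V := (R * R * R)%type.
Implicit Types (f g : V -> R[i]) (j k : 'I_3).

Definition ccontinuous f := continuous (fun x => complex.Re (f x)) /\
  continuous (fun x => complex.Im (f x)).

(** A relation instead of the operator [cpartial], so that existence and value of the derivative are
    established together and the rules compose. *)
Definition has_partial j f g := forall x,
  is_derive x (basis3 R j) (fun y => complex.Re (f y)) (complex.Re (g x)) /\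
  is_derive x (basis3 R j) (fun y => complex.Im (f y)) (complex.Im (g x)).

Definition rapid f := forall N, exists B, forall x,
  (1 + enorm x) ^+ N * cabs (f x) <= B.

Lemma has_partialE j f g : has_partial j f g -> cpartial j f = g.
Proof.
move=> fg; apply/funext => x; have [h1 h2] := fg x.
by apply: complex_ext => /=; exact: is_derive_val.
Qed.

Lemma has_partialD j f g f' g' : has_partial j f f' -> has_partial j g g' ->
  has_partial j (fun x => f x + g x) (fun x => f' x + g' x).
Proof.
move=> hf hg x; have [f1 f2] := hf x; have [g1 g2] := hg x; split.
  rewrite cReD; under eq_fun do rewrite cReD; exact: isdD.
rewrite cImD; under eq_fun do rewrite cImD; exact: isdD.
Qed.

Lemma has_partialM j f g f' g' : has_partial j f f' -> has_partial j g g' ->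
  has_partial j (fun x => f x * g x) (fun x => f' x * g x + f x * g' x).
Proof.
move=> hf hg x; have [f1 f2] := hf x; have [g1 g2] := hg x; split.
  rewrite cReD !cReM; under eq_fun do rewrite cReM.
  by apply: (is_derive_eq (isdB (isdM f1 g1) (isdM f2 g2))); ring.
rewrite cImD !cImM; under eq_fun do rewrite cImM.
by apply: (is_derive_eq (isdD (isdM f1 g2) (isdM f2 g1))); ring.
Qed.

Lemma has_partial_cst j (c : R[i]) : has_partial j (fun=> c) (fun=> 0).
Proof.
move=> x; split; first exact: (isdcst (complex.Re c) x (basis3 R j)).
exact: (isdcst (complex.Im c) x (basis3 R j)).
Qed.

Lemma has_partialZ j (c : R[i]) f f' : has_partial j f f' ->
  has_partial j (fun x => c * f x) (fun x => c * f' x).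
Proof.
move=> hf; have := has_partialM (has_partial_cst j c) hf.
by under [X in has_partial _ _ X]eq_fun do rewrite mul0r add0r.
Qed.

Lemma has_partial_real j (h h' : V -> R) :
  (forall x, is_derive x (basis3 R j) h (h' x)) ->
  has_partial j (fun x => (h x)%:C) (fun x => (h' x)%:C).
Proof. by move=> hh x; split; [exact: hh|exact: (isdcst 0 x (basis3 R j))]. Qed.

Lemma ccontinuousD f g : ccontinuous f -> ccontinuous g ->
  ccontinuous (fun x => f x + g x).
Proof.
move=> [f1 f2] [g1 g2]; split => x.
  by under eq_fun do rewrite cReD; exact: cvgD (f1 x) (g1 x).
by under eq_fun do rewrite cImD; exact: cvgD (f2 x) (g2 x).
Qed.

Lemma ccontinuousM f g : ccontinuous f -> ccontinuous g ->
  ccontinuous (fun x => f x * g x).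
Proof.
move=> [f1 f2] [g1 g2]; split => x.
  under eq_fun do rewrite cReM.
  exact: cvgB (cvgM (f1 x) (g1 x)) (cvgM (f2 x) (g2 x)).
under eq_fun do rewrite cImM.
exact: cvgD (cvgM (f1 x) (g2 x)) (cvgM (f2 x) (g1 x)).
Qed.

Lemma ccontinuous_cst (c : R[i]) : ccontinuous (fun=> c).
Proof. by split => x; exact: cvg_cst. Qed.

Lemma ccontinuous_real (h : V -> R) : continuous h -> ccontinuous (fun x => (h x)%:C).
Proof. by move=> ch; split => //= x; exact: cvg_cst. Qed.

Lemma coord3_basis j k : coord3 k (basis3 R j) = (j == k)%:R.
Proof. by case: j k => -[|[|[|//]]] ? [[|[|[|//]]] ?]. Qed.

Lemma coord3D k (x y : V) : coord3 k (x + y) = coord3 k x + coord3 k y.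
Proof. by case: k => -[|[|[|//]]] ?. Qed.

Lemma coord3Z k (a : R) (x : V) : coord3 k (a *: x) = a * coord3 k x.
Proof. by case: k => -[|[|[|//]]] ?. Qed.

Lemma continuous_coord3 k : continuous (@coord3 R k).
Proof.
move=> [[x y] z].
have h1 : (fun p : V => p.1.1) p @[p --> (x, y, z)] --> x.
  by apply: (cvg_comp (fun p : V => p.1) fst); [exact: cvg_fst|exact: cvg_fst].
have h2 : (fun p : V => p.1.2) p @[p --> (x, y, z)] --> y.
  by apply: (cvg_comp (fun p : V => p.1) snd); [exact: cvg_fst|exact: cvg_snd].
case: k => -[|[|[|//]]] hk; rewrite /coord3 /=.
- exact: h1.
- exact: h2.
- exact: cvg_snd.
Qed.

Lemma is_derive_coord3 j k (x : V) : is_derive x (basis3 R j) (coord3 k) (j == k)%:R.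
Proof.
apply/is_derive_line.
under eq_fun do rewrite coord3D coord3Z coord3_basis mulrC.
apply: (is_derive_eq (isdD (isdM (isdcst _ 0 (1:R)) (is_derive_id 0 (1:R))) (isdcst _ 0 (1:R)))).
by rewrite mul0r add0r mulr1 addr0.
Qed.

Lemma has_partial_coord j k :
  has_partial j (fun x => (coord3 k x)%:C) (fun=> ((j == k)%:R)%:C).
Proof. by apply: has_partial_real => x; exact: is_derive_coord3. Qed.

Lemma is_derive_dot j (x y : V) : is_derive x (basis3 R j) (fun x => dot x y) (coord3 j y).
Proof.
apply/is_derive_line.
have e (h : R) : dot (h *: basis3 R j + x) y = coord3 j y * h + dot x y.
  rewrite /dot; under eq_bigr do rewrite coord3D coord3Z coord3_basis mulrDl.
  rewrite big_split /= (bigD1 j)//= eqxx big1; first by rewrite addr0 mulr1 mulrC.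
  by move=> i ij; rewrite eq_sym (negbTE ij) mulr0 mul0r.
under eq_fun do rewrite e.
apply: (is_derive_eq (isdD (isdM (isdcst _ 0 (1:R)) (is_derive_id 0 (1:R))) (isdcst _ 0 (1:R)))).
by rewrite mul0r add0r mulr1 addr0.
Qed.

Lemma dotC (x y : V) : dot x y = dot y x.
Proof. by apply: eq_bigr => k _; rewrite mulrC. Qed.

Lemma dotDl (x y z : V) : dot (x + y) z = dot x z + dot y z.
Proof.
by rewrite /dot -big_split /=; apply: eq_bigr => k _; rewrite coord3D mulrDl.
Qed.

Lemma dotZl a (x y : V) : dot (a *: x) y = a * dot x y.
Proof.
by rewrite /dot mulr_sumr; apply: eq_bigr => k _; rewrite coord3Z mulrA.
Qed.

Lemma dot_basis j (y : V) : dot (basis3 R j) y = coord3 j y.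
Proof.
rewrite /dot (bigD1 j)//= coord3_basis eqxx mul1r big1 ?addr0// => i ij.
by rewrite coord3_basis eq_sym (negbTE ij) mul0r.
Qed.

Lemma dot_ge0 (x : V) : 0 <= dot x x.
Proof. by apply: sumr_ge0 => k _; rewrite -expr2 sqr_ge0. Qed.

Lemma enorm_ge0 (x : V) : 0 <= enorm x.
Proof. exact: sqrtr_ge0. Qed.

Lemma enormX2 (x : V) : enorm x ^+ 2 = dot x x.
Proof. by rewrite sqr_sqrtr// dot_ge0. Qed.

Lemma abs_coord3_le k (x : V) : `|coord3 k x| <= enorm x.
Proof.
rewrite -sqrtr_sqr ler_wsqrtr// /dot (bigD1 k)//= expr2 lerDl.
by apply: sumr_ge0 => i _; rewrite -expr2 sqr_ge0.
Qed.

Lemma enorm_le (x : V) : enorm x <= \sum_(k < 3) `|coord3 k x|.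
Proof.
rewrite -[leRHS]ger0_norm ?sumr_ge0// -sqrtr_sqr ler_wsqrtr// expr2 mulr_suml.
apply: ler_sum => k _; rewrite -expr2 -real_normK ?num_real// expr2 ler_wpM2l//.
by rewrite (bigD1 k)//= lerDl sumr_ge0.
Qed.

Lemma cvg_sum_ord (U : Type) (F : set_system U) (FF : Filter F) n
    (f : 'I_n -> U -> R) (l : 'I_n -> R) :
  (forall i : 'I_n, f i t @[t --> F] --> l i) ->
  \sum_(i < n) f i t @[t --> F] --> \sum_(i < n) l i.
Proof.
elim: n f l => [f l _|n ih f l h].
  by rewrite big_ord0; under eq_fun do rewrite big_ord0; exact: cvg_cst.
rewrite big_ord_recr; under eq_fun do rewrite big_ord_recr.
by apply: cvgD; [exact: ih|exact: h].
Qed.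

Lemma continuous_dot (y : V) : continuous (fun x => dot x y).
Proof.
move=> x; rewrite /dot; apply: cvg_sum_ord => k.
by apply: cvgM; [exact: continuous_coord3|exact: cvg_cst].
Qed.

Lemma continuous_enorm2 : continuous (fun x : V => enorm x ^+ 2).
Proof.
rewrite (_ : (fun _ => _) = (fun x => dot x x)); last first.
  by apply/funext => x; rewrite enormX2.
move=> x.
by apply: cvg_sum_ord => k; apply: cvgM; exact: continuous_coord3.
Qed.

Lemma has_partial_cexpi j (s : R) (y : V) :
  has_partial j (fun x => cexpi (s * dot x y))
    (fun x => (0 +i* (s * coord3 j y)) * cexpi (s * dot x y)).
Proof.
move=> x; have d := is_derive_dot j x y; rewrite cReM cImM; split => /=.
  apply: (is_derive_eq (isdcomp (F := @cos R) (is_derive_cos _) (isdM (isdcst s x _) d))).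
  by ring.
apply: (is_derive_eq (isdcomp (F := @sin R) (is_derive_sin _) (isdM (isdcst s x _) d))).
by ring.
Qed.

Lemma ccontinuous_cexpi (s : R) (y : V) : ccontinuous (fun x => cexpi (s * dot x y)).
Proof.
have c x : s * dot t y @[t --> x] --> s * dot x y.
  by apply: cvgM; [exact: cvg_cst|exact: continuous_dot].
split => x /=.
  exact: (cvg_comp (fun x => s * dot x y) (@cos R) (c x) (@continuous_cos R _)).
exact: (cvg_comp (fun x => s * dot x y) (@sin R) (c x) (@continuous_sin R _)).
Qed.

(** The Fourier multiplier of the heat semigroup at time [t]; for positive [t] also a Schwartz test
    function that vanishes nowhere. *)
Definition gauss (t : R) (x : V) : R[i] := (expR (- t * enorm x ^+ 2))%:C.

Lemma has_partial_gauss j (t : R) :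
  has_partial j (gauss t) (fun x => (- (2 * t))%:C * (coord3 j x)%:C * gauss t x).
Proof.
have dE x : is_derive x (basis3 R j) (fun x => enorm x ^+ 2) (2 * coord3 j x).
  under eq_fun do rewrite enormX2.
  have h k := is_derive_coord3 j k x.
  have := @is_derive_sum R _ _ 3 (fun k y => coord3 k y * coord3 k y) x (basis3 R j)
    _ (fun k => isdM (h k) (h k)).
  rewrite (_ : (\sum_(i < 3) _) = (fun y => dot y y)); last first.
    by apply/funext => y; rewrite fct_sumE.
  move=> hd; apply: (is_derive_eq hd).
  rewrite (bigD1 j)//= eqxx big1; first by rewrite addr0 mul1r mulr1 mulr_natl mulr2n.
  by move=> i ij; rewrite eq_sym (negbTE ij) mul0r mulr0 addr0.
have := @has_partial_real j (fun x => expR (- t * enorm x ^+ 2))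
  (fun x => - (2 * t) * coord3 j x * expR (- t * enorm x ^+ 2)) _.
move=> H; rewrite (_ : (fun x => _ * _ * gauss t x) =
    (fun x => (- (2 * t) * coord3 j x * expR (- t * enorm x ^+ 2))%:C)); last first.
  by apply/funext => x; rewrite !rcM.
apply: H => x.
apply: (is_derive_eq (isdcomp (F := @expR R) (is_derive_expR _) (isdM (isdcst (- t) x _) (dE x)))).
by ring.
Qed.

Lemma ccontinuous_gauss t : ccontinuous (gauss t).
Proof.
apply: ccontinuous_real => x.
have c : - t * enorm y ^+ 2 @[y --> x] --> - t * enorm x ^+ 2.
  by apply: cvgM; [exact: cvg_cst|exact: continuous_enorm2].
exact: (cvg_comp (fun x => - t * enorm x ^+ 2) (@expR R) c (@continuous_expR R _)).
Qed.

Lemma cabs_gauss_le1 t x : 0 <= t -> cabs (gauss t x) <= 1.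
Proof.
move=> t0; rewrite cabs_real ger0_norm ?expR_ge0// -expR0 ler_expR.
by rewrite mulNr oppr_le0 mulr_ge0// sqr_ge0.
Qed.

(** The form in which integrals are differentiated with respect to a parameter: a uniform quadratic
    error survives integration. *)
Lemma has_partial_quad j f f' (M : R) :
  (forall x (h : R), cabs (f (h *: basis3 R j + x) - f x - h%:C * f' x) <= M * h ^+ 2) ->
  has_partial j f f'.
Proof.
move=> H x.
have M0 : 0 <= M.
  by have := H x 1; rewrite expr1n mulr1; apply: le_trans; exact: cabs_ge0.
have key (F : V -> R) (d : R) :
    (forall h : R, `|F (h *: basis3 R j + x) - F x - h * d| <= M * h ^+ 2) ->
    is_derive x (basis3 R j) F d.
  move=> HF.
  have c : h^-1 *: ((F \o shift x) (h *: basis3 R j) - F x) @[h --> 0^'] --> d.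
    apply/cvgrPdist_le => e e0.
    near=> h.
    have h0 : h != 0 by near: h; exact: nbhs_dnbhs_neq.
    rewrite distrC /=.
    rewrite (_ : _ - d = h^-1 * (F (h *: basis3 R j + x) - F x - h * d)); last first.
      by rewrite /GRing.scale /=; field.
    rewrite normrM (le_trans (ler_wpM2l _ (HF h)))//.
    rewrite -real_normK ?num_real// normfV expr2 mulrCA mulrA mulrA mulrVK; last first.
      by rewrite unitfE normr_eq0.
    (* Replacing [M] by [M + 1] avoids a division by zero. *)
    rewrite (@le_trans _ _ ((M + 1) * `|h|))// ?ler_wpM2r ?lerDl//.
    rewrite -ler_pdivlMl ?ltr_wpDl//.
    near: h; apply: dnbhs0_le; rewrite mulr_gt0// invr_gt0 ltr_wpDl//.
  apply: DeriveDef; first by apply/cvg_ex; exists d.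
  by apply: cvg_lim c.
split; apply: key => h.
  apply: le_trans (H x h); apply: le_trans (abs_Re_le _).
  by rewrite !cReD !cReN cReM /= mul0r subr0.
apply: le_trans (H x h); apply: le_trans (abs_Im_le _).
by rewrite !cImD !cImN cImM /= mul0r addr0.
Unshelve. all: by end_near. Qed.

(** The sum of the coordinate differences is the distance that arises when two dot products with the
    same vector are compared. *)
Lemma lip_ccontinuous f (M : R) :
  (forall x y, cabs (f x - f y) <= M * \sum_(k < 3) `|coord3 k x - coord3 k y|) ->
  ccontinuous f.
Proof.
move=> H.
have key (F : V -> R) : (forall x y, `|F x - F y| <= M * \sum_(k < 3) `|coord3 k x - coord3 k y|) ->
    continuous F.
  move=> HF x.
  have c : M * (\sum_(k < 3) `|coord3 k x - coord3 k y|) @[y --> x] -->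
      M * (\sum_(k < 3) `|coord3 k x - coord3 k x|).
    apply: cvgM; first exact: cvg_cst.
    apply: cvg_sum_ord => k; apply: cvg_norm; apply: cvgB; first exact: cvg_cst.
    exact: continuous_coord3.
  rewrite big1 ?mulr0 in c; last by move=> k _; rewrite subrr normr0.
  apply/cvgrPdist_le => e e0.
  move/cvgrPdist_le : c => /(_ e e0); apply: filterS => y.
  rewrite sub0r normrN => h; rewrite (le_trans (HF x y))// (le_trans _ h)//.
  exact: ler_norm.
split; apply: key => x y; apply: le_trans (H x y).
  by rewrite (le_trans _ (abs_Re_le _))// cReD cReN.
by rewrite (le_trans _ (abs_Im_le _))// cImD cImN.
Qed.

End complex_derivatives.

(** * The Schwartz class and its multipliers *)

Section schwartz_class.
Local Open Scope classical_set_scope.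
Local Open Scope ring_scope.
Local Open Scope complex_scope.
Context (R : realType).
Local Notation V := (R * R * R)%type.
Local Notation E := (E3 R).
Local Notation mu := (@leb3 R).
Implicit Types (f g : V -> R[i]) (j k : 'I_3).

(* Coinduction, which avoids computing iterated derivatives. *)
Lemma schwartz_stable (P : (V -> R[i]) -> Prop) :
  (forall f, P f -> [/\ ccontinuous f, rapid f &
     forall j, exists2 g, has_partial j f g & P g]) ->
  forall f, P f -> schwartz f.
Proof.
move=> PH f Pf.
have Ps s : P (cpartials s f).
  elim: s => //= j s /PH[_ _ /(_ j)] [g jg Pg].
  by rewrite (has_partialE jg).
split=> [s|N s]; have [[c1 c2] r d] := PH _ (Ps s); last exact: r.
split=> // j x; have [g gP _] := d j; have [h1 h2] := gP x.
by split; [case: h1|case: h2].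
Qed.

Lemma schwartz_ccontinuous f : schwartz f -> ccontinuous f.
Proof. by move=> [/(_ [::])[]]. Qed.

Lemma schwartz_rapid f : schwartz f -> rapid f.
Proof. by move=> [_ h] N; exact: (h N [::]). Qed.

Lemma schwartz_partial f j : schwartz f -> has_partial j f (cpartial j f).
Proof.
move=> [/(_ [::])[_ _ /(_ j) h] _] x; have [h1 h2] := h x.
by split; exact: derivable_is_derive.
Qed.

Lemma cpartials_cat s j f : cpartials s (cpartial j f) = cpartials (rcons s j) f.
Proof. by rewrite /cpartials -cats1 foldr_cat. Qed.

Lemma schwartz_cpartial f j : schwartz f -> schwartz (cpartial j f).
Proof.
move=> [sf rf]; split=> [s|N s].
  have [c1 c2 d] := sf (rcons s j); rewrite -cpartials_cat in c1 c2 d.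
  by split.
by rewrite cpartials_cat; exact: rf.
Qed.

Lemma rapid_ge0 f : rapid f -> forall N, exists2 B, 0 <= B & forall x,
  (1 + enorm x) ^+ N * cabs (f x) <= B.
Proof.
move=> rf N; have [B hB] := rf N; exists B => //.
by apply: le_trans (hB 0); rewrite mulr_ge0 ?cabs_ge0// exprn_ge0// addr_ge0// enorm_ge0.
Qed.

Lemma rapidD f g : rapid f -> rapid g -> rapid (fun x => f x + g x).
Proof.
move=> rf rg N; have [A hA] := rf N; have [B hB] := rg N; exists (A + B) => x.
rewrite (le_trans _ (lerD (hA x) (hB x)))// -mulrDr ler_wpM2l ?cabsD//.
by rewrite exprn_ge0// addr_ge0// enorm_ge0.
Qed.

Lemma rapid_bndM (M : R) f g : (forall x, cabs (g x) <= M) -> rapid f ->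
  rapid (fun x => g x * f x).
Proof.
move=> gM rf N; have [B B0 hB] := rapid_ge0 rf N; exists (M * B) => x.
rewrite cabsM mulrCA ler_pM ?cabs_ge0 ?mulr_ge0 ?cabs_ge0 ?exprn_ge0//.
by rewrite addr_ge0// enorm_ge0.
Qed.

Lemma rapid_coord k f : rapid f -> rapid (fun x => (coord3 k x)%:C * f x).
Proof.
move=> rf N; have [B hB] := rf N.+1; exists B => x.
apply: le_trans (hB x); rewrite cabsM cabs_real mulrA ler_wpM2r ?cabs_ge0//.
have e0 := enorm_ge0 x.
rewrite exprSr ler_wpM2l ?exprn_ge0 ?addr_ge0//.
by rewrite (le_trans (abs_coord3_le k x))// lerDr.
Qed.

Lemma schwartzD f g : schwartz f -> schwartz g -> schwartz (fun x => f x + g x).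
Proof.
move=> sf sg; apply: (@schwartz_stable (fun h => exists f g,
  [/\ schwartz f, schwartz g & h = (fun x => f x + g x)])); last by exists f, g.
move=> _ [{}f [{}g [{}sf {}sg ->]]]; split.
- by apply: ccontinuousD; exact: schwartz_ccontinuous.
- by apply: rapidD; exact: schwartz_rapid.
- move=> j; exists (fun x => cpartial j f x + cpartial j g x).
    by apply: has_partialD; exact: schwartz_partial.
  by exists (cpartial j f), (cpartial j g); split => //; exact: schwartz_cpartial.
Qed.

Lemma schwartzZ (c : R[i]) f : schwartz f -> schwartz (fun x => c * f x).
Proof.
move=> sf; apply: (@schwartz_stable (fun h => exists2 f,
  schwartz f & h = (fun x => c * f x))); last by exists f.
move=> _ [{}f {}sf ->]; split.
- by apply: ccontinuousM; [exact: ccontinuous_cst|exact: schwartz_ccontinuous].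
- by apply: (@rapid_bndM (cabs c)) => //; exact: schwartz_rapid.
- move=> j; exists (fun x => c * cpartial j f x).
    by apply: has_partialZ; exact: schwartz_partial.
  by exists (cpartial j f) => //; exact: schwartz_cpartial.
Qed.

Lemma schwartz_coord k f : schwartz f -> schwartz (fun x => (coord3 k x)%:C * f x).
Proof.
(* The summand [g] is needed for stability: differentiating [x_k f] leaves the extra term [f] when
   the two directions agree. *)
move=> sf; apply: (@schwartz_stable (fun h => exists f g,
  [/\ schwartz f, schwartz g & h = (fun x => (coord3 k x)%:C * f x + g x)])); last first.
  exists f, (fun x => 0 * f x); split => //; first exact: schwartzZ.
  by apply/funext => x; rewrite mul0r addr0.
move=> _ [{}f [{}g [{}sf sg ->]]]; split.
- apply: ccontinuousD; last exact: schwartz_ccontinuous.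
  apply: ccontinuousM; last exact: schwartz_ccontinuous.
  exact/ccontinuous_real/continuous_coord3.
- by apply: rapidD; [apply: rapid_coord|]; exact: schwartz_rapid.
- move=> j; eexists.
    apply: has_partialD (schwartz_partial j sg).
    exact: has_partialM (has_partial_coord j k) (schwartz_partial j sf).
  exists (cpartial j f), (fun x => ((j == k)%:R)%:C * f x + cpartial j g x).
  split; first exact: schwartz_cpartial.
    by apply: schwartzD; [exact: schwartzZ|exact: schwartz_cpartial].
  by apply/funext => x; rewrite addrAC addrC.
Qed.

(* [e] is a bounded function whose logarithmic derivatives [q j] are multipliers. *)
Lemma schwartz_multiplier (e : V -> R[i]) (q : 'I_3 -> V -> R[i]) (M : R) :
  ccontinuous e -> (forall x, cabs (e x) <= M) ->
  (forall j, has_partial j e (fun x => q j x * e x)) ->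
  (forall j f, schwartz f -> schwartz (fun x => q j x * f x)) ->
  forall f, schwartz f -> schwartz (fun x => e x * f x).
Proof.
move=> ce eM eq qS f sf; apply: (@schwartz_stable (fun h => exists2 f,
  schwartz f & h = (fun x => e x * f x))); last by exists f.
move=> _ [{}f {}sf ->]; split.
- by apply: ccontinuousM => //; exact: schwartz_ccontinuous.
- by apply: (@rapid_bndM M) => //; exact: schwartz_rapid.
- move=> j; eexists; first exact: has_partialM (eq j) (schwartz_partial j sf).
  exists (fun x => q j x * f x + cpartial j f x).
    by apply: schwartzD; [exact: qS|exact: schwartz_cpartial].
  by apply/funext => x; rewrite mulrDr; congr (_ + _); rewrite mulrCA mulrA.
Qed.

Lemma schwartz_cexpi (s : R) (y : V) f : schwartz f ->
  schwartz (fun x => cexpi (s * dot x y) * f x).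
Proof.
apply: (@schwartz_multiplier _ (fun j _ => 0 +i* (s * coord3 j y)) 1).
- exact: ccontinuous_cexpi.
- by move=> x; rewrite cabs_cexpi.
- by move=> j; exact: has_partial_cexpi.
- by move=> j g; exact: schwartzZ.
Qed.

Lemma schwartz_gauss (t : R) f : 0 <= t -> schwartz f ->
  schwartz (fun x => gauss t x * f x).
Proof.
move=> t0; apply: (@schwartz_multiplier _ (fun j x => (- (2 * t))%:C * (coord3 j x)%:C) 1).
- exact: ccontinuous_gauss.
- by move=> x; exact: cabs_gauss_le1.
- by move=> j; exact: has_partial_gauss.
- move=> j g sg; under eq_fun do rewrite -mulrA.
  by apply: schwartzZ; exact: schwartz_coord.
Qed.

(** Polynomials, generated so that closure under differentiation is an induction; polynomials times
    a Gaussian then form a class stable under differentiation. *)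
Inductive polyfun : (V -> R[i]) -> Prop :=
| polyfun_cst c : polyfun (fun=> c)
| polyfun_coordM k p : polyfun p -> polyfun (fun x => (coord3 k x)%:C * p x)
| polyfunD p q : polyfun p -> polyfun q -> polyfun (fun x => p x + q x).

Lemma polyfunZ (c : R[i]) p : polyfun p -> polyfun (fun x => c * p x).
Proof.
move=> pp; elim: pp => {p} [a|k p _ ih|p q _ ihp _ ihq].
- exact: polyfun_cst.
- by under eq_fun do rewrite mulrCA; exact: polyfun_coordM.
- by under eq_fun do rewrite mulrDr; exact: polyfunD.
Qed.

Lemma polyfun_partial j p : polyfun p -> exists2 q, has_partial j p q & polyfun q.
Proof.
move=> pp; elim: pp => {p} [a|k p pp [q pq qq]|p q _ [p' ? ?] _ [q' ? ?]].
- by exists (fun=> 0); [exact: has_partial_cst|exact: polyfun_cst].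
- eexists; first exact: has_partialM (has_partial_coord j k) pq.
  by apply: polyfunD; [exact: polyfunZ|exact: polyfun_coordM].
- by eexists; [apply: has_partialD; eassumption|exact: polyfunD].
Qed.

(** With r the norm, (1 + r)^N <= 2^N (1 + r^(2N+2)), and exp(t r^2) dominates both 1 and (t
    r^2)^(N+1) / (N+1)!. *)
Lemma rapid_gauss (t : R) : 0 < t -> rapid (gauss t).
Proof.
move=> t0 N; exists (2 ^+ N * (1 + N.+1`!%:R / t ^+ N.+1)) => x.
set r := enorm x; have r0 : 0 <= r := enorm_ge0 x.
rewrite cabs_real ger0_norm ?expR_ge0//.
have h1 : (1 + r) ^+ N <= 2 ^+ N * (1 + (r ^+ 2) ^+ N.+1).
  have [r1|r1] := leP r 1.
    rewrite (@le_trans _ _ (2 ^+ N))//; last first.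
      by rewrite ler_peMr ?exprn_ge0// lerDl !exprn_ge0.
    by rewrite lerXn2r ?nnegrE ?addr_ge0// -[leRHS]/(1 + 1) lerD2l.
  rewrite (@le_trans _ _ ((2 * r) ^+ N))//.
    by rewrite lerXn2r ?nnegrE ?addr_ge0 ?mulr_ge0// mulr_natl mulr2n lerD2r ltW.
  rewrite exprMn ler_wpM2l ?exprn_ge0// (@le_trans _ _ ((r ^+ 2) ^+ N.+1))//; last first.
    by rewrite lerDr.
  by rewrite -exprM ler_weXn2l ?(ltW r1)// mul2n -addnn addSn leqW// leq_addr.
rewrite mulNr expRN -ler_pdivlMr ?invr_gt0 ?expR_gt0// invrK.
rewrite (le_trans h1)// -mulrA ler_wpM2l ?exprn_ge0//.
have tr0 : 0 <= t * r ^+ 2 by rewrite mulr_ge0 ?(ltW t0)// sqr_ge0.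
have h2 := expR_ge1Dxn N tr0.
have e1 : 1 <= expR (t * r ^+ 2) by rewrite -expR0 ler_expR.
rewrite mulrDl mul1r lerD//.
rewrite mulrAC ler_pdivlMr ?exprn_gt0// -exprMn mulrC.
rewrite -ler_pdivrMl ?ltr0n ?fact_gt0// mulrC mulrC.
by apply: (le_trans _ h2); rewrite [leLHS]mulrC lerDr.
Qed.

Lemma schwartz_gauss1 (t : R) : 0 < t -> schwartz (gauss t).
Proof.
move=> t0; apply: (@schwartz_stable (fun h => exists2 p, polyfun p & h = (fun x => p x * gauss t x))); last first.
  by exists (fun=> 1); [exact: polyfun_cst|apply/funext => x; rewrite mul1r].
have rP p : polyfun p -> ccontinuous (fun x => p x * gauss t x) /\ rapid (fun x => p x * gauss t x).
  move=> pp; elim: pp => {p} [a|k p pp [c r]|p q _ [cp rp] _ [cq rq]].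
  - split; first by apply: ccontinuousM; [exact: ccontinuous_cst|exact: ccontinuous_gauss].
    by apply: (@rapid_bndM (cabs a)) => //; exact: rapid_gauss.
  - under [X in ccontinuous X /\ rapid X]eq_fun do rewrite -mulrA.
    split; last exact: rapid_coord.
    by apply: ccontinuousM => //; exact/ccontinuous_real/continuous_coord3.
  - under [X in ccontinuous X /\ rapid X]eq_fun do rewrite mulrDl.
    by split; [exact: ccontinuousD|exact: rapidD].
move=> _ [p pp ->]; have [c r] := rP p pp; split=> // j.
have [q pq qq] := polyfun_partial j pp.
eexists; first exact: has_partialM pq (has_partial_gauss j t).
exists (fun x => q x + (- (2 * t))%:C * ((coord3 j x)%:C * p x)).
  by apply: polyfunD => //; apply: polyfunZ; exact: polyfun_coordM.
by apply/funext => x; ring.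
Qed.

Lemma cmeas_ccontinuous f : ccontinuous f -> cmeasurable (setT : set E) f.
Proof. by move=> [c1 c2]; split; exact: continuous_measurable3. Qed.

(** Each of the three factors 1 + x_k^2 is at most (1 + |x|)^2. Hence seminorms of order 6 suffice
    to bound a function by a multiple of the integrable [cauchy3]. *)
Lemma cauchy3_ge (x : V) : (1 + enorm x) ^- 6 <= cauchy3 x.
Proof.
have r0 := enorm_ge0 x.
rewrite /cauchy3 /cauchy1 -!invfM lef_pV2 ?posrE ?exprn_gt0 ?ltr_wpDr//; last first.
  by rewrite !mulr_gt0// ltr_pwDl ?sqr_ge0.
have h k : 1 + coord3 k x ^+ 2 <= (1 + enorm x) ^+ 2.
  rewrite sqrrD expr1n mul1r -addrA lerD2l -real_normK ?num_real//.
  rewrite (@le_trans _ _ (enorm x ^+ 2))// ?lerDr ?mulrn_wge0//.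
  by rewrite lerXn2r ?nnegrE ?abs_coord3_le.
have p k : 0 <= 1 + coord3 k x ^+ 2 by rewrite addr_ge0// sqr_ge0.
rewrite (_ : 6%N = (2 + 2 + 2)%N)// !exprD.
have h0 := h (@Ordinal 3 0 isT); have h1 := h (@Ordinal 3 1 isT); have h2 := h (@Ordinal 3 2 isT).
have p0 := p (@Ordinal 3 0 isT); have p1 := p (@Ordinal 3 1 isT); have p2 := p (@Ordinal 3 2 isT).
rewrite ler_pM ?mulr_ge0//.
by rewrite ler_pM.
Qed.

Lemma rapid_le_cauchy3 f : rapid f -> exists2 B, 0 <= B & forall x : V,
  cabs (f x) <= B * cauchy3 x.
Proof.
move=> /rapid_ge0 /(_ 6) [B B0 hB]; exists B => // x.
have r0 : 0 < (1 + enorm x) ^+ 6 by rewrite exprn_gt0// ltr_wpDr ?enorm_ge0.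
rewrite (@le_trans _ _ (B / (1 + enorm x) ^+ 6))//.
  by rewrite ler_pdivlMr// mulrC.
by rewrite ler_wpM2l// cauchy3_ge.
Qed.

Lemma cinte_rapid f : ccontinuous f -> rapid f -> cintegrable mu setT f.
Proof.
move=> /cmeas_ccontinuous mf /rapid_le_cauchy3[B B0 hB].
apply: (@cinte_le _ _ _ _ _ (fun x => B%:C * (cauchy3 x)%:C)) => //.
  by apply: cinteZ; exact: cinte_cauchy3.
move=> x; rewrite cabsM !cabs_real (le_trans (hB x))//.
by rewrite ler_pM ?(ltW (cauchy3_gt0 _))// ?ler_norm.
Qed.

Lemma cinte_schwartz f : schwartz f -> cintegrable mu setT f.
Proof.
by move=> sf; apply: cinte_rapid; [exact: schwartz_ccontinuous|exact: schwartz_rapid].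
Qed.

Lemma schwartz_bounded f : schwartz f -> exists B, forall x, cabs (f x) <= B.
Proof.
move=> /schwartz_rapid/(_ 0) [B hB]; exists B => x.
by have := hB x; rewrite expr0 mul1r.
Qed.

End schwartz_class.

(** * Fourier inversion *)

Section fourier_theory.
Local Open Scope classical_set_scope.
Local Open Scope ring_scope.
Local Open Scope complex_scope.
Context (R : realType).
Local Notation V := (R * R * R)%type.
Local Notation E := (E3 R).
Local Notation mu := (@leb3 R).
Local Notation cint := (cintegral mu setT).
Local Notation cinte := (cintegrable mu setT).
Implicit Types (f g : V -> R[i]) (j k : 'I_3) (s : R).

Lemma cabs_cint_bound (c : R) f g : 0 <= c -> cmeasurable (setT : set E) f -> cinte g ->
  (forall x, cabs (f x) <= c * cabs (g x)) ->
  cabs (cint f) <= c * fine (L1 mu g).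
Proof.
move=> c0 mf gi fg.
have Lg : L1 mu g \is a fin_num by rewrite ge0_fin_numE ?L1_ge0//; exact: cinte_L1.
rewrite -lee_fin EFinM fineK//.
apply: le_trans (cabs_cint_le_gen mu mf) _.
rewrite -[c in leRHS](ger0_norm c0) -cabs_real -L1Z; last exact: cinte_meas gi.
apply: le_L1 => //; first by apply: cmeasM; [exact: cmeas_cst|exact: cinte_meas gi].
by move=> x; rewrite cabsM cabs_real ger0_norm.
Qed.

Let eps (n : nat) : R := n.+1%:R^-1.

Let eps_gt0 n : 0 < eps n. Proof. by rewrite invr_gt0. Qed.

Let eps_le1 n : eps n <= 1.
Proof. by rewrite invf_le1// ler1n. Qed.

Let cvg_eps : eps n @[n --> \oo] --> (0 : R).
Proof. exact: cvg_harmonic. Qed.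

(** The difference quotient is taken along the steps 1/(n+1), because [cvg_cint] is about
    sequences. *)
Lemma has_partial_seq j f f' (x : V) : has_partial j f f' ->
  cabs (n.+1%:R%:C * (f (eps n *: basis3 R j + x) - f x) - f' x) @[n --> \oo] --> (0 : R).
Proof.
move=> ff'; have [h1 h2] := ff' x.
have key (F : V -> R) (d : R) : is_derive x (basis3 R j) F d ->
    n.+1%:R * (F (eps n *: basis3 R j + x) - F x) @[n --> \oo] --> d.
  move=> [Fd <-].
  have Fc : h^-1 *: ((F \o shift x) (h *: basis3 R j) - F x) @[h --> 0^'] -->
    'D_(basis3 R j) F x by exact: Fd.
  have /cvg_at_rightP/(_ eps (conj eps_gt0 cvg_eps)) h := cvg_dnbhs_at_right Fc.
  move=> P nP; have := h P nP; rewrite /nbhs /=.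
  by apply: filterS => n /=; rewrite invrK.
have := key _ _ h1; have := key _ _ h2 => /cvgrPdist_le c2 /cvgrPdist_le c1.
apply/cvgrPdist_le => e e0.
have e2 : 0 < e / 2 by rewrite divr_gt0.
move: (c1 _ e2) (c2 _ e2); apply: filterS2 => n n1 n2.
rewrite sub0r normrN ger0_norm ?cabs_ge0// (le_trans (cabs_le_ReIm _))//.
rewrite [leRHS](splitr e) lerD//.
  rewrite cReD cReN cReM cReD cReN /= mul0r subr0 distrC (le_trans _ n1)//.
rewrite cImD cImN cImM cImD cImN /= mul0r addr0 distrC (le_trans _ n2)//.
Qed.

(** The constant 3 comes from x^2 <= 2 (a + x)^2 + 2 a^2. A majorant at a point moved by at most 1
    is thereby controlled at the original point. *)
Lemma cauchy1_shift (x a : R) : `|a| <= 1 -> cauchy1 (a + x) <= 3 * cauchy1 x.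
Proof.
move=> a1; rewrite /cauchy1 -[3]invrK -invfM lef_pV2 ?posrE; last 2 first.
- by rewrite ltr_pwDl ?sqr_ge0.
- by rewrite mulr_gt0// ltr_pwDl ?sqr_ge0.
have a2 : a ^+ 2 <= 1 by rewrite -real_normK ?num_real// expr_le1.
rewrite mulrC ler_pdivrMr//.
have := sqr_ge0 (2 * a + x); have := sqr_ge0 x; have := sqr_ge0 (a + x).
by rewrite !expr2 in a2 *; nra.
Qed.

Lemma cauchy3_shift (c : R) j (x : V) : 0 <= c <= 1 ->
  cauchy3 (c *: basis3 R j + x) <= 27 * cauchy3 x.
Proof.
move=> /andP[c0 c1]; rewrite /cauchy3.
have h k : cauchy1 (coord3 k (c *: basis3 R j + x)) <= 3 * cauchy1 (coord3 k x).
  rewrite coord3D coord3Z coord3_basis; apply: cauchy1_shift.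
  by case: (j == k); rewrite ?mulr1 ?mulr0 ?normr0// ger0_norm.
have h0 := h (@Ordinal 3 0 isT); have h1 := h (@Ordinal 3 1 isT); have h2 := h (@Ordinal 3 2 isT).
have p y : 0 <= cauchy1 y :> R by exact/ltW/cauchy1_gt0.
rewrite (_ : 27 = 3 * 3 * 3); last by rewrite -!natrM.
rewrite (_ : 3 * 3 * 3 * _ = (3 * cauchy1 x.1.1) * (3 * cauchy1 x.1.2) * (3 * cauchy1 x.2)); last by ring.
by rewrite ler_pM ?mulr_ge0 ?p// ler_pM ?p.
Qed.

(* Integrate the difference quotients, which have mean zero by translation
   invariance, and pass to the limit. *)
Lemma cint_cpartial0 g j : schwartz g -> cint (cpartial j g) = 0.
Proof.
move=> sg; have gi := cinte_schwartz sg.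
have pg := schwartz_partial j sg; have sd := schwartz_cpartial j sg.
have [B B0 hB] := rapid_le_cauchy3 (schwartz_rapid sd).
pose F n (x : E) := n.+1%:R%:C * (g (eps n *: basis3 R j + x) - g x).
have gs n : cinte (fun x : E => g (eps n *: basis3 R j + (x : V))) by exact: cinte_shift.
have F0 n : cint (F n) = 0.
  rewrite cintZ; last exact: cinteB.
  by rewrite cintB// cint_shift// subrr mulr0.
have Fi n : cinte (F n) by apply: cinteZ; exact: cinteB.
(* By the mean value theorem the quotient is a derivative at a point at distance at most 1; 54 is 27
   from [cauchy3_shift] for each of the real and imaginary parts. *)
have Fb n x : cabs (F n x) <= 54 * B * cauchy3 x.
  have key (p q : V -> R) : (forall y, is_derive y (basis3 R j) p (q y)) ->
      (forall y, `|q y| <= B * cauchy3 y) ->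
      n.+1%:R * `|p (eps n *: basis3 R j + x) - p x| <= 27 * B * cauchy3 x.
    move=> pq qB; have [c /andP[c0 c1] ->] := line_MVT x (ltW (eps_gt0 n)) pq.
    rewrite normrM mulrCA [`|eps n|]ger0_norm; last exact: ltW.
    rewrite divff ?mulr1// (le_trans (qB _))// [27 * B]mulrC -mulrA ler_wpM2l//.
    by apply: cauchy3_shift; rewrite c0 (le_trans c1)// eps_le1.
  rewrite /F cabsM cabs_real ger0_norm//.
  rewrite (le_trans (ler_wpM2l _ (cabs_le_ReIm _)))// mulrDr.
  rewrite (_ : 54 * B * cauchy3 x = 27 * B * cauchy3 x + 27 * B * cauchy3 x); last by ring.
  rewrite lerD//.
    rewrite cReD cReN; apply: (key (fun y => complex.Re (g y)) (fun y => complex.Re (cpartial j g y))).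
      by move=> y; have [] := pg y.
    by move=> y; rewrite (le_trans (abs_Re_le _)).
  rewrite cImD cImN; apply: (key (fun y => complex.Im (g y)) (fun y => complex.Im (cpartial j g y))).
    by move=> y; have [] := pg y.
  by move=> y; rewrite (le_trans (abs_Im_le _)).
have := @cvg_cint _ _ _ mu F (cpartial j g) (fun x => 54 * B * cauchy3 x).
have di := cinte_schwartz sd.
move=> /(_ (fun n => cinte_meas (Fi n)) (cinte_meas di)).
have Fl : {ae mu, forall x, cabs (F n x - cpartial j g x) @[n --> \oo] --> (0 : R)}.
  by apply: aeW => x; exact: has_partial_seq.
have Fb' : {ae mu, forall x, forall n, cabs (F n x) <= 54 * B * cauchy3 x}.
  by apply: aeW => x n; exact: Fb.
move=> /(_ Fl (integrable_cauchy3 _) Fb').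
under eq_cvg do rewrite F0 sub0r cabsN.
by move/(cvg_lim (@Rhausdorff R)); rewrite lim_cst// => /cabs_eq0.
Qed.

(** The sign [s] treats both transforms at once: -1 gives [fourier], and 1 gives [inv_fourier] up to
    its constant. *)
Definition FT s f (xi : V) : R[i] := cint (fun x => cexpi (s * dot x xi) * f x).

Lemma cmeas_cexpi_dot s (xi : V) : cmeasurable (setT : set E) (fun x : E => cexpi (s * dot x xi)).
Proof.
by apply: cmeas_cexpi; apply: measurable_funM => //; exact: measurable_dot.
Qed.

Lemma cinte_FT s f (xi : V) : cinte f -> cinte (fun x => cexpi (s * dot x xi) * f x).
Proof.
move=> fi; apply: (@cinte_bndM _ _ _ _ 1) => //.
  exact: cmeas_cexpi_dot.
by move=> x; rewrite cabs_cexpi.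
Qed.

Lemma cabs_FT_le s f (xi : V) : cinte f -> cabs (FT s f xi) <= fine (L1 mu f).
Proof.
move=> fi; rewrite -[leRHS]mul1r; apply: cabs_cint_bound => //.
  exact: cinte_meas (cinte_FT _ _ fi).
by move=> x; rewrite cabsM cabs_cexpi.
Qed.

Lemma FTZ s (c : R[i]) f (xi : V) : cinte f ->
  FT s (fun x => c * f x) xi = c * FT s f xi.
Proof.
move=> fi; rewrite -cintZ; last exact: cinte_FT.
by apply: eq_cint => x; rewrite mulrCA.
Qed.

(** The quadratic Taylor error of the exponential costs a factor x_j^2, and x_j^2 f is still
    integrable. *)
Lemma has_partial_FT s f j : schwartz f ->
  has_partial j (FT s f) (FT s (fun x => (0 +i* s) * ((coord3 j x)%:C * f x))).
Proof.
move=> sf.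
have s1 := schwartz_coord j sf; have s2 := schwartz_coord j s1.
have s3 := schwartzZ (0 +i* s) s1.
have fi := cinte_schwartz sf; have i2 := cinte_schwartz s2; have i3 := cinte_schwartz s3.
apply: (@has_partial_quad _ _ _ _ (2 * s ^+ 2 *
  fine (L1 mu (fun x => (coord3 j x)%:C * ((coord3 j x)%:C * f x))))) => xi h.
rewrite /FT -cintZ; last exact: cinte_FT.
rewrite -cintB; [|exact: cinte_FT|exact: cinte_FT].
rewrite -cintB; last 2 first.
- by apply: cinteB; exact: cinte_FT.
- by apply: cinteZ; exact: cinte_FT.
rewrite mulrAC; apply: cabs_cint_bound => //.
- by rewrite mulr_ge0 ?sqr_ge0// mulr_ge0// sqr_ge0.
- apply: cmeasB; last by apply: cmeasM; [exact: cmeas_cst|exact: cinte_meas (cinte_FT _ _ i3)].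
  by apply: cmeasB; exact: cinte_meas (cinte_FT _ _ fi).
move=> x.
have -> : cexpi (s * dot x (h *: basis3 R j + xi)) * f x - cexpi (s * dot x xi) * f x -
    h%:C * (cexpi (s * dot x xi) * ((0 +i* s) * ((coord3 j x)%:C * f x))) =
    cexpi (s * dot x xi) * (f x * (cexpi (s * (h * coord3 j x)) - 1 -
      (0 +i* (s * (h * coord3 j x))))).
  rewrite dotC dotDl dotZl dot_basis mulrDr cexpiD [dot xi x]dotC.
  have -> : (0 +i* (s * (h * coord3 j x))) = (0 +i* s) * (h%:C * (coord3 j x)%:C).
    by apply: complex_ext; rewrite ?cReM ?cImM /=; ring.
  by ring.
rewrite cabsM cabs_cexpi mul1r cabsM mulrC.
rewrite (le_trans (ler_wpM2r (cabs_ge0 _) (cabs_cexpiB1id _)))//.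
rewrite !cabsM !cabs_real; set c := coord3 j x.
have cc : `|c| * `|c| = c ^+ 2 by rewrite -expr2 real_normK ?num_real.
rewrite le_eqVlt; apply/orP; left; apply/eqP.
transitivity (2 * s ^+ 2 * h ^+ 2 * (`|c| * `|c|) * cabs (f x)); last by ring.
by rewrite cc; ring.
Qed.

Lemma ccontinuous_FT s f : schwartz f -> ccontinuous (FT s f).
Proof.
move=> sf; have fi := cinte_schwartz sf.
pose G x := \sum_(k < 3) (cabs ((coord3 k x)%:C * f x))%:C.
have Gi : cinte G.
  by apply: cinte_sum => k; apply: cinte_cabs; apply: cinte_schwartz; exact: schwartz_coord.
apply: (@lip_ccontinuous _ _ (2 * `|s| * fine (L1 mu G))) => xi eta.
rewrite /FT -cintB; [|exact: cinte_FT|exact: cinte_FT].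
set D := \sum_(k < 3) _.
have D0 : 0 <= D by exact: sumr_ge0.
rewrite mulrAC; apply: cabs_cint_bound => //.
- by rewrite !mulr_ge0.
- by apply: cmeasB; exact: cinte_meas (cinte_FT _ _ fi).
move=> x.
have -> : cexpi (s * dot x xi) * f x - cexpi (s * dot x eta) * f x =
    cexpi (s * dot x eta) * ((cexpi (s * (dot x xi - dot x eta)) - 1) * f x).
  rewrite mulrBl mul1r mulrBr mulrA -cexpiD -mulrDr.
  by rewrite [dot x eta + _]addrC subrK.
rewrite cabsM cabs_cexpi mul1r cabsM.
rewrite (le_trans (ler_wpM2r (cabs_ge0 _) (cabs_cexpiB1 _)))//.
rewrite normrM mulrA -!mulrA ler_wpM2l// ler_wpM2l//.
have -> : cabs (G x) = \sum_(k < 3) `|coord3 k x| * cabs (f x).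
  rewrite /G -rc_sum cabs_real ger0_norm ?sumr_ge0//; last by move=> k _; exact: cabs_ge0.
  by apply: eq_bigr => k _; rewrite cabsM cabs_real.
rewrite -mulr_suml mulrA ler_wpM2r ?cabs_ge0//.
rewrite /dot -sumrB mulr_sumr (le_trans (ler_norm_sum _ _ _))//.
apply: ler_sum => k _; rewrite -mulrBr normrM mulrC ler_wpM2r//.
by rewrite /D (bigD1 k)//= lerDl sumr_ge0.
Qed.

(** Integration by parts: the derivative of the product of [f] and the exponential has mean zero. *)
Lemma FT_cpartial s f j (xi : V) : schwartz f ->
  FT s (cpartial j f) xi = - (0 +i* (s * coord3 j xi)) * FT s f xi.
Proof.
move=> sf; have fi := cinte_schwartz sf.
have di := cinte_schwartz (schwartz_cpartial j sf).
have := cint_cpartial0 j (schwartz_cexpi s xi sf).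
rewrite (has_partialE (has_partialM (has_partial_cexpi j s xi) (schwartz_partial j sf))).
under eq_cint do rewrite -mulrA.
rewrite cintD; last 2 first.
- by apply: cinteZ; exact: cinte_FT.
- exact: cinte_FT.
rewrite cintZ; last exact: cinte_FT.
by move/eqP; rewrite addrC addr_eq0 => /eqP; rewrite mulNr.
Qed.

(** Induction on the exponent: one more factor |xi_j| is traded for a derivative of [f] by
    [FT_cpartial], at the price of a division by |s|. *)
Lemma rapid_FT s f : s != 0 -> schwartz f -> rapid (FT s f).
Proof.
move=> s0 sf N; elim: N f sf => [|N ih] f sf.
  exists (fine (L1 mu f)) => xi; rewrite expr0 mul1r.
  by apply: cabs_FT_le; exact: cinte_schwartz.
have [A hA] := ih f sf.
have /choice[B hB] j := ih _ (schwartz_cpartial j sf).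
exists (A + \sum_(j < 3) B j / `|s|) => xi.
have r0 := enorm_ge0 xi.
have p0 : 0 <= (1 + enorm xi) ^+ N by rewrite exprn_ge0// addr_ge0.
rewrite exprSr -mulrA mulrDl mul1r mulrDr lerD//.
rewrite (@le_trans _ _ (\sum_(j < 3) (1 + enorm xi) ^+ N * (`|coord3 j xi| * cabs (FT s f xi))))//.
  rewrite -mulr_sumr ler_wpM2l// -mulr_suml ler_wpM2r ?cabs_ge0//.
  exact: enorm_le.
apply: ler_sum => j _; rewrite ler_pdivlMr ?normr_gt0//.
have := hB j xi; rewrite FT_cpartial// cabsM cabsN.
have -> : cabs (0 +i* (s * coord3 j xi)) = `|s| * `|coord3 j xi|.
  by rewrite /cabs /= expr0n add0r sqrtr_sqr normrM.
by move=> h; apply: le_trans h; rewrite le_eqVlt; apply/orP; left; apply/eqP; ring.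
Qed.

Lemma schwartz_FT s f : s != 0 -> schwartz f -> schwartz (FT s f).
Proof.
move=> s0 sf; apply: (@schwartz_stable _ (fun h => exists2 f, schwartz f & h = FT s f)); last by exists f.
move=> _ [{}f {}sf ->]; split.
- exact: ccontinuous_FT.
- exact: rapid_FT.
- move=> j; eexists; first exact: has_partial_FT.
  by eexists; last reflexivity; apply: schwartzZ; exact: schwartz_coord.
Qed.

Lemma fourierE f : fourier f = FT (-1) f.
Proof. by apply/funext => xi; apply: eq_cint => x; rewrite mulN1r. Qed.

Lemma inv_fourierE f : inv_fourier f = fun x => ((2 * pi) ^- 3)%:C * FT 1 f x.
Proof.
apply/funext => x; congr (_ * _); apply: eq_cint => xi.
by rewrite mul1r dotC.
Qed.

Lemma schwartz_fourier f : schwartz f -> schwartz (fourier f).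
Proof. by move=> sf; rewrite fourierE; apply: schwartz_FT => //; rewrite oppr_eq0 oner_eq0. Qed.

Lemma schwartz_inv_fourier f : schwartz f -> schwartz (inv_fourier f).
Proof. by move=> sf; rewrite inv_fourierE; apply: schwartzZ; apply: schwartz_FT => //; rewrite oner_eq0. Qed.

End fourier_theory.

(** * Inversion by regularization with the Poisson kernel *)

Section inversion.
Local Open Scope classical_set_scope.
Local Open Scope ring_scope.
Local Open Scope complex_scope.
Context (R : realType).
Local Notation V := (R * R * R)%type.
Local Notation E := (E3 R).
Local Notation mu := (@leb3 R).
Local Notation cint := (cintegral mu setT).
Local Notation cinte := (cintegrable mu setT).
Implicit Types (j k : 'I_3) (s : R).

Let eps (n : nat) : R := n.+1%:R^-1.

Let eps_gt0 n : 0 < eps n. Proof. by rewrite invr_gt0. Qed.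

Let cvg_eps : eps n @[n --> \oo] --> (0 : R).
Proof. exact: cvg_harmonic. Qed.

Lemma cmeas_FT s (f : E -> R[i]) : cmeasurable setT f -> cmeasurable (setT : set E) (FT s f).
Proof.
move=> mf; apply: (@cmeas_cint_param _ _ _ _ _ mu (fun z : E * E => cexpi (s * dot z.2 z.1) * f z.2)).
apply: cmeasM.
  apply: cmeas_cexpi; apply: measurable_funM => //.
  by apply: measurable_dot; [exact: measurable_snd|exact: measurable_fst].
exact: (cmeas_comp mf measurable_snd).
Qed.

(* Regularizing with [laplace3 e] makes the double integral absolutely convergent. *)
Lemma poisson (f : E -> R[i]) (e : R) (x : V) : 0 < e -> cinte f ->
  cint (fun xi => cexpi (dot x xi) * FT (-1) f xi * (laplace3 e xi)%:C) =
  cint (fun y => f y * (8 / e ^+ 3 * cauchy3 (e^-1 *: (x - y)))%:C).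
Proof.
move=> e0 fi; have mf := cinte_meas fi.
pose G (z : E * E) := cexpi (dot x z.1) * cexpi (-1 * dot z.2 z.1) * f z.2 * (laplace3 e z.1)%:C.
have mG : cmeasurable setT G.
  apply: cmeasM; first apply: cmeasM; first apply: cmeasM.
  - by apply: cmeas_cexpi; apply: measurable_dot => //; exact: measurable_cst.
  - by apply: cmeas_cexpi; apply: measurable_funM => //; exact: measurable_dot.
  - exact: (cmeas_comp mf measurable_snd).
  - by apply: cmeas_real; exact: (measurableT_comp (measurable_laplace3 e0) measurable_fst).
have Go : (\int[mu]_xi L1 mu (fun y => G (xi, y)) < +oo)%E.
  rewrite (L1_tonelli1 mu mu mG).
  have := L1_tensor mu mu (cinte_meas (cinte_laplace3 e0)) mf.
  rewrite (_ : L1 _ _ = L1 (mu \x mu)%E G).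
    move=> ->; have := cinte_L1 (cinte_laplace3 e0); have := cinte_L1 fi => h1 h2.
    by rewrite lte_mul_pinfty ?L1_ge0// ge0_fin_numE ?L1_ge0.
  by apply: eq_integral => z _; rewrite /G !cabsM !cabs_cexpi !mul1r mulrC.
transitivity (cint (fun xi => cint (fun y => G (xi, y)))).
  apply: eq_cint => xi; rewrite /G /= /FT -cintZ; last exact: cinte_FT.
  rewrite -cintZr; last by apply: cinteZ; exact: cinte_FT.
  by apply: eq_cint => y; rewrite !mulrA.
rewrite (cfubini mG Go); apply: eq_cint => y.
rewrite /G /= -cint_laplace3// -cintZ; last exact: cinte_cexpi_laplace3.
apply: eq_cint => xi; rewrite -cexpiD mulN1r -[- dot y xi]mulN1r -dotZl -dotDl.
rewrite [RHS]mulrA; congr (_ * _); rewrite mulrC; congr (_ * cexpi (dot _ _)).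
by rewrite scaleN1r.
Qed.

Lemma cauchy3N (x : V) : cauchy3 (- x) = cauchy3 x.
Proof. by rewrite /cauchy3 /cauchy1 /= !sqrrN. Qed.

Section scaled_cauchy3.
Variables (g : E -> R[i]) (e : R) (x : V).
Hypotheses (e0 : 0 < e) (gi : cinte g).

Let en0 : e != 0. Proof. by rewrite gt_eqF. Qed.

Let F (y : E) := g y * (8 / e ^+ 3 * cauchy3 (e^-1 *: (x - (y : V))))%:C.

Let FE (z : V) : F (x + e *: z) = (8 / e ^+ 3)%:C * (g (x + e *: z) * (cauchy3 z)%:C).
Proof.
rewrite /F opprD addNKr scalerN scalerA mulVf// scale1r cauchy3N.
by rewrite rcM; ring.
Qed.

Let Fi : cinte F.
Proof.
rewrite /F; under eq_fun do rewrite mulrC.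
have c0 : 0 <= 8 / e ^+ 3 by rewrite divr_ge0// exprn_ge0// ltW.
apply: (@cinte_bndM _ _ _ _ (8 / e ^+ 3)) => //.
  apply: cmeas_real; apply: measurable_funM => //.
  have -> : (fun y : E => cauchy3 (e^-1 *: (x - (y : V)))) =
      (fun y : E => cauchy3 (- (e^-1 *: x) + e^-1 *: (y : V))).
    apply/funext => y; rewrite -cauchy3N -scalerN opprB scalerBr addrC.
    by [].
  exact: (measurableT_comp (@measurable_cauchy3 R) (measurable_affine3 (- (e^-1 *: x)) e^-1)).
move=> y; rewrite cabs_real ger0_norm; first by rewrite ler_piMr// cauchy3_le1.
exact: mulr_ge0 c0 (ltW (cauchy3_gt0 _)).
Qed.

Lemma cinte_scaled_cauchy3 :
  cinte (fun z : E => g (x + e *: (z : V)) * (cauchy3 z)%:C).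
Proof.
have h : cinte (fun z : E => F (x + e *: (z : V))).
  apply: (cinte_change (phi := fun z : E => (x + e *: (z : V)) : E) (c := e ^- 3)).
  - exact: measurable_affine3.
  - by rewrite invr_ge0 exprn_ge0// ltW.
  - by move=> f mf f0; exact: ge0_integral_affine3.
  - exact: Fi.
have c0 : 8 / e ^+ 3 != 0 by rewrite mulf_neq0// invr_eq0 expf_neq0.
have := cinteZ ((8 / e ^+ 3)^-1)%:C h.
rewrite (_ : (fun _ => _) = fun z : E => g (x + e *: (z : V)) * (cauchy3 z)%:C)//.
by apply/funext => z; rewrite FE mulrA -rcM mulVf// mul1r.
Qed.

(** The substitution y = x + e z: its Jacobian e^3 cancels the e^-3 of the kernel and leaves the
    factor 8. *)
Lemma cint_scaled_cauchy3 :
  cint (fun y => g y * (8 / e ^+ 3 * cauchy3 (e^-1 *: (x - y)))%:C) =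
  8%:C * cint (fun z => g (x + e *: z) * (cauchy3 z)%:C).
Proof.
have := cint_affine3 x e0 Fi; under eq_cint do rewrite FE.
rewrite cintZ; last exact: cinte_scaled_cauchy3.
have e3 : (e ^- 3)%:C != 0 by rewrite (inj_eq (@complexI _)) invr_eq0 expf_neq0.
by move=> h; apply: (mulfI e3); rewrite -h rcM; ring.
Qed.

End scaled_cauchy3.

(** Convergence is asked at the single point [x], so that indicators of boxes are covered as well as
    continuous functions. *)
Lemma cvg_cauchy3 (g : E -> R[i]) (x : V) (B : R) :
  cmeasurable setT g -> (forall y, cabs (g y) <= B) ->
  (forall z : V, cabs (g (x + eps n *: z) - g x) @[n --> \oo] --> (0 : R)) ->
  cabs (cint (fun z => g (x + eps n *: z) * (cauchy3 z)%:C) - (pi ^+ 3)%:C * g x)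
    @[n --> \oo] --> (0 : R).
Proof.
move=> mg gB gc.
rewrite -cint_cauchy3 -cintZr; last exact: cinte_cauchy3.
apply: (@cvg_cint _ _ _ mu (fun n (z : E) => g (x + eps n *: (z : V)) * (cauchy3 z)%:C)
  _ (fun z => B * cauchy3 z)).
- move=> n; apply: cmeasM; last exact: cinte_meas (cinte_cauchy3 R).
  exact: (cmeas_comp mg (measurable_affine3 x (eps n))).
- by apply: cmeasM; [exact: cinte_meas (cinte_cauchy3 R)|exact: cmeas_cst].
- apply: aeW => z.
  apply: (cvg0_squeeze (cvg0_mulr (cauchy3 z) (gc z))) => n; rewrite cabs_ge0/=.
  rewrite mulrC -mulrBr cabsM cabs_real ger0_norm ?(ltW (cauchy3_gt0 _))//.
  by rewrite mulrC.
- exact: integrable_cauchy3.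
- apply: aeW => z n; rewrite cabsM cabs_real ger0_norm ?(ltW (cauchy3_gt0 _))//.
  by rewrite ler_wpM2r// ltW// cauchy3_gt0.
Qed.

Lemma cvg_eps_shift (x z : V) : (x + eps n *: z : V) @[n --> \oo] --> x.
Proof.
have c (a b : R) : a + eps n * b @[n --> \oo] --> a.
  have : a + eps n * b @[n --> \oo] --> a + 0 * b.
    apply: cvgD; first exact: cvg_cst.
    by apply: cvgM => //; exact: cvg_cst.
  by rewrite mul0r addr0.
case: x z => -[x1 x2] x3 [[z1 z2] z3].
exact: (cvg3 _ (c x1 z1) (c x2 z2) (c x3 z3)).
Qed.

Lemma cvg_laplace3 (xi : V) : laplace3 (eps n) xi @[n --> \oo] --> (1 : R).
Proof.
have c (y : R) : laplace1 (eps n) y @[n --> \oo] --> (1 : R).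
  rewrite -expR0 -oppr0 -[X in expR (- X)](mul0r `|y|).
  apply: (cvg_comp (fun n => - (eps n * `|y|)) (@expR R)); last exact: continuous_expR.
  by apply: cvgN; apply: cvgM => //; exact: cvg_cst.
rewrite (_ : 1 = 1 * 1 * 1 :> R); last by rewrite !mulr1.
by apply: cvgM; [apply: cvgM|]; exact: c.
Qed.

Lemma inv_fourier_fourier (f : V -> R[i]) : schwartz f -> inv_fourier (fourier f) = f.
Proof.
move=> sf; apply/funext => x.
have fi := cinte_schwartz sf; have mf := cinte_meas fi.
have Fi := cinte_schwartz (schwartz_fourier sf).
have [B fB] := schwartz_bounded sf.
have L : cabs (cint (fun xi => cexpi (dot x xi) * FT (-1) f xi * (laplace3 (eps n) xi)%:C) -
    cint (fun xi => cexpi (dot x xi) * fourier f xi)) @[n --> \oo] --> (0 : R).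
  have m1 : cmeasurable (setT : set E) (fun xi : E => cexpi (dot x xi) * fourier f xi).
    apply: cmeasM; last exact: cinte_meas Fi.
    by apply: cmeas_cexpi; apply: measurable_dot => //; exact: measurable_cst.
  apply: (@cvg_cint _ _ _ mu _ _ (fun xi => cabs (fourier f xi))).
  - move=> n; rewrite -fourierE; apply: cmeasM => //.
    by apply: cmeas_real; exact: measurable_laplace3.
  - exact: m1.
  - apply: aeW => xi; rewrite -fourierE.
    have h : `|laplace3 (eps n) xi - 1| @[n --> \oo] --> (0 : R).
      rewrite -(@normr0 R R) -(subrr 1); apply: cvg_norm.
      by apply: cvgB; [exact: cvg_laplace3|exact: cvg_cst].
    apply: (cvg0_squeeze (cvg0_mulr (cabs (fourier f xi)) h)) => n; rewrite cabs_ge0/=.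
    rewrite -[X in cabs (_ - X)]mulr1 -mulrBr !cabsM cabs_cexpi mul1r mulrC.
    by rewrite -cabs_real rcB.
  - exact: cinte_abs Fi.
  - apply: aeW => xi n; rewrite -fourierE !cabsM cabs_cexpi mul1r cabs_real.
    rewrite ler_piMr ?cabs_ge0// ger0_norm ?laplace3_ge0//.
    exact: laplace3_le1.
have K : forall z : V, cabs (f (x + eps n *: z) - f x) @[n --> \oo] --> (0 : R).
  have [c1 c2] := schwartz_ccontinuous sf.
  move=> z; have cz := @cvg_eps_shift x z.
  have /cvgrPdist_le d1 := cvg_comp _ _ cz (c1 x).
  have /cvgrPdist_le d2 := cvg_comp _ _ cz (c2 x).
  apply/cvgrPdist_le => e e0.
  have e2 : 0 < e / 2 by rewrite divr_gt0.
  move: (d1 _ e2) (d2 _ e2); apply: filterS2 => n /= n1 n2.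
  rewrite sub0r normrN ger0_norm ?cabs_ge0// cabs_distC (le_trans (cabs_le_ReIm _))//.
  by rewrite [leRHS](splitr e) lerD// ?cReD ?cReN ?cImD ?cImN.
have K2 := cvg_cauchy3 mf fB K.
have E1 n : cint (fun xi => cexpi (dot x xi) * FT (-1) f xi * (laplace3 (eps n) xi)%:C) =
    8%:C * cint (fun z => f (x + eps n *: z) * (cauchy3 z)%:C).
  by rewrite poisson// cint_scaled_cauchy3.
have K3 : cabs (cint (fun xi => cexpi (dot x xi) * FT (-1) f xi * (laplace3 (eps n) xi)%:C) -
    8%:C * ((pi ^+ 3)%:C * f x)) @[n --> \oo] --> (0 : R).
  apply: (cvg0_squeeze (cvg0_mulr 8 K2)) => n; rewrite cabs_ge0/= E1 -mulrBr cabsM.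
  by rewrite cabs_real ger0_norm// mulrC.
(* The regularized integral has two limits, from the frequency side and from the space side; the
   constants match because 8 pi^3 = (2 pi)^3. *)
rewrite /inv_fourier (cabs_lim_unique L K3) !mulrA -!rcM.
rewrite (_ : (2 * pi) ^- 3 * 8 * pi ^+ 3 = 1) ?mul1r//.
have p0 : pi != 0 :> R by rewrite gt_eqF// pi_gt0.
rewrite (_ : _ * pi ^+ 3 = ((2 * pi) ^+ 3)^-1 * (2 * pi) ^+ 3); last by ring.
by rewrite mulVf// expf_neq0// mulf_neq0// pnatr_eq0.
Qed.

Lemma FT_opp s (f : V -> R[i]) x : FT s f (- x) = FT (- s) f x.
Proof.
apply: eq_cint => y; congr (cexpi _ * _).
by rewrite dotC -scaleN1r dotZl mulrA mulrN1 dotC.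
Qed.

(** Deduced from the other composition by reflecting the variable of integration. *)
Lemma fourier_inv_fourier (f : V -> R[i]) : schwartz f -> fourier (inv_fourier f) = f.
Proof.
move=> sf; rewrite -[RHS](inv_fourier_fourier sf); apply/funext => xi.
have s1 : schwartz (FT 1 f) by apply: schwartz_FT => //; rewrite oner_eq0.
have i1 := cinte_schwartz s1.
rewrite (fourierE (inv_fourier f)) (inv_fourierE f) (FTZ _ _ _ i1).
have e : inv_fourier (fourier f) xi = ((2 * pi) ^- 3)%:C * FT 1 (FT (-1) f) xi.
  by rewrite fourierE inv_fourierE.
etransitivity; last exact: esym e.
apply: (congr1 (fun z => _ * z)).
rewrite {1}/FT -cint_opp3; last exact: cinte_FT.
apply: eq_cint => x; rewrite FT_opp; congr (cexpi _ * _).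
by rewrite -[- x]scaleN1r dotZl mulrA mulrNN mulr1.
Qed.

End inversion.

(** * Injectivity of the Fourier transform on L^1 *)

Section fourier_injective.
Local Open Scope classical_set_scope.
Local Open Scope ring_scope.
Local Open Scope complex_scope.
Context (R : realType).
Local Notation V := (R * R * R)%type.
Local Notation E := (E3 R).
Local Notation mu := (@leb3 R).
Local Notation cint := (cintegral mu setT).
Local Notation cinte := (cintegrable mu setT).

Let eps (n : nat) : R := n.+1%:R^-1.

Let eps_gt0 n : 0 < eps n. Proof. by rewrite invr_gt0. Qed.

(** Coordinate hyperplanes are negligible, hence so are the faces of a box, where its indicator is
    discontinuous. *)
Lemma ae_coord3_neq k (a : R) : {ae mu, forall x : E, coord3 k x != a}.
Proof.
have m1 : measurable ([set a] : set (measurableTypeR R)) by exact: measurable_set1.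
have mN : measurable [set x : E | coord3 k x = a].
  have := measurable_coord3 k (@measurable_id _ E setT) measurableT m1.
  by rewrite setTI.
exists [set x : E | coord3 k x = a]; split => //; last first.
  by move=> x /= /negP; rewrite negbK => /eqP.
have p2 (A : set (measurableTypeR R * measurableTypeR R)) (B : set (measurableTypeR R)) :
    measurable A -> measurable B -> mu (A `*` B) = (@leb2 R A * lebesgue_measure B)%E.
  by move=> mA mB; exact: product_measure1E.
have p1 (A B : set (measurableTypeR R)) : measurable A -> measurable B ->
    @leb2 R (A `*` B) = (lebesgue_measure A * lebesgue_measure B)%E.
  by move=> mA mB; exact: product_measure1E.
have l0 := @lebesgue_measure_set1 R a.
case: k {mN} => -[|[|[|//]]] hk.
- rewrite (_ : [set x : E | _] = ([set a] `*` setT) `*` setT); last first.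
    by apply/seteqP; split => -[[x y] z] /=; rewrite /coord3 /=; tauto.
  by rewrite p2//; [rewrite p1// l0 !mul0e|exact: measurableX].
- rewrite (_ : [set x : E | _] = (setT `*` [set a]) `*` setT); last first.
    by apply/seteqP; split => -[[x y] z] /=; rewrite /coord3 /=; tauto.
  by rewrite p2//; [rewrite p1// l0 mule0 mul0e|exact: measurableX].
- rewrite (_ : [set x : E | _] = setT `*` [set a]); last first.
    by apply/seteqP; split => -[[x y] z] /=; rewrite /coord3 /=; tauto.
  by rewrite p2// l0 mule0.
Qed.

Definition box_indic (A B C : set R) (x : E) : R[i] :=
  (\1_A x.1.1 * \1_B x.1.2 * \1_C x.2)%:C.

Lemma cabs_box_indic A B C x : cabs (box_indic A B C x) <= 1.
Proof.
have h (D : set R) (y : R) : 0 <= (\1_D y : R) <= 1.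
  by rewrite indicE; case: (y \in D); rewrite /= ?lexx ?ler01.
have /andP[a0 a1] := h A x.1.1; have /andP[b0 b1] := h B x.1.2; have /andP[c0 c1] := h C x.2.
by rewrite cabs_real ger0_norm ?mulr_ge0// !mulr_ile1// mulr_ge0.
Qed.

Lemma cmeas_box_indic A B C : ocitvT A -> ocitvT B -> ocitvT C ->
  cmeasurable setT (box_indic A B C).
Proof.
move=> oA oB oC.
have mo D : ocitvT D -> measurable (D : set (measurableTypeR R)).
  by move=> hD; rewrite measurable_ocitvT; exact: sub_sigma_algebra.
have mi D : ocitvT D -> measurable_fun setT (\1_D : measurableTypeR R -> R).
  by move=> /mo mD; exact: measurable_indic.
apply: cmeas_real; apply: measurable_funM; first apply: measurable_funM.
- have m1 : measurable_fun setT (fun x : E => x.1.1) by exact: measurableT_comp.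
  exact: (measurableT_comp (mi A oA) m1).
- have m1 : measurable_fun setT (fun x : E => x.1.2) by exact: measurableT_comp.
  exact: (measurableT_comp (mi B oB) m1).
- exact: (measurableT_comp (mi C oC) (@measurable_snd _ _ _ _)).
Qed.

(** Off the faces the indicator is locally constant, so the sequence is eventually constant. *)
Lemma box_indic_cvg A B C : ocitvT A -> ocitvT B -> ocitvT C ->
  {ae mu, forall y : E, forall z : V,
    cabs (box_indic A B C (y + eps n *: z) - box_indic A B C y) @[n --> \oo] --> (0 : R)}.
Proof.
have key (D : set R) k : ocitvT D -> {ae mu, forall y : E, forall z : V,
    \forall n \near \oo, (\1_D (coord3 k (y + eps n *: z)) : R) = \1_D (coord3 k y)}.
  move=> [->|[[a b] _ <-]].
    by apply: aeW => y z; apply: nearW => n; rewrite !indicT.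
  have := ae_coord3_neq k a; have := ae_coord3_neq k b; apply: filterS2 => y ya yb z.
  have c : coord3 k (y + eps n *: z) @[n --> \oo] --> coord3 k y.
    exact: (cvg_comp _ _ (@cvg_eps_shift R y z) (@continuous_coord3 R k y)).
  rewrite /=.
  have Ha : \forall n \near \oo, (a < coord3 k (y + eps n *: z)) = (a < coord3 k y).
    have := yb; rewrite neq_lt => /orP[h|h].
      have : \forall n \near \oo, coord3 k (y + eps n *: z) < a by exact: cvgr_lt c _ h.
      apply: filterS => n hn.
      by rewrite !ltNge (ltW hn) (ltW h).
    have : \forall n \near \oo, a < coord3 k (y + eps n *: z) by exact: cvgr_gt c _ h.
    apply: filterS => n hn.
    by rewrite hn h.
  have Hb : \forall n \near \oo, (coord3 k (y + eps n *: z) <= b) = (coord3 k y <= b).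
    have := ya; rewrite neq_lt => /orP[h|h].
      have : \forall n \near \oo, coord3 k (y + eps n *: z) < b by exact: cvgr_lt c _ h.
      apply: filterS => n hn.
      by rewrite (ltW hn) (ltW h).
    have : \forall n \near \oo, b < coord3 k (y + eps n *: z) by exact: cvgr_gt c _ h.
    apply: filterS => n hn.
    by rewrite !leNgt hn h.
  move: Ha Hb; apply: filterS2 => n ha hb.
  by rewrite !indicE; congr (_ %:R); rewrite !mem_setE !in_itv /= ha hb.
move=> oA oB oC.
have := key A (@Ordinal 3 0 isT) oA; have := key B (@Ordinal 3 1 isT) oB.
have := key C (@Ordinal 3 2 isT) oC.
apply: filterS3 => y hC hB hA z.
apply: (@cvg_trans _ ((fun _ : nat => 0 : R) @ \oo)); last exact: cvg_cst.
apply: near_eq_cvg; move: (hA z) (hB z) (hC z); apply: filterS3 => n eA eB eC.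
rewrite /coord3 /= in eA eB eC.
by rewrite /box_indic /= eA eB eC subrr cabs0.
Qed.

(** If the transform vanishes, so do all Poisson means of [H]. The kernel being even, Fubini's
    theorem moves it from [H] onto the indicator [Q] of a box; the means of [Q] are bounded and
    converge almost everywhere, so in the limit the integral of [H] over the box is zero. Averaging
    [Q] and not [H] avoids any statement about pointwise convergence of means of an L^1 function. *)
Lemma FT_injective (H : E -> R[i]) : cinte H -> (forall xi, FT (-1) H xi = 0) ->
  {ae mu, forall x, H x = 0}.
Proof.
move=> Hi FH; have mH := cinte_meas Hi.
have k0 n (x : V) : cint (fun y => H y * (8 / eps n ^+ 3 * cauchy3 ((eps n)^-1 *: (x - y)))%:C) = 0.
  rewrite -poisson// -[RHS](cint0 mu); apply: eq_cint => xi.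
  by rewrite FH mulr0 mul0r.
have box A B C : ocitvT A -> ocitvT B -> ocitvT C ->
    cint (fun y => H y * box_indic A B C y) = 0.
  move=> oA oB oC; set Q := box_indic A B C.
  have mQ : cmeasurable setT Q by exact: cmeas_box_indic.
  have Q1 y : cabs (Q y) <= 1 by exact: cabs_box_indic.
  pose Phi n (y : E) := cint (fun z => Q (y + eps n *: z) * (cauchy3 z)%:C).
  have Phi0 n : cint (fun y => H y * Phi n y) = 0.
    pose G (p : E * E) := H p.1 * (Q ((p.1 : V) + (- eps n) *: (p.2 : V)) * (cauchy3 p.2)%:C).
    pose G' (p : E * E) := H ((p.2 : V) + eps n *: (p.1 : V)) * (Q p.2 * (cauchy3 p.1)%:C).
    have mK : cmeasurable setT (fun z : E => (cauchy3 z)%:C) := cinte_meas (cinte_cauchy3 R).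
    have mG : cmeasurable setT G.
      apply: cmeasM; first exact: (cmeas_comp mH measurable_fst).
      apply: cmeasM; last exact: (cmeas_comp mK measurable_snd).
      by apply: (cmeas_comp mQ); exact: measurable_addZ.
    have mG' : cmeasurable setT G'.
      apply: cmeasM; first by apply: (cmeas_comp mH); exact: measurable_addZ.
      by apply: cmeasM; [exact: (cmeas_comp mQ measurable_snd)|exact: (cmeas_comp mK measurable_fst)].
    have Lf f : cinte f -> (fine (L1 mu f))%:E = L1 mu f.
      by move=> fi; rewrite fineK// ge0_fin_numE ?L1_ge0//; exact: cinte_L1.
    have Qz (y : E) : cinte (fun z : E => Q ((y : V) + (- eps n) *: (z : V)) * (cauchy3 z)%:C).
      apply: (@cinte_bndM _ _ _ _ 1) => //; last exact: cinte_cauchy3.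
      by apply: (cmeas_comp mQ); apply: measurable_addZ => //; exact: measurable_cst.
    transitivity (cint (fun y => cint (fun z => G (y, z)))).
      apply: eq_cint => y; rewrite /G /= (cintZ _ (Qz y)).
      apply: (congr1 (fun w => H y * w)).
      rewrite /Phi -cint_opp3.
        by apply: eq_cint => z; rewrite cauchy3N scalerN scaleNr.
      apply: (@cinte_bndM _ _ _ _ 1) => //; last exact: cinte_cauchy3.
      by apply: (cmeas_comp mQ); apply: measurable_addZ => //; exact: measurable_cst.
    rewrite (cfubini mG); last first.
      apply: (L1_param_bound (g := H) (B := fine (L1 mu (fun z : E => (cauchy3 z)%:C)))) => //.
        by apply: fine_ge0; exact: L1_ge0.
      move=> y; rewrite EFinM Lf; last exact: cinte_cauchy3.
      rewrite muleC -L1Z//; apply: le_L1 => //.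
      - by apply: (cmeas_comp mG); exact: pair1_measurable.
      - by apply: cmeasM => //; exact: cmeas_cst.
      - move=> z; rewrite /G /= !cabsM ler_wpM2l ?cabs_ge0// ler_piMl ?cabs_ge0//.
    (* At fixed [z], translating [y] by [eps n *: z] moves the displacement from [Q] to [H]. *)
    transitivity (cint (fun z => cint (fun y => G' (z, y)))).
      apply: eq_cint => z; rewrite /G' /=.
      rewrite -(cint_shift (eps n *: (z : V))).
        apply: eq_cint => y; rewrite /G /= [_ *: _ + _]addrC.
        by rewrite -addrA -scalerDl subrr scale0r addr0.
      rewrite /G /=; under eq_fun do rewrite mulrC.
      apply: (@cinte_bndM _ _ _ _ 1) => //.
        apply: cmeasM; last exact: cmeas_cst.
        by apply: (cmeas_comp mQ); apply: measurable_addZ => //; exact: measurable_cst.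
      have cz : cabs (cauchy3 z)%:C <= 1.
        by rewrite cabs_real ger0_norm ?cauchy3_le1// ltW// cauchy3_gt0.
      by move=> y; rewrite cabsM mulr_ile1 ?cabs_ge0.
    rewrite (cfubini mG'); last first.
      apply: (L1_param_bound (g := fun z : E => (cauchy3 z)%:C) (B := fine (L1 mu H))) => //.
      - exact: cinte_cauchy3.
      - by apply: fine_ge0; exact: L1_ge0.
      move=> z; rewrite EFinM Lf// muleC.
      have -> : L1 mu H = L1 mu (fun y : E => H (eps n *: (z : V) + (y : V))) by rewrite L1_shift.
      have mHs : cmeasurable setT (fun y : E => H (eps n *: (z : V) + (y : V))).
        exact: (cmeas_comp mH (measurable_shift _)).
      rewrite -[X in (X * _)%E]/((cabs (cauchy3 z)%:C)%:E) -L1Z//; apply: le_L1 => //.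
      - by apply: (cmeas_comp mG'); exact: pair1_measurable.
      - by apply: cmeasM => //; exact: cmeas_cst.
      - move=> y; rewrite /G' /= !cabsM [(_ : V) + _]addrC [leRHS]mulrC.
        by rewrite ler_wpM2l ?cabs_ge0// ler_piMl ?cabs_ge0.
    rewrite -[RHS](cint0 mu); apply: eq_cint => y.
    have := k0 n y; rewrite cint_scaled_cauchy3//.
    move/eqP; rewrite mulf_eq0 => /orP[/eqP/(congr1 (@complex.Re R))/=/eqP|/eqP h].
      by rewrite pnatr_eq0.
    transitivity (cint (fun z => Q y * (H ((y : V) + eps n *: (z : V)) * (cauchy3 z)%:C))).
      by apply: eq_cint => z; rewrite /G' /= mulrCA.
    by rewrite cintZ ?h ?mulr0//; exact: cinte_scaled_cauchy3.
  have PhiB n y : cabs (Phi n y) <= fine (L1 mu (fun z : E => (cauchy3 z)%:C)).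
    rewrite -[leRHS]mul1r; apply: cabs_cint_bound => //; last first.
    - by move=> z; rewrite cabsM ler_wpM2r ?cabs_ge0.
    - exact: cinte_cauchy3.
    apply: cmeasM; last exact: cinte_meas (cinte_cauchy3 R).
    by apply: (cmeas_comp mQ); apply: measurable_addZ => //; exact: measurable_cst.
  have mPhi n : cmeasurable setT (Phi n).
    apply: (@cmeas_cint_param _ _ _ _ _ mu (fun p : E * E => Q ((p.1 : V) + eps n *: (p.2 : V)) * (cauchy3 p.2)%:C)).
    apply: cmeasM; first by apply: (cmeas_comp mQ); exact: measurable_addZ.
    exact: (cmeas_comp (cinte_meas (cinte_cauchy3 R)) measurable_snd).
  have lim : cabs (cint (fun y => H y * Phi n y) -
      cint (fun y => H y * ((pi ^+ 3)%:C * Q y))) @[n --> \oo] --> (0 : R).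
  apply: (@cvg_cint _ _ _ mu (fun n y => H y * Phi n y) _
    (fun y => fine (L1 mu (fun z : E => (cauchy3 z)%:C)) * cabs (H y))).
  - by move=> n; exact: cmeasM.
  - by apply: cmeasM => //; apply: cmeasM => //; exact: cmeas_cst.
  - have := box_indic_cvg oA oB oC; apply: filterS => y hy.
    have K := cvg_cauchy3 mQ Q1 hy.
    apply: (cvg0_squeeze (cvg0_mulr (cabs (H y)) K)) => n; rewrite cabs_ge0/=.
    by rewrite -mulrBr cabsM mulrC.
  - exact: (integrableZl measurableT _ (cinte_abs Hi)).
  - by apply: aeW => y n; rewrite cabsM mulrC ler_wpM2r ?cabs_ge0.
  have Qi : cinte (fun y => H y * Q y).
    by under eq_fun do rewrite mulrC; apply: (@cinte_bndM _ _ _ _ 1).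
  move: lim; under eq_cvg do rewrite Phi0 sub0r cabsN.
  move=> /(cvg_lim (@Rhausdorff R)); rewrite lim_cst// => /cabs_eq0.
  under eq_cint do rewrite mulrCA; rewrite cintZ//.
  move/eqP; rewrite mulf_eq0 => /orP[/eqP/(congr1 (@complex.Re R))/=/eqP|/eqP//].
  by rewrite expf_eq0/= gt_eqF// pi_gt0.
(* [integral_box0] concerns real functions; the real and imaginary parts of [H] are treated
   separately. *)
have part (h : E -> R) : mu.-integrable setT (EFin \o h) ->
    (forall A B C, ocitvT A -> ocitvT B -> ocitvT C ->
      \int[mu]_y (h y * complex.Re (box_indic A B C y)) = 0) ->
    {ae mu, forall x, h x = 0}.
  move=> hi hbox.
  have mo D : ocitvT D -> measurable (D : set (measurableTypeR R)).
    by move=> hD; rewrite measurable_ocitvT; exact: sub_sigma_algebra.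
  have z := @integral_box0 R h hi.
  have {z} z : forall A : set E, measurable A -> (\int[mu]_(x in A) (h x)%:E = 0)%E.
    apply: z => A B C oA oB oC.
    have mABC : measurable (A `*` B `*` C : set E).
      by apply: measurableX; [apply: measurableX|]; exact: mo.
    have hf : (\int[mu]_(x in A `*` B `*` C) (h x)%:E)%E \is a fin_num.
      by apply: integrable_fin_num => //; exact: integrableS hi.
    rewrite -(fineK hf); congr EFin; rewrite -(hbox A B C oA oB oC).
    rewrite integral_mkcond; congr fine; apply: eq_integral => -[[x y] w] _.
    rewrite patchE /= /indic; case: ifPn => [/set_mem[[/= xA yB] wC]|].
      by rewrite !mem_set// !mulr1.
    move=> /negP nin; congr EFin.
    have [xA|xA] := boolP (x \in A); last by rewrite mul0r mul0r mulr0.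
    have [yB|yB] := boolP (y \in B); last by rewrite mulr0 mul0r mulr0.
    have [wC|wC] := boolP (w \in C); last by rewrite mulr0 mulr0.
    by exfalso; apply: nin; apply/mem_set; split => /=; [split; exact: set_mem|exact: set_mem].
  have := @integral_ae_eq _ _ _ mu setT measurableT (cst 0%E) (EFin \o h) hi.
  case=> //.
    by move=> D _ mD; rewrite z// integral_cst// mul0e.
  move=> N hN; exists N; move: hN => [mN N0 sN]; split => // x /= nx; apply: sN => /= e.
  by apply: nx; have := e I => -[].
have [H1 H2] := Hi.
have c1 : {ae mu, forall x, complex.Re (H x) = 0}.
  apply: part H1 _ => A B C oA oB oC.
  have := congr1 (@complex.Re R) (box A B C oA oB oC); rewrite /= => h.
  by rewrite -[RHS]h; apply: eq_Rintegral => y _; rewrite cReM /= mulr0 subr0.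
have c2 : {ae mu, forall x, complex.Im (H x) = 0}.
  apply: part H2 _ => A B C oA oB oC.
  have := congr1 (@complex.Im R) (box A B C oA oB oC); rewrite /= => h.
  by rewrite -[RHS]h; apply: eq_Rintegral => y _; rewrite cImM /= mulr0 add0r.
by move: c1 c2; apply: filterS2 => x h1 h2; apply: complex_ext.
Qed.

End fourier_injective.

(** * Convolution *)

Section convolution.
Local Open Scope classical_set_scope.
Local Open Scope ring_scope.
Local Open Scope complex_scope.
Context (R : realType).
Local Notation V := (R * R * R)%type.
Local Notation E := (E3 R).
Local Notation mu := (@leb3 R).
Local Notation cint := (cintegral mu setT).
Local Notation cinte := (cintegrable mu setT).
Implicit Types G H : E -> R[i].

Definition convol G H (xi : E) : R[i] := cint (fun eta => G ((xi : V) - (eta : V)) * H eta).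

Lemma measurable_sub3 d (T : measurableType d) (p q : T -> E) :
  measurable_fun setT p -> measurable_fun setT q ->
  measurable_fun setT (fun t => ((p t : V) - (q t : V)) : E).
Proof.
move=> mp mq; have := measurable_addZ (-1) mp mq.
by apply: eq_measurable_fun => t _; rewrite scaleN1r.
Qed.

(** The parameter is time: convolving slice by slice preserves joint measurability, which the
    nonlinearity needs. *)
Lemma cmeas_convol_param d (T : measurableType d) (f g : T * E -> R[i]) :
  cmeasurable setT f -> cmeasurable setT g ->
  cmeasurable setT (fun p : T * E => convol (fun eta => f (p.1, eta)) (fun eta => g (p.1, eta)) p.2).
Proof.
move=> mf mg.
apply: (@cmeas_cint_param _ _ _ _ _ mu
  (fun p : (T * E) * E => f (p.1.1, ((p.1.2 : V) - (p.2 : V))) * g (p.1.1, p.2))).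
have m1 : measurable_fun setT (fun p : (T * E) * E => p.1.1) by exact: measurableT_comp.
have m2 : measurable_fun setT (fun p : (T * E) * E => p.1.2) by exact: measurableT_comp.
apply: cmeasM.
  apply: (cmeas_comp mf); apply: measurable_fun_pair => //.
  by apply: measurable_sub3.
by apply: (cmeas_comp mg); apply: measurable_fun_pair.
Qed.

Let mK G H : cmeasurable setT G -> cmeasurable setT H ->
  cmeasurable setT (fun p : E * E => G ((p.1 : V) - (p.2 : V)) * H p.2).
Proof.
move=> mG mH; apply: cmeasM; last exact: (cmeas_comp mH measurable_snd).
by apply: (cmeas_comp mG); exact: measurable_sub3.
Qed.

Lemma cmeas_convol G H : cmeasurable setT G -> cmeasurable setT H ->
  cmeasurable setT (convol G H).
Proof. by move=> mG mH; exact: (cmeas_cint_param mu (mK mG mH)). Qed.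

Let L1K G H : cmeasurable setT G -> cmeasurable setT H ->
  L1 (mu \x mu)%E (fun p : E * E => G ((p.1 : V) - (p.2 : V)) * H p.2) = (L1 mu G * L1 mu H)%E.
Proof.
move=> mG mH; rewrite -(L1_tonelli2 mu mu (mK mG mH)).
rewrite muleC -ge0_integralZr//; last 3 first.
- exact: measurable_ecabs.
- by move=> x _; rewrite lee_fin cabs_ge0.
- exact: L1_ge0.
apply: eq_integral => eta _.
have mGs := cmeas_comp mG (measurable_shift (- (eta : V))).
rewrite -(L1_shift (- (eta : V)) mG) -L1Z//.
by apply: eq_integral => xi _; rewrite /= [(xi : V) - _]addrC mulrC.
Qed.

Lemma L1_convol G H : cmeasurable setT G -> cmeasurable setT H ->
  (L1 mu (convol G H) <= L1 mu G * L1 mu H)%E.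
Proof.
move=> mG mH; rewrite -L1K// -(L1_tonelli1 mu mu (mK mG mH)).
apply: ge0_le_integral => //.
- by move=> x _; rewrite lee_fin cabs_ge0.
- by apply: measurable_ecabs; exact: cmeas_convol.
- exact: measurable_L1_param (mK mG mH).
- move=> xi _; apply: cabs_cint_le_gen.
  exact: (cmeas_comp (mK mG mH) (pair1_measurable xi)).
Qed.

Lemma cinte_convol_kernel G H : cinte G -> cinte H ->
  cintegrable (mu \x mu)%E setT (fun p : E * E => G ((p.1 : V) - (p.2 : V)) * H p.2).
Proof.
move=> Gi Hi; have mG := cinte_meas Gi; have mH := cinte_meas Hi.
apply/cintegrableP; split; first exact: mK.
by rewrite L1K// lte_mul_pinfty ?L1_ge0 ?cinte_L1// ge0_fin_numE ?L1_ge0// cinte_L1.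
Qed.

Lemma cinte_convol G H : cinte G -> cinte H -> cinte (convol G H).
Proof. by move=> Gi Hi; exact: (cinte_cint_param (cinte_convol_kernel Gi Hi)). Qed.

(** Bilinearity holds only almost everywhere, since at a given point the integrals defining the
    convolutions may diverge. *)
Lemma convol_sub G H G' H' : cinte G -> cinte H -> cinte G' -> cinte H' ->
  {ae mu, forall xi, convol G H xi - convol G' H' xi =
    convol (fun x => G x - G' x) H xi + convol G' (fun x => H x - H' x) xi}.
Proof.
move=> Gi Hi Gi' Hi'.
have := ae_cinte1 (cinte_convol_kernel Gi Hi); have := ae_cinte1 (cinte_convol_kernel Gi' Hi').
have := ae_cinte1 (cinte_convol_kernel Gi' Hi); apply: filterS3 => xi /= h1 h2 h3.
transitivity (cint (fun eta => (G ((xi : V) - (eta : V)) * H eta - G' ((xi : V) - (eta : V)) * H eta) +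
   (G' ((xi : V) - (eta : V)) * H eta - G' ((xi : V) - (eta : V)) * H' eta))).
  rewrite /convol cintD; [|exact: cinteB|exact: cinteB].
  rewrite (cintB h3 h1) (cintB h1 h2).
  by rewrite addrA subrK.
have e1 : cint (fun eta => G ((xi : V) - (eta : V)) * H eta - G' ((xi : V) - (eta : V)) * H eta) =
    convol (fun x => G x - G' x) H xi.
  by apply: eq_cint => eta; rewrite mulrBl.
have e2 : cint (fun eta => G' ((xi : V) - (eta : V)) * H eta - G' ((xi : V) - (eta : V)) * H' eta) =
    convol G' (fun x => H x - H' x) xi.
  by apply: eq_cint => eta; rewrite mulrBr.
by rewrite -e1 -e2 cintD//; exact: cinteB.
Qed.

Lemma FT_convol G H (x : V) : cinte G -> cinte H ->
  FT 1 (convol G H) x = FT 1 G x * FT 1 H x.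
Proof.
move=> Gi Hi; have mG := cinte_meas Gi; have mH := cinte_meas Hi.
pose K (p : E * E) := cexpi (1 * dot p.1 x) * (G ((p.1 : V) - (p.2 : V)) * H p.2).
have mKK : cmeasurable setT K.
  apply: cmeasM; last exact: mK.
  apply: cmeas_cexpi; apply: measurable_funM => //.
  by apply: measurable_dot; [exact: measurable_fst|exact: measurable_cst].
have Ki : cintegrable (mu \x mu)%E setT K.
  apply: (cinte_le mKK (cinte_convol_kernel Gi Hi)) => p.
  by rewrite /K cabsM cabs_cexpi mul1r.
have e : (\int[mu]_xi L1 mu (fun eta => K (xi, eta)) < +oo)%E.
  by rewrite (L1_tonelli1 mu mu mKK) cinte_L1.
transitivity (cint (fun xi => cint (fun eta => K (xi, eta)))).
  have h := ae_cinte1 (cinte_convol_kernel Gi Hi).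
  apply: cint_ae_eq.
  - by apply: cmeasM; [exact: cmeas_cexpi_dot|exact: cmeas_convol].
  - exact: (cmeas_cint_param mu mKK).
  - by apply: filterS h => xi hxi; rewrite /K /= (cintZ _ hxi).
rewrite (cfubini mKK e) /FT mulrC -cintZr; last exact: cinte_FT.
apply: eq_cint => eta; rewrite /K /=.
have Gs : cinte (fun xi : E => cexpi (1 * dot xi x) * G ((xi : V) - (eta : V))).
  apply: cinte_FT.
  have := cinte_shift (- (eta : V)) Gi.
  rewrite (_ : (fun _ => _) = (fun xi : E => G ((xi : V) - (eta : V))))//.
  by apply/funext => xi; rewrite addrC.
transitivity (cint (fun xi => (cexpi (1 * dot xi x) * G ((xi : V) - (eta : V))) * H eta)).
  by apply: eq_cint => xi; rewrite mulrA.
rewrite (cintZr _ Gs) -(cint_shift (eta : V) Gs).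
transitivity (cint (fun y => cexpi (1 * dot eta x) * (cexpi (1 * dot y x) * G y)) * H eta).
  apply: (congr1 (fun z => z * H eta)); apply: eq_cint => y.
  by rewrite dotDl mulrDr cexpiD -mulrA [_ + y]addrC addrK.
rewrite cintZ; last exact: cinte_FT.
by rewrite mulrAC.
Qed.

(** The factor that this normalization of the transform puts in front of a convolution; being at
    most 1, it disappears from the estimates. *)
Definition k2pi : R := (2 * pi) ^- 3.

Lemma k2pi_ge0 : 0 <= k2pi.
Proof. by rewrite invr_ge0 exprn_ge0// mulr_ge0// pi_ge0. Qed.

Lemma k2pi_le1 : k2pi <= 1.
Proof.
have p1 : 1 <= 2 * (pi : R).
  by have := pi_ge2 R; lra.
by rewrite invf_le1 ?exprn_ege1// exprn_gt0// (lt_le_trans ltr01).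
Qed.

Lemma inv_fourier_convol G H (x : V) : cinte G -> cinte H ->
  inv_fourier G x * inv_fourier H x = inv_fourier (fun xi => k2pi%:C * convol G H xi) x.
Proof.
move=> Gi Hi; rewrite !inv_fourierE FTZ; last exact: cinte_convol.
by rewrite FT_convol// mulrACA -mulrA.
Qed.

End convolution.

(** * Distributions with an integrable Fourier transform *)

Section distributions.
Local Open Scope classical_set_scope.
Local Open Scope ring_scope.
Local Open Scope complex_scope.
Context (R : realType).
Local Notation V := (R * R * R)%type.
Local Notation E := (E3 R).
Local Notation mu := (@leb3 R).
Local Notation cint := (cintegral mu setT).
Local Notation cinte := (cintegrable mu setT).
Implicit Types (f g : distr R) (G H h : E -> R[i]) (phi psi : V -> R[i]) (j k : 'I_3).

Lemma deq_trans f g (l : distr R) : deq f g -> deq g l -> deq f l.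
Proof. by move=> fg gl phi sp; rewrite fg// gl. Qed.

Lemma deq_sym f g : deq f g -> deq g f.
Proof. by move=> fg phi sp; rewrite fg. Qed.

Lemma measurable_ball3 (r : R) : measurable ([set x | enorm x <= r] : set E).
Proof.
have m := measurable_enorm (@measurable_id _ E setT).
have := m measurableT _ (@measurable_itv R `]-oo, r]).
by rewrite setTI; congr measurable; apply/seteqP; split => x /=; rewrite in_itv.
Qed.

Lemma integrable_represents G f : cinte G -> deq f (of_fun G) -> represents G f.
Proof.
move=> Gi fG; split => //.
- split; first exact: (cinte_meas Gi).
  move=> r; have [g1 g2] := Gi; have mB := measurable_ball3 r.
  by split; [exact: integrableS g1|exact: integrableS g2].
- move=> phi sp; have [B hB] := schwartz_bounded sp.
  under eq_fun do rewrite mulrC.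
  by apply: (@cinte_bndM _ _ _ _ B) => //; exact: cinte_meas (cinte_schwartz sp).
Qed.

Lemma bounded_represents h f (B : R) : cmeasurable setT h ->
  (forall x, cabs (h x) <= B) -> deq f (of_fun h) -> represents h f.
Proof.
move=> mh hB fh; have B0 : 0 <= B by exact: le_trans (cabs_ge0 _) (hB 0).
split => //; last first.
  by move=> phi sp; apply: (cinte_bndM mh hB); exact: cinte_schwartz.
split => // r; have mD := measurable_ball3 r.
have gi := cinte_schwartz (@schwartz_gauss1 R 1 ltr01).
(* On the ball of radius r, the constant 1 is at most exp(r^2) exp(-|x|^2), which is integrable. *)
have ki : mu.-integrable [set x | enorm x <= r]
    (fun x => (B * expR (r ^+ 2) * cabs (gauss 1 x))%:E).
  apply: (integrableS measurableT mD) => //.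
  exact: (integrableZl measurableT _ (cinte_abs gi)).
have key x : enorm x <= r -> cabs (h x) <= B * expR (r ^+ 2) * cabs (gauss 1 x).
  move=> xr; have x0 := enorm_ge0 x; have r0 : 0 <= r := le_trans x0 xr.
  rewrite (le_trans (hB x))// -mulrA ler_peMr// cabs_real ger0_norm ?expR_ge0//.
  rewrite -expRD -[leLHS]expR0 ler_expR mulN1r subr_ge0.
  by rewrite lerXn2r ?nnegrE.
have [mh1 mh2] := mh.
split; apply: (le_integrable mD _ _ ki).
- by apply/measurable_EFinP; apply: (measurable_funS measurableT _ mh1).
- move=> x /= xr; rewrite lee_fin (le_trans (abs_Re_le _))// (le_trans (key x xr))//.
  exact: ler_norm.
- by apply/measurable_EFinP; apply: (measurable_funS measurableT _ mh2).
- move=> x /= xr; rewrite lee_fin (le_trans (abs_Im_le _))// (le_trans (key x xr))//.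
  exact: ler_norm.
Qed.

(** Multiplication by a Gaussian makes both functions integrable, and testing against the Gaussian
    times exponentials shows that the products have the same Fourier transform. *)
Lemma rep_unique (h1 h2 : E -> R[i]) f : represents h1 f -> represents h2 f ->
  {ae mu, forall x, h1 x = h2 x}.
Proof.
move=> [[m1 _] i1 d1] [[m2 _] i2 d2].
have sg := @schwartz_gauss1 R 1 ltr01.
have k1 := i1 _ sg; have k2 := i2 _ sg.
have FH xi : FT (-1) (fun x => h1 x * gauss 1 x - h2 x * gauss 1 x) xi = 0.
  have se := schwartz_cexpi (-1) xi sg.
  have e1 (h : E -> R[i]) : cint (fun x => cexpi (-1 * dot x xi) * (h x * gauss 1 x)) =
      of_fun h (fun x => cexpi (-1 * dot x xi) * gauss 1 x).
    by apply: eq_cint => x; rewrite mulrCA.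
  transitivity (cint (fun x => cexpi (-1 * dot x xi) * (h1 x * gauss 1 x) -
      cexpi (-1 * dot x xi) * (h2 x * gauss 1 x))).
    by apply: eq_cint => x; rewrite mulrBr.
  rewrite cintB; [|exact: cinte_FT|exact: cinte_FT].
  by rewrite !e1 -d1// -d2// subrr.
apply: filterS (FT_injective (cinteB k1 k2) FH) => x.
rewrite -mulrBl => /eqP; rewrite mulf_eq0 subr_eq0 => /orP[/eqP//|/eqP].
by move=> /(congr1 (@complex.Re R)) /= /eqP; rewrite gt_eqF// expR_gt0.
Qed.

Lemma fun_ofP h f : represents h f -> represents (fun_of f) f.
Proof. by move=> hf; apply: (@xgetPex _ (fun=> 0) [set h | represents h f]); exists h. Qed.

Lemma fun_of_ae h f : represents h f -> {ae mu, forall x, fun_of f x = h x}.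
Proof. by move=> hf; exact: rep_unique (fun_ofP hf) hf. Qed.

(** The interface between the two worlds: a distribution with integrable transform [G] is handled
    through [deq f (fromhat G)]. *)
Definition fromhat G : distr R := dinv_fourier (of_fun G).

Lemma inv_fourierD phi psi (a : R[i]) : cinte phi -> cinte psi ->
  inv_fourier (fun x => a * phi x + psi x) = fun x => a * inv_fourier phi x + inv_fourier psi x.
Proof.
move=> hp hs; rewrite !inv_fourierE; apply/funext => x.
rewrite mulrCA -mulrDr; congr (_ * _).
rewrite -FTZ// /FT -cintD; [|exact/cinte_FT/cinteZ|exact: cinte_FT].
by apply: eq_cint => y; rewrite mulrDr.
Qed.

Lemma cabs_inv_fourier_le phi (x : V) : cinte phi ->
  cabs (inv_fourier phi x) <= fine (L1 mu phi).
Proof.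
move=> hp; rewrite inv_fourierE cabsM cabs_real ger0_norm ?k2pi_ge0//.
rewrite (le_trans _ (cabs_FT_le 1 x hp))// ler_piMl ?cabs_ge0//.
exact: k2pi_le1.
Qed.

Lemma cmeas_inv_fourier G : cmeasurable setT G -> cmeasurable (setT : set E) (inv_fourier G).
Proof.
by move=> mG; rewrite inv_fourierE; apply: cmeasM; [exact: cmeas_cst|exact: cmeas_FT].
Qed.

Lemma cinte_mul_inv_fourier G phi : cinte G -> schwartz phi ->
  cinte (fun x => G x * inv_fourier phi x).
Proof.
move=> Gi sp; have hp := cinte_schwartz sp.
under eq_fun do rewrite mulrC.
apply: (@cinte_bndM _ _ _ _ (fine (L1 mu phi))) => //.
- exact: cmeas_inv_fourier (cinte_meas hp).
- by move=> x; exact: cabs_inv_fourier_le.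
Qed.

Lemma fromhat_ae_eq G H phi : cinte G -> cinte H -> schwartz phi ->
  {ae mu, forall x, G x = H x} -> fromhat G phi = fromhat H phi.
Proof.
move=> Gi Hi sp GH; apply: cint_ae_eq.
- exact: cinte_meas (cinte_mul_inv_fourier Gi sp).
- exact: cinte_meas (cinte_mul_inv_fourier Hi sp).
- by apply: filterS GH => x ->.
Qed.

Lemma fromhat_sub G H phi : cinte G -> cinte H -> schwartz phi ->
  fromhat (fun x => G x - H x) phi = fromhat G phi - fromhat H phi.
Proof.
move=> Gi Hi sp; have g1 := cinte_mul_inv_fourier Gi sp; have h1 := cinte_mul_inv_fourier Hi sp.
rewrite /fromhat /dinv_fourier /of_fun -cintB//.
by apply: eq_cint => x; rewrite mulrBl.
Qed.

Lemma dfourier_fromhat G f : deq f (fromhat G) -> deq (dfourier f) (of_fun G).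
Proof.
move=> fG phi sp; rewrite /dfourier fG; last exact: schwartz_fourier.
by rewrite /fromhat /dinv_fourier inv_fourier_fourier.
Qed.

Lemma dfourier_represents G f : cinte G -> deq f (fromhat G) -> represents G (dfourier f).
Proof. by move=> Gi fG; apply: integrable_represents => //; exact: dfourier_fromhat. Qed.

Lemma dfourier_deq_fromhat G f : deq (dfourier f) (of_fun G) -> deq f (fromhat G).
Proof.
move=> fG phi sp; have := fG _ (schwartz_inv_fourier sp).
by rewrite /dfourier fourier_inv_fourier.
Qed.

Lemma tempered_deq f g : deq f g -> tempered g -> tempered f.
Proof.
move=> fg [lin [N [C hC]]]; split.
  move=> a phi psi sp ss; rewrite !fg//; first exact: lin.
  by apply: schwartzD => //; exact: schwartzZ.
by exists N, C => phi sp B hB; rewrite fg//; exact: hC.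
Qed.

Lemma tempered_fromhat G : cinte G -> tempered (fromhat G).
Proof.
move=> Gi; split.
  move=> a phi psi sp ss.
  have g1 := cinte_mul_inv_fourier Gi sp; have h1 := cinte_mul_inv_fourier Gi ss.
  rewrite /fromhat /dinv_fourier /of_fun inv_fourierD; [|exact: cinte_schwartz|exact: cinte_schwartz].
  rewrite -cintZ// -cintD//; last exact: cinteZ.
  by apply: eq_cint => x; rewrite mulrDr mulrCA.
(* The order 6 is the exponent in [cauchy3_ge]: it bounds the L^1 norm of [phi], hence its inverse
   transform uniformly. *)
exists 6, (fine (L1 mu (fun x => (cauchy3 x)%:C)) * fine (L1 mu G)) => phi sp B hB.
have hp := cinte_schwartz sp.
have B1 (x : E) : cabs (phi x) <= B * cabs (cauchy3 x)%:C.
  have := hB [::] x isT; rewrite /= mulrC.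
  have n0 : 0 < (1 + enorm x) ^+ 6 by rewrite exprn_gt0// ltr_pwDl ?enorm_ge0.
  rewrite -ler_pdivlMr// => /le_trans; apply.
  have BB : 0 <= B.
    by apply: le_trans (hB [::] 0 isT); rewrite mulr_ge0 ?cabs_ge0// exprn_ge0// addr_ge0 ?enorm_ge0.
  rewrite ler_wpM2l// cabs_real ger0_norm; first exact: cauchy3_ge.
  exact/ltW/cauchy3_gt0.
have BB : 0 <= B.
  apply: le_trans (hB [::] 0 isT); rewrite mulr_ge0 ?cabs_ge0// exprn_ge0// addr_ge0 ?enorm_ge0//.
have Lp : fine (L1 mu phi) <= B * fine (L1 mu (fun x => (cauchy3 x)%:C)).
  have ci := cinte_cauchy3 R.
  have Lf (f : E -> R[i]) : cinte f -> (fine (L1 mu f))%:E = L1 mu f.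
    by move=> fi; rewrite fineK// ge0_fin_numE ?L1_ge0//; exact: cinte_L1.
  rewrite -lee_fin EFinM !Lf// -[B]ger0_norm// -cabs_real -L1Z; last exact: cinte_meas ci.
  apply: le_L1; first exact: cinte_meas hp.
    by apply: cmeasM; [exact: cmeas_cst|exact: cinte_meas ci].
  by move=> x; rewrite cabsM cabs_real ger0_norm.
rewrite /fromhat /dinv_fourier /of_fun.
apply: (@le_trans _ _ (fine (L1 mu phi) * fine (L1 mu G))).
  apply: cabs_cint_bound => //; first by apply: fine_ge0; exact: L1_ge0.
    exact: cinte_meas (cinte_mul_inv_fourier Gi sp).
  by move=> x; rewrite cabsM mulrC ler_wpM2r ?cabs_ge0// cabs_inv_fourier_le.
have G0 : 0 <= fine (L1 mu G) by apply: fine_ge0; exact: L1_ge0.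
by rewrite (le_trans (ler_wpM2r G0 Lp))// le_eqVlt; apply/orP; left; apply/eqP; ring.
Qed.

(** The multiplication formula, by Fubini's theorem. It makes these distributions bounded functions,
    so that their pointwise products make sense. *)
Lemma fromhat_of_fun G : cinte G -> deq (fromhat G) (of_fun (inv_fourier G)).
Proof.
move=> Gi phi sp; have hp := cinte_schwartz sp.
rewrite /fromhat /dinv_fourier /of_fun.
pose K (p : E * E) := ((2 * pi) ^- 3)%:C * (G p.1 * (cexpi (1 * dot p.2 p.1) * phi p.2)).
have mK : cmeasurable setT K.
  apply: cmeasM; first exact: cmeas_cst.
  apply: cmeasM; first exact: (cmeas_comp (cinte_meas Gi) measurable_fst).
  apply: cmeasM; last exact: (cmeas_comp (cinte_meas hp) measurable_snd).
  apply: cmeas_cexpi; apply: measurable_funM => //.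
  by apply: measurable_dot; [exact: measurable_snd|exact: measurable_fst].
have Ki : cintegrable (mu \x mu)%E setT K.
  apply: (cinte_le mK (cinteZ ((2 * pi) ^- 3)%:C (cinte_tensor Gi hp))) => p.
  by rewrite /K !cabsM cabs_cexpi mul1r.
have e : (\int[mu]_xi L1 mu (fun x => K (xi, x)) < +oo)%E.
  by rewrite (L1_tonelli1 mu mu mK) cinte_L1.
transitivity (cint (fun xi => cint (fun x => K (xi, x)))).
  apply: eq_cint => xi; rewrite inv_fourierE /K /=.
  rewrite cintZ; last by apply: cinteZ; exact: cinte_FT.
  rewrite cintZ; last exact: cinte_FT.
  by rewrite mulrCA.
rewrite (cfubini mK e); apply: eq_cint => x; rewrite /K /= inv_fourierE.
have Gx := cinte_FT 1 x Gi.
transitivity (cint (fun xi => (((2 * pi) ^- 3)%:C * (cexpi (1 * dot xi x) * G xi)) * phi x)).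
  by apply: eq_cint => xi; rewrite [dot x xi]dotC; ring.
rewrite cintZr; last exact: cinteZ.
by rewrite cintZ.
Qed.

Lemma fun_of_fromhat G f : cinte G -> deq f (fromhat G) ->
  {ae mu, forall x : E, fun_of f x = inv_fourier G x}.
Proof.
move=> Gi fG; apply: fun_of_ae.
apply: (@bounded_represents _ _ (fine (L1 mu G))).
- exact: cmeas_inv_fourier (cinte_meas Gi).
- by move=> x; exact: cabs_inv_fourier_le.
- exact: deq_trans fG (fromhat_of_fun Gi).
Qed.

Lemma dpartial_fromhat G f j : cinte G -> deq f (fromhat G) ->
  deq (dpartial j f) (fromhat (fun xi => (0 +i* coord3 j xi) * G xi)).
Proof.
move=> Gi fG phi sp; have sd := schwartz_cpartial j sp.
rewrite /dpartial fG// /fromhat /dinv_fourier /of_fun.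
rewrite -cintN; last exact: cinte_mul_inv_fourier.
apply: eq_cint => x; rewrite !inv_fourierE FT_cpartial// mul1r.
by rewrite mulNr mulrN mulrN opprK; ring.
Qed.

End distributions.

(** * The nonlinear terms on the Fourier side *)

Section nonlinearity.
Local Open Scope classical_set_scope.
Local Open Scope ring_scope.
Local Open Scope complex_scope.
Context (R : realType).
Local Notation V := (R * R * R)%type.
Local Notation E := (E3 R).
Local Notation mu := (@leb3 R).
Local Notation cint := (cintegral mu setT).
Local Notation cinte := (cintegrable mu setT).
Local Notation vfun := ('I_3 -> E -> R[i]).
Implicit Types (G H : E -> R[i]) (g h C : vfun) (phi : V -> R[i]) (i j k : 'I_3)
  (u v : vdistr R).

Lemma ae_forall_ord n (P : 'I_n -> E -> Prop) : (forall l, {ae mu, forall x : E, P l x}) ->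
  {ae mu, forall x : E, forall l, P l x}.
Proof. by move=> h; apply: filter_forall. Qed.

Definition advhat g k (xi : E) : R[i] :=
  \sum_(j < 3) (k2pi R)%:C * convol (g j) (fun eta => (0 +i* coord3 j eta) * g k eta) xi.

(* [inv_fourier (cpow G n)] is the power of exponent [n.+1] of [inv_fourier G]. *)
Fixpoint cpow G n : E -> R[i] :=
  if n is n'.+1 then fun xi => (k2pi R)%:C * convol G (cpow G n') xi else G.

(** The index [q] runs over the four nonlinear terms: [None] is the advection, [Some k] the damping
    along the k-th basis vector. *)
Definition src (m : nat) (q : option 'I_3) g i : E -> R[i] :=
  match q with
  | Some k => if i == k then cpow (g k) (2 * m)%N else fun=> 0
  | None => advhat g i
  end.

Definition lerayhat C k (xi : E) : R[i] :=
  C k xi - (\sum_(j < 3) (coord3 j xi)%:C * C j xi) / (enorm xi ^+ 2)%:C * (coord3 k xi)%:C.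

Definition hatrep u g := forall k, cinte (g k) /\ deq (u k) (fromhat (g k)).

(** Finiteness of the X^2 norm. Together with integrability of [g] it makes the transform of the
    gradient integrable. *)
Definition int2 g := forall k, cinte (fun x => (enorm x ^+ 2)%:C * g k x).

Lemma cmeas_ixi j : cmeasurable setT (fun x : E => (0 +i* coord3 j x)).
Proof. by split => /=; [exact: measurable_cst|exact: measurable_coord3]. Qed.

Lemma cabs_ixi (a : R) : cabs (0 +i* a) = `|a|.
Proof. by rewrite /cabs /= expr0n add0r sqrtr_sqr. Qed.

Lemma cmeas_enormX r : cmeasurable setT (fun x : E => (enorm x ^+ r)%:C).
Proof. by apply: cmeas_real; apply: measurable_funX; exact: measurable_enorm. Qed.

Lemma cinte_ixi G j : cinte G -> cinte (fun x => (enorm x ^+ 2)%:C * G x) ->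
  cinte (fun x => (0 +i* coord3 j x) * G x).
Proof.
move=> Gi G2; apply: (cinte_le _ (cinteD Gi G2)).
  by apply: cmeasM; [exact: cmeas_ixi|exact: cinte_meas Gi].
move=> x; rewrite -[X in X + _]mul1r -mulrDl !cabsM ler_wpM2r ?cabs_ge0//.
rewrite cabs_ixi -(rcD 1) cabs_real [leRHS]ger0_norm ?addr_ge0 ?sqr_ge0//.
rewrite (le_trans (abs_coord3_le j x))//.
by have := sqr_ge0 (enorm x - 1); rewrite sqrrB; have := enorm_ge0 x; nra.
Qed.

Lemma cinte_advhat g k : (forall j, cinte (g j)) -> int2 g -> cinte (advhat g k).
Proof.
move=> gi g2; apply: cinte_sum => j; apply: cinteZ; apply: cinte_convol => //.
exact: cinte_ixi.
Qed.

Lemma cinte_cpow G n : cinte G -> cinte (cpow G n).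
Proof. by move=> Gi; elim: n => [//|n ih]; apply: cinteZ; exact: cinte_convol. Qed.

Lemma cinte_src m q g i : (forall j, cinte (g j)) -> int2 g -> cinte (src m q g i).
Proof.
move=> gi g2; case: q => [k|] /=; last exact: cinte_advhat.
by case: ifP => _; [exact: cinte_cpow|exact: cinte0].
Qed.

(** The multiplier is bounded because |xi_j xi_k| <= |xi|^2; at the origin the convention 1/0 = 0
    makes the quotient vanish. *)
Lemma cabs_lerayhat_le C k xi : cabs (lerayhat C k xi) <= cabs (C k xi) + \sum_(j < 3) cabs (C j xi).
Proof.
rewrite (le_trans (cabsB _ _))// lerD2l.
set S := \sum_(j < 3) cabs _; have S0 : 0 <= S by apply: sumr_ge0 => j _; exact: cabs_ge0.
rewrite !cabsM cabsV !cabs_real ger0_norm ?sqr_ge0//.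
have [->|n0] := eqVneq (enorm xi) 0; first by rewrite expr0n invr0 mulr0 mul0r.
have np : 0 < enorm xi by rewrite lt0r n0 enorm_ge0.
rewrite mulrAC ler_pdivrMr ?exprn_gt0// expr2 mulrA.
apply: ler_pM; rewrite ?cabs_ge0 ?normr_ge0 ?abs_coord3_le//.
rewrite (le_trans (cabs_sum _ _ _))// mulr_suml; apply: ler_sum => j _.
by rewrite cabsM cabs_real mulrC ler_wpM2l ?cabs_ge0// abs_coord3_le.
Qed.

Lemma measurable_inv_enorm2 : measurable_fun (setT : set E) (fun x : E => (enorm x ^+ 2)^-1).
Proof.
have m : measurable_fun (setT : set E) (fun x : E => enorm x ^+ 2).
  by apply: measurable_funX; exact: measurable_enorm.
have := measurableT_comp (measurable_powR (-1)) m.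
by apply: eq_measurable_fun => x _; rewrite /= powR_inv1 ?sqr_ge0.
Qed.

Lemma cmeas_lerayhat C k : (forall j, cmeasurable setT (C j)) -> cmeasurable setT (lerayhat C k).
Proof.
move=> mC; have mc j : cmeasurable setT (fun x : E => (coord3 j x)%:C).
  by apply: cmeas_real; exact: measurable_coord3.
apply: cmeasB => //; apply: cmeasM => //; apply: cmeasM.
  by apply: cmeas_sum => j; exact: cmeasM.
by under eq_fun do rewrite -rcV; apply: cmeas_real; exact: measurable_inv_enorm2.
Qed.

Lemma cinte_lerayhat C k : (forall j, cinte (C j)) -> cinte (lerayhat C k).
Proof.
move=> Ci; have := cinteD (cinte_cabs (Ci k)) (cinte_sum (index_enum 'I_3) xpredT (fun j => cinte_cabs (Ci j))).
move=> /(cinte_le (cmeas_lerayhat k (fun j => cinte_meas (Ci j)))); apply => xi.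
rewrite -rc_sum -rcD cabs_real ger0_norm; first exact: cabs_lerayhat_le.
by rewrite addr_ge0 ?cabs_ge0// sumr_ge0// => j _; exact: cabs_ge0.
Qed.

Lemma lerayhat_ae_eq C C' k : (forall j, {ae mu, forall x, C j x = C' j x}) ->
  {ae mu, forall x, lerayhat C k x = lerayhat C' k x}.
Proof.
move=> CC; have := ae_forall_ord CC; apply: filterS => x hx.
by rewrite /lerayhat !hx; congr (_ - _ / _ * _); apply: eq_bigr => j _; rewrite hx.
Qed.

Lemma of_fun_ae_eq G H phi : cmeasurable setT G -> cmeasurable setT H -> schwartz phi ->
  {ae mu, forall x, G x = H x} -> of_fun G phi = of_fun H phi.
Proof.
move=> mG mH sp GH; have mp := cinte_meas (cinte_schwartz sp).
by apply: cint_ae_eq; [exact: cmeasM|exact: cmeasM|apply: filterS GH => x ->].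
Qed.

Lemma represents_meas G (f : distr R) : represents G f -> cmeasurable setT G.
Proof. by move=> [[]]. Qed.

Lemma inv_fourier_sum (I : Type) (r : seq I) (F : I -> E -> R[i]) (x : V) : (forall l, cinte (F l)) ->
  inv_fourier (fun xi => \sum_(l <- r) F l xi) x = \sum_(l <- r) inv_fourier (F l) x.
Proof.
move=> Fi; rewrite inv_fourierE; under [RHS]eq_bigr do rewrite inv_fourierE.
rewrite -mulr_sumr; congr (_ * _); rewrite -cint_sum; last by move=> l; exact: cinte_FT.
by apply: eq_cint => xi; rewrite mulr_sumr.
Qed.

Lemma fun_of_fromhat_rep (f : distr R) G : cinte G -> deq f (fromhat G) ->
  represents (fun_of f) f.
Proof.
move=> Gi fG; apply: (@fun_ofP _ (inv_fourier G)).
apply: (@bounded_represents _ _ _ (fine (L1 mu G))).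
- exact: cmeas_inv_fourier (cinte_meas Gi).
- by move=> x; exact: cabs_inv_fourier_le.
- exact: deq_trans fG (fromhat_of_fun Gi).
Qed.

(** The representatives chosen by [fun_of] agree almost everywhere with inverse transforms, whose
    products are inverse transforms of convolutions. *)
Lemma advection_fromhat u g k : hatrep u g -> int2 g ->
  deq (advection u k) (fromhat (advhat g k)).
Proof.
move=> ug g2; have gi j : cinte (g j) by have [] := ug j.
have ixi j : cinte (fun x => (0 +i* coord3 j x) * g k x) by exact: cinte_ixi.
have Ci j : cinte (fun xi => (k2pi R)%:C * convol (g j) (fun eta => (0 +i* coord3 j eta) * g k eta) xi).
  by apply: cinteZ; exact: cinte_convol.
have d1 j : deq (u j) (fromhat (g j)) by have [] := ug j.
have d2 j := dpartial_fromhat j (gi k) (d1 k).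
have r1 j := fun_of_fromhat_rep (gi j) (d1 j).
have r2 j := fun_of_fromhat_rep (ixi j) (d2 j).
move=> phi sp; rewrite (fromhat_of_fun (cinte_advhat k gi g2) sp).
apply: of_fun_ae_eq => //.
- apply: cmeas_sum => j; apply: cmeasM; first exact: represents_meas (r1 j).
  exact: represents_meas (r2 j).
- exact: cmeas_inv_fourier (cinte_meas (cinte_advhat k gi g2)).
have a1 := ae_forall_ord (fun j => fun_of_fromhat (gi j) (d1 j)).
have a2 := ae_forall_ord (fun j => fun_of_fromhat (ixi j) (d2 j)).
move: a1 a2; apply: filterS2 => x h1 h2.
rewrite /advhat inv_fourier_sum//; apply: eq_bigr => j _.
by rewrite h1 h2 inv_fourier_convol.
Qed.

Lemma inv_fourier_cpow G n (x : V) : cinte G ->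
  inv_fourier (cpow G n) x = inv_fourier G x ^+ n.+1.
Proof.
move=> Gi; elim: n => [//|n ih].
by rewrite exprS -ih inv_fourier_convol//; exact: cinte_cpow.
Qed.

Lemma fromhat0 : deq (@fromhat R (fun=> 0)) (fun=> 0).
Proof.
move=> phi sp; rewrite /fromhat /dinv_fourier /of_fun -[RHS](cint0 mu).
by apply: eq_cint => x; rewrite mul0r.
Qed.

Lemma damping_fromhat m u g k i : hatrep u g ->
  deq (damping m k u i) (fromhat (src m (Some k) g i)).
Proof.
move=> ug; rewrite /damping /=; case: eqP => _; last exact: deq_sym fromhat0.
have [gi d1] := ug k; have r1 := fun_of_fromhat_rep gi d1.
have ci := cinte_cpow (2 * m) gi.
move=> phi sp; rewrite (fromhat_of_fun ci sp); apply: of_fun_ae_eq => //.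
- by apply: cmeasX; exact: represents_meas r1.
- exact: cmeas_inv_fourier (cinte_meas ci).
have h := fun_of_fromhat gi d1.
by apply: (filterS _ h) => x ->; rewrite inv_fourier_cpow// addn1.
Qed.

Lemma cmeas_gauss t : cmeasurable setT (fun x : E => gauss t x).
Proof. by apply: cmeas_ccontinuous; exact: ccontinuous_gauss. Qed.

Lemma cinte_gauss t G : 0 <= t -> cinte G -> cinte (fun x => gauss t x * G x).
Proof.
move=> t0 Gi; apply: (@cinte_bndM _ _ _ _ 1) => //; first exact: cmeas_gauss.
by move=> x; exact: cabs_gauss_le1.
Qed.

Lemma heat_fromhat t (f : distr R) G phi : 0 <= t -> deq f (fromhat G) ->
  schwartz phi -> heat t f phi = fromhat (fun x => gauss t x * G x) phi.
Proof.
move=> t0 fG sp; have si := schwartz_inv_fourier sp.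
have sg := schwartz_gauss t0 si.
transitivity (f (fourier (fun xi => gauss t xi * inv_fourier phi xi))); first by [].
rewrite fG; last exact: schwartz_fourier.
rewrite /fromhat /dinv_fourier inv_fourier_fourier// /of_fun.
by apply: eq_cint => x; rewrite mulrA [G x * _]mulrC.
Qed.

Lemma hatrep_ae u g k : hatrep u g -> {ae mu, forall xi : E, hat u k xi = g k xi}.
Proof. by move=> ug; have [gi d] := ug k; apply: fun_of_ae; exact: dfourier_represents. Qed.

Lemma cinte_hat u g k : hatrep u g -> cinte (hat u k).
Proof.
move=> ug; have [gi d] := ug k; have r := fun_ofP (dfourier_represents gi d).
apply: cinte_ae_eq gi _; first exact: represents_meas r.
by have h := hatrep_ae k ug; apply: (filterS _ h) => x ->.
Qed.

(** [leray] is built on the choices [hat w], equal to [C] almost everywhere only; [fromhat] does not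
    see the difference. *)
Lemma heat_leray t (w : vdistr R) C phi i : 0 <= t -> hatrep w C -> schwartz phi ->
  heat t (leray w i) phi = fromhat (fun x => gauss t x * lerayhat C i x) phi.
Proof.
move=> t0 wC sp; have hi k := cinte_hat k wC.
have Ci j : cinte (C j) by have [] := wC j.
rewrite (heat_fromhat (G := lerayhat (hat w) i))//.
apply: fromhat_ae_eq => //.
- by apply: cinte_gauss => //; exact: cinte_lerayhat.
- by apply: cinte_gauss => //; exact: cinte_lerayhat.
apply: filterS (lerayhat_ae_eq i (fun j => hatrep_ae j wC)) => x ->.
by [].
Qed.

Lemma heat_leray_advection t u g phi i m : 0 <= t -> hatrep u g -> int2 g -> schwartz phi ->
  heat t (leray (advection u) i) phi =
  fromhat (fun x => gauss t x * lerayhat (src m None g) i x) phi.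
Proof.
move=> t0 ug g2 sp; apply: heat_leray => // k; split; last exact: advection_fromhat.
by apply: cinte_advhat => // j; have [] := ug j.
Qed.

Lemma heat_leray_damping t u g phi i m k : 0 <= t -> hatrep u g -> int2 g -> schwartz phi ->
  heat t (leray (damping m k u) i) phi =
  fromhat (fun x => gauss t x * lerayhat (src m (Some k) g) i x) phi.
Proof.
move=> t0 ug g2 sp; apply: heat_leray => // j; split; last exact: damping_fromhat.
by apply: cinte_src => // l; have [] := ug l.
Qed.

End nonlinearity.

(** * The spaces X^rho in terms of Fourier transforms *)

Section spaces.
Local Open Scope classical_set_scope.
Local Open Scope ring_scope.
Local Open Scope complex_scope.
Context (R : realType).
Local Notation V := (R * R * R)%type.
Local Notation E := (E3 R).
Local Notation mu := (@leb3 R).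
Local Notation cint := (cintegral mu setT).
Local Notation cinte := (cintegrable mu setT).
Local Notation vfun := ('I_3 -> E -> R[i]).
Implicit Types (g h : vfun) (k : 'I_3) (u v : vdistr R) (r : nat).

(** The sum of the norms of the components, in place of the norm of the Euclidean length: it lies
    between [Xnorm] and three times [Xnorm], and each estimate can be made component by
    component. *)
Definition wnorm r g : \bar R := 
  (\sum_(k < 3) L1 mu (fun x => ((enorm x ^+ r)%:C * g k x)%R))%E.

Lemma wnorm_ge0 r g : (0 <= wnorm r g)%E.
Proof. by apply: sume_ge0 => k _; exact: L1_ge0. Qed.

Lemma cabs_le_cvabs (z : 'I_3 -> R[i]) k : cabs (z k) <= cvabs z.
Proof.
rewrite -[leLHS]ger0_norm ?cabs_ge0// -sqrtr_sqr ler_wsqrtr// (bigD1 k)//= lerDl.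
by apply: sumr_ge0 => j _; exact: sqr_ge0.
Qed.

Lemma cvabs_le_sum (z : 'I_3 -> R[i]) : cvabs z <= \sum_(k < 3) cabs (z k).
Proof.
have s0 : 0 <= \sum_(k < 3) cabs (z k) by apply: sumr_ge0 => k _; exact: cabs_ge0.
rewrite -[leRHS]ger0_norm// -sqrtr_sqr ler_wsqrtr//.
rewrite !big_ord_recl !big_ord0 !addr0.
have := cabs_ge0 (z ord0); have := cabs_ge0 (z (lift ord0 ord0)).
have := cabs_ge0 (z (lift ord0 (lift ord0 ord0))).
set a := cabs _; set b := cabs _; set c := cabs _ => a0 b0 c0.
have := mulr_ge0 a0 b0; have := mulr_ge0 a0 c0; have := mulr_ge0 b0 c0.
rewrite -/c; move: a b c a0 b0 c0 => a b c a0 b0 c0; nra.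
Qed.

Lemma cvabs_ge0 (z : 'I_3 -> R[i]) : 0 <= cvabs z.
Proof. exact: sqrtr_ge0. Qed.

Lemma measurable_cvabs d (T : measurableType d) (g : 'I_3 -> T -> R[i]) :
  (forall k, cmeasurable setT (g k)) -> measurable_fun setT (fun x => cvabs (g^~ x)).
Proof.
move=> mg; apply: (measurableT_comp (f := @Num.sqrt R)).
  by apply: continuous_measurable_fun => x; exact: sqrt_continuous.
by apply: measurable_sum => k; apply: measurable_funX; exact: measurable_cabs.
Qed.

Lemma Xnorm_hatrep r u g : hatrep u g ->
  Xnorm r%:R u = (\int[mu]_xi (enorm xi ^+ r * cvabs (g^~ xi))%:E)%E.
Proof.
move=> ug; have mg k : cmeasurable setT (g k) by have [/cinte_meas] := ug k.
have mh k := cinte_meas (cinte_hat k ug).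
have mn := measurable_enorm (@measurable_id _ E setT).
have e (z : E) : enorm z `^ r%:R = enorm z ^+ r by rewrite powR_mulrn// enorm_ge0.
rewrite /Xnorm; under eq_integral do rewrite e.
apply: ae_eq_integral => //.
- by apply/measurable_EFinP; apply: measurable_funM; [exact: measurable_funX|exact: measurable_cvabs].
- by apply/measurable_EFinP; apply: measurable_funM; [exact: measurable_funX|exact: measurable_cvabs].
have h := ae_forall_ord (fun k => hatrep_ae k ug).
suff : {ae mu, forall x : E, [set: E] x -> (enorm x ^+ r * cvabs ((hat u)^~ x))%:E =
    (enorm x ^+ r * cvabs (g^~ x))%:E} by [].
apply: filterS h => x hx _.
by congr ((_ * _)%:E); congr cvabs; apply/funext => k; rewrite hx.
Qed.

Lemma Xnorm_le_wnorm r u g : hatrep u g -> (Xnorm r%:R u <= wnorm r g)%E.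
Proof.
move=> ug; have mg k : cmeasurable setT (g k) by have [/cinte_meas] := ug k.
have mn := measurable_enorm (@measurable_id _ E setT).
have mw k : cmeasurable setT (fun x => (enorm x ^+ r)%:C * g k x).
  by apply: cmeasM; [exact: cmeas_enormX|exact: mg].
rewrite (Xnorm_hatrep r ug) /wnorm /L1 -ge0_integral_sum//; last 2 first.
- by move=> k; exact: measurable_ecabs (mw k).
- by move=> k x _; rewrite lee_fin cabs_ge0.
apply: ge0_le_integral => //.
- by move=> x _; rewrite lee_fin mulr_ge0 ?cvabs_ge0// exprn_ge0// enorm_ge0.
- by apply/measurable_EFinP; apply: measurable_funM; [exact: measurable_funX|exact: measurable_cvabs].
- by apply: emeasurable_sum => k; exact: measurable_ecabs (mw k).
move=> x _; rewrite sumEFin lee_fin.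
have n0 : 0 <= enorm x ^+ r by rewrite exprn_ge0// enorm_ge0.
under eq_bigr do rewrite cabsM cabs_real (ger0_norm n0).
by rewrite -mulr_sumr ler_wpM2l// cvabs_le_sum.
Qed.

Lemma L1_le_Xnorm r u g k : hatrep u g ->
  (L1 mu (fun x => ((enorm x ^+ r)%:C * g k x)%R) <= Xnorm r%:R u)%E.
Proof.
move=> ug; have mg j : cmeasurable setT (g j) by have [/cinte_meas] := ug j.
have mn := measurable_enorm (@measurable_id _ E setT).
rewrite (Xnorm_hatrep r ug); apply: ge0_le_integral => //.
- by move=> x _; rewrite lee_fin cabs_ge0.
- by apply: measurable_ecabs; apply: cmeasM; [exact: cmeas_enormX|exact: mg].
- by apply/measurable_EFinP; apply: measurable_funM; [exact: measurable_funX|exact: measurable_cvabs].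
move=> x _; rewrite lee_fin cabsM cabs_real.
have n0 : 0 <= enorm x ^+ r by rewrite exprn_ge0// enorm_ge0.
by rewrite (ger0_norm n0) ler_wpM2l// cabs_le_cvabs.
Qed.

Lemma wnorm_le_Xnorm r u g : hatrep u g -> (wnorm r g <= Xnorm r%:R u + (Xnorm r%:R u + Xnorm r%:R u))%E.
Proof.
move=> ug; have h k := @L1_le_Xnorm r u g k ug.
rewrite /wnorm !big_ord_recl big_ord0 adde0.
by apply: leeD => //; apply: leeD.
Qed.

Lemma hatrep_sub u v g h : hatrep u g -> hatrep v h ->
  hatrep (u - v) (fun k x => g k x - h k x).
Proof.
move=> ug vh k; have [gi d1] := ug k; have [hi d2] := vh k.
split; first exact: cinteB.
by move=> phi sp; rewrite fromhat_sub// -d1// -d2.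
Qed.

Lemma hatrep_Xspace r u g : hatrep u g -> (wnorm r g < +oo)%E -> Xspace r%:R u.
Proof.
move=> ug gr; split.
- by move=> k; have [gi d] := ug k; exact: tempered_deq d (tempered_fromhat gi).
- by move=> k; have [gi d] := ug k; exists (g k); exact: dfourier_represents.
- exact: le_lt_trans (Xnorm_le_wnorm r ug) gr.
Qed.

(** The weight of X^0 is 1, so a finite norm is integrability of the transform; this is how data and
    solutions enter the functional setting. *)
Lemma Xspace0_hatrep u : Xspace 0 u -> hatrep u (hat u).
Proof.
move=> [_ reg fin] k; have [h0 hr0] := reg k; have hr := fun_ofP hr0.
have mh j : cmeasurable setT (hat u j).
  by have [h1 /fun_ofP] := reg j; exact: represents_meas.
split; last by apply: dfourier_deq_fromhat; case: hr.
apply/cintegrableP; split; first exact: mh.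
apply: (@le_lt_trans _ _ (Xnorm 0 u)) => //.
apply: ge0_le_integral => //.
- by move=> x _; rewrite lee_fin cabs_ge0.
- exact: measurable_ecabs (mh k).
- under eq_fun do rewrite powRr0 mul1r.
  by apply/measurable_EFinP; exact: measurable_cvabs.
by move=> x _; rewrite powRr0 mul1r lee_fin; exact: (cabs_le_cvabs (fun k => hat u k x)).
Qed.

Lemma wnorm_fin r g : (wnorm r g < +oo)%E ->
  forall k, (L1 mu (fun x => ((enorm x ^+ r)%:C * g k x)%R) < +oo)%E.
Proof.
move=> gr k; apply: le_lt_trans gr; rewrite /wnorm (bigD1 k)//= leeDl//.
by apply: sume_ge0 => j _; exact: L1_ge0.
Qed.

Lemma wnorm_cinte g : (forall k, cmeasurable setT (g k)) -> (wnorm 0 g < +oo)%E ->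
  forall k, cinte (g k).
Proof.
move=> mg /wnorm_fin h k; apply/cintegrableP; split; first exact: mg.
by have := h k; congr (_ < _)%E; apply: eq_integral => x _; rewrite expr0 mul1r.
Qed.

Lemma wnorm2_int2 g : (forall k, cmeasurable setT (g k)) -> (wnorm 2 g < +oo)%E -> int2 g.
Proof.
move=> mg /wnorm_fin h k; apply/cintegrableP; split; last exact: h.
by apply: cmeasM; [exact: cmeas_enormX|exact: mg].
Qed.

End spaces.

(** * Estimates of the nonlinear terms *)

Section fixed_time.
Local Open Scope classical_set_scope.
Local Open Scope ring_scope.
Local Open Scope complex_scope.
Context (R : realType).
Local Notation V := (R * R * R)%type.
Local Notation E := (E3 R).
Local Notation mu := (@leb3 R).
Local Notation cint := (cintegral mu setT).
Local Notation cinte := (cintegrable mu setT).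
Local Notation vfun := ('I_3 -> E -> R[i]).
Implicit Types (G H : E -> R[i]) (g h C : vfun) (i j k : 'I_3) (r m n : nat).

(** A real version of the norm, faithful for integrable functions, on which ring and order
    arithmetic can be used. *)
Definition rn G : R := fine (L1 mu G).

Lemma rnE G : cinte G -> L1 mu G = (rn G)%:E.
Proof. by move=> Gi; rewrite fineK// ge0_fin_numE ?L1_ge0//; exact: cinte_L1. Qed.

Lemma rn_ge0 G : 0 <= rn G.
Proof. by apply: fine_ge0; exact: L1_ge0. Qed.

Lemma le_rn G H : cmeasurable setT G -> cinte H -> (forall x, cabs (G x) <= cabs (H x)) -> rn G <= rn H.
Proof.
move=> mG Hi GH; have Gi := cinte_le mG Hi GH.
by rewrite -lee_fin -!rnE//; apply: le_L1 => //; exact: cinte_meas Hi.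
Qed.

Lemma rn_ae_eq G H : cmeasurable setT G -> cmeasurable setT H ->
  {ae mu, forall x, G x = H x} -> rn G = rn H.
Proof. by move=> mG mH GH; congr fine; exact: ae_eq_L1. Qed.

Lemma rnD G H : cinte G -> cinte H -> rn (fun x => G x + H x) <= rn G + rn H.
Proof.
move=> Gi Hi; rewrite -lee_fin EFinD -!rnE//; last exact: cinteD.
by apply: L1D; [exact: cinte_meas Gi|exact: cinte_meas Hi].
Qed.

Lemma rnZ (c : R[i]) G : cinte G -> rn (fun x => c * G x) = cabs c * rn G.
Proof.
move=> Gi; apply: EFin_inj; rewrite EFinM -!rnE//; last exact: cinteZ.
by rewrite L1Z//; exact: cinte_meas Gi.
Qed.

Lemma rn0 : rn (fun=> 0) = 0.
Proof. by rewrite /rn L1_cst0. Qed.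

Lemma rn_sum (I : Type) (s : seq I) (F : I -> E -> R[i]) : (forall l, cinte (F l)) ->
  rn (fun x => \sum_(l <- s) F l x) <= \sum_(l <- s) rn (F l).
Proof.
move=> Fi; elim: s => [|l s ih].
  by rewrite big_nil (_ : (fun _ => _) = fun=> 0) ?rn0//; apply/funext => x; rewrite big_nil.
rewrite big_cons (_ : (fun _ => _) = fun x => F l x + \sum_(l <- s) F l x); last first.
  by apply/funext => x; rewrite big_cons.
rewrite (le_trans (rnD (Fi l) (cinte_sum s xpredT Fi)))//.
by rewrite lerD2l.
Qed.

Lemma rn_convol G H : cinte G -> cinte H -> rn (convol G H) <= rn G * rn H.
Proof.
move=> Gi Hi; rewrite -lee_fin EFinM -!rnE//; last exact: cinte_convol.
by apply: L1_convol; [exact: cinte_meas Gi|exact: cinte_meas Hi].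
Qed.

Lemma rn_convol_sub G H G' H' : cinte G -> cinte H -> cinte G' -> cinte H' ->
  rn (fun x => (k2pi R)%:C * convol G H x - (k2pi R)%:C * convol G' H' x) <=
  rn (fun x => G x - G' x) * rn H + rn G' * rn (fun x => H x - H' x).
Proof.
move=> Gi Hi Gi' Hi'.
have c1 := cinte_convol Gi Hi; have c2 := cinte_convol Gi' Hi'.
have d1 := cinteB Gi Gi'; have d2 := cinteB Hi Hi'.
have e1 := cinte_convol d1 Hi; have e2 := cinte_convol Gi' d2.
rewrite (_ : (fun _ => _) = fun x => (k2pi R)%:C * (convol G H x - convol G' H' x)); last first.
  by apply/funext => x; rewrite mulrBr.
rewrite rnZ; last exact: cinteB.
rewrite cabs_real ger0_norm ?k2pi_ge0//.
rewrite (@le_trans _ _ (rn (fun x => convol G H x - convol G' H' x)))//.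
  by rewrite ler_piMl ?rn_ge0// k2pi_le1.
rewrite (rn_ae_eq (H := fun x => convol (fun x => G x - G' x) H x + convol G' (fun x => H x - H' x) x)).
- by rewrite (le_trans (rnD e1 e2))// lerD// rn_convol.
- by apply: cmeasB; [exact: cinte_meas c1|exact: cinte_meas c2].
- by apply: cmeasD; [exact: cinte_meas e1|exact: cinte_meas e2].
- exact: convol_sub.
Qed.

Lemma rn_cpow G n (K : R) : cinte G -> rn G <= K -> rn (cpow G n) <= K ^+ n.+1.
Proof.
move=> Gi GK; have K0 : 0 <= K := le_trans (rn_ge0 G) GK.
elim: n => [|n ih]; first by rewrite expr1.
have ci := cinte_cpow n Gi.
rewrite [cpow _ _]/= rnZ; last exact: cinte_convol.
rewrite cabs_real ger0_norm ?k2pi_ge0//.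
rewrite (@le_trans _ _ (rn (convol G (cpow G n))))//.
  by rewrite ler_piMl ?rn_ge0// k2pi_le1.
by rewrite (le_trans (rn_convol Gi ci))// exprS ler_pM ?rn_ge0.
Qed.

(** The analogue for convolution of |a^(n+1) - b^(n+1)| <= (n+1) K^n |a - b|, by the same
    telescoping. *)
Lemma rn_cpow_sub G H n (K : R) : cinte G -> cinte H -> rn G <= K -> rn H <= K ->
  rn (fun x => cpow G n x - cpow H n x) <= n.+1%:R * K ^+ n * rn (fun x => G x - H x).
Proof.
move=> Gi Hi GK HK; have K0 : 0 <= K := le_trans (rn_ge0 G) GK.
elim: n => [|n ih]; first by rewrite expr0 !mul1r.
have c1 := cinte_cpow n Gi; have c2 := cinte_cpow n Hi.
rewrite (le_trans (rn_convol_sub Gi c1 Hi c2))//.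
set d := rn (fun x => G x - H x) in ih *; have d0 : 0 <= d := rn_ge0 _.
rewrite (@le_trans _ _ (d * K ^+ n.+1 + K * (n.+1%:R * K ^+ n * d)))//.
  by rewrite lerD// ?ler_wpM2l ?rn_cpow// ler_pM ?rn_ge0.
by rewrite le_eqVlt; apply/orP; left; apply/eqP; rewrite -[n.+2%:R]natr1 exprS; ring.
Qed.

Definition rw r g : R := \sum_(k < 3) rn (fun x => (enorm x ^+ r)%:C * g k x).

Definition vsub g h : vfun := fun k x => g k x - h k x.

Lemma rw_ge0 r g : 0 <= rw r g.
Proof. by apply: sumr_ge0 => k _; exact: rn_ge0. Qed.

Lemma rw0E g : rw 0 g = \sum_(k < 3) rn (g k).
Proof. by apply: eq_bigr => k _; congr rn; apply/funext => x; rewrite expr0 mul1r. Qed.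

Lemma rn_le_rw g k : rn (g k) <= rw 0 g.
Proof. by rewrite rw0E (bigD1 k)//= lerDl sumr_ge0// => j _; exact: rn_ge0. Qed.

Lemma wnormE r g : (forall k, cinte (fun x => (enorm x ^+ r)%:C * g k x)) ->
  wnorm r g = (rw r g)%:E.
Proof. by move=> gi; rewrite /wnorm /rw -sumEFin; apply: eq_bigr => k _; exact: rnE. Qed.

Lemma wnorm0E g : (forall k, cinte (g k)) -> wnorm 0 g = (rw 0 g)%:E.
Proof.
move=> gi; apply: wnormE => k.
by rewrite (_ : (fun _ => _) = g k)//; apply/funext => x; rewrite expr0 mul1r.
Qed.

Lemma cinte_enorm1 G : cinte G -> cinte (fun x => (enorm x ^+ 2)%:C * G x) ->
  cinte (fun x => (enorm x ^+ 1)%:C * G x).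
Proof.
move=> Gi G2; apply: (cinte_le _ (cinteD Gi G2)).
  by apply: cmeasM; [exact: cmeas_enormX|exact: cinte_meas Gi].
move=> x; rewrite -[X in X + _]mul1r -mulrDl !cabsM ler_wpM2r ?cabs_ge0//.
rewrite -(rcD 1) !cabs_real [leRHS]ger0_norm ?addr_ge0 ?sqr_ge0//.
have := enorm_ge0 x; rewrite expr1 => x0; rewrite ger0_norm//.
by have := sqr_ge0 (enorm x - 1); rewrite sqrrB; nra.
Qed.

Lemma int2_vsub g h : int2 g -> int2 h -> int2 (vsub g h).
Proof.
move=> g2 h2 k; have := cinteB (g2 k) (h2 k).
by congr cintegrable; apply/funext => x; rewrite mulrBr.
Qed.

(** The free parameter [l] is later tied to time: l^2 bounds the length of the interval of
    integration. *)
Lemma rw1_interp g (l : R) : 0 < l -> (forall k, cinte (g k)) -> int2 g ->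
  rw 1 g <= l * rw 2 g + l^-1 * rw 0 g.
Proof.
move=> l0 gi g2; rewrite rw0E /rw !mulr_sumr -big_split /=; apply: ler_sum => k _.
have c1 := cinteZ l%:C (g2 k); have c2 := cinteZ (l^-1)%:C (gi k).
have a1 : l * rn (fun x => (enorm x ^+ 2)%:C * g k x) = rn (fun x => l%:C * ((enorm x ^+ 2)%:C * g k x)).
  by rewrite (rnZ _ (g2 k)) cabs_real gtr0_norm.
have a2 : l^-1 * rn (g k) = rn (fun x => (l^-1)%:C * g k x).
  by rewrite (rnZ _ (gi k)) cabs_real gtr0_norm ?invr_gt0.
rewrite a1 a2.
apply: (@le_trans _ _ (rn (fun x => (cabs (l%:C * ((enorm x ^+ 2)%:C * g k x)))%:C + (cabs ((l^-1)%:C * g k x))%:C))).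
  apply: le_rn.
  - by apply: cmeasM; [exact: cmeas_enormX|exact: cinte_meas (gi k)].
  - by apply: cinteD; exact: cinte_cabs.
  move=> x; rewrite -rcD [leRHS]cabs_real [leRHS]ger0_norm ?addr_ge0 ?cabs_ge0//.
  rewrite !cabsM !cabs_real mulrA -mulrDl ler_wpM2r ?cabs_ge0//.
  have i0 : 0 < l^-1 by rewrite invr_gt0.
  rewrite expr1 (ger0_norm (enorm_ge0 x)) (gtr0_norm l0) (gtr0_norm i0) (ger0_norm (sqr_ge0 _)).
  have ln0 : l != 0 by rewrite gt_eqF.
  rewrite -subr_ge0.
  have -> : l * enorm x ^+ 2 + l^-1 - enorm x =
     l * (enorm x - l^-1 / 2) ^+ 2 + l^-1 * (3 / 4) by field.
  by rewrite addr_ge0// mulr_ge0 ?sqr_ge0// ?(ltW l0)// ltW.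
have h (A : E -> R[i]) : cinte A -> rn (fun x => (cabs (A x))%:C) = rn A.
  by move=> Ai; congr fine; apply: eq_integral => x _; rewrite cabs_real ger0_norm ?cabs_ge0.
by rewrite (le_trans (rnD (cinte_cabs c1) (cinte_cabs c2)))// !h.
Qed.

Lemma rn_ixi_le G j : cinte (fun x => (enorm x ^+ 1)%:C * G x) -> cmeasurable setT G ->
  rn (fun x => (0 +i* coord3 j x) * G x) <= rn (fun x => (enorm x ^+ 1)%:C * G x).
Proof.
move=> Gi mG; apply: le_rn => //; first by apply: cmeasM => //; exact: cmeas_ixi.
move=> x; rewrite !cabsM ler_wpM2r ?cabs_ge0// cabs_ixi cabs_real expr1.
by rewrite (ger0_norm (enorm_ge0 x)) abs_coord3_le.
Qed.

(** The index [j] of the transporting component and the index [k] of the transported one are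
    independent, so the double sum of products of norms is a product of two sums. *)
Lemma rw_advhat_sub g h : (forall k, cinte (g k)) -> int2 g ->
  (forall k, cinte (h k)) -> int2 h ->
  rw 0 (vsub (advhat g) (advhat h)) <= rw 0 (vsub g h) * rw 1 g + rw 0 h * rw 1 (vsub g h).
Proof.
move=> gi g2 hi h2; have di k := cinteB (gi k) (hi k).
have d2 := int2_vsub g2 h2.
have g1 k := cinte_enorm1 (gi k) (g2 k); have d1 k := cinte_enorm1 (di k) (d2 k).
rewrite !rw0E /rw !big_distrlr /= exchange_big /= [X in _ <= _ + X]exchange_big /= -big_split /=.
apply: ler_sum => k _.
have ix l j : cinte (l k) -> cinte (fun x => (enorm x ^+ 2)%:C * l k x) -> cinte (fun x => (0 +i* coord3 j x) * l k x).
  by move=> li l2; exact: cinte_ixi.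
rewrite (_ : vsub _ _ k = fun xi => \sum_(j < 3)
  ((k2pi R)%:C * convol (g j) (fun eta => (0 +i* coord3 j eta) * g k eta) xi -
   (k2pi R)%:C * convol (h j) (fun eta => (0 +i* coord3 j eta) * h k eta) xi)); last first.
  by apply/funext => xi; rewrite /vsub /advhat -sumrB.
rewrite (le_trans (rn_sum _ _))//.
  by move=> j; apply: cinteB; apply: cinteZ; apply: cinte_convol => //; exact: ix.
rewrite -big_split /=; apply: ler_sum => j _.
rewrite (le_trans (rn_convol_sub (gi j) _ (hi j) _))//; [exact: ix|exact: ix|].
apply: lerD; rewrite ler_wpM2l ?rn_ge0//.
  by apply: rn_ixi_le => //; exact: cinte_meas (gi k).
rewrite (_ : (fun _ => _) = fun x => (0 +i* coord3 j x) * vsub g h k x); last first.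
  by apply/funext => x; rewrite /vsub mulrBr.
exact: (rn_ixi_le j (d1 k) (cinte_meas (di k))).
Qed.

(** The bounds for the quadratic and the power terms are added, so that a single inequality covers
    every [q]. *)
Lemma rw_src_sub m q g h (K : R) : (forall k, cinte (g k)) -> int2 g ->
  (forall k, cinte (h k)) -> int2 h -> rw 0 g <= K -> rw 0 h <= K ->
  rw 0 (vsub (src m q g) (src m q h)) <=
  rw 0 (vsub g h) * rw 1 g + rw 0 h * rw 1 (vsub g h) +
  (2 * m).+1%:R * K ^+ (2 * m) * rw 0 (vsub g h).
Proof.
move=> gi g2 hi h2 gK hK; have K0 : 0 <= K := le_trans (rw_ge0 _ _) gK.
have p0 : 0 <= (2 * m).+1%:R * K ^+ (2 * m) * rw 0 (vsub g h).
  by rewrite !mulr_ge0 ?rw_ge0// exprn_ge0.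
case: q => [k|]; last by rewrite (le_trans (rw_advhat_sub gi g2 hi h2))// lerDl.
rewrite -[leLHS]add0r lerD//; first by rewrite addr_ge0// mulr_ge0 ?rw_ge0.
rewrite [leLHS]rw0E (bigD1 k)//= big1 ?addr0; last first.
  move=> i /negbTE ik; rewrite /vsub /src ik.
  by rewrite (_ : (fun _ => _) = fun=> 0) ?rn0//; apply/funext => x; rewrite subrr.
rewrite /vsub /src eqxx (le_trans (rn_cpow_sub _ (gi k) (hi k) (K := K) _ _))//.
- exact: le_trans (rn_le_rw g k) gK.
- exact: le_trans (rn_le_rw h k) hK.
by rewrite ler_wpM2l ?mulr_ge0 ?exprn_ge0// (rn_le_rw (vsub g h)).
Qed.

(** 4 = 1 + 3: each component is bounded by itself plus the sum of all, and there are three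
    components. *)
Lemma rw_lerayhat C : (forall k, cinte (C k)) -> rw 0 (lerayhat C) <= 4 * rw 0 C.
Proof.
move=> Ci; rewrite !rw0E.
have ai k := cinte_cabs (Ci k).
have h k : rn (lerayhat C k) <= rn (C k) + \sum_(j < 3) rn (C j).
  have c (A : E -> R[i]) : cinte A -> rn (fun x => (cabs (A x))%:C) = rn A.
    by move=> Ai; congr fine; apply: eq_integral => x _; rewrite cabs_real ger0_norm ?cabs_ge0.
  apply: (@le_trans _ _ (rn (fun x => (cabs (C k x))%:C + \sum_(j < 3) (cabs (C j x))%:C))).
    apply: le_rn; [exact: cmeas_lerayhat (fun j => cinte_meas (Ci j))|by apply: cinteD => //; exact: cinte_sum|].
    move=> x; rewrite -rc_sum -rcD cabs_real ger0_norm; first exact: cabs_lerayhat_le.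
    by rewrite addr_ge0 ?cabs_ge0// sumr_ge0// => j _; exact: cabs_ge0.
  rewrite (le_trans (rnD (ai k) (cinte_sum _ _ ai)))// c// lerD2l.
  by rewrite (le_trans (rn_sum _ ai))//; apply: ler_sum => j _; rewrite c.
rewrite (le_trans (ler_sum _ (fun k _ => h k)))// big_split /= sumr_const card_ord.
by rewrite -mulr_natl; set S := \sum_(l < 3) _; lra.
Qed.

Lemma lerayhatB C C' k xi : lerayhat C k xi - lerayhat C' k xi = lerayhat (vsub C C') k xi.
Proof.
rewrite /lerayhat /vsub.
rewrite (_ : \sum_(j < 3) (coord3 j xi)%:C * (C j xi - C' j xi) =
  \sum_(j < 3) (coord3 j xi)%:C * C j xi - \sum_(j < 3) (coord3 j xi)%:C * C' j xi).
  by ring.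
by rewrite -sumrB; apply: eq_bigr => j _; rewrite mulrBr.
Qed.

End fixed_time.

(** * The Lipschitz estimate integrated in time *)

Section time_estimate.
Local Open Scope classical_set_scope.
Local Open Scope ring_scope.
Local Open Scope complex_scope.
Context (R : realType).
Local Notation V := (R * R * R)%type.
Local Notation E := (E3 R).
Local Notation R1 := (measurableTypeR R).
Local Notation mu := (@leb3 R).
Local Notation leb := (@lebesgue_measure R).
Local Notation cinte := (cintegrable mu setT).
Local Notation vfun := ('I_3 -> E -> R[i]).
Local Notation jfun := ('I_3 -> R1 * E -> R[i]).
Implicit Types (G H : E -> R[i]) (g h C : vfun) (i j k : 'I_3) (r m n : nat) (op : vfun -> vfun).

Definition slice (g : jfun) (t : R1) : vfun := fun k xi => g k (t, xi).

(** The Lipschitz constant of x^(2m+1) on [-K, K]. *)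
Definition powbound m (K : R) : R := (2 * m).+1%:R * K ^+ (2 * m).

Lemma powbound_ge0 m K : 0 <= K -> 0 <= powbound m K.
Proof. by move=> K0; rewrite mulr_ge0// exprn_ge0. Qed.

(* The properties of the quadratic and power nonlinearities that the
   fixed-point argument uses. *)
Definition admissible (M : R) m op : Prop :=
  [/\ op (fun _ _ => 0) = (fun _ _ => 0),
      forall g, (forall k, cinte (g k)) -> int2 g -> forall k, cinte (op g k),
      forall g : jfun, (forall k, cmeasurable setT (g k)) ->
        forall k, cmeasurable setT (fun p : R1 * E => op (slice g p.1) k p.2) &
      forall g h K, (forall k, cinte (g k)) -> int2 g -> (forall k, cinte (h k)) -> int2 h ->
        rw 0 g <= K -> rw 0 h <= K ->
        rw 0 (vsub (op g) (op h)) <= M * (rw 0 (vsub g h) * rw 1 g +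
          rw 0 h * rw 1 (vsub g h) + powbound m K * rw 0 (vsub g h))].

Let zfun : vfun := fun _ _ => 0.

Lemma convol0l G : convol (fun=> 0) G = (fun=> 0) :> (E -> R[i]).
Proof.
apply/funext => xi; rewrite /convol -[RHS](cint0 mu).
by apply: eq_cint => x; rewrite mul0r.
Qed.

Lemma src0 m q : src m q zfun = zfun.
Proof.
case: q => [k|]; apply/funext => i; apply/funext => xi; rewrite /src /zfun.
  case: (i == k) => //; elim: (2 * m)%N => [//|n ih].
  by rewrite [cpow _ _]/= convol0l mulr0.
by apply: big1 => j _; rewrite convol0l mulr0.
Qed.

Lemma admissible_src m q : admissible 1 m (src m q).
Proof.
split.
- exact: src0.
- by move=> g gi g2 k; exact: cinte_src.
- move=> g mg k; case: q => [k'|] /=.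
    case: (k == k'); last exact: cmeas_cst.
    elim: (2 * m)%N => [|n ih] /=.
      by apply: (eq_ind _ (cmeasurable setT) (mg k')); apply/funext => -[].
    apply: cmeasM; first exact: cmeas_cst.
    exact: (cmeas_convol_param (mg k') ih).
  apply: cmeas_sum => j; apply: cmeasM; first exact: cmeas_cst.
  apply: (cmeas_convol_param (mg j) (g := fun p : R1 * E => (0 +i* coord3 j p.2) * g k p)).
  by apply: cmeasM => //; exact: (cmeas_comp (cmeas_ixi R j) measurable_snd).
- by move=> g h K gi g2 hi h2 gK hK; rewrite mul1r; exact: rw_src_sub.
Qed.

Lemma lerayhat0 k : lerayhat zfun k = (fun=> 0).
Proof.
apply/funext => xi; rewrite /lerayhat /zfun big1 ?mul0r ?subr0// => j _.
by rewrite mulr0.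
Qed.

Lemma admissible_lerayhat M m op : admissible M m op -> admissible (4 * M) m (fun g => lerayhat (op g)).
Proof.
move=> [op0 opi opm opL]; split.
- by rewrite op0; apply/funext => k; exact: lerayhat0.
- by move=> g gi g2 k; apply: cinte_lerayhat => j; exact: opi.
- move=> g mg k; have mo := opm g mg.
  have mc j : cmeasurable setT (fun p : R1 * E => (coord3 j p.2)%:C).
    by apply: cmeas_real; exact: measurable_coord3.
  apply: cmeasB => //; apply: cmeasM => //; apply: cmeasM.
    by apply: cmeas_sum => j; apply: cmeasM => //; exact: mo.
  under eq_fun do rewrite -rcV.
  have me := cmeas_real (@measurable_inv_enorm2 R).
  exact: (cmeas_comp me (@measurable_snd _ _ R1 E)).
- move=> g h K gi g2 hi h2 gK hK.
  rewrite (_ : vsub _ _ = lerayhat (vsub (op g) (op h))); last first.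
    by apply/funext => k; apply/funext => xi; exact: lerayhatB.
  rewrite (le_trans (rw_lerayhat _))//; first by move=> k; apply: cinteB; exact: opi.
  by rewrite -mulrA ler_wpM2l// opL.
Qed.

Lemma rwD g h : (forall k, cinte (g k)) -> (forall k, cinte (h k)) ->
  rw 0 (fun k x => g k x + h k x) <= rw 0 g + rw 0 h.
Proof.
by move=> gi hi; rewrite !rw0E -big_split /=; apply: ler_sum => k _; exact: rnD.
Qed.

Lemma rwZ (a : R) g : 0 <= a -> (forall k, cinte (g k)) ->
  rw 0 (fun k x => a%:C * g k x) = a * rw 0 g.
Proof.
move=> a0 gi; rewrite !rw0E mulr_sumr; apply: eq_bigr => k _.
by rewrite rnZ// cabs_real ger0_norm.
Qed.

Lemma admissibleD M M' m op op' : admissible M m op -> admissible M' m op' ->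
  admissible (M + M') m (fun g k x => op g k x + op' g k x).
Proof.
move=> [op0 opi opm opL] [op0' opi' opm' opL']; split.
- by rewrite op0 op0'; apply/funext => k; apply/funext => x; rewrite addr0.
- by move=> g gi g2 k; apply: cinteD; [exact: opi|exact: opi'].
- by move=> g mg k; apply: cmeasD; [exact: opm|exact: opm'].
- move=> g h K gi g2 hi h2 gK hK; rewrite mulrDl.
  apply: le_trans (lerD (opL g h K gi g2 hi h2 gK hK) (opL' g h K gi g2 hi h2 gK hK)).
  rewrite (_ : vsub _ _ = fun k x => vsub (op g) (op h) k x + vsub (op' g) (op' h) k x); last first.
    by apply/funext => k; apply/funext => x; rewrite /vsub opprD addrACA.
  by apply: rwD => k; apply: cinteB; first [exact: opi|exact: opi'].
Qed.

Lemma admissibleZ (a : R) M m op : 0 <= a -> admissible M m op ->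
  admissible (a * M) m (fun g k x => a%:C * op g k x).
Proof.
move=> a0 [op0 opi opm opL]; split.
- by rewrite op0; apply/funext => k; apply/funext => x; rewrite mulr0.
- by move=> g gi g2 k; apply: cinteZ; exact: opi.
- by move=> g mg k; apply: cmeasM; [exact: cmeas_cst|exact: opm].
- move=> g h K gi g2 hi h2 gK hK; rewrite -mulrA.
  apply: le_trans (ler_wpM2l a0 (opL g h K gi g2 hi h2 gK hK)).
  rewrite (_ : vsub _ _ = fun k x => a%:C * vsub (op g) (op h) k x); last first.
    by apply/funext => k; apply/funext => x; rewrite /vsub mulrBr.
  by rewrite rwZ// => k; apply: cinteB; exact: opi.
Qed.

Lemma cmeas_slice (g : jfun) t : (forall k, cmeasurable setT (g k)) ->
  forall k, cmeasurable setT (slice g t k).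
Proof. by move=> mg k; exact: (cmeas_comp (mg k) (pair1_measurable t)). Qed.

Lemma measurable_wnorm r (g : jfun) : (forall k, cmeasurable setT (g k)) ->
  measurable_fun setT (fun t => wnorm r (slice g t)).
Proof.
move=> mg; apply: emeasurable_sum => k.
apply: (measurable_L1_param mu (f := fun p : R1 * E => (enorm p.2 ^+ r)%:C * g k p)).
by apply: cmeasM => //; exact: (cmeas_comp (cmeas_enormX R r) measurable_snd).
Qed.

Lemma ae_finite (D : set R1) (f : R1 -> \bar R) : measurable D -> measurable_fun setT f ->
  (forall t, 0 <= f t)%E -> (\int[leb]_(t in D) f t < +oo)%E ->
  {ae leb, forall t, D t -> (f t < +oo)%E}.
Proof.
move=> mD mf f0 foo.
have fi : leb.-integrable D f.
  apply/integrableP; split; first exact: measurable_funS mf.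
  by under eq_integral do rewrite gee0_abs//.
by apply: filterS (integrable_ae mD fi) => t h Dt; have := h Dt; rewrite ge0_fin_numE.
Qed.

Let mitv (a b : R) : measurable (`[a, b] : set R1).
Proof. exact: measurable_itv. Qed.

(** After [rw1_interp] the Lipschitz bound is affine in the X^2 norms of [g] and of [g - h]. Terms
    in 1/l gain l^2 from the length of the interval, terms in l already carry a norm integrable in
    time; the result is of order l and linear in the distance [A]. *)
Lemma integral_op_sub M m op (g h : jfun) (t0 t1 l K A : R) :
  admissible M m op -> 0 <= M ->
  (forall k, cmeasurable setT (g k)) -> (forall k, cmeasurable setT (h k)) ->
  0 < l <= 1 -> t0 <= t1 -> t1 - t0 <= l ^+ 2 -> 0 <= K -> 0 <= A ->
  (forall t, (t0 <= t <= t1)%R -> wnorm 0 (slice g t) <= K%:E)%E ->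
  (forall t, (t0 <= t <= t1)%R -> wnorm 0 (slice h t) <= K%:E)%E ->
  (\int[leb]_(t in `[t0, t1]) wnorm 2 (slice g t) <= K%:E)%E ->
  (\int[leb]_(t in `[t0, t1]) wnorm 2 (slice h t) < +oo)%E ->
  (forall t, (t0 <= t <= t1)%R -> wnorm 0 (vsub (slice g t) (slice h t)) <= A%:E)%E ->
  (\int[leb]_(t in `[t0, t1]) wnorm 2 (vsub (slice g t) (slice h t)) <= A%:E)%E ->
  (\int[leb]_(t in `[t0, t1]) wnorm 0 (vsub (op (slice g t)) (op (slice h t))) <=
    (M * l * (4 * K + powbound m K) * A)%:E)%E.
Proof.
move=> [op0 opi opm opL] M0 mg mh /andP[l0 l1] t01 tl K0 A0 gK hK g2K h2K dA d2A.
have mG := measurable_wnorm 2 mg; have mH := measurable_wnorm 2 mh.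
pose d : jfun := fun k p => g k p - h k p.
have md k : cmeasurable setT (d k) by exact: cmeasB.
have mD := measurable_wnorm 2 md.
have fg := ae_finite (mitv t0 t1) mG (fun t => wnorm_ge0 2 _) (le_lt_trans g2K (ltry _)).
have fh := ae_finite (mitv t0 t1) mH (fun t => wnorm_ge0 2 _) h2K.
have c0 := powbound_ge0 m K0.
(* [a], [b] and [e] are the coefficients of 1 and of the X^2 norms of [g] and of [g - h]. *)
pose a := M * (A * K / l + K * A / l + powbound m K * A).
have a0 : 0 <= a.
  have li : 0 <= l^-1 by rewrite invr_ge0 ltW.
  rewrite /a; apply: mulr_ge0 => //; apply: addr_ge0; last exact: mulr_ge0.
  by apply: addr_ge0; apply: mulr_ge0 => //; exact: mulr_ge0.
pose b := M * A * l; pose e := M * K * l.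
have b0 : 0 <= b by rewrite /b !mulr_ge0// ltW.
have e0 : 0 <= e by rewrite /e !mulr_ge0// ltW.
have tD (t : R) : `[t0, t1]%classic t -> t0 <= t <= t1 by rewrite /= in_itv.
pose o : jfun := fun k p => op (slice g p.1) k p.2 - op (slice h p.1) k p.2.
have mo k : cmeasurable setT (o k) by apply: cmeasB; exact: opm.
have mO := measurable_wnorm 0 mo.
apply: (@le_trans _ _ (\int[leb]_(t in `[t0, t1]) (a%:E + b%:E * wnorm 2 (slice g t) +
    e%:E * wnorm 2 (slice d t)))%E).
  apply: ae_ge0_le_integral => //.
  - by move=> t _; exact: wnorm_ge0.
  - exact: measurable_funS mO.
  - by move=> t _; rewrite !adde_ge0 ?mule_ge0 ?lee_fin ?wnorm_ge0.
  - apply: (measurable_funS measurableT) => //.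
    by apply: emeasurable_funD; [apply: emeasurable_funD|]; try exact: measurable_cst;
      apply: emeasurable_funM => //; exact: measurable_cst.
  move: fg fh; apply: filterS2 => t hg hh Dt.
  have tI := tD _ Dt.
  have {}hg := hg Dt; have {}hh := hh Dt.
  have mgt := cmeas_slice t mg; have mht := cmeas_slice t mh.
  have gi := wnorm_cinte mgt (le_lt_trans (gK t tI) (ltry _)).
  have hi := wnorm_cinte mht (le_lt_trans (hK t tI) (ltry _)).
  have g2 := wnorm2_int2 mgt hg; have h2 := wnorm2_int2 mht hh.
  have di k := cinteB (gi k) (hi k); have d2 := int2_vsub g2 h2.
  have gr := gK t tI; have hr := hK t tI; have dr := dA t tI.
  rewrite wnorm0E// lee_fin in gr; rewrite wnorm0E// lee_fin in hr; rewrite wnorm0E// lee_fin in dr.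
  rewrite wnorm0E; last by move=> k; apply: cinteB; exact: opi.
  rewrite (_ : slice d t = vsub (slice g t) (slice h t))// (wnormE g2) (wnormE d2) -!EFinM -!EFinD lee_fin.
  rewrite (le_trans (opL _ _ K gi g2 hi h2 gr hr))//.
  have i1 := rw1_interp l0 gi g2; have i2 := rw1_interp l0 di d2.
  have r1 := rw_ge0 1 (slice g t); have r2 := rw_ge0 1 (vsub (slice g t) (slice h t)).
  have r3 := rw_ge0 0 (slice h t); have r4 := rw_ge0 0 (vsub (slice g t) (slice h t)).
  have li : 0 <= l^-1 by rewrite invr_ge0 ltW.
  apply: (@le_trans _ _ (M * (A * (l * rw 2 (slice g t) + l^-1 * K) +
     K * (l * rw 2 (vsub (slice g t) (slice h t)) + l^-1 * A) + powbound m K * A))).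
    rewrite ler_wpM2l// lerD ?ler_wpM2l// lerD// ler_pM//.
      by rewrite (le_trans i1)// lerD2l ler_wpM2l.
    by rewrite (le_trans i2)// lerD2l ler_wpM2l.
  by rewrite le_eqVlt; apply/orP; left; apply/eqP; rewrite /a /b /e; ring.
rewrite ge0_integralD//; last 4 first.
- by move=> t _; rewrite adde_ge0 ?mule_ge0 ?lee_fin ?wnorm_ge0.
- apply: (measurable_funS measurableT) => //.
  apply: emeasurable_funD; first exact: measurable_cst.
  by apply: emeasurable_funM => //; exact: measurable_cst.
- by move=> t _; rewrite mule_ge0 ?lee_fin ?wnorm_ge0.
- apply: (measurable_funS measurableT) => //.
  by apply: emeasurable_funM => //; exact: measurable_cst.
rewrite ge0_integralD//; last 2 first.
- by move=> t _; rewrite mule_ge0 ?lee_fin ?wnorm_ge0.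
- apply: (measurable_funS measurableT) => //.
  by apply: emeasurable_funM => //; exact: measurable_cst.
rewrite integral_cst// ge0_integralZl//; last 2 first.
- exact: measurable_funS mG.
- by move=> t _; exact: wnorm_ge0.
rewrite ge0_integralZl//; last 2 first.
- exact: measurable_funS mD.
- by move=> t _; exact: wnorm_ge0.
have ll : (leb `[t0, t1]%classic <= (l ^+ 2)%:E)%E.
  apply: (@le_trans _ _ (t1 - t0)%:E); last by rewrite lee_fin.
  by rewrite lebesgue_measure_itv /= lte_fin; have [//|t10] := ltP t0 t1; rewrite (le_anti (introT andP (conj t01 t10))) subrr.
apply: (@le_trans _ _ (a%:E * (l ^+ 2)%:E + b%:E * K%:E + e%:E * A%:E)%E).
  apply: leeD; last by apply: lee_wpmul2l; rewrite ?lee_fin.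
  apply: leeD; first by apply: lee_wpmul2l; [rewrite lee_fin|exact: ll].
  by apply: lee_wpmul2l; rewrite ?lee_fin.
rewrite -!EFinM -!EFinD lee_fin.
have ln0 : l != 0 by rewrite gt_eqF.
(* In 4K, two copies come from the terms in 1/l and two from the X^2 norms; l <= 1 then removes the
   extra factor of the power term. *)
rewrite (_ : a * l ^+ 2 + b * K + e * A = M * l * A * (4 * K + powbound m K * l)); last first.
  by rewrite /a /b /e; field.
rewrite -[leRHS]mulrAC ler_wpM2l ?mulr_ge0 ?(ltW l0)//.
by rewrite lerD2l ler_piMr.
Qed.

End time_estimate.

(** * Duhamel's operator *)

Section duhamel.
Local Open Scope classical_set_scope.
Local Open Scope ring_scope.
Local Open Scope complex_scope.
Context (R : realType).
Local Notation V := (R * R * R)%type.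
Local Notation E := (E3 R).
Local Notation R1 := (measurableTypeR R).
Local Notation mu := (@leb3 R).
Local Notation leb := (@lebesgue_measure R).
Local Notation lm := (leb \x mu)%E.
Local Notation cinte := (cintegrable mu setT).
Local Notation vfun := ('I_3 -> E -> R[i]).
Local Notation jfun := ('I_3 -> R1 * E -> R[i]).
Implicit Types (G : E -> R[i]) (F H : R1 * E -> R[i]) (g h : vfun) (k : 'I_3) (r : nat) (t tau : R) (D : set R).

(* The cut-off lets Duhamel's integral range over all times. *)
Definition hk t tau (xi : E) : R :=
  if (0 <= tau) && (tau <= t) then expR (- (t - tau) * enorm xi ^+ 2) else 0.

Lemma hk_ge0 t tau xi : 0 <= hk t tau xi.
Proof. by rewrite /hk; case: ifP => // _; exact: expR_ge0. Qed.

Lemma hk_le1 t tau xi : hk t tau xi <= 1.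
Proof.
rewrite /hk; case: ifP => // /andP[_ tt]; rewrite -[leRHS]expR0 ler_expR mulNr oppr_le0.
by rewrite mulr_ge0 ?sqr_ge0// subr_ge0.
Qed.

Lemma measurable_hk d (T : measurableType d) (p q : T -> R1) (x : T -> E) :
  measurable_fun setT p -> measurable_fun setT q -> measurable_fun setT x ->
  measurable_fun setT (fun z => hk (p z) (q z) (x z)).
Proof.
move=> mp mq mx; apply: measurable_fun_ifT => //.
  by apply: measurable_and; apply: measurable_fun_ler => //; exact: measurable_cst.
apply: (measurableT_comp (@measurable_expR R)); apply: measurable_funM.
  under eq_fun do rewrite opprB.
  exact: measurable_funB.
by apply: measurable_funX; exact: measurable_enorm.
Qed.

Lemma cmeas_hk d (T : measurableType d) (p q : T -> R1) (x : T -> E) :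
  measurable_fun setT p -> measurable_fun setT q -> measurable_fun setT x ->
  cmeasurable setT (fun z => (hk (p z) (q z) (x z))%:C).
Proof. by move=> mp mq mx; apply: cmeas_real; exact: measurable_hk. Qed.

Definition duh F (p : R1 * E) : R[i] :=
  cintegral leb setT (fun tau : R1 => (hk p.1 tau p.2)%:C * F (tau, p.2)).

Let cmeas_duh_kernel F : cmeasurable setT F ->
  cmeasurable setT (fun z : (R1 * E) * R1 => (hk z.1.1 z.2 z.1.2)%:C * F (z.2, z.1.2)).
Proof.
move=> mF.
have m1 : measurable_fun setT (fun z : (R1 * E) * R1 => z.1.1) by exact: measurableT_comp.
have m2 : measurable_fun setT (fun z : (R1 * E) * R1 => z.1.2) by exact: measurableT_comp.
apply: cmeasM; first exact: cmeas_hk.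
by apply: (cmeas_comp mF); apply: measurable_fun_pair.
Qed.

Lemma cmeas_duh F : cmeasurable setT F -> cmeasurable setT (duh F).
Proof. by move=> mF; exact: (cmeas_cint_param leb (cmeas_duh_kernel mF)). Qed.

Let cmeas_duh_kernel1 F p : cmeasurable setT F ->
  cmeasurable setT (fun tau : R1 => (hk p.1 tau p.2)%:C * F (tau, p.2)).
Proof. by move=> mF; exact: (cmeas_comp (cmeas_duh_kernel mF) (pair1_measurable p)). Qed.

Let cmeas_sec F (xi : E) : cmeasurable setT F -> cmeasurable setT (fun tau : R1 => F (tau, xi) : R[i]).
Proof. by move=> mF; exact: (cmeas_comp mF (pair2_measurable xi)). Qed.

Lemma cabs_duh_le F p : cmeasurable setT F ->
  ((cabs (duh F p))%:E <= L1 leb (fun tau => F (tau, p.2)))%E.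
Proof.
move=> mF; apply: le_trans (cabs_cint_le_gen leb (cmeas_duh_kernel1 p mF)) _.
apply: le_L1; [exact: cmeas_duh_kernel1|exact: cmeas_sec|move=> tau].
by rewrite cabsM cabs_real ger0_norm ?hk_ge0// ler_piMl ?cabs_ge0// hk_le1.
Qed.

Lemma L1_duh F t : cmeasurable setT F ->
  (L1 mu (fun xi => duh F (t, xi)) <= L1 lm F)%E.
Proof.
move=> mF; rewrite -(L1_tonelli2 leb mu mF); apply: ge0_le_integral => //.
- by move=> x _; rewrite lee_fin cabs_ge0.
- by apply: measurable_ecabs; exact: (cmeas_comp (cmeas_duh mF) (pair1_measurable (t : R1))).
- have mF' : cmeasurable setT (fun p : E * R1 => F (p.2, p.1)).
    by apply: (cmeas_comp mF); exact: measurable_fun_pair.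
  exact: (measurable_L1_param leb mF').
- by move=> xi _; exact: (cabs_duh_le (t, xi) mF).
Qed.

(** After a translation by [tau], the integrand is dominated by the density of the exponential law
    of rate |xi|^2; at xi = 0 it vanishes. *)
Lemma integral_hk tau (xi : E) :
  (\int[leb]_t (enorm xi ^+ 2 * hk t tau xi)%:E <= 1)%E.
Proof.
have mhk : measurable_fun setT (fun t : R1 => (enorm xi ^+ 2 * hk t tau xi)%:E).
  apply/measurable_EFinP; apply: measurable_funM => //.
  by apply: measurable_hk => //; exact: measurable_cst.
have [x0|x0] := eqVneq (enorm xi ^+ 2) 0.
  by under eq_integral do rewrite x0 mul0r; rewrite integral0.
have xp : 0 < enorm xi ^+ 2 by rewrite lt0r x0 sqr_ge0.
rewrite -(integral_exponential_pdf xp).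
have h := @ge0_integral_affine R tau 1 (fun t => (enorm xi ^+ 2 * hk t tau xi)%:E) ltr01 mhk.
rewrite invr1 mul1e in h; rewrite -h; last first.
  by move=> t; rewrite lee_fin mulr_ge0 ?sqr_ge0// hk_ge0.
apply: ge0_le_integral => //.
- by move=> t _; rewrite lee_fin mulr_ge0 ?sqr_ge0// hk_ge0.
- exact: (measurableT_comp mhk (measurable_affine tau 1)).
- by apply/measurable_EFinP; exact: measurable_exponential_pdf.
move=> t _; rewrite lee_fin mul1r /hk /exponential_pdf patchE.
case: ifPn => [/andP[tau0 tt]|_].
  rewrite ifT; last by rewrite inE /= in_itv /= andbT; rewrite lerDl in tt.
  by rewrite [tau + t]addrC addrK mulNr mulNr [t * _]mulrC.
by rewrite mulr0; case: ifP => // _; rewrite mulr_ge0 ?sqr_ge0// expR_ge0.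
Qed.

Lemma L1_hk tau (xi : E) :
  (L1 leb (fun t : R1 => ((enorm xi ^+ 2)%:C * (hk t tau xi)%:C)%R) <= 1)%E.
Proof.
apply: le_trans (integral_hk tau xi).
rewrite le_eqVlt; apply/orP; left; apply/eqP; apply: eq_integral => t _.
by rewrite -rcM cabs_real ger0_norm// mulr_ge0 ?sqr_ge0// hk_ge0.
Qed.

(** Parabolic gain of two derivatives: at fixed frequency, Tonelli's theorem puts the integral over
    the final time inside, where [L1_hk] bounds it by 1. *)
Lemma L1_duh2 F : cmeasurable setT F ->
  (L1 lm (fun p : R1 * E => ((enorm p.2 ^+ 2)%:C * duh F p)%R) <= L1 lm F)%E.
Proof.
move=> mF; have mD := cmeas_duh mF.
have mD2 : cmeasurable setT (fun p : R1 * E => (enorm p.2 ^+ 2)%:C * duh F p).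
  by apply: cmeasM => //; exact: (cmeas_comp (cmeas_enormX R 2) measurable_snd).
rewrite -(L1_tonelli2 leb mu mD2) -(L1_tonelli2 leb mu mF).
have sw (A : R1 * E -> R[i]) : cmeasurable setT A -> measurable_fun setT (fun xi => L1 leb (fun t : R1 => A (t, xi))).
  move=> mA; have mA' : cmeasurable setT (fun p : E * R1 => A (p.2, p.1)).
    by apply: (cmeas_comp mA); exact: measurable_fun_pair.
  exact: (measurable_L1_param leb mA').
apply: ge0_le_integral => //.
- by move=> x _; exact: L1_ge0.
- exact: (sw _ mD2).
- exact: sw.
move=> xi _ /=; have mFx := cmeas_sec xi mF.
pose K (z : R1 * R1) := ((enorm xi ^+ 2)%:C * (hk z.1 z.2 xi)%:C) * F (z.2, xi).
have mK : cmeasurable setT K.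
  apply: cmeasM; last exact: (cmeas_comp mFx measurable_snd).
  by apply: cmeasM; [exact: cmeas_cst|apply: cmeas_hk => //; exact: measurable_cst].
apply: (@le_trans _ _ (\int[leb]_t L1 leb (fun tau => K (t, tau)))%E).
  apply: ge0_le_integral => //.
  - by move=> t _; rewrite lee_fin cabs_ge0.
  - exact: measurable_ecabs (cmeas_sec xi mD2).
  - exact: (measurable_L1_param leb mK).
  move=> t _; rewrite /duh /= cabsM EFinM.
  rewrite (_ : (fun tau => K (t, tau)) = fun tau => (enorm xi ^+ 2)%:C * ((hk t tau xi)%:C * F (tau, xi))); last first.
    by apply/funext => tau; rewrite /K /= mulrA.
  have m1 := cmeas_duh_kernel1 (t, xi) mF.
  rewrite L1Z//; apply: lee_wpmul2l; first by rewrite lee_fin cabs_ge0.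
  exact: (cabs_cint_le_gen leb m1).
rewrite (L1_tonelli1 leb leb mK) -(L1_tonelli2 leb leb mK).
apply: ge0_le_integral => //.
- by move=> tau _; exact: L1_ge0.
- have mK' : cmeasurable setT (fun p : R1 * R1 => K (p.2, p.1)).
    by apply: (cmeas_comp mK); exact: measurable_fun_pair.
  exact: (measurable_L1_param leb mK').
- exact: measurable_ecabs.
move=> tau _; rewrite (_ : (fun t => K (t, tau)) = fun t => F (tau, xi) * ((enorm xi ^+ 2)%:C * (hk t tau xi)%:C)); last first.
  by apply/funext => t; rewrite /K /= mulrC.
rewrite L1Z; last by apply: cmeasM; [exact: cmeas_cst|apply: cmeas_hk => //; exact: measurable_cst].
rewrite -[leRHS]mule1; apply: lee_wpmul2l; first by rewrite lee_fin cabs_ge0.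
exact: L1_hk.
Qed.

(** The free heat evolution, extended by 0 to negative times; written as the kernel with source at
    time 0, it inherits the kernel estimates. *)
Definition hterm G (p : R1 * E) : R[i] := (hk p.1 0 p.2)%:C * G p.2.

Lemma cmeas_hterm G : cmeasurable setT G -> cmeasurable setT (hterm G).
Proof.
move=> mG; apply: cmeasM; last exact: (cmeas_comp mG measurable_snd).
by apply: cmeas_hk => //; exact: measurable_cst.
Qed.

Lemma L1_hterm G t : cmeasurable setT G ->
  (L1 mu (fun xi => hterm G (t, xi)) <= L1 mu G)%E.
Proof.
move=> mG; apply: le_L1 => //; first exact: (cmeas_comp (cmeas_hterm mG) (pair1_measurable (t : R1))).
move=> xi; rewrite cabsM cabs_real ger0_norm ?hk_ge0// ler_piMl ?cabs_ge0//.
exact: hk_le1.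
Qed.

Lemma L1_hterm2 G : cmeasurable setT G ->
  (L1 lm (fun p : R1 * E => ((enorm p.2 ^+ 2)%:C * hterm G p)%R) <= L1 mu G)%E.
Proof.
move=> mG; have mH := cmeas_hterm mG.
have mH2 : cmeasurable setT (fun p : R1 * E => (enorm p.2 ^+ 2)%:C * hterm G p).
  by apply: cmeasM => //; exact: (cmeas_comp (cmeas_enormX R 2) measurable_snd).
rewrite -(L1_tonelli2 leb mu mH2).
apply: ge0_le_integral => //.
- by move=> x _; exact: L1_ge0.
- have mA' : cmeasurable setT (fun p : E * R1 => (enorm p.1 ^+ 2)%:C * hterm G (p.2, p.1)).
    by apply: (cmeas_comp mH2 (p := fun p : E * R1 => (p.2, p.1))); exact: measurable_fun_pair.
  exact: (measurable_L1_param leb mA').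
- exact: measurable_ecabs.
move=> xi _; rewrite (_ : (fun t => _) = fun t : R1 => G xi * ((enorm xi ^+ 2)%:C * (hk t 0 xi)%:C)); last first.
  by apply/funext => t; rewrite /hterm /= mulrA mulrC.
rewrite L1Z; last by apply: cmeasM; [exact: cmeas_cst|apply: cmeas_hk => //; exact: measurable_cst].
rewrite -[leRHS]mule1; apply: lee_wpmul2l; first by rewrite lee_fin cabs_ge0.
exact: L1_hk.
Qed.

Lemma duh_sub F H t : cintegrable lm setT F -> cintegrable lm setT H ->
  {ae mu, forall xi : E, duh F (t, xi) - duh H (t, xi) = duh (fun p => F p - H p) (t, xi)}.
Proof.
move=> Fi Hi; move: (ae_cinte2 Fi) (ae_cinte2 Hi); apply: filterS2 => xi f1 h1.
have c (A : R1 * E -> R[i]) : cmeasurable setT A -> cintegrable leb setT (fun tau => A (tau, xi)) ->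
    cintegrable leb setT (fun tau : R1 => (hk t tau xi)%:C * A (tau, xi)).
  move=> mA ai; apply: (@cinte_bndM _ _ _ _ 1) => //.
    by apply: cmeas_hk => //; exact: measurable_cst.
  by move=> tau; rewrite cabs_real ger0_norm ?hk_ge0// hk_le1.
rewrite /duh /= -cintB; [|exact: c (cinte_meas Fi) f1|exact: c (cinte_meas Hi) h1].
by apply: eq_cint => tau; rewrite mulrBr.
Qed.

Definition tcut D F (p : R1 * E) : R[i] := (\1_D p.1)%:C * F p.

Lemma cmeas_cut D F : measurable (D : set R1) -> cmeasurable setT F -> cmeasurable setT (tcut D F).
Proof.
move=> mD mF; apply: cmeasM => //; apply: cmeas_real.
have mi : measurable_fun setT (\1_D : R1 -> R) by exact: measurable_indic.
exact: (measurableT_comp mi (@measurable_fst _ _ R1 E)).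
Qed.

Lemma cabs_tcut D F p : cabs (tcut D F p) = \1_D p.1 * cabs (F p).
Proof. by rewrite cabsM cabs_real ger0_norm// indicE; case: (_ \in _). Qed.

(** Causality: the kernel at time [t] sees the source on [0, t] only. *)
Lemma duh_cut D F t (xi : E) : `[0, t]%classic `<=` D -> duh (tcut D F) (t, xi) = duh F (t, xi).
Proof.
move=> tD; apply: eq_cint => tau; rewrite /tcut /= /hk.
case: ifPn => [/andP[a b]|_]; last by rewrite !mul0r.
by rewrite indicE mem_set ?mul1r//; apply: tD; rewrite /= in_itv /= a b.
Qed.

Definition jnorm (F : jfun) : \bar R := (\sum_(k < 3) L1 lm (F k))%E.

Lemma jnorm_ge0 (F : jfun) : (0 <= jnorm F)%E.
Proof. by apply: sume_ge0 => k _; exact: L1_ge0. Qed.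

Lemma integral_wnorm (D : set R1) r (g : jfun) : measurable D -> (forall k, cmeasurable setT (g k)) ->
  (\int[leb]_(t in D) wnorm r (slice g t) =
   jnorm (fun k => tcut D (fun p => (enorm p.2 ^+ r)%:C * g k p)%R))%E.
Proof.
move=> mD mg; rewrite /jnorm /wnorm.
have mw k : cmeasurable setT (fun p : R1 * E => (enorm p.2 ^+ r)%:C * g k p).
  by apply: cmeasM => //; exact: (cmeas_comp (cmeas_enormX R r) measurable_snd).
rewrite ge0_integral_sum//; last 2 first.
- by move=> k; apply: (measurable_funS measurableT) => //; exact: (measurable_L1_param mu (mw k)).
- by move=> k t _; exact: L1_ge0.
apply: eq_bigr => k _; rewrite -(L1_tonelli1 leb mu (cmeas_cut mD (mw k))).
rewrite integral_mkcond; apply: eq_integral => t _; rewrite patchE.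
case: ifPn => tD.
  by apply: eq_integral => xi _; rewrite /tcut /= indicE tD mul1r.
transitivity (0 : \bar R)%E; first by [].
rewrite -(L1_cst0 mu); apply: eq_integral => xi _.
by rewrite /tcut /= indicE (negbTE tD) mul0r.
Qed.

Definition sol (g0 : vfun) (F : jfun) : jfun := fun k p => hterm (g0 k) p - duh (F k) p.

Lemma cmeas_sol (g0 : vfun) (F : jfun) : (forall k, cmeasurable setT (g0 k)) ->
  (forall k, cmeasurable setT (F k)) -> forall k, cmeasurable setT (sol g0 F k).
Proof. by move=> mg mF k; apply: cmeasB; [exact: cmeas_hterm|exact: cmeas_duh]. Qed.

Lemma wnorm0_sum g : wnorm 0 g = (\sum_(k < 3) L1 mu (g k))%E.
Proof.
by apply: eq_bigr => k _; apply: eq_integral => x _; rewrite expr0 mul1r.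
Qed.

Lemma wnorm_sol (g0 : vfun) (F : jfun) t : (forall k, cmeasurable setT (g0 k)) ->
  (forall k, cmeasurable setT (F k)) ->
  (wnorm 0 (slice (sol g0 F) t) <= wnorm 0 g0 + jnorm F)%E.
Proof.
move=> mg mF; rewrite !wnorm0_sum /jnorm -big_split /=; apply: lee_sum => k _.
have mh := cmeas_hterm (mg k); have md := cmeas_duh (mF k).
apply: le_trans (L1B mu (cmeas_comp mh (pair1_measurable (t : R1))) (cmeas_comp md (pair1_measurable (t : R1)))) _.
by apply: leeD; [exact: L1_hterm|exact: L1_duh].
Qed.

Lemma jnorm_le (F H : jfun) : (forall k, cmeasurable setT (F k)) -> (forall k, cmeasurable setT (H k)) ->
  (forall k p, cabs (F k p) <= cabs (H k p)) -> (jnorm F <= jnorm H)%E.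
Proof. by move=> mF mH FH; apply: lee_sum => k _; exact: le_L1. Qed.

Lemma indic01 D (x : R) : 0 <= (\1_D x : R) <= 1.
Proof. by rewrite indicE; case: (x \in D); rewrite /= ?lexx ?ler01. Qed.

Lemma integral_wnorm_sol (g0 : vfun) (F : jfun) (D : set R1) : measurable D ->
  (forall k, cmeasurable setT (g0 k)) -> (forall k, cmeasurable setT (F k)) ->
  (\int[leb]_(t in D) wnorm 2 (slice (sol g0 F) t) <= wnorm 0 g0 + jnorm F)%E.
Proof.
move=> mD mg mF; have ms := cmeas_sol mg mF; rewrite integral_wnorm//.
rewrite wnorm0_sum /jnorm -big_split /=; apply: lee_sum => k _.
have mh := cmeas_hterm (mg k); have md := cmeas_duh (mF k).
have me := cmeas_comp (cmeas_enormX R 2) (@measurable_snd _ _ R1 E).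
apply: (@le_trans _ _ (L1 lm (fun p : R1 * E => (enorm p.2 ^+ 2)%:C * hterm (g0 k) p -
    (enorm p.2 ^+ 2)%:C * duh (F k) p)%R)).
  apply: le_L1.
  - by apply: cmeas_cut => //; exact: cmeasM.
  - by apply: cmeasB; exact: cmeasM.
  move=> p; rewrite cabs_tcut /sol mulrBr.
  by have /andP[a b] := indic01 D p.1; rewrite ler_piMl ?cabs_ge0.
apply: le_trans (L1B lm (cmeasM me mh) (cmeasM me md)) _.
by apply: leeD; [exact: L1_hterm2|exact: L1_duh2].
Qed.

Section sol_difference.
Variables (g0 : vfun) (F H : jfun) (D : set R1).
Hypotheses (mD : measurable D) (mg : forall k, cmeasurable setT (g0 k)).
Hypotheses (Fi : forall k, cintegrable lm setT (F k)) (Hi : forall k, cintegrable lm setT (H k)).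

Let A : jfun := fun k => duh (tcut D (fun p => F k p - H k p)).

Let mF k := cinte_meas (Fi k).
Let mH k := cinte_meas (Hi k).
Let mFH k : cmeasurable setT (tcut D (fun p => F k p - H k p)).
Proof. by apply: cmeas_cut => //; exact: cmeasB. Qed.

Let AE t k : `[0, t]%classic `<=` D -> {ae mu, forall xi : E,
  vsub (slice (sol g0 F) t) (slice (sol g0 H) t) k xi = - A k (t, xi)}.
Proof.
move=> tD; apply: filterS (duh_sub t (Fi k) (Hi k)) => xi h.
rewrite /vsub /slice /sol /A duh_cut// -h.
by ring.
Qed.

(** The free evolutions cancel and, by causality, only the difference of the sources on [D]
    remains. *)
Lemma wnorm_sol_sub t : `[0, t]%classic `<=` D ->
  (wnorm 0 (vsub (slice (sol g0 F) t) (slice (sol g0 H) t)) <=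
   jnorm (fun k => tcut D (fun p => F k p - H k p)%R))%E.
Proof.
move=> tD; rewrite wnorm0_sum; apply: lee_sum => k _.
have ms1 := cmeas_sol mg mF; have ms2 := cmeas_sol mg mH.
have mA := cmeas_comp (cmeas_duh (mFH k)) (pair1_measurable (t : R1)).
rewrite (ae_eq_L1 _ (cmeasN mA) (AE k tD)); last by apply: cmeasB; exact: cmeas_slice.
by rewrite L1N; exact: L1_duh.
Qed.

Lemma integral_wnorm_sol_sub (I : set R1) : measurable I ->
  (forall t, I t -> `[0, t]%classic `<=` D) ->
  (\int[leb]_(t in I) wnorm 2 (vsub (slice (sol g0 F) t) (slice (sol g0 H) t)) <=
   jnorm (fun k => tcut D (fun p => F k p - H k p)%R))%E.
Proof.
move=> mI ID; have mA k : cmeasurable setT (A k) by exact: cmeas_duh.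
have ms1 := cmeas_sol mg mF; have ms2 := cmeas_sol mg mH.
have me := cmeas_comp (cmeas_enormX R 2) (@measurable_snd _ _ R1 E).
rewrite (_ : (\int[leb]_(t in I) _ = \int[leb]_(t in I) wnorm 2 (slice A t))%E); last first.
  apply: eq_integral => t /set_mem It; apply: eq_bigr => k _.
  rewrite -[RHS]L1N; apply: ae_eq_L1.
  - by apply: cmeasM; [exact: cmeas_enormX|apply: cmeasB; exact: cmeas_slice].
  - by apply: cmeasN; apply: cmeasM; [exact: cmeas_enormX|exact: cmeas_slice].
  by apply: filterS (AE k (ID t It)) => xi ->; rewrite mulrN.
rewrite integral_wnorm//; apply: lee_sum => k _.
apply: le_trans (L1_duh2 (mFH k)); apply: le_L1.
- by apply: cmeas_cut => //; apply: cmeasM => //; exact: mA.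
- by apply: cmeasM => //; exact: mA.
by move=> p; rewrite cabs_tcut; have /andP[a b] := indic01 I p.1; rewrite ler_piMl ?cabs_ge0.
Qed.

End sol_difference.

End duhamel.

(** * Picard iteration *)

Section riesz_fischer.
Local Open Scope classical_set_scope.
Local Open Scope ring_scope.
Local Open Scope complex_scope.
Context d (T : measurableType d) (R : realType) (mu : {measure set T -> \bar R}).
Implicit Types f : nat -> T -> R[i].

(* A junk value unless [u] converges. *)
Definition relim (u : nat -> R) : R := fine (limn_esup (fun n => (u n)%:E)).

(** An upper limit is measurable with no assumption of convergence. The formula being pointwise, a
    slice of the limit is by definition the limit of the slices. *)
Definition climit f (x : T) : R[i] :=
  relim (fun n => complex.Re (f n x)) +i* relim (fun n => complex.Im (f n x)).

Lemma relim_cvg (u : nat -> R) (l : R) : u n @[n --> \oo] --> l -> relim u = l.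
Proof.
move=> ul; rewrite /relim.
have h : (u n)%:E @[n --> \oo] --> l%:E by apply/cvg_EFin => //; exact: nearW.
by rewrite (cvg_limn_einf_sup h).2.
Qed.

Lemma cmeas_climit f : (forall n, cmeasurable setT (f n)) -> cmeasurable setT (climit f).
Proof.
move=> mf; have h (u : nat -> T -> R) : (forall n, measurable_fun setT (u n)) ->
    measurable_fun setT (fun x => relim (fun n => u n x)).
  move=> mu'; apply: (measurableT_comp (fine_measurable measurableT)).
  apply: (measurable_fun_limn_esup (f := fun n x => (u n x)%:E)) => n.
  exact/measurable_EFinP.
by split; apply: h => n; have [] := mf n.
Qed.

Lemma sum_half_le (B : R) n : 0 <= B -> \sum_(0 <= i < n) B * 2^-1 ^+ i <= 2 * B.
Proof.
move=> B0; suff -> : \sum_(0 <= i < n) B * 2^-1 ^+ i = 2 * B - 2 * B * 2^-1 ^+ n.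
  by rewrite gerBl !mulr_ge0// exprn_ge0.
elim: n => [|n ih]; first by rewrite big_nil expr0 mulr1 subrr.
by rewrite big_nat_recr//= ih exprS; field.
Qed.

Lemma nneseries_half_le (u : nat -> \bar R) (B : R) : 0 <= B -> (forall n, 0 <= u n)%E ->
  (forall n, u n <= (B * 2^-1 ^+ n)%:E)%E -> (\sum_(0 <= n <oo) u n <= (2 * B)%:E)%E.
Proof.
move=> B0 u0 uB; apply: lime_le; first by apply: is_cvg_nneseries => n _ _.
apply: nearW => n; apply: (@le_trans _ _ (\sum_(0 <= i < n) (B * 2^-1 ^+ i)%:E)%E).
  by apply: lee_sum => i _.
by rewrite sumEFin lee_fin sum_half_le.
Qed.

Lemma cvg_summable (u : nat -> R) : (\sum_(0 <= n <oo) (`|u n.+1 - u n|)%:E < +oo)%E ->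
  cvgn u.
Proof.
move=> h; have := nnseries_is_cvg (fun i => normr_ge0 (u i.+1 - u i)) h.
move=> /(@normed_cvg _ R^o) c.
rewrite (_ : u = (fun n => u 0%N + series (telescope u) n)); last first.
  by apply/funext => n; rewrite -eq_sum_telescope.
by apply: is_cvgD; [exact: is_cvg_cst|exact: c].
Qed.

Section summable.
Variables (f : nat -> T -> R[i]) (B : R).
Hypotheses (B0 : 0 <= B) (mf : forall n, cmeasurable setT (f n)).
Hypothesis fB : forall n, (L1 mu (fun x => (f n.+1 x - f n x)%R) <= (B * 2^-1 ^+ n)%:E)%E.

Let D x : \bar R := (\sum_(0 <= n <oo) (cabs (f n.+1 x - f n x))%:E)%E.

Let D0 x : (0 <= D x)%E.
Proof. by apply: nneseries_ge0 => n _ _; rewrite lee_fin cabs_ge0. Qed.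

Let mD : measurable_fun setT D.
Proof.
apply: (ge0_emeasurable_sum (P := xpredT)) => // [n x _ _|n _]; first by rewrite lee_fin cabs_ge0.
by apply: measurable_ecabs; exact: cmeasB.
Qed.

Let intD : (\int[mu]_x D x <= (2 * B)%:E)%E.
Proof.
rewrite integral_nneseries//; last 2 first.
- by move=> n; apply: measurable_ecabs; exact: cmeasB.
- by move=> n x _; rewrite lee_fin cabs_ge0.
by apply: nneseries_half_le => // n; exact: L1_ge0.
Qed.

Let aeD : {ae mu, forall x, D x \is a fin_num}.
Proof.
have Di : mu.-integrable setT D.
  apply/integrableP; split => //.
  by under eq_integral do rewrite gee0_abs//; exact: le_lt_trans intD (ltry _).
by apply: filterS (integrable_ae measurableT Di) => x; exact.
Qed.

(** The sum [D] of the moduli of the increments has a finite integral, hence is finite almost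
    everywhere. *)
Lemma ae_cvg_climit : {ae mu, forall x, cabs (f n x - climit f x) @[n --> \oo] --> (0 : R)}.
Proof.
apply: filterS aeD => x Dx.
have Dl : (D x < +oo)%E by rewrite -ge0_fin_numE.
have c1 : cvgn (fun n => complex.Re (f n x)).
  apply: cvg_summable; apply: le_lt_trans Dl.
  apply: lee_nneseries; first by move=> *; rewrite lee_fin.
  by move=> n *; rewrite lee_fin -cReN -cReD abs_Re_le.
have c2 : cvgn (fun n => complex.Im (f n x)).
  apply: cvg_summable; apply: le_lt_trans Dl.
  apply: lee_nneseries; first by move=> *; rewrite lee_fin.
  by move=> n *; rewrite lee_fin -cImN -cImD abs_Im_le.
have e1 := relim_cvg c1; have e2 := relim_cvg c2.
move/cvgrPdist_le : c1 => c1; move/cvgrPdist_le : c2 => c2.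
apply/cvgrPdist_le => e e0; have e20 : 0 < e / 2 by rewrite divr_gt0.
move: (c1 _ e20) (c2 _ e20); apply: filterS2 => n n1 n2.
rewrite sub0r normrN ger0_norm ?cabs_ge0// cabs_distC (le_trans (cabs_le_ReIm _))//.
by rewrite [leRHS](splitr e) cReD cReN cImD cImN /climit /= e1 e2 lerD.
Qed.

Lemma cvg_L1_climit : L1 mu (fun x => (f n x - climit f x)%R) @[n --> \oo] --> (0 : \bar R)%E.
Proof.
have gi : mu.-integrable setT (EFin \o (fine \o D)).
  have Di : mu.-integrable setT D.
    apply/integrableP; split => //.
    by under eq_integral do rewrite gee0_abs//; exact: le_lt_trans intD (ltry _).
  apply: (le_integrable measurableT _ _ Di).
    by apply/measurable_EFinP; exact: (measurableT_comp (fine_measurable measurableT) mD).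
  move=> x _; rewrite /= gee0_abs// ger0_norm ?fine_ge0//.
  by case: (D x) (D0 x) => [r| |]//= _; rewrite leey.
(* [f n - f 0] is a sum of increments, hence dominated by [D]. *)
have := @cvg_L1 _ _ _ mu (fun n x => f n x - f 0%N x) (fun x => climit f x - f 0%N x) (fine \o D).
have m1 n : cmeasurable setT (fun x => f n x - f 0%N x) by exact: cmeasB.
have m2 : cmeasurable setT (fun x => climit f x - f 0%N x).
  by apply: cmeasB => //; exact: cmeas_climit.
have e n x : (f n x - f 0%N x) - (climit f x - f 0%N x) = f n x - climit f x by ring.
move=> /(_ m1 m2); under eq_cvg do under eq_fun do rewrite e.
apply.
- by apply: filterS ae_cvg_climit => x h; under eq_cvg do rewrite e.
- exact: gi.
apply: filterS aeD => x Dx n; rewrite -lee_fin fineK//.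
apply: (@le_trans _ _ (\sum_(0 <= i < n) (cabs (f i.+1 x - f i x))%:E)%E).
  rewrite sumEFin lee_fin -(telescope_sumr (fun i => f i x) (leq0n n)); exact: cabs_sum.
by apply: nneseries_lim_ge => i _ _; rewrite lee_fin cabs_ge0.
Qed.

End summable.
End riesz_fischer.

(** * The fixed-point problem for the nonlinearity *)

Section picard.
Local Open Scope classical_set_scope.
Local Open Scope ring_scope.
Local Open Scope complex_scope.
Context (R : realType).
Local Notation V := (R * R * R)%type.
Local Notation E := (E3 R).
Local Notation R1 := (measurableTypeR R).
Local Notation mu := (@leb3 R).
Local Notation leb := (@lebesgue_measure R).
Local Notation lm := (leb \x mu)%E.
Local Notation cinte := (cintegrable mu setT).
Local Notation vfun := ('I_3 -> E -> R[i]).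
Local Notation jfun := ('I_3 -> R1 * E -> R[i]).
Implicit Types (F H G : jfun) (k : 'I_3).

Definition jsub F H : jfun := fun k p => F k p - H k p.

Definition jcut (D : set R) F : jfun := fun k => tcut D (F k).

Definition jmeas F := forall k, cmeasurable setT (F k).

Definition jinte F := forall k, cintegrable lm setT (F k).

Lemma jinte_meas F : jinte F -> jmeas F.
Proof. by move=> Fi k; exact: cinte_meas (Fi k). Qed.

Lemma jinteP F : jinte F <-> jmeas F /\ (jnorm F < +oo)%E.
Proof.
split=> [Fi|[mF Foo] k].
  split; first exact: jinte_meas.
  rewrite /jnorm; apply: lte_sum_pinfty => k _; exact: cinte_L1.
apply/cintegrableP; split; first exact: mF.
apply: le_lt_trans Foo; rewrite /jnorm (bigD1 k)//= leeDl//.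
by apply: sume_ge0 => j _; exact: L1_ge0.
Qed.

Lemma jinte_sub F H : jinte F -> jinte H -> jinte (jsub F H).
Proof. by move=> Fi Hi k; exact: cinteB. Qed.

Lemma jmeas_sub F H : jmeas F -> jmeas H -> jmeas (jsub F H).
Proof. by move=> Fi Hi k; exact: cmeasB. Qed.

Lemma jmeas_cut (D : set R1) F : measurable D -> jmeas F -> jmeas (jcut D F).
Proof. by move=> mD mF k; exact: cmeas_cut. Qed.

Lemma jnorm_cut_le (D : set R1) F : measurable D -> jmeas F -> (jnorm (jcut D F) <= jnorm F)%E.
Proof.
move=> mD mF; apply: jnorm_le => //; first exact: jmeas_cut.
by move=> k p; rewrite cabs_tcut; have /andP[a b] := indic01 D p.1; rewrite ler_piMl ?cabs_ge0.
Qed.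

Lemma jinte_cut (D : set R1) F : measurable D -> jinte F -> jinte (jcut D F).
Proof.
move=> mD Fi; have mF := jinte_meas Fi; apply/jinteP; split; first exact: jmeas_cut.
by apply: le_lt_trans (jnorm_cut_le mD mF) _; have /jinteP[] := Fi.
Qed.

Lemma jnormD F G H : jmeas F -> jmeas H -> jmeas G ->
  (forall k p, cabs (F k p) <= cabs (G k p) + cabs (H k p)) ->
  (jnorm F <= jnorm G + jnorm H)%E.
Proof.
move=> mF mH mG FGH; rewrite /jnorm -big_split /=; apply: lee_sum => k _.
have c (A : R1 * E -> R[i]) : cmeasurable setT A -> cmeasurable setT (fun p => (cabs (A p))%:C).
  by move=> mA; apply: cmeas_real; exact: measurable_cabs.
apply: (@le_trans _ _ (L1 lm (fun p => (cabs (G k p))%:C + (cabs (H k p))%:C)%R)).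
  apply: le_L1; [exact: mF|by apply: cmeasD; exact: c|move=> p].
  by rewrite -rcD cabs_real ger0_norm ?addr_ge0 ?cabs_ge0.
apply: le_trans (L1D lm (c _ (mG k)) (c _ (mH k))) _.
by apply: leeD; rewrite le_eqVlt; apply/orP; left; apply/eqP; apply: eq_integral => p _;
  rewrite cabs_real ger0_norm ?cabs_ge0.
Qed.

Lemma jsub_le F G H : jmeas F -> jmeas G -> jmeas H ->
  (jnorm (jsub F H) <= jnorm (jsub F G) + jnorm (jsub G H))%E.
Proof.
move=> mF mG mH; apply: jnormD; [exact: jmeas_sub|exact: jmeas_sub|exact: jmeas_sub|move=> k p].
by rewrite /jsub (_ : F k p - H k p = (F k p - G k p) + (G k p - H k p)) ?cabsD//; ring.
Qed.

Lemma jsubC F H : jnorm (jsub F H) = jnorm (jsub H F).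
Proof.
by apply: eq_bigr => k _; apply: eq_integral => p _; rewrite /jsub cabs_distC.
Qed.

Lemma jnorm_tri F G : jmeas F -> jmeas G -> (jnorm F <= jnorm G + jnorm (jsub F G))%E.
Proof.
move=> mF mG; apply: jnormD => //; first exact: jmeas_sub.
by move=> k p; rewrite (_ : F k p = G k p + jsub F G k p) ?cabsD// /jsub addrC subrK.
Qed.

Lemma integral_wnorm0 (D : set R1) F : measurable D -> jmeas F ->
  (\int[leb]_(t in D) wnorm 0 (slice F t) = jnorm (jcut D F))%E.
Proof.
move=> mD mF; rewrite integral_wnorm//; apply: eq_bigr => k _.
by apply: eq_integral => p _; rewrite /jcut /tcut expr0 mul1r.
Qed.

Lemma jnorm3 F : jnorm F = (L1 lm (F ord0) + (L1 lm (F (lift ord0 ord0)) +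
  L1 lm (F (lift ord0 (lift ord0 ord0)))))%E.
Proof. by rewrite /jnorm !big_ord_recl big_ord0 adde0. Qed.

Lemma jnorm0 : @jnorm R (fun _ _ => 0) = 0%E.
Proof. by rewrite /jnorm big1// => k _; exact: L1_cst0. Qed.

Lemma jnorm_eq0 F : jmeas F -> jnorm F = 0%E -> forall k, {ae lm, forall p, F k p = 0}.
Proof.
move=> mF F0 k; apply: L1_eq0; first exact: mF.
apply/eqP; rewrite eq_le L1_ge0 andbT -F0 /jnorm (bigD1 k)//= leeDl//.
by apply: sume_ge0 => j _; exact: L1_ge0.
Qed.

(** The Lipschitz estimate against 0, where an admissible operator vanishes. *)
Lemma jnorm_op_le (op : vfun -> vfun) (M : R) m F (K t0 t1 l : R) :
  admissible M m op -> 0 <= M -> jmeas F ->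
  0 < l <= 1 -> t0 <= t1 -> t1 - t0 <= l ^+ 2 -> 0 <= K ->
  (forall t, (t0 <= t <= t1)%R -> wnorm 0 (slice F t) <= K%:E)%E ->
  (\int[leb]_(t in `[t0, t1]) wnorm 2 (slice F t) <= K%:E)%E ->
  (jnorm (jcut `[t0, t1] (fun k p => op (slice F p.1) k p.2)) <=
    (M * l * (4 * K + powbound m K) * K)%:E)%E.
Proof.
move=> op_adm M0 mF ll t01 tl K0 FK F2K.
have mi : measurable (`[t0, t1]%classic : set R1) by exact: measurable_itv.
have [op0 _ mop _] := op_adm.
rewrite -integral_wnorm0//; last exact: mop.
pose z : jfun := fun _ _ => 0.
have mz : jmeas z by move=> k; exact: cmeas_cst.
have sz (h : vfun) : vsub h (fun _ _ => 0) = h.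
  by apply/funext => k; apply/funext => x; rewrite /vsub subr0.
have wz r : wnorm r (fun _ _ => 0) = 0%E :> \bar R.
  rewrite /wnorm big1// => k _; rewrite -(L1_cst0 mu); apply: eq_integral => x _.
  by rewrite mulr0.
have := @integral_op_sub _ M m op F z t0 t1 l K K op_adm M0 mF mz ll t01 tl K0 K0.
rewrite (_ : (fun t => wnorm 0 (vsub (op (slice F t)) (op (slice z t)))) =
   (fun t => wnorm 0 (slice (fun k p => op (slice F p.1) k p.2) t))); last first.
  by apply/funext => t; rewrite (_ : slice z t = fun _ _ => 0)// op0 sz.
apply.
- exact: FK.
- by move=> t _; rewrite (_ : slice z t = fun _ _ => 0)// wz lee_fin.
- exact: F2K.
- by under eq_integral do rewrite (_ : slice z _ = fun _ _ => 0)// wz; rewrite integral0.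
- by move=> t tt; rewrite (_ : slice z t = fun _ _ => 0)// sz; exact: FK.
- by under eq_integral do rewrite (_ : slice z _ = fun _ _ => 0)// sz.
Qed.

Section operator.
Variables (op : vfun -> vfun) (M : R) (m : nat) (g0 : vfun).
Hypotheses (op_adm : admissible M m op) (M0 : 0 <= M).
Hypothesis g0i : forall k, cinte (g0 k).

Let mg0 k : cmeasurable setT (g0 k) := cinte_meas (g0i k).

Definition opsol F : jfun := fun k p => op (slice (sol g0 F) p.1) k p.2.

(** From a nonlinearity to the path that it generates by Duhamel's formula, and back to the
    nonlinearity of that path: fixed points correspond to solutions on [0, T]. *)
Definition psi (T : R) F : jfun := jcut `[0, T] (opsol F).

Lemma cmeas_opsol F : jmeas F -> jmeas (opsol F).
Proof.
by move=> mF k; have [_ _ h _] := op_adm; apply: h; exact: cmeas_sol.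
Qed.

Let mitv (a b : R) : measurable (`[a, b]%classic : set R1).
Proof. exact: measurable_itv. Qed.

Lemma cmeas_psi T F : jmeas F -> jmeas (psi T F).
Proof. by move=> mF; apply: jmeas_cut => //; exact: cmeas_opsol. Qed.

Lemma wnorm0_g0 : wnorm 0 g0 = (rw 0 g0)%:E.
Proof. exact: wnorm0E. Qed.

(** The left side concerns a short interval, the right side the whole past of [t1]: this asymmetry
    lets the uniqueness proof advance interval by interval. *)
Lemma jnorm_opsol_sub F H (K t0 t1 l : R) : jinte F -> jinte H ->
  0 < l <= 1 -> t0 <= t1 -> t1 - t0 <= l ^+ 2 ->
  (wnorm 0 g0 + jnorm F <= K%:E)%E -> (wnorm 0 g0 + jnorm H <= K%:E)%E ->
  (jnorm (jcut `[t0, t1] (jsub (opsol F) (opsol H))) <=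
   (M * l * (4 * K + powbound m K))%:E * jnorm (jcut `[0%R, t1] (jsub F H)))%E.
Proof.
move=> Fi Hi ll t01 tl FK HK.
have mF := jinte_meas Fi; have mH := jinte_meas Hi.
have K0 : 0 <= K.
  by rewrite -lee_fin; apply: le_trans FK; rewrite adde_ge0 ?wnorm_ge0 ?jnorm_ge0.
have Ai := jinte_cut (mitv 0 t1) (jinte_sub Fi Hi).
have Af : jnorm (jcut `[0, t1] (jsub F H)) \is a fin_num.
  by rewrite ge0_fin_numE ?jnorm_ge0//; have /jinteP[] := Ai.
rewrite -(fineK Af); set A := fine _.
have A0 : 0 <= A by apply: fine_ge0; exact: jnorm_ge0.
rewrite -integral_wnorm0//; last by apply: jmeas_sub; exact: cmeas_opsol.
rewrite -EFinM.
apply: (integral_op_sub op_adm M0 (cmeas_sol mg0 mF) (cmeas_sol mg0 mH)) => //.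
- by move=> t _; apply: le_trans FK; exact: wnorm_sol.
- by move=> t _; apply: le_trans HK; exact: wnorm_sol.
- by apply: le_trans FK; exact: integral_wnorm_sol.
- by apply: le_lt_trans (ltry K); apply: le_trans HK; exact: integral_wnorm_sol.
- move=> t /andP[_ tt1]; rewrite fineK//; apply: wnorm_sol_sub => //.
  by move=> s /=; rewrite !in_itv /= => /andP[-> /le_trans]; exact.
- rewrite fineK//; apply: integral_wnorm_sol_sub => //.
  move=> t /=; rewrite in_itv /= => /andP[_ tt1] s /=.
  by rewrite !in_itv /= => /andP[-> /le_trans]; exact.
Qed.

Lemma jnorm_opsol F (K t0 t1 l : R) : jinte F ->
  0 < l <= 1 -> t0 <= t1 -> t1 - t0 <= l ^+ 2 ->
  (wnorm 0 g0 + jnorm F <= K%:E)%E ->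
  (jnorm (jcut `[t0, t1] (opsol F)) <= (M * l * (4 * K + powbound m K) * K)%:E)%E.
Proof.
move=> Fi ll t01 tl FK; have mF := jinte_meas Fi.
have K0 : 0 <= K.
  by rewrite -lee_fin; apply: le_trans FK; rewrite adde_ge0 ?wnorm_ge0 ?jnorm_ge0.
apply: (jnorm_op_le op_adm M0 (cmeas_sol mg0 mF) ll t01 tl K0).
- by move=> t _; apply: le_trans FK; exact: wnorm_sol.
- by apply: le_trans FK; exact: integral_wnorm_sol.
Qed.

Lemma jsub_psi T F H : jsub (psi T F) (psi T H) = jcut `[0, T] (jsub (opsol F) (opsol H)).
Proof. by apply/funext => k; apply/funext => p; rewrite /jsub /psi /jcut /tcut mulrBr. Qed.

(* [l ^+ 2] is the time of existence. *)
Definition contracting (K l : R) :=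
  [/\ 0 < l <= 1, M * l * (4 * K + powbound m K) <= 2^-1 &
      M * l * (4 * K + powbound m K) * K <= 1].

Lemma exists_contracting (K : R) : 0 <= K -> exists l, contracting K l.
Proof.
move=> K0; have c0 := powbound_ge0 m K0.
pose c := M * (4 * K + powbound m K).
have cp : 0 <= c by rewrite mulr_ge0// addr_ge0// mulr_ge0.
(* With l = 1/a, the term 2c gives c l <= 1/2, the term 2cK gives c K l <= 1, and the final 1 gives
   l <= 1. *)
pose a := 2 * c * (1 + K) + 1.
have a1 : 1 <= a.
  by rewrite /a lerDr; apply: mulr_ge0; [exact: mulr_ge0|exact: addr_ge0].
have a0 : 0 < a by exact: lt_le_trans ltr01 a1.
exists a^-1; split.
- by rewrite invr_gt0 a0 invf_le1.
- rewrite -mulrA mulrCA mulrC -/c ler_pdivrMr// /a.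
  by have := mulr_ge0 cp K0; nra.
- rewrite (_ : _ * K = c * K / a); last by rewrite /c; ring.
  by rewrite ler_pdivrMr// mul1r /a; have := mulr_ge0 cp K0; nra.
Qed.

Section existence.
Variables (K l : R).
Hypotheses (KE : K = rw 0 g0 + 1) (hl : contracting K l).

Let T := l ^+ 2.

Let ll : 0 < l <= 1. Proof. by have [] := hl. Qed.

Let l0 : 0 < l. Proof. by have /andP[] := ll. Qed.

Let T0 : 0 <= T. Proof. by rewrite exprn_ge0// ltW. Qed.

Let TT : T - 0 <= l ^+ 2. Proof. by rewrite subr0. Qed.

(** The iteration stays in the unit ball; its radius is the 1 added to the size of the datum in
    [K]. *)
Let ball F : (jnorm F <= 1)%E -> (wnorm 0 g0 + jnorm F <= K%:E)%E.
Proof. by move=> h; rewrite wnorm0_g0 KE EFinD; exact: leeD. Qed.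

Lemma jnorm_psi_le1 F : jinte F -> (jnorm F <= 1)%E -> (jnorm (psi T F) <= 1)%E.
Proof.
move=> Fi F1; apply: le_trans (jnorm_opsol Fi ll T0 TT (ball F1)) _.
by rewrite lee_fin; have [] := hl.
Qed.

Lemma jnorm_psi_sub F H : jinte F -> jinte H -> (jnorm F <= 1)%E -> (jnorm H <= 1)%E ->
  (jnorm (jsub (psi T F) (psi T H)) <= (2^-1)%:E * jnorm (jsub F H))%E.
Proof.
move=> Fi Hi F1 H1; rewrite jsub_psi.
apply: le_trans (jnorm_opsol_sub Fi Hi ll T0 TT (ball F1) (ball H1)) _.
have mS := jmeas_sub (jinte_meas Fi) (jinte_meas Hi).
apply: (@le_trans _ _ ((2^-1)%:E * jnorm (jcut `[0%R, T] (jsub F H)))%E).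
  by apply: lee_wpmul2r; [exact: jnorm_ge0|rewrite lee_fin; have [] := hl].
by apply: lee_wpmul2l; [rewrite lee_fin|exact: jnorm_cut_le].
Qed.

Let Fn n : jfun := iter n (psi T) (fun _ _ => 0).

Let Fn_prop n : jinte (Fn n) /\ (jnorm (Fn n) <= 1)%E.
Proof.
elim: n => [|n [ih1 ih2]]; first by split; [move=> k; exact: cinte0|rewrite jnorm0 lee_fin].
have h := jnorm_psi_le1 ih1 ih2; split; last exact: h.
by apply/jinteP; split; [exact: cmeas_psi (jinte_meas ih1)|exact: le_lt_trans h (ltry _)].
Qed.

Let Fni n : jinte (Fn n) := (Fn_prop n).1.
Let Fn1 n : (jnorm (Fn n) <= 1)%E := (Fn_prop n).2.
Let mFn n : jmeas (Fn n) := jinte_meas (Fni n).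

Let Fn_half n : (jnorm (jsub (Fn n.+1) (Fn n)) <= (1 * 2^-1 ^+ n)%:E)%E.
Proof.
elim: n => [|n ih].
  rewrite expr0 mul1r (_ : jsub _ _ = Fn 1%N); first exact: (Fn1 1).
  by apply/funext => k; apply/funext => p; rewrite /jsub subr0.
apply: le_trans (jnorm_psi_sub (Fni n.+1) (Fni n) (Fn1 n.+1) (Fn1 n)) _.
apply: (@le_trans _ _ ((2^-1)%:E * (1 * 2^-1 ^+ n)%:E)%E).
  by apply: lee_wpmul2l => //; rewrite lee_fin.
by rewrite -EFinM lee_fin !mul1r exprS.
Qed.

Definition picard_limit : jfun := fun k => climit (fun n => Fn n k).

Local Notation F := picard_limit.

Let mF : jmeas F.
Proof. by move=> k; apply: cmeas_climit => n; exact: mFn. Qed.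

Let cvgF : jnorm (jsub (Fn n) F) @[n --> \oo] --> 0%E.
Proof.
have c k : L1 lm (fun p => (Fn n k p - F k p)%R) @[n --> \oo] --> 0%E.
  apply: (@cvg_L1_climit _ _ _ lm (fun n => Fn n k) 1) => //; first by move=> n; exact: mFn.
  move=> n; apply: le_trans (Fn_half n); rewrite /jnorm (bigD1 k)//= leeDl//.
  by apply: sume_ge0 => j _; exact: L1_ge0.
have -> : (fun n => jnorm (jsub (Fn n) F)) = (fun n =>
    L1 lm (jsub (Fn n) F ord0) + (L1 lm (jsub (Fn n) F (lift ord0 ord0)) +
    L1 lm (jsub (Fn n) F (lift ord0 (lift ord0 ord0)))))%E.
  by apply/funext => n; exact: jnorm3.
rewrite -[X in _ --> X]adde0; apply: cvgeD; [by []|exact: (c ord0)|].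
by rewrite -[X in _ --> X]adde0; apply: cvgeD; [|exact: (c (lift ord0 ord0))|exact: c].
Qed.

Let limit_le (x : \bar R) (y : R) (u : nat -> \bar R) : u n @[n --> \oo] --> 0%E ->
  (forall n, x <= y%:E + u n)%E -> (x <= y%:E)%E.
Proof.
move=> u0 h; have c : (y%:E + u n)%E @[n --> \oo] --> y%:E.
  by rewrite -[X in _ --> X]adde0; apply: cvgeD => //; exact: cvg_cst.
have <- := cvg_lim (@ereal_hausdorff R) c.
by apply: lime_ge; [apply/cvg_ex; exists y%:E|exact: nearW].
Qed.

Lemma picard_limit_le1 : (jnorm F <= 1)%E.
Proof.
apply: (limit_le cvgF) => n; rewrite jsubC.
apply: le_trans (jnorm_tri mF (mFn n)) _.
by apply: leeD => //; exact: Fn1.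
Qed.

Lemma jinte_picard_limit : jinte F.
Proof. by apply/jinteP; split => //; exact: le_lt_trans picard_limit_le1 (ltry _). Qed.

(** Equality in L^1 is expressed by a vanishing norm. The limit is compared with the iterates [n.+1]
    and [n], whose distances to it tend to 0. *)
Lemma picard_fixed : jnorm (jsub (psi T F) F) = 0%E.
Proof.
apply/eqP; rewrite eq_le jnorm_ge0 andbT.
have cS : jnorm (jsub (Fn n.+1) F) @[n --> \oo] --> 0%E.
  by have := cvgF; rewrite -(cvg_shiftS (fun n => jnorm (jsub (Fn n) F))).
have cD : (jnorm (jsub (Fn n) F) + jnorm (jsub (Fn n.+1) F))%E @[n --> \oo] --> 0%E.
  by rewrite -[X in _ --> X]adde0; apply: cvgeD; [|exact: cvgF|exact: cS].
apply: (limit_le cD) => n; rewrite add0e.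
have mP := cmeas_psi T mF.
apply: le_trans (jsub_le mP (mFn n.+1) mF) _; apply: leeD => //.
rewrite [Fn n.+1]iterS -/(Fn n) jsubC.
apply: le_trans (jnorm_psi_sub (Fni n) jinte_picard_limit (Fn1 n) picard_limit_le1) _.
rewrite -[leRHS]mul1e; apply: lee_wpmul2r; first exact: jnorm_ge0.
by rewrite lee_fin invf_le1// ler1n.
Qed.

End existence.

Section uniqueness.
Variables (F H : jfun) (T : R).
Hypotheses (Fi : jinte F) (Hi : jinte H).
Hypothesis FT : jnorm (jsub (psi T F) F) = 0%E.
Hypothesis HT : jnorm (jsub (psi T H) H) = 0%E.

Let a (t : R) : \bar R := jnorm (jcut `[0, t] (jsub F H)).

Let mF := jinte_meas Fi.
Let mH := jinte_meas Hi.

Let fixedE (G : jfun) k : jinte G -> jnorm (jsub (psi T G) G) = 0%E ->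
  {ae lm, forall p, G k p = psi T G k p}.
Proof.
move=> Gi G0; have mG := jinte_meas Gi.
have := jnorm_eq0 (jmeas_sub (cmeas_psi T mG) mG) G0 k; apply: filterS => p /eqP.
by rewrite subr_eq0 => /eqP.
Qed.

Let a_eq (D : set R1) : measurable D -> D `<=` `[0, T]%classic ->
  jnorm (jcut D (jsub F H)) = jnorm (jcut D (jsub (opsol F) (opsol H))).
Proof.
move=> mD DT; apply: eq_bigr => k _; apply: ae_eq_L1.
- by apply: jmeas_cut => //; exact: jmeas_sub.
- by apply: jmeas_cut => //; apply: jmeas_sub; exact: cmeas_opsol.
move: (fixedE k Fi FT) (fixedE k Hi HT); apply: filterS2 => p eF eH.
rewrite /jcut /tcut /jsub eF eH /psi /jcut /tcut.
rewrite indicE; have [pD|] := boolP (p.1 \in D); last by rewrite !mul0r.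
by rewrite indicE mem_set ?mul1r//; apply: DT; exact: set_mem.
Qed.

Let a_fin t : a t \is a fin_num.
Proof.
rewrite ge0_fin_numE ?jnorm_ge0//; have mi := mitv 0 t.
by have /jinteP[] := jinte_cut mi (jinte_sub Fi Hi).
Qed.

Let half_eq0 (x : \bar R) : x \is a fin_num -> (0 <= x)%E -> (x <= (2^-1)%:E * x)%E -> x = 0%E.
Proof.
case: x => // x _; rewrite -EFinM !lee_fin => x0 xx; congr EFin.
by apply/eqP; rewrite eq_le x0 andbT; lra.
Qed.

(** [F] and [H] may lie outside the unit ball and [T] may be large: [K] is taken to bound both, and
    the interval is swept in steps of the length l^2 that [K] allows. *)
Lemma picard_unique : 0 <= T -> jnorm (jcut `[0, T] (jsub F H)) = 0%E.
Proof.
move=> T0.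
have fF : jnorm F \is a fin_num by rewrite ge0_fin_numE ?jnorm_ge0//; have /jinteP[] := Fi.
have fH : jnorm H \is a fin_num by rewrite ge0_fin_numE ?jnorm_ge0//; have /jinteP[] := Hi.
have F0 : 0 <= fine (jnorm F) by apply: fine_ge0; exact: jnorm_ge0.
have H0 : 0 <= fine (jnorm H) by apply: fine_ge0; exact: jnorm_ge0.
pose K := rw 0 g0 + fine (jnorm F) + fine (jnorm H).
have K0 : 0 <= K by rewrite !addr_ge0// rw_ge0.
have KF : (wnorm 0 g0 + jnorm F <= K%:E)%E.
  by rewrite wnorm0_g0 -(fineK fF) -EFinD lee_fin lerDl.
have KH : (wnorm 0 g0 + jnorm H <= K%:E)%E.
  by rewrite wnorm0_g0 -(fineK fH) -EFinD lee_fin /K addrAC lerDl.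
have [l [ll lh _]] := exists_contracting K0.
have step t0 t1 : 0 <= t0 <= t1 -> t1 <= T -> t1 - t0 <= l ^+ 2 ->
    (jnorm (jcut `[t0, t1] (jsub F H)) <= (2^-1)%:E * a t1)%E.
  move=> /andP[t00 t01] t1T tl; rewrite a_eq//; last first.
    move=> s /=; rewrite !in_itv /= => /andP[s0 s1].
    by rewrite (le_trans t00 s0) (le_trans s1 t1T).
  apply: le_trans (jnorm_opsol_sub Fi Hi ll t01 tl KF KH) _.
  by apply: lee_wpmul2r; [exact: jnorm_ge0|rewrite lee_fin].
have l2 : 0 < l ^+ 2 by rewrite exprn_gt0//; have /andP[] := ll.
have main n : a (Num.min (n%:R * l ^+ 2) T) = 0%E.
  elim: n => [|n ih].
    rewrite mul0r min_l//; apply: half_eq0 => //; first exact: jnorm_ge0.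
    by apply: step; rewrite ?lexx// subrr ltW.
  set t0 := Num.min _ _ in ih; set t1 := Num.min _ _.
  have t00 : 0 <= t0 by rewrite le_min T0 andbT mulr_ge0// ltW.
  have t1T : t1 <= T by rewrite ge_min lexx orbT.
  have t01 : t0 <= t1.
    by rewrite le_min !ge_min lexx orbT andbT ler_wpM2r ?(ltW l2)// ler_nat leqnSn.
  have tl : t1 - t0 <= l ^+ 2.
    rewrite lerBlDl /t0; have [nT|Tn] := leP (n%:R * l ^+ 2) T.
      by rewrite /t1 ge_min -natr1 mulrDl mul1r addrC lexx.
    by rewrite (le_trans t1T)// lerDl ltW.
  apply: half_eq0 => //; first exact: jnorm_ge0.
  (* As the difference vanishes on [0, t0], its norm on [0, t1] is at most its norm on [t0, t1],
     which is at most half of the former. *)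
  apply: le_trans (step t0 t1 _ t1T tl); last by rewrite t00 t01.
  rewrite -[leRHS]add0e -ih; have mS := jmeas_sub mF mH.
  apply: jnormD; [exact: jmeas_cut|exact: jmeas_cut|exact: jmeas_cut|move=> k p].
  rewrite !cabs_tcut -mulrDl ler_wpM2r ?cabs_ge0// !indicE.
  have [p1|] := boolP (p.1 \in _); last by rewrite addr_ge0.
  have := set_mem p1; rewrite /= in_itv /= => /andP[q0 q1].
  have [pt|pt] := leP p.1 t0.
    by rewrite (mem_set (_ : `[0, t0]%classic p.1)) ?lerDl//= in_itv /= q0 pt.
  by rewrite (mem_set (_ : `[t0, t1]%classic p.1)) ?lerDr//= in_itv /= (ltW pt) q1.
have := main (Num.bound (T / l ^+ 2)); rewrite min_r//.
by rewrite -ler_pdivrMr// ltW// archi_boundP// divr_ge0// ltW.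
Qed.

End uniqueness.

End operator.
End picard.

(** * Duhamel's formula against test functions *)

Section time_integrals.
Local Open Scope classical_set_scope.
Local Open Scope ring_scope.
Local Open Scope complex_scope.
Context (R : realType).
Local Notation V := (R * R * R)%type.
Local Notation E := (E3 R).
Local Notation R1 := (measurableTypeR R).
Local Notation mu := (@leb3 R).
Local Notation leb := (@lebesgue_measure R).
Local Notation lm := (leb \x mu)%E.
Local Notation cinte := (cintegrable mu setT).
Local Notation vfun := ('I_3 -> E -> R[i]).
Local Notation jfun := ('I_3 -> R1 * E -> R[i]).
Implicit Types (k i : 'I_3).

Lemma has_time_integral_unique (D : set R1) (f : R1 -> R[i]) (I J : R[i]) :
  measurable D ->
  has_time_integral D f I -> has_time_integral D f J -> I = J.
Proof.
move=> mD [g [fg [g1 g2] ->]] [h [fh [h1 h2] ->]].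
have e (a b : R1 -> R) : leb.-integrable D (EFin \o a) -> leb.-integrable D (EFin \o b) ->
    {ae leb, forall t, D t -> a t = b t} -> \int[leb]_(t in D) a t = \int[leb]_(t in D) b t.
  move=> ai bi ab; congr fine; apply: ae_eq_integral => //.
  - by case/integrableP : ai.
  - by case/integrableP : bi.
  by apply: filterS ab => t h0 Dt; congr EFin; exact: h0.
have gh : {ae leb, forall t : R1, D t -> g t = h t}.
  have fg' : {ae leb, forall t : R1, D t -> f t = g t} := fg.
  have fh' : {ae leb, forall t : R1, D t -> f t = h t} := fh.
  by move: fg' fh'; apply: filterS2 => t e1 e2 Dt; rewrite -(e1 Dt) -(e2 Dt).
by rewrite /cintegral; congr (_ +i* _); apply: e => //; apply: filterS gh => t ght Dt; rewrite ght.
Qed.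

Section pairing.
Variables (t : R) (phi : V -> R[i]).
Hypotheses (t0 : 0 <= t) (sp : schwartz phi).

Let psi_ : E -> R[i] := inv_fourier phi.

Let psi_bound : exists B, forall x : E, cabs (psi_ x) <= B.
Proof. exact: schwartz_bounded (schwartz_inv_fourier sp). Qed.

Let mpsi : cmeasurable (setT : set E) psi_.
Proof. exact: cinte_meas (cinte_schwartz (schwartz_inv_fourier sp)). Qed.

Let ker (F : R1 * E -> R[i]) (p : R1 * E) : R[i] := ((hk t p.1 p.2)%:C * F p) * psi_ p.2.

Let cinte_ker F : cintegrable lm setT F -> cintegrable lm setT (ker F).
Proof.
move=> Fi; have [B hB] := psi_bound.
have h1 : cintegrable lm setT (fun p => (hk t p.1 p.2)%:C * F p).
  apply: (@cinte_bndM _ _ _ _ 1) => //.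
    by apply: cmeas_hk => //; exact: measurable_cst.
  by move=> p; rewrite cabs_real ger0_norm ?hk_ge0// hk_le1.
rewrite /ker; under eq_fun do rewrite mulrC.
apply: (@cinte_bndM _ _ _ _ B) => //; first exact: (cmeas_comp mpsi measurable_snd).
Qed.

(** An absolutely convergent integral over time and frequency: one order of integration gives the
    time integral of the pairings, the other the pairing of Duhamel's integral. *)
Definition duh_pairing (F : R1 * E -> R[i]) : R[i] := cintegral lm setT (ker F).

Lemma duh_pairingD (F H : R1 * E -> R[i]) : cintegrable lm setT F -> cintegrable lm setT H ->
  duh_pairing (fun p => F p + H p) = duh_pairing F + duh_pairing H.
Proof.
move=> Fi Hi; rewrite /duh_pairing -cintD; [|exact: cinte_ker|exact: cinte_ker].
by apply: eq_cint => p; rewrite /ker mulrDr mulrDl.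
Qed.

Lemma duh_pairingZ (a : R[i]) (F : R1 * E -> R[i]) : cintegrable lm setT F ->
  duh_pairing (fun p => a * F p) = a * duh_pairing F.
Proof.
move=> Fi; rewrite /duh_pairing -cintZ; last exact: cinte_ker.
by apply: eq_cint => p; rewrite /ker; ring.
Qed.

Lemma duh_pairing_sum (I : Type) (r : seq I) (F : I -> R1 * E -> R[i]) :
  (forall l, cintegrable lm setT (F l)) ->
  duh_pairing (fun p => \sum_(l <- r) F l p) = \sum_(l <- r) duh_pairing (F l).
Proof.
move=> Fi; rewrite /duh_pairing -cint_sum; last by move=> l; exact: cinte_ker.
by apply: eq_cint => p; rewrite /ker mulr_sumr mulr_suml.
Qed.

Let fubini_ker F : cintegrable lm setT F ->
  cintegral leb setT (fun tau : R1 => cintegral mu setT (fun xi => ker F (tau, xi))) = duh_pairing F.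
Proof. by move=> Fi; exact: cint12 (cinte_ker Fi). Qed.

Lemma fromhat_duh (F : R1 * E -> R[i]) : cintegrable lm setT F ->
  fromhat (fun xi => duh F (t, xi)) phi = duh_pairing F.
Proof.
move=> Fi; rewrite /duh_pairing -(cint21 (cinte_ker Fi)); have mF := cinte_meas Fi.
apply: cint_ae_eq.
- apply: cmeasM => //; exact: (cmeas_comp (cmeas_duh mF) (pair1_measurable (t : R1))).
- have mk := cinte_meas (cinte_ker Fi).
  have mk' : cmeasurable setT (fun q : E * R1 => ker F (q.2, q.1)).
    by apply: (cmeas_comp mk); exact: measurable_fun_pair.
  exact: (cmeas_cint_param leb mk').
have h1 : cintegrable lm setT (fun p => (hk t p.1 p.2)%:C * F p).
  apply: (@cinte_bndM _ _ _ _ 1) => //.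
    by apply: cmeas_hk => //; exact: measurable_cst.
  by move=> p; rewrite cabs_real ger0_norm ?hk_ge0// hk_le1.
apply: filterS (ae_cinte2 h1) => xi hxi.
by rewrite /duh /= -cintZr.
Qed.

Lemma has_time_integral_duh (F : R1 * E -> R[i]) (f : R -> R[i]) : cintegrable lm setT F ->
  {ae leb, forall tau : R1, `[0, t]%classic tau ->
     f tau = fromhat (fun xi => gauss (t - tau) xi * F (tau, xi)) phi} ->
  has_time_integral `[0, t] f (fromhat (fun xi => duh F (t, xi)) phi).
Proof.
(* The inner integral is measurable in time by Fubini's theorem and agrees almost everywhere with
   [f], whose own measurability is unknown. *)
move=> Fi fE; exists (fun tau : R1 => cintegral mu setT (fun xi => ker F (tau, xi))).
have ki := cinte_ker Fi.
have mi : measurable (`[0, t]%classic : set R1) by exact: measurable_itv.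
have [i1 i2] := cinte_cint_param ki.
have out (tau : R1) : tau \notin (`[0, t]%classic : set R1) ->
    cintegral mu setT (fun xi => ker F (tau, xi)) = 0.
  move=> nt; rewrite -[RHS](cint0 mu); apply: eq_cint => xi; rewrite /ker /hk /=.
  case: ifPn => [tt|_]; last by rewrite !mul0r.
  by move: nt; rewrite mem_set//= in_itv /= tt.
split.
- apply: filterS fE => tau h Dt; rewrite (h Dt); apply: eq_cint => xi.
  rewrite /ker /hk /=; move: Dt; rewrite /= in_itv /= => ->.
  by rewrite /gauss.
- by split; [exact: integrableS i1|exact: integrableS i2].
rewrite fromhat_duh// -fubini_ker//.
have e (P : R[i] -> R) : P 0 = 0 ->
    \int[leb]_tau P (cintegral mu setT (fun xi => ker F (tau, xi))) =
    \int[leb]_(tau in `[0, t]) P (cintegral mu setT (fun xi => ker F (tau, xi))).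
  move=> P0; rewrite /Rintegral [in RHS]integral_mkcond; congr fine.
  by apply: eq_integral => tau _; rewrite patchE; case: ifPn => // nt; rewrite out// P0.
by rewrite [LHS]/cintegral e// (e (@complex.Im R)).
Qed.

End pairing.

(** * Duhamel's formula for the full nonlinearity *)

Section formula.
Variables (alpha : R) (m : nat).
Hypothesis alpha0 : 0 <= alpha.

Definition forcing (q : option 'I_3) : vfun -> vfun := fun g => lerayhat (src m q g).

Definition nonlin : vfun -> vfun := fun g k xi =>
  forcing None g k xi + alpha%:C * \sum_(q < 3) forcing (Some q) g k xi.

(** Left in the shape that the closure properties of [admissible] produce: a 4 from the Leray
    projector for the advection and for each of the three damping terms. *)
Definition nonlin_cst : R := 4 * 1 + alpha * (4 * 1 + (4 * 1 + 4 * 1)).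

Lemma nonlin_cst_ge0 : 0 <= nonlin_cst.
Proof. by rewrite addr_ge0// mulr_ge0. Qed.

Lemma admissible_forcing q : admissible (4 * 1) m (forcing q).
Proof. by apply: admissible_lerayhat; exact: admissible_src. Qed.

Lemma admissible_nonlin : admissible nonlin_cst m nonlin.
Proof.
have h q := admissible_forcing (Some q).
have := admissibleD (admissible_forcing None) (admissibleZ alpha0
  (admissibleD (h ord0) (admissibleD (h (lift ord0 ord0)) (h (lift ord0 (lift ord0 ord0)))))).
congr admissible; apply/funext => g; apply/funext => k; apply/funext => xi.
by rewrite /nonlin !big_ord_recl big_ord0 addr0.
Qed.

Variables (w : R -> vdistr R) (G : jfun) (l K : R).
Hypotheses (l01 : 0 < l <= 1) (K0 : 0 <= K) (mG : jmeas G).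
Let T := l ^+ 2.
Hypothesis wG : forall t, 0 <= t <= T -> hatrep (w t) (slice G t).
Hypothesis GK : forall t, 0 <= t <= T -> (wnorm 0 (slice G t) <= K%:E)%E.
Hypothesis G2 : (\int[leb]_(t in `[0%R, T]) wnorm 2 (slice G t) <= K%:E)%E.

(** The path [w] is any path with a jointly measurable representative [G], so that the formula
    serves the constructed solution and an arbitrary one alike. *)
Definition forcing_cut q : jfun := jcut `[0, T] (fun k p => forcing q (slice G p.1) k p.2).

Definition nonlin_cut : jfun := jcut `[0, T] (fun k p => nonlin (slice G p.1) k p.2).

Let T0 : 0 <= T. Proof. by rewrite exprn_ge0// ltW//; have /andP[] := l01. Qed.

Let mi (a b : R) : measurable (`[a, b]%classic : set R1).
Proof. exact: measurable_itv. Qed.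

Let jinte_op op M : admissible M m op -> 0 <= M ->
  jinte (jcut `[0, T] (fun k p => op (slice G p.1) k p.2)).
Proof.
move=> adm M0; have [_ _ mop _] := adm; apply/jinteP; split.
  by apply: jmeas_cut => //; exact: mop.
apply: le_lt_trans (ltry (M * l * (4 * K + powbound m K) * K)).
by apply: jnorm_op_le => //; rewrite ?subr0.
Qed.

Lemma jinte_forcing_cut q : jinte (forcing_cut q).
Proof. exact: (jinte_op (admissible_forcing q)). Qed.

Lemma jinte_nonlin_cut : jinte nonlin_cut.
Proof. exact: (jinte_op admissible_nonlin nonlin_cst_ge0). Qed.

Lemma nonlin_cutE k p : nonlin_cut k p =
  forcing_cut None k p + alpha%:C * \sum_(q < 3) forcing_cut (Some q) k p.
Proof.
rewrite /nonlin_cut /forcing_cut /jcut /tcut /nonlin mulrDr; congr (_ + _).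
by rewrite mulrCA mulr_sumr.
Qed.

Let ae_int2 : {ae leb, forall t : R1, `[0, T]%classic t -> int2 (slice G t)}.
Proof.
have := ae_finite (mi 0 T) (measurable_wnorm 2 mG) (fun t => wnorm_ge0 2 _) (le_lt_trans G2 (ltry K)).
by apply: filterS => t h Dt; apply: wnorm2_int2 (h Dt); exact: cmeas_slice.
Qed.

Lemma has_time_integral_advection t i phi : 0 <= t <= T -> schwartz phi ->
  has_time_integral `[0, t] (fun tau => heat (t - tau) (leray (advection (w tau)) i) phi)
    (fromhat (fun xi => duh (forcing_cut None i) (t, xi)) phi).
Proof.
move=> /andP[t0 tT] sp; apply: has_time_integral_duh => //; first exact: jinte_forcing_cut.
apply: filterS ae_int2 => tau h; rewrite /= in_itv /= => /andP[tau0 taut].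
have tauT : `[0, T]%classic tau by rewrite /= in_itv /= tau0 (le_trans taut).
have tt : 0 <= tau <= T by rewrite tau0 (le_trans taut).
rewrite (heat_leray_advection i m _ (wG tt) (h tauT) sp) ?subr_ge0//.
apply: eq_cint => xi; rewrite /forcing_cut /jcut /tcut /forcing indicE mem_set//.
by rewrite mul1r.
Qed.

Lemma has_time_integral_damping t i k phi : 0 <= t <= T -> schwartz phi ->
  has_time_integral `[0, t] (fun tau => heat (t - tau) (leray (damping m k (w tau)) i) phi)
    (fromhat (fun xi => duh (forcing_cut (Some k) i) (t, xi)) phi).
Proof.
move=> /andP[t0 tT] sp; apply: has_time_integral_duh => //; first exact: jinte_forcing_cut.
apply: filterS ae_int2 => tau h; rewrite /= in_itv /= => /andP[tau0 taut].
have tauT : `[0, T]%classic tau by rewrite /= in_itv /= tau0 (le_trans taut).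
have tt : 0 <= tau <= T by rewrite tau0 (le_trans taut).
rewrite (heat_leray_damping i m k _ (wG tt) (h tauT) sp) ?subr_ge0//.
apply: eq_cint => xi; rewrite /forcing_cut /jcut /tcut /forcing indicE mem_set//.
by rewrite mul1r.
Qed.

(** The nonlinearity is split after pairing, where all integrals converge, and not frequency by
    frequency, where that is known almost everywhere only. *)
Lemma fromhat_sol (u0 : vdistr R) (g0 : vfun) t i phi : hatrep u0 g0 ->
  0 <= t <= T -> schwartz phi ->
  fromhat (slice (sol g0 nonlin_cut) t i) phi = heat t (u0 i) phi -
    fromhat (fun xi => duh (forcing_cut None i) (t, xi)) phi -
    alpha%:C * \sum_(k < 3) fromhat (fun xi => duh (forcing_cut (Some k) i) (t, xi)) phi.
Proof.
move=> u0g0 /andP[t0 tT] sp; have [gi d0] := u0g0 i.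
have Ni := jinte_nonlin_cut i; have Fi q := jinte_forcing_cut q i.
have hi : cinte (fun xi => gauss t xi * g0 i xi) by exact: cinte_gauss.
have di : cinte (fun xi => duh (nonlin_cut i) (t, xi)).
  have mN := cinte_meas Ni; apply/cintegrableP; split.
    exact: (cmeas_comp (cmeas_duh mN) (pair1_measurable (t : R1))).
  exact: le_lt_trans (L1_duh t mN) (cinte_L1 Ni).
have -> : slice (sol g0 nonlin_cut) t i =
    fun xi => gauss t xi * g0 i xi - duh (nonlin_cut i) (t, xi).
  apply/funext => xi; rewrite /slice /sol /hterm /hk /= lexx t0 /= subr0.
  by rewrite /gauss.
rewrite fromhat_sub// -(heat_fromhat t0 d0 sp) -addrA; congr (_ + _).
rewrite -opprD; congr (- _); rewrite !fromhat_duh//.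
under [X in _ = _ + _ * X]eq_bigr do rewrite fromhat_duh//.
rewrite -duh_pairing_sum// -duh_pairingZ//; last exact: cinte_sum.
rewrite -duh_pairingD//; last by apply: cinteZ; exact: cinte_sum.
by apply: eq_cint => p; rewrite nonlin_cutE.
Qed.

End formula.
End time_integrals.

(** * Continuity in time and sampling *)

Section convergence.
Local Open Scope classical_set_scope.
Local Open Scope ring_scope.
Context (R : realType).

Lemma cvge0P (T : Type) (F : set_system T) (FF : Filter F) (f : T -> \bar R) :
  (forall x, 0 <= f x)%E ->
  (f x @[x --> F] --> 0%E) <-> (forall e : R, 0 < e -> \forall x \near F, (f x < e%:E)%E).
Proof.
move=> f0; split=> [cf e e0|h A].
  apply: (cf [set y | y < e%:E]%E); rewrite /nbhs /=.
  apply/nbhs_ballP; exists e => //= r; rewrite /ball /= sub0r normrN lte_fin.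
  exact: le_lt_trans (ler_norm r).
rewrite /nbhs /= => /nbhs_ballP[e /= e0 eA].
have := h e e0; apply: filterS => x fx /=.
move: fx (f0 x); case: (f x) => // r; rewrite lte_fin lee_fin => re r0.
by apply: eA; rewrite /ball /= sub0r normrN ger0_norm.
Qed.

Lemma cvge0_le (T : Type) (F : set_system T) {FF : Filter F} (f g : T -> \bar R) :
  (forall x, 0 <= f x <= g x)%E -> g x @[x --> F] --> 0%E -> f x @[x --> F] --> 0%E.
Proof.
move=> fg g0; apply: (squeeze_cvge (f := fun=> 0%E) _ _ g0); last exact: cvg_cst.
by apply: nearW.
Qed.

Lemma cvge0D (T : Type) (F : set_system T) {FF : Filter F} (f g : T -> \bar R) :
  f x @[x --> F] --> 0%E -> g x @[x --> F] --> 0%E -> (f x + g x)%E @[x --> F] --> 0%E.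
Proof. by move=> f0 g0; rewrite -[X in _ --> X]adde0; apply: cvgeD. Qed.

Lemma cvge0_sum (T : Type) (F : set_system T) {FF : Filter F} n (f : 'I_n -> T -> \bar R) :
  (forall k, f k x @[x --> F] --> 0%E) -> (\sum_(k < n) f k x)%E @[x --> F] --> 0%E.
Proof.
elim: n f => [|n ih] f h.
  by rewrite (_ : (fun _ => _) = fun=> 0%E); [exact: cvg_cst|apply/funext => x; rewrite big_ord0].
rewrite (_ : (fun _ => _) = fun x => (f ord0 x + \sum_(k < n) f (lift ord0 k) x)%E); last first.
  by apply/funext => x; rewrite big_ord_recl.
by apply: cvge0D => //; exact: ih.
Qed.

(** A sequential criterion, since dominated convergence is available for sequences. *)
Lemma cvg_within_seq (D : set R) (f : R -> \bar R) (t : R) : (forall x, 0 <= f x)%E ->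
  (forall s : nat -> R, (forall n, D (s n)) -> s n @[n --> \oo] --> t ->
     f (s n) @[n --> \oo] --> 0%E) ->
  f s @[s --> within D (nbhs t)] --> 0%E.
Proof.
move=> f0 h; apply/cvge0P => // e e0.
apply: contrapT => nf.
have ex n : exists s, [/\ D s, `|t - s| < n.+1%:R^-1 & ~ (f s < e%:E)%E].
  apply: contrapT => ne; apply: nf; rewrite near_withinE; apply/nbhs_ballP.
  exists n.+1%:R^-1 => //=.
  move=> s ts Ds; apply: contrapT => nfs; apply: ne; exists s; split=> //.
have [s hs] := choice ex.
have Ds n : D (s n) by have [] := hs n.
have st : s n @[n --> \oo] --> t.
  apply/cvgrPdist_lt => d d0.
  have /cvgrPdist_lt/(_ d d0) := @cvg_harmonic R.
  apply: filterS => n /=; rewrite sub0r normrN ger0_norm ?invr_ge0//.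
  by apply: lt_trans; have [] := hs n.
have /cvge0P -/(_ _ e e0) := h s Ds st => /(_ (fun n => f0 _)) [N _ /(_ N (leqnn N))].
by have [] := hs N.
Qed.

(* The Heine-Cantor theorem for a family of functions known only through
   their distances [d]. *)
Lemma uniform_continuity (d : R -> R -> \bar R) (a b : R) :
  (forall s t, 0 <= d s t)%E -> (forall s t, d s t = d t s) ->
  (forall r s t, a <= r <= b -> a <= s <= b -> a <= t <= b -> (d r t <= d r s + d s t)%E) ->
  (forall t, a <= t <= b -> d s t @[s --> within `[a, b] (nbhs t)] --> 0%E) ->
  forall e : R, 0 < e -> exists2 del : R, 0 < del &
    forall s t, a <= s <= b -> a <= t <= b -> `|s - t| < del -> (d s t < e%:E)%E.
Proof.
move=> d0 dC dT dc e e0.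
pose P (i x : R) := a <= x <= b -> forall y, a <= y <= b -> `|x - y| < i -> (d x y < e%:E)%E.
have e2 : 0 < e / 2 by rewrite divr_gt0.
have /compact_near_coveringP h := @segment_compact R a b.
have {}h : \forall i \near (0 : R)^'+, `[a, b] `<=` P i.
  apply: h => x /=; rewrite in_itv /= => xab.
  have /(cvge0P _ (d0^~ x))/(_ _ e2) := dc x xab.
  rewrite near_withinE => /nbhs_ballP[r /= r0 hr].
  have r2 : 0 < r / 2 by rewrite divr_gt0.
  exists (ball x (r / 2), [set i | i < r / 2]) => /=.
    by split; [exact: nbhsx_ballx|exact: nbhs_right_lt].
  move=> [y i] /= [xy ir] yab z zab yz.
  have dy : (d y x < (e / 2)%:E)%E.
    apply: hr; last by rewrite /= in_itv.
    by rewrite /ball /= in xy *; rewrite (lt_trans xy)// ltr_pdivrMr// ltr_pMr// ltr1n.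
  have dz : (d z x < (e / 2)%:E)%E.
    apply: hr; last by rewrite /= in_itv.
    rewrite /ball /= in xy *; rewrite (splitr r) -[x](subrK y) -addrA.
    by rewrite (le_lt_trans (ler_normD _ _))// ltrD// (lt_trans yz).
  rewrite (splitr e) EFinD; apply: le_lt_trans (dT y x z yab xab zab) _.
  by apply: lteD => //; rewrite dC.
have [i [i0 hi]] : exists i : R, 0 < i /\ `[a, b] `<=` P i.
  have h2 : \forall i \near (0 : R)^'+, 0 < i /\ `[a, b] `<=` P i.
    by apply: filterI h; exact: nbhs_right_gt.
  by have [i [i0 hi]] := filter_ex h2; exists i.
by exists i => // s t sab tab st; apply: hi; rewrite //= in_itv.
Qed.

End convergence.

(** * Uniform grids of a time interval *)

Section grid.
Local Open Scope classical_set_scope.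
Local Open Scope ring_scope.
Local Open Scope complex_scope.
Context (R : realType) (T : R) (T0 : 0 < T).
Implicit Types (N : nat).

Definition gpt N i : R := i%:R * (T / N.+1%:R).

(** Half-open, so that the cells are disjoint. Indices run over [N.+2] values although the mesh is
    T/(N+1): the last cell starts at T and is there to contain the endpoint. *)
Definition cell N i : set R := `[gpt N i, gpt N i.+1[.

Let h0 N : 0 < T / N.+1%:R. Proof. by rewrite divr_gt0. Qed.

Lemma cellP N i t : cell N i t <-> i%:R <= t / (T / N.+1%:R) < i.+1%:R.
Proof. by rewrite /cell /= in_itv /= /gpt ler_pdivlMr// ltr_pdivrMr. Qed.

Lemma cell_inj N i j t : cell N i t -> cell N j t -> i = j.
Proof.
move=> /cellP/andP[a1 a2] /cellP/andP[b1 b2]; apply/eqP; rewrite eqn_leq.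
by rewrite -ltnS -[(j <= i)%N]ltnS -!(ltr_nat R) (le_lt_trans a1 b2) (le_lt_trans b1 a2).
Qed.

Lemma cell_exists N t : 0 <= t <= T -> exists i : 'I_N.+2, cell N i t.
Proof.
move=> /andP[t0 tT]; pose x := t / (T / N.+1%:R).
have x0 : 0 <= x by rewrite divr_ge0// ltW.
have /andP[x1 x2] := truncn_itv x0.
have xN : x <= N.+1%:R by rewrite ler_pdivrMr// mulrC divfK.
have iN : (Num.truncn x < N.+2)%N.
  by rewrite ltnS -(ler_nat R) (le_trans x1).
by exists (Ordinal iN); apply/cellP; rewrite x1 x2.
Qed.

Lemma gpt_itv N (i : 'I_N.+2) : 0 <= gpt N i <= T.
Proof.
rewrite /gpt mulr_ge0 ?(ltW (h0 N))//= mulrA ler_pdivrMr// mulrC ler_wpM2l ?(ltW T0)//.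
by rewrite ler_nat -ltnS ltn_ord.
Qed.

Lemma cell_gpt N i t : cell N i t -> `|t - gpt N i| <= T / N.+1%:R.
Proof.
rewrite /cell /= in_itv /= => /andP[a b]; rewrite ger0_norm ?subr_ge0//.
by rewrite lerBlDl (le_trans (ltW b))// /gpt -natr1 mulrDl mul1r.
Qed.

Lemma cell_sum N (i : 'I_N.+2) t (x : 'I_N.+2 -> R[i]) : cell N i t ->
  \sum_(j < N.+2) (\1_(cell N j) t)%:C * x j = x i.
Proof.
move=> it; rewrite (bigD1 i)//= big1 ?addr0.
  by rewrite indicE mem_set// mul1r.
move=> j ji; rewrite indicE memNset ?mul0r// => jt.
by move: ji; rewrite -val_eqE /= (cell_inj jt it) eqxx.
Qed.

Lemma measurable_cell N i : measurable (cell N i : set (measurableTypeR R)).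
Proof. exact: measurable_itv. Qed.

Lemma fine_grid (del : R) : 0 < del -> exists N, T / N.+1%:R < del.
Proof.
move=> d0; exists (Num.truncn (T / del)).
have h : 0 <= T / del by rewrite divr_ge0// ltW.
have /andP[_] := truncn_itv h.
by rewrite ltr_pdivrMr// => Td; rewrite ltr_pdivrMr// mulrC.
Qed.

(** Stated for the distances alone: it is applied both to a path given by functions and to one whose
    slices are chosen separately at each time. *)
Lemma grid_approximation (d : R -> R -> \bar R) (e : nat -> R) :
  (forall s t, 0 <= d s t)%E -> (forall s t, d s t = d t s) ->
  (forall r s t, 0 <= r <= T -> 0 <= s <= T -> 0 <= t <= T -> (d r t <= d r s + d s t)%E) ->
  (forall t, 0 <= t <= T -> d s t @[s --> within `[0, T] (nbhs t)] --> 0%E) ->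
  (forall n, 0 < e n) ->
  exists N : nat -> nat, forall n t (i : 'I_(N n).+2), 0 <= t <= T -> cell (N n) i t ->
    (d t (gpt (N n) i) < (e n)%:E)%E.
Proof.
move=> d0 dC dT dc e0.
have h n : exists N, forall t (i : 'I_N.+2), 0 <= t <= T -> cell N i t ->
    (d t (gpt N i) < (e n)%:E)%E.
  have [del del0 hd] := uniform_continuity d0 dC dT dc (e0 n).
  have [N hN] := fine_grid del0; exists N => t i tT it.
  by apply: hd => //; [exact: gpt_itv|exact: le_lt_trans (cell_gpt it) hN].
by have [N hN] := choice h; exists N.
Qed.

End grid.

(** * Continuity in time of Duhamel's operator *)

Section sol_continuity.
Local Open Scope classical_set_scope.
Local Open Scope ring_scope.
Local Open Scope complex_scope.
Context (R : realType).
Local Notation V := (R * R * R)%type.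
Local Notation E := (E3 R).
Local Notation R1 := (measurableTypeR R).
Local Notation mu := (@leb3 R).
Local Notation leb := (@lebesgue_measure R).
Local Notation lm := (leb \x mu)%E.
Local Notation cinte := (cintegrable mu setT).
Local Notation vfun := ('I_3 -> E -> R[i]).
Local Notation jfun := ('I_3 -> R1 * E -> R[i]).

Lemma cvg_dist0 (u : nat -> R) (l : R) : u n @[n --> \oo] --> l ->
  `|u n - l| @[n --> \oo] --> (0 : R).
Proof.
move=> /cvgrPdist_le ul; apply/cvgrPdist_le => e e0; have := ul e e0; apply: filterS => n.
by rewrite sub0r normrN normr_id distrC.
Qed.

(** The cut-off makes the kernel jump where the two times meet; the hypothesis keeps the sequence on
    one side. *)
Lemma hk_cvg (s : nat -> R) (t tau : R) (xi : E) : s n @[n --> \oo] --> t ->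
  (\forall n \near \oo, (tau <= s n) = (tau <= t)) ->
  hk (s n) tau xi @[n --> \oo] --> hk t tau xi.
Proof.
move=> st h; rewrite /hk; case: ifPn => [/andP[a b]|nab].
  have c : expR (- (s n - tau) * enorm xi ^+ 2) @[n --> \oo] --> expR (- (t - tau) * enorm xi ^+ 2).
    apply: (cvg_comp (fun n => - (s n - tau) * enorm xi ^+ 2) (@expR R)); last exact: continuous_expR.
    by apply: cvgM; [apply: cvgN; apply: cvgB => //; exact: cvg_cst|exact: cvg_cst].
  apply: cvg_trans c; apply: near_eq_cvg; apply: filterS h => n hn.
  by rewrite a hn b.
apply: (@cvg_trans _ ((fun _ : nat => 0 : R) @ \oo)); last exact: cvg_cst.
apply: near_eq_cvg; apply: filterS h => n hn.
by rewrite hn (negbTE nab).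
Qed.

Lemma L1_duh_time (F : R1 * E -> R[i]) (s t : R) : cintegrable lm setT F ->
  (L1 mu (fun xi => (duh F (s, xi) - duh F (t, xi))%R) <=
   L1 lm (fun p => ((hk s p.1 p.2)%:C * F p - (hk t p.1 p.2)%:C * F p)%R))%E.
Proof.
move=> Fi; have mF := cinte_meas Fi.
have hi r : cintegrable lm setT (fun p => (hk r p.1 p.2)%:C * F p).
  apply: (@cinte_bndM _ _ _ _ 1) => //.
    by apply: cmeas_hk => //; exact: measurable_cst.
  by move=> p; rewrite cabs_real ger0_norm ?hk_ge0// hk_le1.
have md r := cmeas_comp (cmeas_duh mF) (pair1_measurable (r : R1)).
have mD := cinte_meas (cinteB (hi s) (hi t)).
rewrite -(L1_tonelli2 leb mu mD); apply: ae_ge0_le_integral => //.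
- by move=> x _; rewrite lee_fin cabs_ge0.
- by apply: measurable_ecabs; apply: cmeasB; exact: md.
- by move=> x _; exact: L1_ge0.
- have mD' : cmeasurable setT (fun q : E * R1 => (fun p => (hk s p.1 p.2)%:C * F p - (hk t p.1 p.2)%:C * F p) (q.2, q.1)).
    by apply: (cmeas_comp mD); exact: measurable_fun_pair.
  exact: (measurable_L1_param leb mD').
move: (ae_cinte2 (hi s)) (ae_cinte2 (hi t)); apply: filterS2 => xi h1 h2 _.
rewrite /duh /= -cintB//; apply: cabs_cint_le_gen.
exact: cinte_meas (cinteB h1 h2).
Qed.

Lemma cvg_sol (g0 : vfun) (F : jfun) (s : nat -> R) (t : R) :
  (forall k, cinte (g0 k)) -> jinte F -> (forall n, 0 <= s n) -> 0 <= t ->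
  s n @[n --> \oo] --> t ->
  wnorm 0 (vsub (slice (sol g0 F) (s n)) (slice (sol g0 F) t)) @[n --> \oo] --> 0%E.
Proof.
move=> gi Fi s0 t0 st; have mF := jinte_meas Fi.
have comp k : L1 mu (vsub (slice (sol g0 F) (s n)) (slice (sol g0 F) t) k) @[n --> \oo] --> 0%E.
  have mg := cinte_meas (gi k).
  have mh r := cmeas_comp (cmeas_hterm mg) (pair1_measurable (r : R1)).
  have md r := cmeas_comp (cmeas_duh (mF k)) (pair1_measurable (r : R1)).
  have c1 : L1 mu (fun xi => (hterm (g0 k) (s n, xi) - hterm (g0 k) (t, xi))%R) @[n --> \oo] --> 0%E.
    apply: (@cvg_L1 _ _ _ mu (fun n xi => hterm (g0 k) (s n, xi)) _ (fun xi => cabs (g0 k xi))).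
    - by move=> n; exact: mh.
    - exact: mh.
    - apply: aeW => xi.
      have h : hk (s n) 0 xi @[n --> \oo] --> hk t 0 xi.
        by apply: hk_cvg => //; apply: nearW => n; rewrite s0 t0.
      have h' : `|hk (s n) 0 xi - hk t 0 xi| @[n --> \oo] --> (0 : R).
        exact: cvg_dist0.
      apply: (cvg0_squeeze (cvg0_mulr (cabs (g0 k xi)) h')) => n; rewrite cabs_ge0/=.
      by rewrite /hterm /= -mulrBl -rcB cabsM cabs_real mulrC.
    - exact: cinte_abs (gi k).
    - apply: aeW => xi n; rewrite /hterm cabsM cabs_real ger0_norm ?hk_ge0//.
      by rewrite ler_piMl ?cabs_ge0// hk_le1.
  have c2 : L1 lm (fun p => ((hk (s n) p.1 p.2)%:C * F k p - (hk t p.1 p.2)%:C * F k p)%R) @[n --> \oo] --> 0%E.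
    have mk r : cmeasurable setT (fun p : R1 * E => (hk r p.1 p.2)%:C * F k p).
      by apply: cmeasM => //; apply: cmeas_hk => //; exact: measurable_cst.
    apply: (@cvg_L1 _ _ _ lm (fun n p => (hk (s n) p.1 p.2)%:C * F k p) _ (fun p => cabs (F k p))).
    - by move=> n; exact: mk.
    - exact: mk.
    (* The jump of the kernel sits at source time [t], a negligible set of the product. *)
    - have : {ae lm, forall p : R1 * E, p.1 != t}.
        exists ([set t] `*` setT); split.
        + by apply: measurableX => //; exact: measurable_set1.
        + have mt : measurable ([set t] : set R1) by exact: measurable_set1.
          transitivity (leb [set t] * mu setT)%E; first exact: product_measure1E.
          by rewrite lebesgue_measure_set1 mul0e.
        + by move=> [x y] /= /negP; rewrite negbK => /eqP ->.
      apply: filterS => p pt.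
      have h : hk (s n) p.1 p.2 @[n --> \oo] --> hk t p.1 p.2.
        apply: hk_cvg => //; move: pt; rewrite neq_lt => /orP[pt|tp].
          have : \forall n \near \oo, p.1 < s n by exact: cvgr_gt st _ pt.
          by apply: filterS => n sn; rewrite (ltW sn) (ltW pt).
        have : \forall n \near \oo, s n < p.1 by exact: cvgr_lt st _ tp.
        by apply: filterS => n sn; rewrite leNgt sn leNgt tp.
      have h' : `|hk (s n) p.1 p.2 - hk t p.1 p.2| @[n --> \oo] --> (0 : R).
        exact: cvg_dist0.
      apply: (cvg0_squeeze (cvg0_mulr (cabs (F k p)) h')) => n; rewrite cabs_ge0/=.
      by rewrite -mulrBl -rcB cabsM cabs_real mulrC.
    - exact: cinte_abs (Fi k).
    - apply: aeW => p n; rewrite cabsM cabs_real ger0_norm ?hk_ge0//.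
      by rewrite ler_piMl ?cabs_ge0// hk_le1.
  apply: (@cvge0_le _ _ _ _ _ _ _ (cvge0D c1 c2)) => n; rewrite L1_ge0 /=.
  apply: (@le_trans _ _ (L1 mu (fun xi => ((hterm (g0 k) (s n, xi) - hterm (g0 k) (t, xi)) -
      (duh (F k) (s n, xi) - duh (F k) (t, xi)))%R))).
    rewrite le_eqVlt; apply/orP; left; apply/eqP; apply: eq_integral => xi _.
    by congr ((cabs _)%:E); rewrite /vsub /slice /sol; ring.
  apply: le_trans (L1B mu (cmeasB (mh (s n)) (mh t)) (cmeasB (md (s n)) (md t))) _.
  by apply: leeD => //; exact: L1_duh_time.
rewrite (_ : (fun n => _) = fun n => (\sum_(k < 3)
    L1 mu (vsub (slice (sol g0 F) (s n)) (slice (sol g0 F) t) k))%E); last first.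
  by apply/funext => n; exact: wnorm0_sum.
exact: (cvge0_sum (f := fun k n => L1 mu (vsub (slice (sol g0 F) (s n)) (slice (sol g0 F) t) k))).
Qed.

End sol_continuity.

(** * Existence *)

Section paths.
Local Open Scope classical_set_scope.
Local Open Scope ring_scope.
Local Open Scope complex_scope.
Context (R : realType).
Local Notation V := (R * R * R)%type.
Local Notation E := (E3 R).
Local Notation R1 := (measurableTypeR R).
Local Notation mu := (@leb3 R).
Local Notation leb := (@lebesgue_measure R).
Local Notation lm := (leb \x mu)%E.
Local Notation cinte := (cintegrable mu setT).
Local Notation vfun := ('I_3 -> E -> R[i]).
Local Notation jfun := ('I_3 -> R1 * E -> R[i]).
Implicit Types (g h : vfun) (k : 'I_3).

Lemma wnorm0_ae_eq g h : (forall k, cinte (g k)) -> (forall k, cinte (h k)) ->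
  (wnorm 0 (vsub g h) <= 0)%E -> forall k, {ae mu, forall x, g k x = h k x}.
Proof.
move=> gi hi w0 k; have di := cinteB (gi k) (hi k).
have L0 : L1 mu (vsub g h k) = 0%E.
  apply/eqP; rewrite eq_le L1_ge0 andbT; apply: le_trans w0.
  by rewrite wnorm0_sum (bigD1 k)//= leeDl//; apply: sume_ge0 => j _; exact: L1_ge0.
apply: filterS (L1_eq0 (cinte_meas di) L0) => x /eqP.
by rewrite subr_eq0 => /eqP.
Qed.

(** The value of [Xnorm] according to [Xnorm_hatrep], in a form whose measurability in time is
    visible. *)
Definition weighted_cvabs r (g : vfun) : \bar R :=
  (\int[mu]_xi (enorm xi ^+ r * cvabs (fun k => g k xi))%:E)%E.

Lemma measurable_weighted_cvabs r (G : jfun) : jmeas G ->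
  measurable_fun setT (fun t => weighted_cvabs r (slice G t)).
Proof.
move=> mG; pose H (p : R1 * E) : R[i] := (enorm p.2 ^+ r * cvabs (fun k => G k p))%:C.
have mH : cmeasurable setT H.
  apply: cmeas_real; apply: measurable_funM; last exact: measurable_cvabs.
  by apply: measurable_funX; exact: measurable_enorm.
have := measurable_L1_param mu mH; apply: eq_measurable_fun => t _.
apply: eq_integral => xi _; rewrite /H cabs_real ger0_norm//.
by rewrite mulr_ge0 ?cvabs_ge0// exprn_ge0// enorm_ge0.
Qed.

Lemma Xnorm_ge0 (rho : R) (u : vdistr R) : (0 <= Xnorm rho u)%E.
Proof.
by apply: integral_ge0 => x _; rewrite lee_fin mulr_ge0 ?powR_ge0 ?cvabs_ge0.
Qed.

Definition lowpass (r : R) g : vfun := fun k xi => (\1_[set x : E | enorm x <= r] xi)%:C * g k xi.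

Let indic_ball (r : R) (xi : E) : \1_[set x : E | enorm x <= r] xi = (nat_of_bool (enorm xi <= r)%R)%:R :> R.
Proof.
rewrite indicE; congr (_ %:R); congr nat_of_bool.
by apply/idP/idP => [/set_mem//|h]; apply/mem_set.
Qed.

Lemma cmeas_lowpass r g k : cmeasurable setT (g k) -> cmeasurable setT (lowpass r g k).
Proof.
by move=> mg; apply: cmeasM => //; apply: cmeas_real; apply: measurable_indic; exact: measurable_ball3.
Qed.

Lemma cinte_lowpass r g k : cinte (g k) -> cinte (lowpass r g k).
Proof.
move=> gi; apply: (cinte_le (cmeas_lowpass r (cinte_meas gi)) gi) => xi.
by rewrite /lowpass cabsM cabs_real indic_ball normr_nat ler_piMl ?cabs_ge0// lern1 leq_b1.
Qed.

Let lowpass_bound (r : R) (xi : E) : 0 <= r ->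
  cabs ((enorm xi ^+ 2)%:C * (\1_[set x : E | enorm x <= r] xi)%:C) <= r ^+ 2.
Proof.
move=> r0; rewrite cabsM !cabs_real indic_ball normr_nat ger0_norm ?sqr_ge0//.
case: (leP (enorm xi) r) => h; last by rewrite mulr0n mulr0 sqr_ge0.
by rewrite mulr1n mulr1 lerXn2r ?nnegrE// enorm_ge0.
Qed.

Lemma wnorm2_lowpass r g : 0 <= r -> (forall k, cinte (g k)) ->
  (wnorm 2 (lowpass r g) <= (r ^+ 2)%:E * wnorm 0 g)%E.
Proof.
move=> r0 gi; rewrite wnorm0_sum ge0_sume_distrr; last by move=> k _; exact: L1_ge0.
apply: lee_sum => k _; have mg := cinte_meas (gi k).
rewrite -[r ^+ 2]ger0_norm ?sqr_ge0// -cabs_real -L1Z//.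
apply: le_L1.
- by apply: cmeasM; [exact: cmeas_enormX|exact: cmeas_lowpass].
- by apply: cmeasM => //; exact: cmeas_cst.
move=> xi; rewrite /lowpass mulrA cabsM [leRHS]cabsM ler_wpM2r ?cabs_ge0//.
by rewrite [leRHS]cabs_real [leRHS]ger0_norm ?sqr_ge0// lowpass_bound.
Qed.

(** With P the truncation, g - P h = (g - P g) + P (g - h), and on truncated functions the X^2 norm
    costs r^2 times the X^0 norm. *)
Lemma wnorm2_vsub_lowpass r g h : 0 <= r -> (forall k, cinte (g k)) -> (forall k, cinte (h k)) ->
  (wnorm 2 (vsub g (lowpass r h)) <=
   wnorm 2 (vsub g (lowpass r g)) + (r ^+ 2)%:E * wnorm 0 (vsub g h))%E.
Proof.
move=> r0 gi hi; have di k : cinte (vsub g h k) := cinteB (gi k) (hi k).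
apply: (@le_trans _ _ (wnorm 2 (vsub g (lowpass r g)) + wnorm 2 (lowpass r (vsub g h)))%E); last first.
  by apply: leeD => //; exact: wnorm2_lowpass.
rewrite /wnorm -big_split /=; apply: lee_sum => k _.
have m1 : cmeasurable setT (fun x : E => (enorm x ^+ 2)%:C * vsub g (lowpass r g) k x).
  apply: cmeasM; first exact: cmeas_enormX.
  by apply: cmeasB; [exact: cinte_meas (gi k)|exact: cinte_meas (cinte_lowpass r (gi k))].
have m2 : cmeasurable setT (fun x : E => (enorm x ^+ 2)%:C * lowpass r (vsub g h) k x).
  by apply: cmeasM; [exact: cmeas_enormX|exact: cinte_meas (cinte_lowpass r (di k))].
apply: le_trans (L1D mu m1 m2); rewrite le_eqVlt; apply/orP; left; apply/eqP.
by apply: eq_integral => xi _; congr ((cabs _)%:E); rewrite /vsub /lowpass; ring.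
Qed.

Lemma cvg_lowpass g : (forall k, cmeasurable setT (g k)) -> (wnorm 2 g < +oo)%E ->
  wnorm 2 (vsub g (lowpass n%:R g)) @[n --> \oo] --> 0%E.
Proof.
move=> mg g2; have gi := wnorm2_int2 mg g2.
apply: (cvge0_sum (f := fun k n => L1 mu (fun x => ((enorm x ^+ 2)%:C * vsub g (lowpass n%:R g) k x)%R))) => k.
have me : cmeasurable setT (fun x : E => (enorm x ^+ 2)%:C) by exact: cmeas_enormX.
have := @cvg_L1 _ _ _ mu (fun n x => (enorm x ^+ 2)%:C * lowpass n%:R g k x)
  (fun x => (enorm x ^+ 2)%:C * g k x) (fun x => cabs ((enorm x ^+ 2)%:C * g k x)).
have m1 n : cmeasurable setT (fun x => (enorm x ^+ 2)%:C * lowpass n%:R g k x).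
  by apply: cmeasM => //; exact: cmeas_lowpass.
have m2 : cmeasurable setT (fun x => (enorm x ^+ 2)%:C * g k x) := cmeasM me (mg k).
have e n : L1 mu (fun x => ((enorm x ^+ 2)%:C * lowpass n%:R g k x - (enorm x ^+ 2)%:C * g k x)%R) =
    L1 mu (fun x => ((enorm x ^+ 2)%:C * vsub g (lowpass n%:R g) k x)%R).
  by apply: eq_integral => x _; rewrite /vsub mulrBr cabs_distC.
move=> /(_ m1 m2); under eq_cvg do rewrite e; apply.
- apply: aeW => x; apply: (@cvg_trans _ ((fun _ : nat => 0 : R) @ \oo)); last exact: cvg_cst.
  apply: near_eq_cvg; exists (Num.bound (enorm x)) => // n /= hn.
  have xn : enorm x <= n%:R.
    by rewrite (le_trans (ltW (archi_boundP (enorm_ge0 x))))// ler_nat.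
  by rewrite /lowpass indic_ball xn mul1r subrr cabs0.
- exact: cinte_abs (gi k).
apply: aeW => x n; rewrite !cabsM ler_wpM2l ?cabs_ge0// cabs_real indic_ball normr_nat.
by rewrite ler_piMl ?cabs_ge0// lern1 leq_b1.
Qed.

End paths.

(** * The solution generated by the fixed point *)

Section existence.
Local Open Scope classical_set_scope.
Local Open Scope ring_scope.
Local Open Scope complex_scope.
Context (R : realType).
Local Notation V := (R * R * R)%type.
Local Notation E := (E3 R).
Local Notation R1 := (measurableTypeR R).
Local Notation mu := (@leb3 R).
Local Notation leb := (@lebesgue_measure R).
Local Notation lm := (leb \x mu)%E.
Local Notation cinte := (cintegrable mu setT).
Local Notation vfun := ('I_3 -> E -> R[i]).
Local Notation jfun := ('I_3 -> R1 * E -> R[i]).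
Variables (alpha : R) (m : nat) (u0 : vdistr R) (g0 : vfun) (l : R) (F : jfun).
Hypotheses (alpha0 : 0 <= alpha) (u0g0 : hatrep u0 g0).
Let K := rw 0 g0 + 1.
Hypotheses (l01 : 0 < l <= 1) (Fi : jinte F) (F1 : (jnorm F <= 1)%E).
Hypothesis FE : jnorm (jsub (psi (nonlin alpha m) g0 (l ^+ 2) F) F) = 0%E.

Let T := l ^+ 2.
Let G : jfun := sol g0 F.

Definition path_of (G : jfun) (t : R) : vdistr R := fun k => fromhat (slice G t k).

Local Notation u := (path_of G).

Let g0i k : cinte (g0 k). Proof. by have [] := u0g0 k. Qed.
Let mF : jmeas F := jinte_meas Fi.
Let mg0 k : cmeasurable setT (g0 k) := cinte_meas (g0i k).
Let mG : jmeas G. Proof. exact: cmeas_sol. Qed.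
Let T0 : 0 < T. Proof. by rewrite exprn_gt0//; have /andP[] := l01. Qed.
Let K0 : 0 <= K. Proof. by rewrite addr_ge0// rw_ge0. Qed.

Let KF : (wnorm 0 g0 + jnorm F <= K%:E)%E.
Proof. by rewrite wnorm0E// /K EFinD; exact: leeD. Qed.

Let GK t : (wnorm 0 (slice G t) <= K%:E)%E.
Proof. by apply: le_trans KF; exact: wnorm_sol. Qed.

Let mi (a b : R) : measurable (`[a, b]%classic : set R1).
Proof. exact: measurable_itv. Qed.

Let G2 : (\int[leb]_(t in `[0%R, T]) wnorm 2 (slice G t) <= K%:E)%E.
Proof. by apply: le_trans KF; exact: integral_wnorm_sol. Qed.

Let Gi t k : cinte (slice G t k).
Proof. by apply: wnorm_cinte (le_lt_trans (GK t) (ltry _)) k; exact: cmeas_slice. Qed.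

Lemma hatrep_path t : hatrep (u t) (slice G t).
Proof. by move=> k; split. Qed.

Lemma CT_X_path : CT_X T 0 u.
Proof.
split=> [t _|t]; first exact: (hatrep_Xspace (r := 0) (hatrep_path t) (le_lt_trans (GK t) (ltry _))).
rewrite in_itv /= => /andP[t0 tT].
apply: (cvg_within_seq (f := fun s => Xnorm 0 (u s - u t))) => [x|s sT st]; first exact: Xnorm_ge0.
have c : wnorm 0 (vsub (slice G (s n)) (slice G t)) @[n --> \oo] --> 0%E.
  by apply: cvg_sol => // n; have := sT n; rewrite /= in_itv /= => /andP[].
apply: (@cvge0_le _ _ _ _ _ _ _ c) => n; rewrite Xnorm_ge0 /=.
exact: (Xnorm_le_wnorm 0 (hatrep_sub (hatrep_path (s n)) (hatrep_path t))).
Qed.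

Let dist (s t : R) : \bar R := wnorm 0 (vsub (slice G s) (slice G t)).

Lemma wnorm_vsubC g h : wnorm 0 (vsub g h) = wnorm 0 (vsub h g) :> \bar R.
Proof.
rewrite !wnorm0_sum; apply: eq_bigr => k _; apply: eq_integral => x _.
by rewrite /vsub cabs_distC.
Qed.

Lemma wnorm_vsub_tri (g h f : vfun) : (forall k, cmeasurable setT (g k)) ->
  (forall k, cmeasurable setT (h k)) -> (forall k, cmeasurable setT (f k)) ->
  (wnorm 0 (vsub g f) <= wnorm 0 (vsub g h) + wnorm 0 (vsub h f))%E.
Proof.
move=> mg mh mf; rewrite !wnorm0_sum -big_split /=; apply: lee_sum => k _.
apply: le_trans (L1D mu (cmeasB (mg k) (mh k)) (cmeasB (mh k) (mf k))).
rewrite le_eqVlt; apply/orP; left; apply/eqP; apply: eq_integral => x _.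
by congr ((cabs _)%:E); rewrite /vsub; ring.
Qed.

Let dist_cvg t : 0 <= t <= T -> dist s t @[s --> within `[0, T] (nbhs t)] --> 0%E.
Proof.
move=> /andP[t0 tT]; apply: cvg_within_seq => [x|s sT st]; first exact: wnorm_ge0.
by apply: cvg_sol => // n; have := sT n; rewrite /= in_itv /= => /andP[].
Qed.

Lemma L1T_X_path : L1T_X T 2 u.
Proof.
have aeG : {ae leb, forall t : R1, `[0, T]%classic t -> (wnorm 2 (slice G t) < +oo)%E}.
  exact: ae_finite (mi 0 T) (measurable_wnorm 2 mG) (fun t => wnorm_ge0 2 _) (le_lt_trans G2 (ltry _)).
split.
- apply: filterS aeG => t h tT; exact: (hatrep_Xspace (r := 2) (hatrep_path t) (h tT)).
(* Truncation at frequency n multiplies the X^0 error by n^2; a cubic precision leaves an error of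
   at most 1/(n+1). *)
- pose e n : R := n.+1%:R^-1 ^+ 3.
  have e0 n : 0 < e n by rewrite exprn_gt0// invr_gt0.
  have [N hN] := @grid_approximation R T T0 dist e (fun s t => wnorm_ge0 0 _)
    (fun s t => wnorm_vsubC _ _)
    (fun r s t _ _ _ => wnorm_vsub_tri (cmeas_slice r mG) (cmeas_slice s mG) (cmeas_slice t mG))
    dist_cvg e0.
  pose v n (j : 'I_(N n).+2) : vdistr R :=
    fun k => fromhat (lowpass n%:R (slice G (gpt T (N n) j)) k).
  have vrep n j : hatrep (v n j) (lowpass n%:R (slice G (gpt T (N n) j))).
    by move=> k; split => //; exact: cinte_lowpass.
  exists (fun n t k phi => \sum_(j < (N n).+2) (\1_(cell T (N n) j) t)%:C * v n j k phi).
  split.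
    move=> n; exists (N n).+2, (fun j => cell T (N n) j), (v n); split => //.
      by move=> j; exact: measurable_cell.
    move=> j; apply: (hatrep_Xspace (r := 2) (vrep n j)).
    apply: le_lt_trans (wnorm2_lowpass (ler0n _ n) (Gi _)) _.
    by rewrite wnorm0E// -EFinM ltry.
  apply: filterS aeG => t h; rewrite in_itv /= => tT.
  have {}h : (wnorm 2 (slice G t) < +oo)%E by apply: h; rewrite /= in_itv.
  have c1 := cvg_lowpass (cmeas_slice t mG) h.
  have c2 : (n.+1%:R^-1)%:E @[n --> \oo] --> (0 : R)%:E.
    by apply/cvg_EFin; [exact: nearW|exact: cvg_harmonic].
  apply: (@cvge0_le _ _ _ _ _ _ _ (cvge0D c1 c2)) => n; rewrite Xnorm_ge0 /=.
  have [j tj] := cell_exists T0 (N n) tT.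
  rewrite (_ : (fun k phi => _) = v n j); last first.
    by apply/funext => k; apply/funext => phi; rewrite (cell_sum T0 (fun j => v n j k phi) tj).
  apply: le_trans (Xnorm_le_wnorm 2 (hatrep_sub (hatrep_path t) (vrep n j))) _.
  apply: le_trans (wnorm2_vsub_lowpass (ler0n _ n) (Gi t) (Gi _)) _.
  apply: leeD => //; apply: (@le_trans _ _ ((n%:R ^+ 2)%:E * (e n)%:E)%E).
    by apply: lee_wpmul2l; [rewrite lee_fin sqr_ge0|apply: ltW; exact: hN].
  rewrite -EFinM lee_fin /e; set c := n.+1%:R^-1; have c0 : 0 <= c by rewrite invr_ge0.
  rewrite (_ : n%:R ^+ 2 * c ^+ 3 = c * (n%:R * c) ^+ 2); last by ring.
  by rewrite ler_piMr// exprn_ile1 ?mulr_ge0// ler_pdivrMr// mul1r ler_nat.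
- apply: le_lt_trans (ltry K); apply: le_trans G2.
  have e t : Xnorm 2 (u t) = weighted_cvabs 2 (slice G t) by exact: (Xnorm_hatrep 2 (hatrep_path t)).
  apply: ge0_le_integral => //.
  + by move=> t _; exact: Xnorm_ge0.
  + apply: (measurable_funS measurableT) => //; under eq_fun do rewrite e.
    exact: measurable_weighted_cvabs.
  + by apply: (measurable_funS measurableT) => //; exact: measurable_wnorm.
  + by move=> t _; exact: (Xnorm_le_wnorm 2 (hatrep_path t)).
Qed.

Lemma NSEM_solution_path : NSEM_solution alpha m u0 T u.
Proof.
move=> t; rewrite in_itv /= => tT i phi sp; have /andP[t0 t1] := tT.
exists (fromhat (fun xi => duh (forcing_cut m G l None i) (t, xi)) phi),
  (fun k => fromhat (fun xi => duh (forcing_cut m G l (Some k) i) (t, xi)) phi).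
have hK s : 0 <= s <= l ^+ 2 -> (wnorm 0 (slice G s) <= K%:E)%E by [].
have hG s : 0 <= s <= l ^+ 2 -> hatrep (u s) (slice G s) by move=> _; exact: hatrep_path.
split.
- exact: (has_time_integral_advection m l01 K0 mG hG hK G2 i tT sp).
- by move=> k; exact: (has_time_integral_damping m l01 K0 mG hG hK G2 i k tT sp).
rewrite -(fromhat_sol m alpha0 l01 K0 mG hK G2 i u0g0 tT sp).
have Ni := jinte_nonlin_cut m alpha0 l01 K0 mG hK G2.
have Ci k : cinte (slice (sol g0 (nonlin_cut alpha m G l)) t k).
  apply: wnorm_cinte; first exact: cmeas_slice (cmeas_sol mg0 (jinte_meas Ni)).
  apply: le_lt_trans (wnorm_sol t mg0 (jinte_meas Ni)) _.
  by rewrite lte_add_pinfty//; [rewrite wnorm0E// ltry|have /jinteP[] := Ni].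
(* [nonlin_cut] of the path is [psi] of [F], hence at distance 0 from [F]; both therefore generate
   the same path. *)
apply: fromhat_ae_eq => //; apply: (wnorm0_ae_eq (Gi t) Ci).
have := wnorm_sol_sub measurableT mg0 Fi Ni (@subsetT _ `[0, t]%classic) => /le_trans; apply.
rewrite -FE jsubC; apply: jnorm_cut_le => //; apply: jmeas_sub => //.
exact: jinte_meas Ni.
Qed.

End existence.

(** * Uniqueness *)

Section any_solution.
Local Open Scope classical_set_scope.
Local Open Scope ring_scope.
Local Open Scope complex_scope.
Context (R : realType).
Local Notation V := (R * R * R)%type.
Local Notation E := (E3 R).
Local Notation R1 := (measurableTypeR R).
Local Notation mu := (@leb3 R).
Local Notation leb := (@lebesgue_measure R).
Local Notation lm := (leb \x mu)%E.
Local Notation cinte := (cintegrable mu setT).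
Local Notation vfun := ('I_3 -> E -> R[i]).
Local Notation jfun := ('I_3 -> R1 * E -> R[i]).
Variables (alpha : R) (m : nat) (u0 : vdistr R) (g0 : vfun) (l : R) (v : R -> vdistr R).
Hypotheses (alpha0 : 0 <= alpha) (u0g0 : hatrep u0 g0) (l01 : 0 < l <= 1).
Let T := l ^+ 2.
Hypotheses (vC : CT_X T 0 v) (vL : L1T_X T 2 v) (vS : NSEM_solution alpha m u0 T v).

Let g0i k : cinte (g0 k). Proof. by have [] := u0g0 k. Qed.
Let mg0 k : cmeasurable setT (g0 k) := cinte_meas (g0i k).
Let T0 : 0 < T. Proof. by rewrite exprn_gt0//; have /andP[] := l01. Qed.

Let mi (a b : R) : measurable (`[a, b]%classic : set R1).
Proof. exact: measurable_itv. Qed.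

(** The representative is chosen separately at each time, so nothing is known about its dependence
    on [t] beyond continuity in norm. *)
Let Gh t : vfun := hat (v t).

Let hr t : 0 <= t <= T -> hatrep (v t) (Gh t).
Proof. by move=> tT; apply: Xspace0_hatrep; have [h _] := vC; apply: h; rewrite in_itv. Qed.

Let Ghi t k : 0 <= t <= T -> cinte (Gh t k).
Proof. by move=> tT; have [] := hr tT k. Qed.

Let dist (s t : R) : \bar R := wnorm 0 (vsub (Gh s) (Gh t)).

Let dist_tri r s t : 0 <= r <= T -> 0 <= s <= T -> 0 <= t <= T ->
  (dist r t <= dist r s + dist s t)%E.
Proof.
by move=> rT sT tT; apply: wnorm_vsub_tri => k; apply: (@cinte_meas _ _ _ mu); exact: Ghi.
Qed.

Let dist_cvg t : 0 <= t <= T -> dist s t @[s --> within `[0, T] (nbhs t)] --> 0%E.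
Proof.
move=> tT; have [_ h] := vC; have := h t; rewrite in_itv /= => /(_ tT) c.
apply/cvge0P => [x|e e0]; first exact: wnorm_ge0.
have e3 : 0 < e / 3 by rewrite divr_gt0.
have /(cvge0P _ (fun s => Xnorm_ge0 0 (v s - v t)))/(_ _ e3) := c.
rewrite !near_withinE; apply: filterS => s hs sT.
have {}hs := hs sT; have sT' : 0 <= s <= T by move: sT; rewrite /= in_itv.
apply: le_lt_trans (wnorm_le_Xnorm 0 (hatrep_sub (hr sT') (hr tT))) _.
rewrite (_ : e%:E = ((e / 3)%:E + ((e / 3)%:E + (e / 3)%:E))%E); last first.
  by rewrite -!EFinD; congr EFin; field.
by apply: lteD => //; apply: lteD.
Qed.

(** A geometric precision makes the increments of the samples summable, as [cvg_L1_climit]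
    requires. *)
Let e (n : nat) : R := 2^-1 ^+ n.

Let e0 n : 0 < e n. Proof. by rewrite exprn_gt0// invr_gt0. Qed.

Let exN : exists N : nat -> nat, forall n t (i : 'I_(N n).+2), 0 <= t <= T ->
  cell T (N n) i t -> (dist t (gpt T (N n) i) < (e n)%:E)%E.
Proof.
exact: (grid_approximation T0 (fun s t => wnorm_ge0 0 _) (fun s t => wnorm_vsubC _ _)
  dist_tri dist_cvg e0).
Qed.

Let N : nat -> nat := projT1 (cid exN).

Let hN n t (i : 'I_(N n).+2) : 0 <= t <= T -> cell T (N n) i t ->
  (dist t (gpt T (N n) i) < (e n)%:E)%E.
Proof. exact: (projT2 (cid exN)). Qed.

(** A step function in time, hence jointly measurable, whereas [Gh] may not be. *)
Let P n k (p : R1 * E) : R[i] :=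
  \sum_(j < (N n).+2) (\1_(cell T (N n) j) p.1)%:C * Gh (gpt T (N n) j) k p.2.

Let gi n (j : 'I_(N n).+2) k : cinte (Gh (gpt T (N n) j) k).
Proof. by apply: Ghi; exact: gpt_itv. Qed.

Let mP n k : cmeasurable setT (P n k).
Proof.
apply: cmeas_sum => j; apply: cmeasM.
  apply: cmeas_real.
  have mc : measurable_fun setT (\1_(cell T (N n) j) : R1 -> R).
    by apply: measurable_indic; exact: measurable_cell.
  exact: (measurableT_comp mc (@measurable_fst _ _ R1 E)).
exact: (cmeas_comp (cinte_meas (gi j k)) measurable_snd).
Qed.

Let PE n (j : 'I_(N n).+2) k t xi : cell T (N n) j t ->
  P n k (t, xi) = Gh (gpt T (N n) j) k xi.
Proof. by move=> tj; rewrite /P (cell_sum T0 (fun j => Gh (gpt T (N n) j) k xi) tj). Qed.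

Let PL1 n k t : 0 <= t <= T -> (L1 mu (fun xi => (P n k (t, xi) - Gh t k xi)%R) <= (e n)%:E)%E.
Proof.
move=> tT; have [j tj] := cell_exists T0 (N n) tT.
apply: le_trans (ltW (hN tT tj)).
rewrite /dist wnorm0_sum (bigD1 k)//=; apply: (@le_trans _ _ (L1 mu (vsub (Gh t) (Gh (gpt T (N n) j)) k))).
  rewrite le_eqVlt; apply/orP; left; apply/eqP; apply: eq_integral => xi _.
  by rewrite (PE _ _ tj) /vsub cabs_distC.
by rewrite leeDl//; apply: sume_ge0 => i _; exact: L1_ge0.
Qed.

Definition sampled_limit : jfun := fun k => climit (fun n => P n k).

Local Notation G := sampled_limit.

Let mG : jmeas G. Proof. by move=> k; apply: cmeas_climit => n; exact: mP. Qed.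

Let le_cvg0 (x : \bar R) (a : nat -> \bar R) : a n @[n --> \oo] --> 0%E ->
  (forall n, x <= a n)%E -> (x <= 0)%E.
Proof.
move=> a0 xa; have <- := cvg_lim (@ereal_hausdorff R) a0.
by apply: lime_ge; [apply/cvg_ex; exists 0%E|exact: nearW].
Qed.

(** At a fixed time the slices of the samples converge in L^1 both to [Gh t] and to the slice of
    [G]. *)
Let G_ae t k : 0 <= t <= T -> {ae mu, forall xi : E, Gh t k xi = slice G t k xi}.
Proof.
move=> tT; have mh := cinte_meas (Ghi k tT); have mGt := cmeas_slice t mG k.
have mPt n : cmeasurable setT (fun xi : E => P n k (t, xi)).
  exact: (cmeas_comp (mP n k) (pair1_measurable (t : R1))).
have c1 : L1 mu (fun xi => (P n k (t, xi) - G k (t, xi))%R) @[n --> \oo] --> 0%E.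
  (* The constant 2 covers e(n+1) + e(n), which is three halves of 2^-n. *)
  apply: (@cvg_L1_climit _ _ _ mu (fun n xi => P n k (t, xi)) 2) => // n.
  apply: (@le_trans _ _ (L1 mu (fun xi => (P n.+1 k (t, xi) - Gh t k xi) - (P n k (t, xi) - Gh t k xi))%R)).
    rewrite le_eqVlt; apply/orP; left; apply/eqP; apply: eq_integral => xi _.
    by congr ((cabs _)%:E); ring.
  apply: le_trans (L1B mu (cmeasB (mPt n.+1) mh) (cmeasB (mPt n) mh)) _.
  apply: le_trans (leeD (PL1 n.+1 k tT) (PL1 n k tT)) _.
  rewrite -EFinD lee_fin /e exprS.
  by have : 0 <= 2^-1 ^+ n :> R by [rewrite exprn_ge0]; set q := 2^-1 ^+ n; lra.
have c2 : L1 mu (fun xi => (P n k (t, xi) - Gh t k xi)%R) @[n --> \oo] --> 0%E.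
  have ce : (e n)%:E @[n --> \oo] --> 0%E.
    apply/cvg_EFin; [exact: nearW|apply: cvg_expr].
    by rewrite ger0_norm// invf_lt1// ltr1n.
  by apply: (@cvge0_le _ _ _ _ _ _ _ ce) => n; rewrite L1_ge0 PL1.
have L0 : L1 mu (fun xi => (Gh t k xi - slice G t k xi)%R) = 0%E.
  apply/eqP; rewrite eq_le L1_ge0 andbT; apply: (le_cvg0 (cvge0D c1 c2)) => n.
  apply: le_trans (L1B mu (cmeasB (mPt n) mGt) (cmeasB (mPt n) mh)).
  rewrite le_eqVlt; apply/orP; left; apply/eqP; apply: eq_integral => xi _.
  by congr ((cabs _)%:E); rewrite /slice; ring.
apply: filterS (L1_eq0 (cmeasB mh mGt) L0) => xi /eqP.
by rewrite subr_eq0 => /eqP.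
Qed.

Let hG t : 0 <= t <= T -> hatrep (v t) (slice G t).
Proof.
move=> tT k; have [hi d] := hr tT k.
have gi' : cinte (slice G t k) by apply: cinte_ae_eq hi (G_ae k tT); exact: cmeas_slice.
split => //; apply: deq_trans d _ => phi sp; apply: fromhat_ae_eq => //; exact: G_ae.
Qed.

Let Gi t k : 0 <= t <= T -> cinte (slice G t k).
Proof. by move=> tT; have [] := hG tT k. Qed.

(** Since e(0) = 1, every slice is within distance 1 of one of finitely many samples. *)
Let bound0 : exists2 K : R, 0 <= K & forall t, 0 <= t <= T -> (wnorm 0 (slice G t) <= K%:E)%E.
Proof.
pose K := 1 + \sum_(j < (N 0).+2) rw 0 (Gh (gpt T (N 0) j)).
have K0 : 0 <= K by rewrite addr_ge0// sumr_ge0// => j _; exact: rw_ge0.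
exists K => // t tT; have [j tj] := cell_exists T0 (N 0) tT.
have -> : wnorm 0 (slice G t) = wnorm 0 (Gh t).
  rewrite !wnorm0_sum; apply: eq_bigr => k _; apply/esym; apply: ae_eq_L1.
  - exact: cinte_meas (Ghi k tT).
  - exact: cmeas_slice.
  - exact: G_ae.
have d1 := hN tT tj; have jT := gpt_itv T0 j.
apply: (@le_trans _ _ (dist t (gpt T (N 0) j) + wnorm 0 (Gh (gpt T (N 0) j)))%E).
  rewrite /dist !wnorm0_sum -big_split /=; apply: lee_sum => k _.
  have m1 := cinte_meas (Ghi k tT); have m2 := cinte_meas (Ghi k jT).
  apply: le_trans (L1D mu (cmeasB m1 m2) m2).
  rewrite le_eqVlt; apply/orP; left; apply/eqP; apply: eq_integral => xi _.
  by rewrite subrK.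
rewrite [wnorm 0 (Gh _)]wnorm0E//.
apply: (@le_trans _ _ (1%:E + (rw 0 (Gh (gpt T (N 0) j)))%:E)%E).
  by apply: leeD => //; exact: ltW d1.
rewrite -EFinD lee_fin lerD2l (bigD1 j)//= lerDl.
by apply: sumr_ge0 => i _; exact: rw_ge0.
Qed.

(** The measurable representative [G] also gives the measurability in time of the X^2 norm of [v],
    needed to compare the integrals. *)
Let bound2 : (\int[leb]_(t in `[0%R, T]) wnorm 2 (slice G t) < +oo)%E.
Proof.
have [_ _ fin] := vL.
have mX : measurable_fun (`[0, T]%classic : set R1) (fun t => Xnorm 2 (v t)).
  have : measurable_fun (`[0, T]%classic : set R1) (fun t => weighted_cvabs 2 (slice G t)).
    by apply: (measurable_funS measurableT) => //; exact: measurable_weighted_cvabs.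
  apply: eq_measurable_fun => t /set_mem; rewrite /= in_itv /= => tT.
  by rewrite (Xnorm_hatrep 2 (hG tT)).
have X0 t : (0 <= Xnorm 2 (v t))%E by exact: Xnorm_ge0.
apply: (@le_lt_trans _ _ (\int[leb]_(t in `[0%R, T])
    (Xnorm 2 (v t) + (Xnorm 2 (v t) + Xnorm 2 (v t))))%E).
  apply: ge0_le_integral => //.
  - by move=> t _; exact: wnorm_ge0.
  - by apply: (measurable_funS measurableT) => //; exact: measurable_wnorm.
  - by apply: emeasurable_funD => //; exact: emeasurable_funD.
  - move=> t; rewrite /= in_itv /= => tT; exact: (wnorm_le_Xnorm 2 (hG tT)).
rewrite ge0_integralD//; last 2 first.
- by move=> t _; rewrite adde_ge0.
- exact: emeasurable_funD.
rewrite ge0_integralD//.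
have f3 := lte_add_pinfty fin fin; exact: (lte_add_pinfty fin f3).
Qed.

(** [F] is the nonlinearity of [G]. Duhamel's formula says that [v] is the path generated by [F], so
    that path and [G] agree at each time almost everywhere in frequency, and they have the same
    nonlinearity. *)
Lemma solution_is_fixed_point : exists F : jfun, [/\ jinte F,
  jnorm (jsub (psi (nonlin alpha m) g0 T F) F) = 0%E &
  forall t, 0 <= t <= T -> forall k, deq (v t k) (fromhat (slice (sol g0 F) t k))].
Proof.
have [K1 K10 GK1] := bound0.
pose K2 := fine (\int[leb]_(t in `[0%R, T]) wnorm 2 (slice G t))%E.
have K20 : 0 <= K2 by apply: fine_ge0; apply: integral_ge0 => t _; exact: wnorm_ge0.
have G2E : (\int[leb]_(t in `[0%R, T]) wnorm 2 (slice G t) = K2%:E)%E.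
  by rewrite fineK// ge0_fin_numE ?bound2//; apply: integral_ge0 => t _; exact: wnorm_ge0.
pose K := K1 + K2; have K0 : 0 <= K by rewrite addr_ge0.
have GK t : 0 <= t <= l ^+ 2 -> (wnorm 0 (slice G t) <= K%:E)%E.
  by move=> tT; apply: le_trans (GK1 t tT) _; rewrite lee_fin lerDl.
have G2K : (\int[leb]_(t in `[0%R, (l ^+ 2)%R]) wnorm 2 (slice G t) <= K%:E)%E.
  by rewrite G2E lee_fin lerDr.
pose F := nonlin_cut alpha m G l.
have Fi : jinte F := jinte_nonlin_cut m alpha0 l01 K0 mG GK G2K.
have mF := jinte_meas Fi.
have vF t : 0 <= t <= T -> forall k, deq (v t k) (fromhat (slice (sol g0 F) t k)).
  move=> tT i phi sp.
  have tT' : t \in `[0, T] by rewrite in_itv.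
  have [I [J [hI hJ ->]]] := vS tT' i sp.
  rewrite (fromhat_sol m alpha0 l01 K0 mG GK G2K i u0g0 tT sp).
  have mt : measurable (`[0, t]%classic : set R1) by exact: mi.
  have -> : I = fromhat (fun xi => duh (forcing_cut m G l None i) (t, xi)) phi.
    apply: (has_time_integral_unique mt hI).
    exact: (has_time_integral_advection m l01 K0 mG hG GK G2K i tT sp).
  congr (_ - _ * _); apply: eq_bigr => k _.
  apply: (has_time_integral_unique mt (hJ k)).
  exact: (has_time_integral_damping m l01 K0 mG hG GK G2K i k tT sp).
exists F; split => //.
have mS := cmeas_sol mg0 mF.
have Si t k : cinte (slice (sol g0 F) t k).
  apply: wnorm_cinte; first exact: cmeas_slice.
  apply: le_lt_trans (wnorm_sol t mg0 mF) _.
  by rewrite lte_add_pinfty//; [rewrite wnorm0E// ltry|have /jinteP[] := Fi].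
have SG t k : 0 <= t <= T -> {ae mu, forall xi, slice (sol g0 F) t k xi = slice G t k xi}.
  move=> tT; have [gi' d] := hG tT k.
  exact: (rep_unique (dfourier_represents (Si t k) (vF t tT k)) (dfourier_represents gi' d)).
have w0 r t : 0 <= t <= T -> wnorm r (vsub (slice (sol g0 F) t) (slice G t)) = 0%E.
  move=> tT; rewrite /wnorm big1// => k _; rewrite -(L1_cst0 mu); apply: ae_eq_L1.
  - apply: cmeasM; first exact: cmeas_enormX.
    by apply: cmeasB; exact: cmeas_slice.
  - exact: cmeas_cst.
  by apply: filterS (SG t k tT) => xi eq; rewrite /vsub eq subrr mulr0.
have F0 : 0 <= fine (jnorm F) by apply: fine_ge0; exact: jnorm_ge0.
have fF : jnorm F \is a fin_num by rewrite ge0_fin_numE ?jnorm_ge0//; have /jinteP[] := Fi.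
(* One constant bounding [G] and the path generated by [F] together, as the Lipschitz estimate
   demands. *)
pose K' := K + (rw 0 g0 + fine (jnorm F)).
have K'0 : 0 <= K' by rewrite !addr_ge0// rw_ge0.
have KK' : (K%:E <= K'%:E)%E by rewrite lee_fin lerDl addr_ge0// rw_ge0.
have SK : (wnorm 0 g0 + jnorm F <= K'%:E)%E.
  by rewrite wnorm0E// -(fineK fF) -EFinD lee_fin lerDr.
apply/eqP; rewrite eq_le jnorm_ge0 andbT.
have -> : jsub (psi (nonlin alpha m) g0 T F) F =
    jcut `[0, T] (fun k p => nonlin alpha m (slice (sol g0 F) p.1) k p.2 - nonlin alpha m (slice G p.1) k p.2).
  apply/funext => k; apply/funext => p.
  by rewrite /jsub /F /nonlin_cut /psi /jcut /tcut /opsol mulrBr.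
have [_ _ mop _] := admissible_nonlin m alpha0.
rewrite -integral_wnorm0//; last by move=> k; apply: cmeasB; exact: mop.
(* The Lipschitz estimate at distance A = 0: paths that agree almost everywhere have the same
   nonlinearity in L^1. *)
rewrite (_ : 0%E = (nonlin_cst alpha * l * (4 * K' + powbound m K') * 0)%:E); last by rewrite mulr0.
apply: (integral_op_sub (admissible_nonlin m alpha0) (nonlin_cst_ge0 alpha0) mS mG l01 (ltW T0)) => //.
- by rewrite subr0.
- by move=> t _; apply: le_trans SK; exact: wnorm_sol.
- by move=> t tT; apply: le_trans KK'; exact: GK.
- by apply: le_trans SK; exact: integral_wnorm_sol.
- by move=> t tT; rewrite w0.
- by rewrite integral0_eq// => t; rewrite /= in_itv /= => tT; rewrite w0.
Qed.

End any_solution.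

Local Open Scope ring_scope.

Theorem theorem1p1 (R : realType) (alpha : R) (m : nat) (u0 : vdistr R)
    (alpha_gt0 : 0 < alpha) (m_ge1 : (1 <= m)%N)
    (u0_X0 : Xspace 0 u0) (u0_div : div_free u0) :
  exists T : R, 0 < T /\
  exists u : R -> vdistr R,
    [/\ CT_X T 0 u, L1T_X T 2 u, NSEM_solution alpha m u0 T u &
        forall v : R -> vdistr R,
          CT_X T 0 v -> L1T_X T 2 v -> NSEM_solution alpha m u0 T v ->
          forall t, t \in `[0, T] -> forall k, deq (u t k) (v t k)].
Proof.
have a0 := ltW alpha_gt0.
have u0g := Xspace0_hatrep u0_X0.
have gi k : cintegrable (@leb3 R) setT (hat u0 k) by have [] := u0g k.
have adm := admissible_nonlin m a0; have M0 := nonlin_cst_ge0 a0.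
pose K := rw 0 (hat u0) + 1.
have K0 : 0 <= K by rewrite addr_ge0// rw_ge0.
have [l hl] := exists_contracting m M0 K0; have [l01 _ _] := hl.
pose F := picard_limit (nonlin alpha m) (hat u0) l.
have Fi : jinte F := jinte_picard_limit adm M0 gi erefl hl.
have F1 := picard_limit_le1 adm M0 gi erefl hl.
have FE := picard_fixed adm M0 gi erefl hl.
have T0 : 0 < l ^+ 2 by rewrite exprn_gt0//; have /andP[] := l01.
exists (l ^+ 2); split => //; exists (path_of (sol (hat u0) F)); split.
- exact: (CT_X_path l u0g Fi F1).
- exact: (L1T_X_path u0g l01 Fi F1).
- exact: (NSEM_solution_path a0 u0g l01 Fi F1 FE).
move=> v vC vL vS t; rewrite in_itv /= => tT k.
have [H [Hi HE vH]] := solution_is_fixed_point a0 u0g l01 vC vL vS.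
(* The nonlinearities of the two solutions are fixed points of one map, so they agree on [0, T];
   Duhamel's formula carries the equality over to the solutions at every time. *)
have FH := picard_unique adm M0 gi Fi Hi FE HE (ltW T0).
have mg j := cinte_meas (gi j).
have Si (A : 'I_3 -> measurableTypeR R * E3 R -> R[i]) j : jinte A ->
    cintegrable (@leb3 R) setT (slice (sol (hat u0) A) t j).
  move=> Ai; have mA := jinte_meas Ai.
  apply: wnorm_cinte; first exact: cmeas_slice (cmeas_sol mg mA).
  apply: le_lt_trans (wnorm_sol t mg mA) _.
  by rewrite lte_add_pinfty//; [rewrite wnorm0E// ltry|have /jinteP[] := Ai].
apply: deq_trans (deq_sym (vH t tT k)) => phi sp.
apply: fromhat_ae_eq => //; [exact: Si|exact: Si|].
apply: (wnorm0_ae_eq (fun j => Si F j Fi) (fun j => Si H j Hi)).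
have mT : measurable (`[0, l ^+ 2]%classic : set (measurableTypeR R)).
  exact: measurable_itv.
have tT' : (`[0, t] `<=` `[0, l ^+ 2])%classic.
  move=> s; rewrite /= !in_itv /= => /andP[-> st].
  by have /andP[_ /(le_trans st)] := tT.
by rewrite -FH; exact: (wnorm_sol_sub mT mg Fi Hi tT').
Qed.
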